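(* Let $\mu$ be a finitely supported probability measure on $\mathrm{Diff}_+^2(\mathbb S^1)$ such that $\operatorname{supp}\mu$ does not preserve any probability measure on $\mathbb S^1$. Let $d,r,\Pi,\Xi,m_i^\pm,\nu_i^\pm$ ($i\in[d]$) be the structural data of the random walk described in the context. Then for $\mathbf P$-almost every $\omega\in\Sigma$ and every $i\in[d]$ there exist subsets $W^s(\omega,i),W^u(\omega,i)\subset\mathbb S^1$ such that, writing $W^s(\omega)=\bigcup_{i\in[d]}W^s(\omega,i)$ and $W^u(\omega)=\bigcup_{i\in[d]}W^u(\omega,i)$, the following hold for $\mathbf P$-almost every $\omega$: (1) Each of $W^s(\omega,i),W^u(\omega,i)$ is a disjoint union of $r$ open intervals. (2) For every $i\in[d]$, $\Pi(\omega,i)\subset W^s(\omega,i)\subset\mathbb S^1\setminus\Xi(\omega)$ and $\Xi(\omega,i)\subset W^u(\omega,i)\subset\mathbb S^1\setminus\Pi(\omega)$. (3) The sets $W^s(\omega,i)$, $i\in[d]$, are pairwise disjoint and $\bigcup_{i\in[d]}W^s(\omega,i)=\mathbb S^1\setminus\Xi(\omega)$; likewise the sets $W^u(\omega,i)$ are pairwise disjoint and $\bigcup_{i\in[d]}W^u(\omega,i)=\mathbb S^1\setminus\Pi(\omega)$. (4) For all $n\in\mathbb Z$, $f_\omega^nW^s(\omega,i)=W^s(\sigma^n\omega,i)$ and $f_\omega^nW^u(\omega,i)=W^u(\sigma^n\omega,i)$. (5) For every connected component $I$ of $W^s(\omega,i)$ and $J$ of $W^u(\omega,i)$, $\nu_i^+(I)=1/r$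 and $\nu_i^-(J)=1/r$. In particular $\nu_i^+(W^s(\omega,i))=1$ and $\nu_i^-(W^u(\omega,i))=1$ for all $i\in[d]$. (6) For every $x\in\Pi(\omega,i)$ and $y\in\Xi(\omega,i)$, $$\lim_{n\to\pm\infty}\frac1n\log(f_\omega^n)'(x)=\lambda_i^+,\qquad \lim_{n\to\pm\infty}\frac1n\log(f_\omega^n)'(y)=\lambda_i^-,$$ where $\lambda_i^+<0$ and $\lambda_i^->0$ are the Lyapunov exponents corresponding to $\nu_i^+$ and $\nu_i^-$. (7) For all closed intervals $I\subset W^s(\omega)$ and $J\subset W^u(\omega)$, as $n\to+\infty$, $|f_\omega^nI|\to0$ and $|f_\omega^{-n}J|\to0$ exponentially fast.
   Context: $\mathrm{Diff}_+^2(\mathbb S^1)$ is the group of orientation-preserving $C^2$ circle diffeomorphisms; $|I|$ is the length of an interval; $\log$ is to base $2$. Let $\mathcal S=\operatorname{supp}\mu$, $\Sigma=\mathcal S^{\mathbb Z}$, $\pi^+:\Sigma\to\mathcal S^{\mathbb Z_{\ge0}}$ and $\pi^-:\Sigma\to\mathcal S^{\mathbb Z_{<0}}$ the projections, $\sigma$ the left shift, $\mathbf P=\mu^{\mathbb Z}$. For $\omega=(\dots,f_{-1},f_0,f_1,\dots)$ set $f_\omega^n=f_{n-1}\cdots f_0$ for $n\ge0$, $f_\omega^n=f_n^{-1}\cdots f_{-1}^{-1}$ for $n<0$, $f_\omega=f_\omega^1$, and $F(\omega,x)=(\sigma\omega,f_\omega x)$ on $\Sigma\times\mathbb S^1$.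 An $F$-invariant probability measure $m$ projecting to $\mathbf P$ with disintegration $dm=d\mathbf P(\omega)dm_\omega$ is a $u$-state (resp. $s$-state) if $\omega\mapsto m_\omega$ factors a.e. through $\pi^-$ (resp. $\pi^+$). $\mu^+=\mu$, and $\mu^-$ is the push-forward of $\mu$ under $f\mapsto f^{-1}$. $\nu$ is $\mu$-stationary if $\nu=\int f_*\nu\,d\mu(f)$, and ergodic if it is not a nontrivial convex combination of two stationary measures. $[d]=\{0,\dots,d-1\}$ with addition mod $d$; $\mathbb S_r$ is the space of $r$-element subsets of $\mathbb S^1$ (with its natural metric $\inf_\tau\sum_i d(x_i,y_{\tau(i)})$, infimum over permutations); $u_{\underline x}$ is the uniform probability measure on $\underline x\in\mathbb S_r$. Structural data (their existence under the stated hypothesis on $\mu$ is a theorem which may be taken as given): positive integers $d,r$ and measurable maps $\Pi,\Xi:\Sigma\times[d]\to\mathbb S_r$ such that: the measures $dm_i^+=d\mathbf P(\omega)du_{\Pi(\omega,i)}$ (resp. $dm_i^-=d\mathbf P(\omega)du_{\Xi(\omega,i)}$), $i\in[d]$, are exactly the ergodic $u$-states (resp. $s$-states); the measures $\nu_i^+=\int u_{\Pi(\omega,i)}d\mathbf P(\omega)$ (resp. $\nu_i^-=\int u_{\Xi(\omega,i)}d\mathbf P(\omega)$) are exactly the ergodic $\mu^+$-stationary (resp. $\mu^-$-stationary) measures; and for $\mathbf P$-a.e. $\omega$: $\Pi(\omega,i)$ depends only on $(\pi^-\omega,i)$ and $\Xi(\omega,i)$ only on $(\pi^+\omega,i)$;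 $f_\omega^n\Pi(\omega,i)=\Pi(\sigma^n\omega,i)$ and $f_\omega^n\Xi(\omega,i)=\Xi(\sigma^n\omega,i)$ for all $n\in\mathbb Z$; with $\Pi(\omega)=\bigcup_i\Pi(\omega,i)$ and $\Xi(\omega)=\bigcup_i\Xi(\omega,i)$, the set $\Pi(\omega)\cup\Xi(\omega)$ has exactly $2dr$ points which, listed in cyclic order $x_0,\dots,x_{2dr-1}$ with $x_0\in\Pi(\omega,0)$, satisfy $x_{2j}\in\Pi(\omega,j\bmod d)$, $x_{2j+1}\in\Xi(\omega,j\bmod d)$. The Lyapunov exponents are $\lambda_i^\pm=\int\log f_\omega'(x)\,dm_i^\pm(\omega,x)$. *)

(* Defs.v *)
From HB Require Import structures.
From mathcomp Require Import all_boot all_order all_algebra.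
From mathcomp Require Import all_classical all_reals all_analysis.
From mathcomp Require Import generic_quotient zify.

Set Implicit Arguments.
Unset Strict Implicit.
Unset Printing Implicit Defensive.
Import Order.TTheory GRing.Theory Num.Theory.
Import numFieldNormedType.Exports.

Local Open Scope ring_scope.
Local Open Scope card_scope.
Local Open Scope classical_set_scope.
Local Open Scope quotient_scope.

Section circle.
Context (R : realType).

Definition eqmod1 (s t : R) : bool := s - t \is a Num.int.

Lemma eqmod1_refl : reflexive eqmod1.
Proof. by move=> t; rewrite /eqmod1 subrr. Qed.

Lemma eqmod1_sym : symmetric eqmod1.
Proof. by move=> s t; rewrite /eqmod1 -opprB rpredN. Qed.

Lemma eqmod1_trans : transitive eqmod1.
Proof.
by move=> t s u st tu; rewrite /eqmod1 -[s](subrK t) -addrA rpredD.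
Qed.

Canonical eqmod1_equiv := EquivRel eqmod1 eqmod1_refl eqmod1_sym eqmod1_trans.

Definition circle : Type := quotient_topology {eq_quot eqmod1_equiv}.

HB.instance Definition _ := PointedTopological.on circle.
HB.instance Definition _ := Quotient.on circle.

HB.instance Definition _ :=
  Measurable.copy circle (g_sigma_algebraType (@open circle)).

End circle.

Section diffeomorphisms.
Context (R : realType).
Implicit Types (f g : circle R -> circle R) (F G : R -> R) (s t : R).

Definition cproj t : circle R := \pi_(circle R) t.

Lemma cproj_eqP s t : cproj s = cproj t <-> s - t \is a Num.int.
Proof.
by rewrite /cproj; split=> [/eqmodP//|h]; apply/eqmodP.
Qed.

Lemma cproj_repr (x : circle R) : cproj (repr x) = x.
Proof. exact: reprK. Qed.

Definition C2 F :=
  [/\ forall t, derivable F t 1, forall t, derivable F^`() t 1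
    & continuous (F^`()^`())].

Definition is_lift F f := forall t, cproj (F t) = f (cproj t).

(* A bijective lift commuting with t |-> t + 1 is increasing, so that the
   circle map it induces has degree one and preserves the orientation. *)
Definition is_diff2 f := exists F G,
  [/\ C2 F, C2 G, cancel F G & cancel G F] /\
  (forall t, F (t + 1) = F t + 1) /\ is_lift F f.

Lemma C2_id : C2 id.
Proof.
have d1 : (id : R -> R)^`() = cst 1.
  by apply/funext => t; rewrite derive1E derive_id.
have d2 : (cst 1 : R -> R)^`() = cst 0.
  by apply/funext => t; rewrite derive1E derive_cst.
split => [t|t|]; [exact: derivable_id|rewrite d1; exact: derivable_cst|].
by rewrite d1 d2 => t; exact: cst_continuous.
Qed.

Lemma C2_comp F G : C2 F -> C2 G -> C2 (F \o G).
Proof.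
move=> [F1 F2 F3] [G1 G2 G3].
have isd (H : R -> R) t : derivable H t 1 -> is_derive t (1 : R) H ((derive1 H) t).
  by move=> dH; rewrite derive1E; exact: derivableP.
have cont (H : R -> R) : (forall t, derivable H t 1) -> continuous H.
  by move=> dH t; apply/differentiable_continuous/derivable1_diffP.
have dFG t : is_derive t (1 : R) (F \o G) (derive1 F (G t) * derive1 G t).
  by apply: is_derive1_comp; exact: isd.
have dE : derive1 (F \o G) = (derive1 F \o G) * (derive1 G).
  by apply/funext => t; rewrite derive1E; exact: derive_val.
have dF'G t : is_derive t (1 : R) (derive1 F \o G) (derive1 (derive1 F) (G t) * derive1 G t).
  by apply: is_derive1_comp; exact: isd.
have dd t : is_derive t (1 : R) ((derive1 F \o G) * (derive1 G))
    (derive1 F (G t) * derive1 (derive1 G) t + derive1 G t * (derive1 (derive1 F) (G t) * derive1 G t)).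
  by apply: is_deriveM; exact: isd.
have ddE : derive1 (derive1 (F \o G)) =
    (fun t => (derive1 F) (G t) * derive1 (derive1 G) t + derive1 G t * (derive1 (derive1 F) (G t) * derive1 G t)).
  by apply/funext => t; rewrite dE derive1E; exact: derive_val.
split => [t|t|].
- exact: (@ex_derive _ _ _ _ _ _ _ (dFG t)).
- by rewrite dE; exact: (@ex_derive _ _ _ _ _ _ _ (dd t)).
rewrite ddE => t.
have cFG (H : R -> R) : continuous H -> {for t, continuous (H \o G)}.
  by move=> cH; exact: (continuous_comp (cont G G1 t) (cH (G t))).
apply: cvgD; apply: cvgM.
- exact: (cFG _ (cont _ F2)).
- exact: (G3 t).
- exact: (cont _ G2 t).
- apply: cvgM; first exact: (cFG _ F3).
  exact: (cont _ G2 t).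
Qed.

Lemma cancel_addr1 F G : cancel F G -> cancel G F ->
  (forall t, F (t + 1) = F t + 1) -> forall t, G (t + 1) = G t + 1.
Proof. by move=> FK GK F1 t; rewrite -{1}[t]GK -F1 FK. Qed.

Lemma addr_int F (n : R) : (forall t, F (t + 1) = F t + 1) ->
  n \is a Num.int -> forall t, F (t + n) = F t + n.
Proof.
move=> F1 /intrP[m ->] t.
have Fn (k : nat) s : F (s + k%:R) = F s + k%:R.
  elim: k s => [|k IH] s; first by rewrite !addr0.
  by rewrite -natr1 !addrA F1 IH.
case: m => k; first exact: Fn.
rewrite NegzE mulrNz -[in RHS](subrK (k.+1%:R) t).
by rewrite Fn addrK.
Qed.

Lemma is_diff2_id : is_diff2 id.
Proof. by exists id, id; split; [split=> //; exact: C2_id|]. Qed.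

Lemma is_diff2_comp f g : is_diff2 f -> is_diff2 g -> is_diff2 (f \o g).
Proof.
move=> [F [F' [[F2 F'2 FK F'K] [F1 Ff]]]] [G [G' [[G2 G'2 GK G'K] [G1 Gg]]]].
exists (F \o G), (G' \o F'); split; first split.
- exact: C2_comp.
- exact: C2_comp.
- by move=> t /=; rewrite FK GK.
- by move=> t /=; rewrite G'K F'K.
split=> t /=; first by rewrite G1 F1.
by rewrite Ff Gg.
Qed.

Lemma is_diff2_inv f : is_diff2 f ->
  {g | [/\ is_diff2 g, cancel f g & cancel g f]}.
Proof.
move=> fD; apply: cid; move: fD.
move=> [F [G [[F2 G2 FK GK] [F1 Ff]]]].
have G1 := cancel_addr1 FK GK F1.
have Gg : is_lift G (fun x => cproj (G (repr x))).
  move=> t; apply/cproj_eqP.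
  have /cproj_eqP/= tn : cproj t = cproj (repr (cproj t)) by rewrite cproj_repr.
  rewrite (_ : G t = G (repr (cproj t)) + (t - repr (cproj t))).
    by rewrite addrAC subrr add0r.
  by rewrite -(addr_int G1 tn) addrC subrK.
exists (fun x => cproj (G (repr x))); split.
- by exists G, F; split.
- by move=> x; rewrite -{1}[x]cproj_repr -Ff -Gg FK cproj_repr.
- by move=> x; rewrite -Ff GK cproj_repr.
Qed.

Definition diff2 := {f : circle R -> circle R | is_diff2 f}.

HB.instance Definition _ := gen_eqMixin diff2.
HB.instance Definition _ := gen_choiceMixin diff2.

Definition diff2_fun (f : diff2) : circle R -> circle R := sval f.

Lemma diff2_inj : injective diff2_fun.
Proof. by move=> [f Df] [g Dg]/= fg; exact: eq_exist. Qed.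

Definition diff2_one : diff2 := exist is_diff2 id is_diff2_id.
Definition diff2_mul (f g : diff2) : diff2 :=
  exist is_diff2 (diff2_fun f \o diff2_fun g)
    (is_diff2_comp (svalP f) (svalP g)).
Definition diff2_inv (f : diff2) : diff2 :=
  let: exist g gP := is_diff2_inv (svalP f) in
  exist is_diff2 g (let: And3 Dg _ _ := gP in Dg).

Fact diff2_funVK (f : diff2) : cancel (diff2_fun (diff2_inv f)) (diff2_fun f).
Proof. by rewrite /diff2_inv; case: is_diff2_inv => g []. Qed.

Fact diff2_funKV (f : diff2) : cancel (diff2_fun f) (diff2_fun (diff2_inv f)).
Proof. by rewrite /diff2_inv; case: is_diff2_inv => g []. Qed.

Fact diff2_mulA : associative diff2_mul.
Proof. by move=> f g h; exact: diff2_inj. Qed.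
Fact diff2_mul1 : left_id diff2_one diff2_mul.
Proof. by move=> f; exact: diff2_inj. Qed.
Fact diff2_1mul : right_id diff2_one diff2_mul.
Proof. by move=> f; exact: diff2_inj. Qed.
Fact diff2_mulV : left_inverse diff2_one diff2_inv diff2_mul.
Proof. by move=> f; apply/diff2_inj/funext => x /=; exact: diff2_funKV. Qed.
Fact diff2_Vmul : right_inverse diff2_one diff2_inv diff2_mul.
Proof. by move=> f; apply/diff2_inj/funext => x /=; exact: diff2_funVK. Qed.

HB.instance Definition _ := isGroup.Build diff2
  diff2_mulA diff2_mul1 diff2_1mul diff2_mulV diff2_Vmul.

HB.instance Definition _ := isPointed.Build diff2 diff2_one.

(* Only finitely supported measures are considered on the group, so every
   subset may be taken to be measurable. *)
HB.instance Definition _ := @isMeasurable.Build default_measure_display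
  diff2 discrete_measurable discrete_measurable0
  discrete_measurableC discrete_measurableU.

Fact diff2_lift (f : diff2) : exists F, C2 F /\ is_lift F (diff2_fun f).
Proof.
by have [F [G [[F2 _ _ _] [_ Ff]]]] := svalP f; exists F.
Qed.

Definition clift (f : diff2) : R -> R := sval (cid (diff2_lift f)).

(* The derivative with respect to arc length; see cderivE for the
   independence of the lift. *)
Definition cderiv (f : diff2) (x : circle R) : R := derive1 (clift f) (repr x).

Lemma continuous_int_cst (H : R -> R) : continuous H ->
  (forall t, H t \is a Num.int) -> forall s t, H s = H t.
Proof.
move=> cH Hint.
suff le s t : s <= t -> H s = H t.
  by move=> s t; case: (leP s t) => [|/ltW] /le.
move=> st; apply/eqP/negPn/negP => nst.
have /intrP[m Hm] := Hint s; have /intrP[n Hn] := Hint t.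
pose a : R := (Num.min m n)%:~R.
have aint : a \is a Num.int by exact: intr_int.
have [| |c _ Hc] := @IVT _ H s t (a + 2^-1) st.
- by apply: continuous_subspaceT.
- have half : (2^-1 : R) <= 1 by rewrite invf_le1 ?ler1n ?ltr0n.
  have half0 : (0 : R) <= 2^-1 by rewrite invr_ge0 ler0n.
  have step (p q : int) : (p < q)%R -> (p%:~R + 2^-1 : R) <= q%:~R.
    move=> pq; have p1q : (p + 1 <= q)%R by lia.
    by apply: le_trans (_ : (p + 1)%:~R <= _); rewrite ?ler_int// intrD lerD2l.
  move: nst; rewrite Hm Hn eqr_int /a.
  case: (ltgtP m n) => // mn _.
    by rewrite min_l ?max_r ?ler_int ?(ltW mn)// lerDl half0 step.
  by rewrite min_r ?max_l ?ler_int ?(ltW mn)// lerDl half0 step.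
have : 2^-1 \is a @Num.int R.
  by rewrite -(addKr a 2^-1) -Hc addrC rpredB.
move=> /intrP[q]; case: (leP q 0) => hq e.
  have : (2^-1 : R) <= 0 by rewrite e lerz0.
  by rewrite leNgt invr_gt0 ltr0n.
have : (1 : R) <= 2^-1 by rewrite e ler1z; lia.
by rewrite leNgt invf_lt1 ?ltr1n.
Qed.

Lemma cderivE (f : diff2) F t : C2 F -> is_lift F (diff2_fun f) ->
  cderiv f (cproj t) = (derive1 F) t.
Proof.
move=> F2 Ff; rewrite /cderiv /clift; case: cid => L [L2 Lf] /=.
set u := repr _.
pose k := u - t.
have kint : k \is a Num.int.
  by apply/cproj_eqP; rewrite /u cproj_repr.
have cont (H : R -> R) : C2 H -> continuous H.
  by move=> [dH _ _] s; apply/differentiable_continuous/derivable1_diffP.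
pose D s := L (s + k) - F s.
have cD : continuous D.
  move=> s; apply: (@continuousB _ _ _ (L \o (fun s => s + k)) F);
    last exact: cont.
  apply: continuous_comp; last exact: cont.
  by apply: (@continuousD _ _ _ id (cst k)) => //; exact: cst_continuous.
have Dint s : D s \is a Num.int.
  apply/cproj_eqP; rewrite Lf Ff; congr (diff2_fun f _).
  by apply/cproj_eqP; rewrite addrC addKr.
have DE s : L (s + k) = F s + D t.
  by rewrite -(continuous_int_cst cD Dint s t) /D [RHS]addrC subrK.
have [dL _ _] := L2; have [dF _ _] := F2.
have sE : (fun s => L (s + k)) = F + cst (D t) by apply/funext => s; exact: DE.
have e1 : is_derive t (1 : R) (F + cst (D t)) (derive1 F t + 0).
  by apply: is_deriveD; rewrite derive1E; exact: derivableP.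
have e3 : is_derive t (1 : R) (shift k) (1 : R).
  rewrite (_ : shift k = id + cst k :> (R -> R))//.
  by rewrite -[X in is_derive _ _ _ X]addr0; apply: is_deriveD.
have e2 : is_derive t (1 : R) (L \o shift k) (derive1 L (t + k) * 1).
  by apply: is_derive1_comp; rewrite derive1E; exact: derivableP.
have -> : u = t + k by rewrite /k addrC subrK.
have := @derive_val _ _ _ _ _ _ _ e2.
rewrite [X in 'D_1 X t](_ : _ = F + cst (D t)) //.
by rewrite (@derive_val _ _ _ _ _ _ _ e1) addr0 mulr1 => ->.
Qed.

End diffeomorphisms.

Coercion diff2_fun : diff2 >-> Funclass.

Section circle_geometry.
Context (R : realType).
Implicit Types (A : set (circle R)) (x y : circle R).

Definition cdist x y : R :=
  inf [set `|s - t| | s in @cproj R @^-1` [set x] & t in @cproj R @^-1` [set y]].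

Definition arc_length A : \bar R :=
  lebesgue_measure (`[0, 1[ `&` @cproj R @^-1` A).

Definition open_arc A := exists a b : R,
  a < b <= a + 1 /\ A = @cproj R @` `]a, b[.

Definition closed_arc A := exists a b : R,
  a <= b < a + 1 /\ A = @cproj R @` `[a, b].

Definition disjoint_open_arcs r A := exists I : 'I_r -> set (circle R),
  [/\ forall k, open_arc (I k), trivIset setT I & A = \bigcup_k I k].

Definition component A I := exists2 x, A x & I = connected_component A x.

(* x 0, ..., x (n - 1) go once around the circle in the positive direction. *)
Definition cyclic_listing n (x : nat -> circle R) A := exists t : nat -> R,
  [/\ forall i j, (i < j < n)%N -> t i < t j,
      t n.-1 < t 0 + 1,
      forall i, (i < n)%N -> x i = cproj (t i)
    & A = x @` `I_n].

Record Sr (r : nat) := MkSr { Sr_set :> set (circle R); _ : Sr_set #= `I_r }.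

(* Enumerations of both sets are allowed to vary: this is the infimum over
   the permutations of one of them. *)
Definition Sr_dist r (A B : Sr r) : R :=
  inf [set s | exists x y : 'I_r -> circle R,
    [/\ range x = A, range y = B & s = \sum_(i < r) cdist (x i) (y i)]].

Definition Sr_open r (U : set (Sr r)) := forall A : Sr r, U A ->
  exists2 e : R, 0 < e & forall B : Sr r, Sr_dist A B < e -> U B.

Definition Sr_borel r : set (set (Sr r)) := <<s @Sr_open r >>.

Definition unif r (A : Sr r) : set (circle R) -> \bar R :=
  fun B => ((r%:R^-1)%:E * counting (A `&` B))%E.

End circle_geometry.

Section random_walk.
Context (R : realType).

Definition meas_eq d (T : measurableType d) (m1 m2 : set T -> \bar R) :=
  forall A, measurable A -> m1 A = m2 A.

Record fsprob := FSProb {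
  fsprob_mu :> probability (diff2 R) R;
  fsprob_fin : exists2 A, finite_set A & fsprob_mu A = 1%E }.

Definition supp (mu : fsprob) : set (diff2 R) :=
  [set f | (0 < mu [set f])%E].

Lemma supp_neq0 (mu : fsprob) : exists f, f \in supp mu.
Proof.
apply: contrapT => /forallNP sn.
have mu0 f : mu [set f] = 0%E.
  apply/eqP; rewrite eq_le measure_ge0 andbT leNgt; apply/negP => h.
  by apply: (sn f); rewrite inE.
have [A /finite_seqP[s ->]] := fsprob_fin mu.
suff -> : mu [set` s] = 0%E by move/eqP; rewrite eq_sym onee_eq0.
elim: s => [|f s IH]; first by rewrite set_nil measure0.
rewrite (_ : [set` f :: s] = [set f] `|` [set` s]); last first.
  apply/seteqP; split=> g /=; rewrite inE.
    by case/predU1P => [->|gs]; [left|right].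
  by case=> [->|gs]; rewrite ?eqxx ?gs ?orbT.
apply/eqP; rewrite eq_le measure_ge0 andbT.
have : (mu ([set f] `|` [set` s]) <= mu [set f] + mu [set` s])%E.
  by apply: measureU2.
by rewrite mu0 IH adde0.
Qed.

Definition letter (mu : fsprob) : Type := {f : diff2 R | f \in supp mu}.

HB.instance Definition _ (mu : fsprob) := Choice.on (letter mu).
HB.instance Definition _ (mu : fsprob) := isPointed.Build (letter mu)
  (let: exist f h := cid (supp_neq0 mu) in exist _ f h).

Definition Sigma (mu : fsprob) : Type := int -> letter mu.

HB.instance Definition _ (mu : fsprob) := Pointed.on (Sigma mu).

Definition cylinders (mu : fsprob) : set (set (Sigma mu)) :=
  [set C | exists n (B : set (letter mu)), C = [set w | B (w n)]].

HB.instance Definition _ (mu : fsprob) :=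
  Measurable.copy (Sigma mu) (g_sigma_algebraType (@cylinders mu)).

Section walk.
Context (mu : fsprob).
Implicit Types (w : Sigma mu) (nu : probability (circle R) R).

Definition step w (n : int) : diff2 R := val (w n).

Definition past w : {n : int | n < 0} -> letter mu := fun n => w (val n).
Definition future w : {n : int | 0 <= n} -> letter mu := fun n => w (val n).

Definition sigma (n : int) w : Sigma mu := fun k => w (k + n).

Fixpoint fwd w (n : nat) : diff2 R :=
  if n is k.+1 then (step w k%:Z * fwd w k)%g else 1%g.

Fixpoint bwd w (n : nat) : diff2 R :=
  if n is k.+1 then ((step w (- n%:Z))^-1 * bwd w k)%g else 1%g.

Definition fpow w (n : int) : diff2 R :=
  match n with Posz k => fwd w k | Negz k => bwd w k.+1 end.

Definition skew (z : Sigma mu * circle R) : Sigma mu * circle R :=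
  (sigma 1 z.1, fpow z.1 1 z.2).

(* The product measure mu^Z, characterized by its values on cylinders. *)
Definition is_bernoulli (P : probability (Sigma mu) R) :=
  forall (s : seq int) (B : int -> set (diff2 R)), uniq s ->
    P [set w | forall n, n \in s -> B n (step w n)] =
    (\prod_(n <- s) fine (mu (B n)))%:E.

Definition mu_minus : set (diff2 R) -> \bar R :=
  pushforward mu (fun f : diff2 R => f^-1%g : diff2 R).

Definition stationary (m : set (diff2 R) -> \bar R) nu :=
  forall A, measurable A ->
    nu A = (\int[m]_f pushforward nu (diff2_fun f) A)%E.

Definition ergodic_stationary (m : set (diff2 R) -> \bar R) nu :=
  stationary m nu /\
  forall nu1 nu2 (t : R), stationary m nu1 -> stationary m nu2 ->
    0 < t < 1 ->
    meas_eq nu (fun A => t%:E * nu1 A + (1 - t)%:E * nu2 A)%E ->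
    meas_eq nu1 nu2.

Section states.
Variables (P : probability (Sigma mu) R).
Implicit Types (m : probability (Sigma mu * circle R)%type R).

Definition skew_invariant m := meas_eq (pushforward m skew) m.

Definition projects_to_P m := meas_eq (pushforward m fst) P.

Definition disintegration m (k : R.-pker Sigma mu ~> circle R) :=
  meas_eq m (fun C => \int[P]_w k w (xsection C w))%E.

Definition factors_through (T : Type) (p : Sigma mu -> T)
    (k : R.-pker Sigma mu ~> circle R) :=
  exists k' : T -> set (circle R) -> \bar R,
    {ae P, forall w, meas_eq (k w) (k' (p w))}.

(* u-states are obtained for p := past, s-states for p := future. *)
Definition state (T : Type) (p : Sigma mu -> T) m :=
  [/\ skew_invariant m, projects_to_P m &
    exists2 k, disintegration m k & factors_through p k].

Definition skew_ergodic m := forall C, measurable C -> skew @^-1` C = C ->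
  m C = 0%E \/ m C = 1%E.

Definition log2 (x : R) : R := ln x / ln 2.

Definition lyapunov m : R :=
  (\int[m]_z log2 (cderiv (fpow z.1 1) z.2))%R.

Definition lyapunov_quotient w (x : circle R) (n : int) : R :=
  n%:~R^-1 * log2 (cderiv (fpow w n) x).

Definition total_set r d (Pi : Sigma mu -> 'I_d -> Sr R r) w : set (circle R) :=
  \bigcup_i Pi w i.

(* The half of the structural data concerning one of the families Pi, Xi. *)
Record state_data (d r : nat) (T : Type) (p : Sigma mu -> T)
    (mu' : set (diff2 R) -> \bar R) (Pi : Sigma mu -> 'I_d -> Sr R r)
    (m : 'I_d -> probability (Sigma mu * circle R)%type R)
    (nu : 'I_d -> probability (circle R) R) : Prop := {
  sd_measurable : forall i U, @Sr_borel R r U ->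
    measurable [set w | U (Pi w i)];
  sd_m : forall i,
    meas_eq (m i) (fun C => \int[P]_w unif (Pi w i) (xsection C w))%E;
  sd_ergodic_states : forall m',
    (state p m' /\ skew_ergodic m') <-> exists i, meas_eq m' (m i);
  sd_nu : forall i, meas_eq (nu i) (fun A => \int[P]_w unif (Pi w i) A)%E;
  sd_ergodic_stationary : forall nu',
    ergodic_stationary mu' nu' <-> exists i, meas_eq nu' (nu i);
  sd_factors : exists Pi' : T -> 'I_d -> set (circle R),
    {ae P, forall w, forall i, Pi w i = Pi' (p w) i :> set (circle R)};
  sd_equivariant : {ae P, forall w, forall i n,
    fpow w n @` Pi w i = Pi (sigma n w) i} }.

Record structural_data (d r : nat) (Pi Xi : Sigma mu -> 'I_d -> Sr R r)
    (mp mm : 'I_d -> probability (Sigma mu * circle R)%type R)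
    (nup num : 'I_d -> probability (circle R) R) : Prop := {
  sd_d : (0 < d)%N;
  sd_r : (0 < r)%N;
  sd_plus : state_data past mu Pi mp nup;
  sd_minus : state_data future mu_minus Xi mm num;
  sd_cyclic : {ae P, forall w,
    total_set Pi w `|` total_set Xi w #= `I_(2 * d * r)%N /\
    exists x : nat -> circle R,
      cyclic_listing (2 * d * r)%N x (total_set Pi w `|` total_set Xi w) /\
      forall j (i : 'I_d), (j < d * r)%N -> i = (j %% d)%N :> nat ->
        (Pi w i : set (circle R)) (x (2 * j)%N) /\
        (Xi w i : set (circle R)) (x (2 * j).+1)} }.

End states.
End walk.

Definition preserves (A : set (diff2 R)) (nu : probability (circle R) R) :=
  forall f, A f -> meas_eq (pushforward nu (diff2_fun f)) nu.

Definition exponentially_small (u : nat -> \bar R) :=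
  exists C rho : R, 0 < rho < 1 /\ forall n, (u n <= (C * rho ^+ n)%:E)%E.

End random_walk.

(* Main.v *)
Require Import Defs.
From HB Require Import structures.
From mathcomp Require Import finmap.
From mathcomp Require Import all_boot all_order all_algebra.
From mathcomp Require Import all_classical all_reals all_analysis.
From mathcomp Require Import measurable_realfun.
From mathcomp Require Import ring lra zify.

Set Implicit Arguments.
Unset Strict Implicit.
Unset Printing Implicit Defensive.
Import Order.TTheory GRing.Theory Num.Theory.
Import numFieldNormedType.Exports.

Local Open Scope ring_scope.
Local Open Scope card_scope.
Local Open Scope classical_set_scope.

(** The sets [W^s(w, i)] and [W^u(w, i)] are read off the points themselves:
    the points of [Xi w] cut the circle into arcs, each of which contains one
    point of [Pi w], and [W^s(w, i)] is the union of the arcs around the points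
    of [Pi w i]; the sets [W^u] are obtained by exchanging the two families. The
    two halves of the theorem are treated together: a boolean [e] stands for a
    direction of time, [fam true] is [Pi], [fam false] is [Xi], and the family
    [fam e] only depends on the past with respect to the direction [e].

    The exponents have the stated signs ([lam_lt0]). The points of [fam e] are
    independent of the steps to come, so that the exponent is the mean of
    [ln f'] for a stationary measure [nu]. Since [nu] is not invariant, the mean
    relative entropy [h] of its images is positive, and it is additive along the
    walk ([Ew_entropy]). Let [nu] be smoothed at a small scale by a kernel with a
    tail of exponent [1 + b]. Integrating the elementary inequality
    [H <= expR H - 1], where [H] compares the smoothed density with its transport
    by a word of length [n], bounds [n * (h + lambda)] by a constant plus
    [1 + b] times the mean of [ln (1 + (f^n)')] ([smoothing_ineq],
    [entropy_exponent]). By the ergodic theorem the latter mean is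
    [n * max 0 lambda] up to [o(n)], so that [h + lambda <= (1 + b) * max 0 lambda] for every
    [b > 0]; this forces [lambda < 0] ([exponent_lt0]).

    The arcs are contracted ([gap_contraction]). Because the exponent is negative
    and [ln f'] is Lipschitz, a point [x] of [fam e] is the origin, on each side,
    of a maximal arc of points asymptotic to it, whose end depends equivariantly
    on [x]. Suppose that the past is replaced by an independent one. The new
    points of [fam e] are the images of points which, at a late time, are close
    to the actual ones, because an event hardly depends on the remote past; being
    in a contracted neighbourhood, they have the same stable ends. Therefore the
    law of the stable ends of the points of [fam e] only depends on the future
    ([stable_end_law]). The image of the measure carried by [fam e] under the map
    to the stable ends is thus an ergodic state of the opposite direction, hence
    one of those in the list, and the ends belong to the opposite family
    ([stable_end_in_opposite]): everything that lies before the first point of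
    that family is asymptotic to [x], at an exponential rate
    ([exponential_contraction]).

    Each arc has mass [1 / r] ([gapset_mass]). The label of an arc can be read on
    the opposite family, as the label of its end in the direction [e]. Replace
    again the past by an independent one: the opposite family, its arcs and their
    labels do not change, and by interlacing each arc contains exactly one of
    the [r] new points with its label ([gapset_count]). Averaging over the new
    past gives the mass of the arc for the stationary measure.

    The remaining assertions follow from the equivariance of the families, from
    the ergodic theorem in both directions of time, and from the covering of a
    closed arc by arcs issued from a point of the family
    ([closed_arc_contracts]). *)

(** * Directed distance on the circle *)

Section directed_distance.
Context {R : realType}.
Implicit Types (x y z : circle R) (s t l : R).

Definition fpart t : R := t - (Num.floor t)%:~R.

Lemma fpart_itv t : 0 <= fpart t < 1.
Proof. by have /andP[] := floor_itv t; rewrite /fpart intrD; lra. Qed.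

Lemma cproj_fpart t : cproj (fpart t) = cproj t.
Proof.
by apply/cproj_eqP; rewrite /fpart addrAC subrr add0r rpredN; exact: intr_int.
Qed.

Lemma int_lt1 s : s \is a Num.int -> -1 < s < 1 -> s = 0.
Proof.
move=> /intrP[m ->]; rewrite -[-1]/((-1)%:~R) -[X in _ && (_ < X)]/(1%:~R).
by rewrite !ltr_int => h; have -> : m = 0 by lia.
Qed.

Lemma cproj_inj_lt1 s t : -1 < s - t < 1 -> cproj s = cproj t -> s = t.
Proof. by move=> h /cproj_eqP /int_lt1 /(_ h); lra. Qed.

Lemma fpart_id t : 0 <= t < 1 -> fpart t = t.
Proof.
move=> h; apply: cproj_inj_lt1; last exact: cproj_fpart.
by have := fpart_itv t; lra.
Qed.

Lemma fpart_cproj s t : cproj s = cproj t -> fpart s = fpart t.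
Proof.
move=> h; apply: cproj_inj_lt1; last by rewrite !cproj_fpart.
by have := fpart_itv t; have := fpart_itv s; lra.
Qed.

(** The representative in [0, 1); [repr] is an arbitrary one. *)
Definition rep x : R := fpart (repr x).

Lemma rep_itv x : 0 <= rep x < 1. Proof. exact: fpart_itv. Qed.

Lemma cproj_rep x : cproj (rep x) = x.
Proof. by rewrite /rep cproj_fpart cproj_repr. Qed.

Lemma rep_cproj t : rep (cproj t) = fpart t.
Proof. by apply: fpart_cproj; rewrite cproj_repr. Qed.

Definition adv x t : circle R := cproj (rep x + t).

(** The length of the arc that leads from [x] to [y] in the positive
    direction. It is not symmetric, but it is additive along arcs and a
    diffeomorphism preserves the order that it defines on the points seen from
    [x]; this makes it easier to handle than a distance. *)
Definition ell x y : R := fpart (rep y - rep x).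

Lemma ell_itv x y : 0 <= ell x y < 1. Proof. exact: fpart_itv. Qed.
Lemma ell_ge0 x y : 0 <= ell x y. Proof. by have /andP[] := ell_itv x y. Qed.
Lemma ell_lt1 x y : ell x y < 1. Proof. by have /andP[] := ell_itv x y. Qed.

Lemma cproj_addl s t l : cproj s = cproj t -> cproj (s + l) = cproj (t + l).
Proof.
by move=> /cproj_eqP h; apply/cproj_eqP; rewrite opprD addrACA subrr addr0.
Qed.

Lemma cproj_addr s t l : cproj s = cproj t -> cproj (l + s) = cproj (l + t).
Proof. by move=> h; rewrite ![l + _]addrC; exact: cproj_addl. Qed.

Lemma cproj_add1 s : cproj (s + 1) = cproj s.
Proof. by apply/cproj_eqP; rewrite addrC addKr rpred1. Qed.

Lemma cproj_sub1 s : cproj (s - 1) = cproj s.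
Proof. by rewrite -cproj_add1 subrK. Qed.

Lemma adv_cproj s t : adv (cproj s) t = cproj (s + t).
Proof. by apply: cproj_addl; rewrite cproj_rep. Qed.

Lemma adv0 x : adv x 0 = x. Proof. by rewrite /adv addr0 cproj_rep. Qed.

Lemma adv1 x : adv x 1 = x. Proof. by rewrite /adv cproj_add1 cproj_rep. Qed.

Lemma adv_adv x s t : adv (adv x s) t = adv x (s + t).
Proof. by rewrite {2}/adv adv_cproj -addrA. Qed.

Lemma adv_ell x y : adv x (ell x y) = y.
Proof.
rewrite /adv /ell (cproj_addr _ (cproj_fpart _)) addrC subrK; exact: cproj_rep.
Qed.

Lemma ell_adv x t : 0 <= t < 1 -> ell x (adv x t) = t.
Proof.
move=> h; apply: cproj_inj_lt1.
  by have := ell_itv x (adv x t); lra.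
rewrite /ell cproj_fpart /adv rep_cproj.
rewrite (cproj_addl _ (cproj_fpart _)); congr cproj; lra.
Qed.

Lemma ellP s y : cproj (s + ell (cproj s) y) = y.
Proof. by rewrite -adv_cproj adv_ell. Qed.

Lemma ellE s l : 0 <= l < 1 -> ell (cproj s) (cproj (s + l)) = l.
Proof. by move=> h; rewrite -adv_cproj ell_adv. Qed.

Lemma ellE2 s t : s <= t < s + 1 -> ell (cproj s) (cproj t) = t - s.
Proof.
by move=> h; rewrite -[in cproj t](subrK s t) [_ + s]addrC ellE//; lra.
Qed.

Lemma ellxx x : ell x x = 0.
Proof. by rewrite -[in X in ell _ X](adv0 x) ell_adv// lexx ltr01. Qed.

Lemma ell_eq0 x y : ell x y = 0 -> x = y.
Proof. by move=> h; rewrite -(adv_ell x y) h adv0. Qed.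

Lemma ell_gt0 x y : x <> y -> 0 < ell x y.
Proof.
by move=> xy; rewrite lt_neqAle ell_ge0 andbT; apply/eqP => /esym/ell_eq0.
Qed.

Lemma ell_sym x y : x <> y -> ell y x = 1 - ell x y.
Proof.
move=> xy; have h0 := ell_gt0 xy; have h1 := ell_lt1 x y.
have e : adv y (1 - ell x y) = x.
  by rewrite -{1}(adv_ell x y) adv_adv addrC subrK adv1.
by rewrite -[in LHS]e ell_adv//; lra.
Qed.

(** The hypothesis says that [y] is met before [z] on the way from [x]. *)
Lemma ell_split x y z : ell x y <= ell x z -> ell x z = ell x y + ell y z.
Proof.
move=> h; have h0 := ell_ge0 x y; have h1 := ell_lt1 x z.
have e : adv y (ell x z - ell x y) = z.
  by rewrite -{1}(adv_ell x y) adv_adv addrC subrK adv_ell.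
suff -> : ell y z = ell x z - ell x y by lra.
by rewrite -[in LHS]e ell_adv//; lra.
Qed.

(** The same additivity, the position of [y] being read from the end of the
    arc. *)
Lemma ell_splitr x y z : ell y z <= ell x z -> ell x z = ell x y + ell y z.
Proof.
move=> h; have h0 := ell_ge0 y z; have h1 := ell_lt1 x z.
have e : adv x (ell x z - ell y z) = y.
  rewrite -adv_adv adv_ell.
  by rewrite -[X in adv X _](adv_ell y z) adv_adv subrr adv0.
suff -> : ell x y = ell x z - ell y z by lra.
by rewrite -[in LHS]e ell_adv//; lra.
Qed.

Lemma ell_add x y z : ell x y + ell y z < 1 -> ell x z = ell x y + ell y z.
Proof.
move=> h; have h0 := ell_ge0 x y; have h1 := ell_ge0 y z.
have e : adv x (ell x y + ell y z) = z by rewrite -adv_adv !adv_ell.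
by rewrite -[in LHS]e ell_adv//; lra.
Qed.

Lemma ell_add1 x y z : 1 <= ell x y + ell y z ->
  ell x z = ell x y + ell y z - 1.
Proof.
move=> h; have h0 := ell_lt1 x y; have h1 := ell_lt1 y z.
have e : adv x (ell x y + ell y z - 1) = z.
  rewrite -{1}(adv1 x) adv_adv (_ : 1 + _ = ell x y + ell y z); last lra.
  by rewrite -adv_adv !adv_ell.
by rewrite -[in LHS]e ell_adv//; lra.
Qed.

(** Mirror images are handled together: [ellb true] measures arcs in the
    positive direction and [ellb false] in the negative one. *)
Definition ellb (b : bool) x y : R := if b then ell x y else ell y x.
Definition advb (b : bool) x t : circle R := if b then adv x t else adv x (- t).

Lemma ellb_itv b x y : 0 <= ellb b x y < 1.
Proof. by case: b; exact: ell_itv. Qed.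

Lemma ellb_ge0 b x y : 0 <= ellb b x y.
Proof. by have /andP[] := ellb_itv b x y. Qed.

Lemma ellb_lt1 b x y : ellb b x y < 1.
Proof. by have /andP[] := ellb_itv b x y. Qed.

Lemma advb1 b x : advb b x 1 = x.
Proof. by case: b; rewrite /advb ?adv1// /adv cproj_sub1 cproj_rep. Qed.

Lemma advb_adv b x s t : advb b (advb b x s) t = advb b x (s + t).
Proof. by case: b; rewrite /advb adv_adv// -opprD. Qed.

Lemma advb_ell b x y : advb b x (ellb b x y) = y.
Proof.
case: b; rewrite /advb /ellb ?adv_ell//.
by rewrite -{1}(adv_ell y x) adv_adv subrr adv0.
Qed.

Lemma ellb_adv b x t : 0 <= t < 1 -> ellb b x (advb b x t) = t.
Proof.
case: b; rewrite /advb /ellb; first exact: ell_adv.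
move=> h; have e : adv (adv x (- t)) t = x by rewrite adv_adv addNr adv0.
by rewrite -{2}e ell_adv.
Qed.

Lemma ellbxx b x : ellb b x x = 0. Proof. by case: b; exact: ellxx. Qed.

Lemma ellb_gt0 b x y : x <> y -> 0 < ellb b x y.
Proof. by case: b => xy; apply: ell_gt0 => // /esym. Qed.

Lemma ellb_sym b x y : x <> y -> ellb b y x = 1 - ellb b x y.
Proof. by case: b => xy; apply: ell_sym => // /esym. Qed.

Lemma ellbN b x y : ellb (~~ b) x y = ellb b y x. Proof. by case: b. Qed.

Lemma ellb_split b x y z :
  ellb b x y <= ellb b x z -> ellb b x z = ellb b x y + ellb b y z.
Proof. by case: b => /= h; [exact: ell_split|rewrite addrC; exact: ell_splitr]. Qed.

Lemma ellb_splitr b x y z :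
  ellb b y z <= ellb b x z -> ellb b x z = ellb b x y + ellb b y z.
Proof. by case: b => /= h; [exact: ell_splitr|rewrite addrC; exact: ell_split]. Qed.

Lemma ellb_add b x y z :
  ellb b x y + ellb b y z < 1 -> ellb b x z = ellb b x y + ellb b y z.
Proof.
by case: b => /= h; [exact: ell_add|rewrite addrC; apply: ell_add; rewrite addrC].
Qed.

Lemma ellb_add1 b x y z :
  1 <= ellb b x y + ellb b y z -> ellb b x z = ellb b x y + ellb b y z - 1.
Proof.
by case: b => /= h; [exact: ell_add1|rewrite [_ + ell z y]addrC; apply: ell_add1; rewrite addrC].
Qed.

Lemma ellb_triangle b x y z : ellb b x z <= ellb b x y + ellb b y z.
Proof.
have [/ellb_add->//|/ellb_add1->] := ltP (ellb b x y + ellb b y z) 1.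
by rewrite lerBlDr lerDl.
Qed.

End directed_distance.

(** * Lifts of diffeomorphisms *)

Section lifts.
Context {R : realType}.
Implicit Types (f g : diff2 R) (x y z : circle R) (s t : R).

(** A lift is injective and of degree one, hence increasing; its derivative
    does not vanish because it has a differentiable inverse. *)
Lemma lift_exists f : exists F : R -> R,
  [/\ C2 F, is_lift F f, forall t, F (t + 1) = F t + 1
    & forall s t, s <= t -> F s <= F t] /\
  ((forall s t, s < t -> F s < F t) /\ forall t, 0 < derive1 F t).
Proof.
have [F [G [[F2 G2 FK GK] [F1 Ff]]]] := svalP f.
have cF : continuous F.
  by case: F2 => d _ _ t; apply/differentiable_continuous/derivable1_diffP.
have mF : {mono F : s t / s <= t}.
  have m : {in `]-oo, +oo[%R &, {mono F : s t / s <= t}}.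
    apply: itv_continuous_inj_le.
    - by exists 0, 1; have := F1 0; rewrite add0r => ->; rewrite ltr01 lerDl ler01 !in_itv.
    - exact: continuous_subspaceT.
    - by move=> u v _ _; exact: (can_inj FK).
  by move=> s t; apply: m; rewrite in_itv.
have sF := leW_mono mF.
exists F; split; split => //; try by move=> s t; rewrite ?mF ?sF.
move=> t; rewrite lt_neqAle; apply/andP; split; last first.
  apply: (@incr_derive1_ge0 _ _ setT) => //.
  - by move=> u _; case: F2 => h _ _; exact: h.
  - by move=> u v _ _; rewrite sF.
  - by rewrite interiorT.
apply/eqP => F'0.
have isd (H : R -> R) u : derivable H u 1 -> is_derive u (1 : R) H ((derive1 H) u).
  by move=> dH; rewrite derive1E; exact: derivableP.
have h : is_derive t (1 : R) (G \o F) (derive1 G (F t) * derive1 F t).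
  by case: F2 => d _ _; case: G2 => d' _ _; apply: is_derive1_comp; exact: isd.
have : 'D_1 (G \o F) t = 1.
  by rewrite (_ : G \o F = id) ?derive_id//; apply/funext => u /=; rewrite FK.
by rewrite (@derive_val _ _ _ _ _ _ _ h) -F'0 mulr0 => /esym/eqP; rewrite oner_eq0.
Qed.

(** Unlike [clift], this lift is known to commute with the unit translation,
    so that it computes the lengths of images of arcs. *)
Definition rlift f : R -> R := sval (cid (lift_exists f)).

Lemma liftP f :
  [/\ C2 (rlift f), is_lift (rlift f) f, forall t, rlift f (t + 1) = rlift f t + 1
    & forall s t, s <= t -> rlift f s <= rlift f t] /\
  ((forall s t, s < t -> rlift f s < rlift f t) /\
   forall t, 0 < derive1 (rlift f) t).
Proof. exact: (svalP (cid (lift_exists f))). Qed.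

Lemma lift_C2 f : C2 (rlift f).
Proof. by have [[]] := liftP f. Qed.
Lemma liftE f t : cproj (rlift f t) = f (cproj t).
Proof. by have [[_ h _ _] _] := liftP f; exact: h. Qed.
Lemma lift1 f t : rlift f (t + 1) = rlift f t + 1.
Proof. by have [[_ _ h _] _] := liftP f; exact: h. Qed.
Lemma lift_le f s t : s <= t -> rlift f s <= rlift f t.
Proof. by have [[_ _ _ h] _] := liftP f; exact: h. Qed.
Lemma lift_lt f s t : s < t -> rlift f s < rlift f t.
Proof. by have [_ [h _]] := liftP f; exact: h. Qed.
Lemma lift_deriv_gt0 f t : 0 < derive1 (rlift f) t.
Proof. by have [_ [_ h]] := liftP f; exact: h. Qed.

Lemma lift_derivable f t : derivable (rlift f) t 1.
Proof. by have [] := lift_C2 f. Qed.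
Lemma lift_derivable2 f t : derivable (derive1 (rlift f)) t 1.
Proof. by have [] := lift_C2 f. Qed.

Lemma derivable_continuous (F : R -> R) :
  (forall t, derivable F t 1) -> continuous F.
Proof. by move=> d t; apply/differentiable_continuous/derivable1_diffP. Qed.

Lemma lift_deriv2_continuous f : continuous (derive1 (derive1 (rlift f))).
Proof. by have [_ _ h] := lift_C2 f; exact: h. Qed.

Lemma lift_continuous f : continuous (rlift f).
Proof. exact/derivable_continuous/lift_derivable. Qed.
Lemma lift_deriv_continuous f : continuous (derive1 (rlift f)).
Proof. exact/derivable_continuous/lift_derivable2. Qed.

Lemma cderiv_cproj f t : cderiv f (cproj t) = derive1 (rlift f) t.
Proof. by apply: cderivE; [exact: lift_C2|exact: liftE]. Qed.

Lemma cderiv_gt0 f x : 0 < cderiv f x.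
Proof. by rewrite -(cproj_rep x) cderiv_cproj lift_deriv_gt0. Qed.

Lemma diff2M f g x : ((f * g)%g : diff2 R) x = f (g x). Proof. by []. Qed.
Lemma diff21 x : (1%g : diff2 R) x = x. Proof. by []. Qed.
Lemma diff2K f : cancel f (f^-1%g : diff2 R).
Proof. by move=> x; rewrite -diff2M mulVg. Qed.
Lemma diff2VK f : cancel (f^-1%g : diff2 R) f.
Proof. by move=> x; rewrite -diff2M mulgV. Qed.
Lemma diff2_injective f : injective f. Proof. exact: can_inj (diff2K f). Qed.

Lemma cderivM f g x : cderiv (f * g)%g x = cderiv f (g x) * cderiv g x.
Proof.
rewrite -(cproj_rep x); set t := rep x; rewrite -liftE !cderiv_cproj.
have l2 : is_lift (rlift f \o rlift g) ((f * g)%g : diff2 R).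
  by move=> u /=; rewrite !liftE.
have := cderivE t (C2_comp (lift_C2 f) (lift_C2 g)) l2.
rewrite cderiv_cproj => ->; rewrite derive1E.
have h : is_derive t (1 : R) (rlift f \o rlift g)
    (derive1 (rlift f) (rlift g t) * derive1 (rlift g) t).
  by apply: is_derive1_comp; rewrite derive1E; apply: derivableP; exact: lift_derivable.
exact: (@derive_val _ _ _ _ _ _ _ h).
Qed.

Lemma cderiv1 x : cderiv (1%g : diff2 R) x = 1.
Proof.
have := cderivM 1%g 1%g x; rewrite mulg1 diff21 => /esym/eqP.
by rewrite -subr_eq0 -{3}[cderiv _ x]mulr1 -mulrBr mulf_eq0 gt_eqF ?cderiv_gt0//= subr_eq0 => /eqP.
Qed.

Lemma cderivV f x : cderiv f^-1%g (f x) = (cderiv f x)^-1.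
Proof.
apply: (mulIf (lt0r_neq0 (cderiv_gt0 f x))).
by rewrite mulVf ?(lt0r_neq0 (cderiv_gt0 f x))// -cderivM mulVg cderiv1.
Qed.

Lemma ell_lift f s l : 0 <= l < 1 ->
  ell (f (cproj s)) (f (cproj (s + l))) = rlift f (s + l) - rlift f s.
Proof.
move=> h; rewrite -!liftE ellE2//; apply/andP; split.
  by apply: lift_le; lra.
by rewrite -lift1; apply: lift_lt; lra.
Qed.

Lemma ell_liftE f x y :
  ell (f x) (f y) = rlift f (rep x + ell x y) - rlift f (rep x).
Proof. by rewrite -ell_lift ?ell_itv// cproj_rep -/(adv x _) adv_ell. Qed.

Lemma ell_mono f x y z : (ell (f x) (f y) < ell (f x) (f z)) = (ell x y < ell x z).
Proof.
rewrite !ell_liftE ltrD2r; apply/idP/idP => [|h]; last by apply: lift_lt; lra.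
by apply: contraTT; rewrite -!leNgt => h; apply: lift_le; lra.
Qed.

Lemma ellb_mono b f x y z :
  (ellb b (f x) (f y) < ellb b (f x) (f z)) = (ellb b x y < ellb b x z).
Proof.
case: b; first exact: ell_mono.
rewrite /ellb.
have [->|/eqP xy] := eqVneq x y.
  rewrite !ellxx.
  have [->|/eqP yz] := eqVneq y z; first by rewrite !ellxx ltxx.
  rewrite !ell_gt0// => [/esym//|/diff2_injective/esym//].
have [->|/eqP xz] := eqVneq x z.
  by rewrite !ellxx !ltNge !ell_ge0.
rewrite !(@ell_sym _ x)// ![ell (f _) (f x)]ell_sym; try by move/diff2_injective.
by rewrite !ltrD2l !ltrN2 ell_mono.
Qed.

Lemma ellb_mono_le b f x y z :
  (ellb b (f x) (f y) <= ellb b (f x) (f z)) = (ellb b x y <= ellb b x z).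
Proof. by rewrite !leNgt ellb_mono. Qed.

(** The mean value theorem, with an intermediate point on the arc. *)
Lemma ell_mvt f x y : exists2 z, (ell x z <= ell x y) &
  ell (f x) (f y) = cderiv f z * ell x y.
Proof.
rewrite ell_liftE; set s := rep x; set l := ell x y.
have l0 : 0 <= l by exact: ell_ge0.
have dF t : is_derive t (1 : R) (rlift f) (derive1 (rlift f) t).
  by rewrite derive1E; apply: derivableP; exact: lift_derivable.
have [||c cI ->] := @MVT_segment R (rlift f) (derive1 (rlift f)) s (s + l).
- by rewrite lerDl.
- exact/continuous_subspaceT/lift_continuous.
exists (adv x (c - s)).
  have l1 := ell_lt1 x y; move: cI; rewrite in_itv /= => /andP[? ?].
  by rewrite ell_adv// /l; move: l1; rewrite -/l; lra.
rewrite (_ : adv x (c - s) = cproj c) ?cderiv_cproj; last first.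
  by rewrite /adv -/s; congr cproj; lra.
by congr (_ * _); lra.
Qed.

Lemma ellb_mvt b f x y : exists2 z, (ellb b x z <= ellb b x y) &
  ellb b (f x) (f y) = cderiv f z * ellb b x y.
Proof.
case: b => /=; first exact: ell_mvt.
have [z zl ->] := ell_mvt f y x; exists z => //.
by rewrite (ell_split zl) lerDr ell_ge0.
Qed.

(** The logarithmic derivative of the derivative of a lift is continuous and
    periodic, hence bounded. This is what the C2 assumption is for: it
    controls the distortion of long compositions. *)
Lemma lncderiv_lip f : exists2 K, 0 <= K &
  forall b x y, `|ln (cderiv f y) - ln (cderiv f x)| <= K * ellb b x y.
Proof.
pose F' := derive1 (rlift f); pose h t := ln (F' t); pose h' t := derive1 F' t / F' t.
have dh t : is_derive t (1 : R) h (h' t).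
  rewrite /h' mulrC.
  have d1 : is_derive (F' t) (1 : R) (@ln R) (F' t)^-1.
    by apply: is_derive1_ln; exact: lift_deriv_gt0.
  have d2 : is_derive t (1 : R) F' (derive1 F' t).
    by rewrite derive1E; apply: derivableP; exact: lift_derivable2.
  exact: is_derive1_comp.
have ch' : continuous (fun t => `|h' t|).
  move=> t; apply: continuous_comp; last exact: norm_continuous.
  apply: (@continuousM _ _ (derive1 F') (fun t => (F' t)^-1)).
    exact: lift_deriv2_continuous.
  apply: continuousV; first by rewrite lt0r_neq0// lift_deriv_gt0.
  exact: lift_deriv_continuous.
have [c _ hc] := @EVT_max R (fun t => `|h' t|) 0 2 (ler0n _ _) (continuous_subspaceT ch').
exists `|h' c| => // b.
have H x y : `|ln (cderiv f y) - ln (cderiv f x)| <= `|h' c| * ell x y.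
  have -> : cderiv f y = F' (rep x + ell x y).
    by rewrite /F' -cderiv_cproj -/(adv x _) adv_ell.
  have -> : cderiv f x = F' (rep x) by rewrite /F' -cderiv_cproj cproj_rep.
  set s := rep x; set l := ell x y.
  have [s0 s1] : 0 <= s /\ s < 1 by have /andP := rep_itv x.
  have [l0 l1] : 0 <= l /\ l < 1 by have /andP := ell_itv x y.
  have [||u uI] := @MVT_segment R h h' s (s + l).
  - by rewrite lerDl.
  - apply: continuous_subspaceT; apply: derivable_continuous => t.
    exact: (@ex_derive _ _ _ _ _ _ _ (dh t)).
  move=> e; change (`|h (s + l) - h s| <= `|h' c| * l); rewrite e normrM (_ : s + l - s = l); last by lra.
  rewrite (ger0_norm l0) ler_wpM2r// hc// in_itv /=.
  by move: uI; rewrite in_itv /=; lra.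
case: b => x y; first exact: H.
by rewrite distrC; exact: H.
Qed.

Lemma lncderiv_bounded f : exists B, forall x, `|ln (cderiv f x)| <= B.
Proof.
have [K K0 h] := lncderiv_lip f.
exists (K + `|ln (cderiv f (cproj 0))|) => x.
rewrite -[ln _](subrK (ln (cderiv f (cproj 0)))).
apply: le_trans (ler_normD _ _) _; rewrite lerD2r.
apply: le_trans (h true _ _) _; rewrite ler_piMr//.
by rewrite ltW// ellb_lt1.
Qed.

End lifts.

(** * Topology and Borel structure of the circle *)

Section circle_borel.
Context {R : realType}.
Implicit Types (f g : diff2 R) (x y z : circle R) (s t : R) (A : set (circle R)).

Lemma cproj_continuous : continuous (@cproj R).
Proof. exact: pi_continuous. Qed.

Lemma open_cproj (U : set R) : open U -> open (@cproj R @` U).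
Proof.
move=> oU; rewrite /open /= /quotient_open.
rewrite [X in open X](_ : _ = \bigcup_(m in [set: int]) ((fun t => t + m%:~R) @^-1` U)).
  apply: bigcup_open => m _; apply: open_comp => // t _.
  by apply: (@continuousD _ _ _ id (cst _)) => //; exact: cst_continuous.
apply/seteqP; split => [t [u Uu /esym ut]|t [m _ /= tU]].
  have /intrP[m mE] : u - t \is a Num.int by apply/cproj_eqP.
  by exists m => //=; rewrite -mE addrC subrK.
exists (t + m%:~R) => //; apply/cproj_eqP; rewrite addrC addKr; exact: intr_int.
Qed.

Lemma open_arc_open s t : open (@cproj R @` `]s, t[).
Proof. by apply: open_cproj; exact: interval_open. Qed.

Lemma open_arc_connected s t : connected (@cproj R @` `]s, t[).
Proof.
apply: connected_continuous_connected.
  by apply/connected_intervalP; exact: interval_is_interval.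
exact/continuous_subspaceT/cproj_continuous.
Qed.

(** A connected subset of the union that meets [I] cannot meet [U], which
    would disconnect it. *)
Lemma open_connected_component (T : topologicalType) (I U : set T) (x : T) :
  open I -> open U -> I `&` U = set0 -> connected I -> I x ->
  connected_component (I `|` U) x = I.
Proof.
move=> oI oU IU cI Ix; apply/seteqP; split; last first.
  by apply: connected_component_max => //; exact: subsetUl.
move=> y [C [Cx CIU cC] Cy].
suff CI : C `&` I = C by move: Cy; rewrite -CI => -[].
apply: cC; first by exists x.
  by exists I.
exists (~` U); first exact: open_closedC.
apply/seteqP; split => z [Cz]; last by move=> nUz; split=> //; case: (CIU _ Cz).
move=> Iz; split => // Uz; have : (I `&` U) z by [].
by rewrite IU.
Qed.

Lemma open_ell_ball (U : set (circle R)) x : open U -> U x ->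
  exists2 e : R, 0 < e & forall b y, ellb b x y < e -> U y.
Proof.
move=> oU Ux.
have : nbhs (rep x) (@cproj R @^-1` U).
  by apply: open_nbhs_nbhs; split; [exact: oU|rewrite /= cproj_rep].
move=> /nbhs_ballP[e /= e0 eU]; exists e => // b y xy.
have := ellb_ge0 b x y => l0.
rewrite -(advb_ell b x y).
case: b xy l0 => xy l0; apply: (eU); rewrite /ball /= opprD.
  by rewrite addrA subrr add0r normrN ger0_norm.
by rewrite addrA subrr add0r opprK ger0_norm.
Qed.

Lemma measurable_open_circle (U : set (circle R)) : open U -> measurable U.
Proof. by move=> oU; exact: sub_sigma_algebra. Qed.

Lemma measurable_open_arc s t : measurable (@cproj R @` `]s, t[).
Proof. by apply: measurable_open_circle; exact: open_arc_open. Qed.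

Lemma continuous_circle_measurable (f : circle R -> circle R) :
  continuous f -> measurable_fun setT f.
Proof.
move=> /continuousP cf; apply: measurability; first by [].
by move=> A [B oB <-]; rewrite setTI; apply: measurable_open_circle; exact: cf.
Qed.

Lemma measurable_cproj : measurable_fun setT (@cproj R).
Proof.
apply: measurability; first by [].
move=> A [B oB <-]; rewrite setTI; apply: open_measurable.
by have /continuousP := cproj_continuous; exact.
Qed.

Lemma measurable_cproj0 : measurable [set (cproj 0 : circle R)].
Proof.
rewrite -[X in measurable X]setCK; apply: measurableC.
rewrite (_ : ~` _ = @cproj R @` `]0, 1[); first exact: measurable_open_arc.
apply/seteqP; split => x /= h; last first.
  case: h => t; rewrite in_itv /= => h <- /cproj_inj_lt1 e.
  by have : t = 0; [apply: e; lra|lra].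
exists (rep x); last exact: cproj_rep.
have /andP[h0 h1] := rep_itv x; rewrite in_itv /= h1 andbT lt_neqAle h0 andbT.
by apply/eqP => e; apply: h; rewrite e cproj_rep.
Qed.

(** Below a level in (0, 1), the representative cuts an open arc together with
    the base point. *)
Lemma measurable_rep : measurable_fun setT (@rep R).
Proof.
apply: (measurability _ (RGenInftyO.measurableE R)).
move=> _ [_ [a ->] <-]; rewrite setTI.
have [a0|a0] := leP a 0.
  rewrite (_ : _ @^-1` _ = set0); first exact: measurable0.
  apply/seteqP; split => x //=; rewrite in_itv /= => h.
  by have := rep_itv x; lra.
have [a1|a1] := leP 1 a.
  rewrite (_ : _ @^-1` _ = setT); first exact: measurableT.
  apply/seteqP; split => x //= _; rewrite in_itv /=.
  by have := rep_itv x; lra.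
rewrite (_ : _ @^-1` _ = [set cproj 0] `|` @cproj R @` `]0, a[).
  by apply: measurableU; [exact: measurable_cproj0|exact: measurable_open_arc].
apply/seteqP; split => x /=; rewrite in_itv /= => h.
  have /andP[h0 h1] := rep_itv x.
  have [r0|r0] := eqVneq (rep x) 0; first by left; rewrite -r0 cproj_rep.
  right; exists (rep x); last exact: cproj_rep.
  by rewrite in_itv /= h lt_neqAle eq_sym r0 h0.
case: h => [->|[t]]; first by rewrite rep_cproj fpart_id// lexx ltr01.
by rewrite in_itv /= => h <-; rewrite rep_cproj fpart_id; lra.
Qed.

Lemma measurable_fpart : measurable_fun setT (@fpart R).
Proof.
rewrite (_ : fpart = @rep R \o @cproj R); last first.
  by apply/funext => t /=; rewrite rep_cproj.
by apply: measurableT_comp; [exact: measurable_rep|exact: measurable_cproj].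
Qed.

Lemma measurable_ell d (T : measurableType d) (u v : T -> circle R) :
  measurable_fun setT u -> measurable_fun setT v ->
  measurable_fun setT (fun p => ell (u p) (v p)).
Proof.
move=> mu mv; apply: (measurableT_comp measurable_fpart).
apply: measurable_funB; apply: (measurableT_comp measurable_rep) => //.
Qed.

Lemma measurable_ellb b d (T : measurableType d) (u v : T -> circle R) :
  measurable_fun setT u -> measurable_fun setT v ->
  measurable_fun setT (fun p => ellb b (u p) (v p)).
Proof. by case: b => mu mv; exact: measurable_ell. Qed.

Lemma measurable_advb b d (T : measurableType d) (u : T -> circle R) (v : T -> R) :
  measurable_fun setT u -> measurable_fun setT v ->
  measurable_fun setT (fun p => advb b (u p) (v p)).
Proof.
move=> mu mv; case: b; apply: (measurableT_comp measurable_cproj).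
  by apply: measurable_funD => //; exact: (measurableT_comp measurable_rep).
apply: measurable_funD; first exact: (measurableT_comp measurable_rep).
exact: measurableT_comp.
Qed.

Lemma diff2_continuous f : continuous f.
Proof.
apply/quotient_continuous.
rewrite (_ : _ \o _ = @cproj R \o rlift f).
  move=> t; apply: continuous_comp; first exact: lift_continuous.
  exact: cproj_continuous.
by apply/funext => t /=; rewrite liftE.
Qed.

Lemma diff2_measurable f : measurable_fun setT f.
Proof. by apply: continuous_circle_measurable; exact: diff2_continuous. Qed.

Lemma cproj_image_shift (a b : R) (m : int) :
  @cproj R @` `[a + m%:~R, b + m%:~R] = @cproj R @` `[a, b].
Proof.
have cm t (k : int) : cproj (t + k%:~R) = cproj t.
  by apply/cproj_eqP; rewrite addrC addKr; exact: intr_int.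
apply/seteqP; split => x [t]; rewrite /= in_itv /= => h <-.
  exists (t - m%:~R); last by rewrite -mulrNz cm.
  by rewrite /= in_itv /=; lra.
by exists (t + m%:~R); [rewrite /= in_itv /=; lra|rewrite cm].
Qed.

Lemma cproj_arcC (c e : R) : c <= e < c + 1 ->
  ~` (@cproj R @` `[c, e]) = @cproj R @` `]e, c + 1[.
Proof.
move=> ce; apply/seteqP; split => x /= h; last first.
  case: h => t; rewrite in_itv /= => ht <- [u]; rewrite in_itv /= => hu.
  move=> /cproj_eqP ut; suff : u - t = 0 by lra.
  by apply: int_lt1 => //; lra.
have l01 := ell_itv (cproj c) x; have lx := ellP c x.
have lt : e < c + ell (cproj c) x.
  rewrite ltNge; apply/negP => le; apply: h; exists (c + ell (cproj c) x) => //.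
  by rewrite in_itv /=; lra.
by exists (c + ell (cproj c) x) => //; rewrite in_itv /=; lra.
Qed.

(** After an integer translation the arc starts in [0, 1), and its trace on
    the fundamental domain consists of at most two intervals. *)
Lemma arc_length_le (a b : R) : a <= b < a + 1 ->
  (arc_length (@cproj R @` `[a, b]) <= (b - a)%:E)%E.
Proof.
move=> ab.
have H (c e : R) : c <= e < c + 1 -> 0 <= c < 1 ->
  (arc_length (@cproj R @` `[c, e]) <= (e - c)%:E)%E.
  move=> ce c0; rewrite /arc_length.
  have mI (u v : R) : measurable (`[u, v]%classic : set R) by exact: measurable_itv.
  pose k : R := Num.min 1 e; pose e' : R := e - 1.
  have m2 := measurableU _ _ (mI c k) (mI 0 e').
  apply: (@le_trans _ _ (lebesgue_measure (`[c, k]%classic `|` `[0, e']%classic))).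
    have sub : `[0, 1[ `&` @cproj R @^-1` (@cproj R @` `[c, e]) `<=`
               `[c, k]%classic `|` `[0, e']%classic.
      move=> t [/=]; rewrite in_itv /= => t01 [u]; rewrite /= in_itv /= => uce.
      move=> /cproj_eqP/intrP[m mE].
      have m0 : (-1 < m < 2)%R.
        apply/andP; split; rewrite -(ltr_int R) -mE.
          by rewrite -[(-1)%:~R]/(-1 : R); lra.
        by rewrite -[2%:~R]/(2 : R); lra.
      have [m1|m1] : m = 0 \/ m = 1 by lia.
        by move: mE; rewrite m1 => mE; left; rewrite /k /= in_itv /= le_min; lra.
      by move: mE; rewrite m1 => mE; right; rewrite /e' /= in_itv /=; lra.
    apply: le_measure => //; rewrite inE //.
    apply: measurableI; first exact: measurable_itv.
    rewrite -[X in measurable X]setTI; apply: measurable_cproj => //.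
    rewrite -[X in measurable X]setCK; apply: measurableC.
    apply: measurable_open_circle.
    rewrite (_ : ~` _ = @cproj R @` `]e, c + 1[); first exact: open_arc_open.
    exact: cproj_arcC.
  apply: le_trans (measureU2 _ _ _) _; try exact: measurable_itv.
  change (lebesgue_measure (`[c, k]%classic : set R) +
    lebesgue_measure (`[0%R, e']%classic : set R) <= (e - c)%:E)%E.
  rewrite !lebesgue_measure_itv /= !lte_fin -!EFinB /k /e'.
  have [e1|e1] := leP 1 e.
    case: ifPn => // h1; case: ifPn => // h2; rewrite ?adde0 ?add0e ?lee_fin -?EFinD ?lee_fin; lra.
  have -> : (0 < e - 1) = false by apply/negbTE; rewrite -leNgt; lra.
  by rewrite adde0; case: ifPn => // _; rewrite lee_fin; lra.
have := H (a - (Num.floor a)%:~R) (b - (Num.floor a)%:~R).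
rewrite -!mulrNz cproj_image_shift => /(_ _ _)/le_trans; apply.
- by rewrite !mulrNz; lra.
- by rewrite mulrNz; exact: fpart_itv.
- by rewrite lee_fin; lra.
Qed.

End circle_borel.

(** * Expectations of bounded functions *)

Section expectation.
Context {R : realType} {d} {T : measurableType d}.
Implicit Types (f g : T -> R) (A : set T) (c : R).

(** Bounded measurable functions are integrable for every probability and
    stable under the operations used here; their expectations [EX] are real
    numbers that can be added and compared without side conditions on
    integrability. *)
Definition bm f := measurable_fun setT f /\ exists B : R, forall x, `|f x| <= B.

Lemma bm_cst c : bm (cst c).
Proof. by split => //; exists `|c|. Qed.

Lemma bmD f g : bm f -> bm g -> bm (fun x => f x + g x).
Proof.
move=> [mf [B fB]] [mg [C gC]]; split; first exact: measurable_funD.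
exists (B + C) => x; apply: le_trans (ler_normD _ _) _; exact: lerD.
Qed.

Lemma bmM f g : bm f -> bm g -> bm (fun x => f x * g x).
Proof.
move=> [mf [B fB]] [mg [C gC]]; split; first exact: measurable_funM.
by exists (B * C) => x; rewrite normrM ler_pM.
Qed.

Lemma bmN f : bm f -> bm (fun x => - f x).
Proof.
move=> [mf [B fB]]; split; first exact: measurableT_comp.
by exists B => x; rewrite normrN.
Qed.

Lemma bmB f g : bm f -> bm g -> bm (fun x => f x - g x).
Proof. by move=> bf bg; apply: bmD => //; exact: bmN. Qed.

Lemma bmZ c f : bm f -> bm (fun x => c * f x).
Proof. by move=> bf; apply: bmM => //; exact: bm_cst. Qed.

Lemma bm_norm f : bm f -> bm (fun x => `|f x|).
Proof.
move=> [mf [B fB]]; split; first exact: measurableT_comp.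
by exists B => x; rewrite normr_id.
Qed.

Lemma bm_max f g : bm f -> bm g -> bm (fun x => Num.max (f x) (g x)).
Proof.
move=> [mf [B fB]] [mg [C gC]]; split; first exact: measurable_maxr.
exists (B + C) => x; have B0 : 0 <= B by apply: le_trans (fB x).
have C0 : 0 <= C by apply: le_trans (gC x).
have [_|_] := leP (f x) (g x); first by apply: le_trans (gC x) _; rewrite lerDr.
by apply: le_trans (fB x) _; rewrite lerDl.
Qed.

Lemma bm_indic A : measurable A -> bm (\1_A : T -> R).
Proof.
move=> mA; split; first exact: measurable_indic.
by exists 1 => x; rewrite indicE; case: (_ \in _); rewrite ?normr1 ?normr0.
Qed.

Lemma bm_sum (I : Type) (r : seq I) (P : pred I) (F : I -> T -> R) :
  (forall i, bm (F i)) -> bm (fun x => \sum_(i <- r | P i) F i x).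
Proof.
move=> bF; elim: r => [|i r IH].
  by under [fun _ => _]funext do rewrite big_nil; exact: bm_cst.
under [fun _ => _]funext do rewrite big_cons.
by case: (P i) => //; exact: bmD.
Qed.

Variable m : probability T R.

Definition EX f : R := (\int[m]_x f x)%R.

Lemma bm_integrable f : bm f -> m.-integrable setT (EFin \o f).
Proof.
move=> [mf [B fB]]; apply: measurable_bounded_integrable => //.
  by rewrite (le_lt_trans (probability_le1 m measurableT))// ltry.
exists B; split; first exact: num_real.
by move=> C BC x _; apply: le_trans (fB x) _; exact: ltW.
Qed.

Lemma EXE f : bm f -> (\int[m]_x (f x)%:E)%E = (EX f)%:E.
Proof.
move=> bf; rewrite /EX /Rintegral fineK//.
by apply: integrable_fin_num => //; exact: bm_integrable.
Qed.

Lemma EXD f g : bm f -> bm g -> EX (fun x => f x + g x) = EX f + EX g.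
Proof. by move=> bf bg; apply: RintegralD => //; exact: bm_integrable. Qed.

Lemma EXB f g : bm f -> bm g -> EX (fun x => f x - g x) = EX f - EX g.
Proof. by move=> bf bg; apply: RintegralB => //; exact: bm_integrable. Qed.

Lemma EXZ c f : bm f -> EX (fun x => c * f x) = c * EX f.
Proof. by move=> bf; apply: RintegralZl => //; exact: bm_integrable. Qed.

Lemma EX_cst c : EX (cst c) = c.
Proof.
by rewrite /EX Rintegral_cst// -[X in _ * X]/(fine (m setT)) probability_setT mulr1.
Qed.

Lemma EXN f : bm f -> EX (fun x => - f x) = - EX f.
Proof.
move=> bf; rewrite -mulN1r -EXZ//; congr EX.
by apply/funext => x; rewrite mulN1r.
Qed.

Lemma EX_ge0 f : (forall x, 0 <= f x) -> 0 <= EX f.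
Proof. by move=> f0; apply: Rintegral_ge0 => x _. Qed.

Lemma EX_le f g : bm f -> bm g -> (forall x, f x <= g x) -> EX f <= EX g.
Proof. by move=> bf bg fg; apply: le_Rintegral => //; exact: bm_integrable. Qed.

Lemma EX_ae f g : bm f -> bm g -> {ae m, forall x, f x = g x} -> EX f = EX g.
Proof.
move=> [mf _] [mg _] fg; rewrite /EX /Rintegral; congr fine.
apply: ae_eq_integral => //; try exact/measurable_EFinP.
by apply: filterS fg => x /= -> _.
Qed.

Lemma EX_norm_le f B : bm f -> (forall x, `|f x| <= B) -> `|EX f| <= B.
Proof.
move=> bf fB; apply: le_trans (le_normr_Rintegral _ (bm_integrable bf)) _ => //.
rewrite -[leRHS](EX_cst B); apply: EX_le => //; [exact: bm_norm|exact: bm_cst].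
Qed.

Lemma EX_indic A : measurable A -> (EX \1_A)%:E = m A.
Proof.
by move=> mA; rewrite -EXE ?integral_indic ?setIT//; exact: bm_indic.
Qed.

Lemma EX_sum (I : Type) (r : seq I) (P : pred I) (F : I -> T -> R) :
  (forall i, bm (F i)) ->
  EX (fun x => \sum_(i <- r | P i) F i x) = \sum_(i <- r | P i) EX (F i).
Proof.
move=> bF; elim: r => [|i r IH].
  by under [in LHS]eq_fun do rewrite big_nil; rewrite big_nil; exact: EX_cst.
under [in LHS]eq_fun do rewrite big_cons.
rewrite big_cons; case: (P i) => //; rewrite -IH; apply: EXD => //.
exact: bm_sum.
Qed.

Lemma EX_eq0 f : bm f -> (forall x, 0 <= f x) -> EX f = 0 ->
  {ae m, forall x, f x = 0}.
Proof.
move=> bf f0 e0.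
have mf : measurable_fun setT (EFin \o f) by apply/measurable_EFinP; case: bf.
have := ae_eq_integral_abs m measurableT mf => -[h _].
have : ae_eq m setT (EFin \o f) (cst 0%E).
  apply: h; rewrite -[RHS]/((0:R)%:E) -e0 -EXE//.
  by apply: eq_integral => x _ /=; rewrite ger0_norm.
by apply: filterS => x /(_ I) /= [].
Qed.

Lemma EX_dct (F : nat -> T -> R) f B : (forall n, bm (F n)) -> bm f ->
  (forall n x, `|F n x| <= B) ->
  {ae m, forall x, F ^~ x @ \oo --> f x} ->
  (fun n => EX (F n)) @ \oo --> EX f.
Proof.
move=> bF bf FB Ff.
have [|||||_ _] := @dominated_convergence _ _ _ m setT measurableT
  (fun n x => (F n x)%:E) (EFin \o f) (cst B%:E).
- by move=> n; apply/measurable_EFinP; case: (bF n).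
- by apply/measurable_EFinP; case: bf.
- apply: filterS Ff => x h _; apply: cvg_EFin => //.
  by apply: nearW => n.
- exact: (bm_integrable (bm_cst B)).
- by apply: aeW => x n _ /=; rewrite lee_fin.
rewrite (EXE bf) (_ : [sequence _]_n = (fun n => (EX (F n))%:E)).
  by move=> h; exact: (fine_cvg h).
by apply/funext => n /=; exact: EXE.
Qed.

End expectation.

Section change_of_variables.
Context {R : realType} {d d'} {T : measurableType d} {T' : measurableType d'}.

Lemma bm_comp (f : T' -> R) (h : T -> T') : bm f -> measurable_fun setT h ->
  bm (fun x => f (h x)).
Proof.
move=> [mf [B fB]] mh; split; first exact: measurableT_comp.
by exists B => x; exact: fB.
Qed.

Lemma EX_push (m : probability T R) (m' : probability T' R) (h : T -> T')
    (f : T' -> R) : measurable_fun setT h ->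
  (forall A, measurable A -> m (h @^-1` A) = m' A) -> bm f ->
  EX m (fun x => f (h x)) = EX m' f.
Proof.
move=> mh hm bf; apply: EFin_inj; rewrite -!EXE//; last exact: bm_comp.
rewrite -(@eq_measure_integral _ _ _ _ _ (pushforward m h)); last first.
  by move=> A mA _; exact: hm.
rewrite integral_pushforward//; first by apply/measurable_EFinP; case: bf.
exact: (bm_integrable m (bm_comp bf mh)).
Qed.

End change_of_variables.

(** * The pointwise ergodic theorem *)

Lemma exists_nat_gt {R : realType} (x : R) : exists n : nat, x < n%:R.
Proof.
exists (Num.bound `|x|); apply: le_lt_trans (ler_norm x) _.
exact: archi_boundP.
Qed.

Lemma cvg_ge_near {R : realType} (u : nat -> R) (l a : R) :
  u @ \oo --> l -> (\forall n \near \oo, a <= u n) -> a <= l.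
Proof.
by move=> ul au; rewrite -(cvg_lim _ ul)//; apply: limr_ge => //; exact: cvgP ul.
Qed.

Section birkhoff.
Context {R : realType} {d} {T : measurableType d} (m : probability T R).
Variables (h : T -> T).
Hypothesis mh : measurable_fun setT h.
Hypothesis hm : forall A, measurable A -> m (h @^-1` A) = m A.
Hypothesis erg : forall A, measurable A -> h @^-1` A = A -> m A = 0%E \/ m A = 1%E.
Implicit Types (f : T -> R).

Definition bsum f n x : R := \sum_(k < n) f (iter k h x).

Lemma bsumS f n x : bsum f n.+1 x = f x + bsum f n (h x).
Proof.
rewrite /bsum big_ord_recl /=; congr (_ + _).
by apply: eq_bigr => k _; rewrite -iterSr.
Qed.

(** [bmax f n] is the largest of the first [n.+1] nonempty Birkhoff sums. *)
Fixpoint bmax f n x : R :=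
  if n is k.+1 then f x + Num.max 0 (bmax f k (h x)) else f x.

Lemma bsum_le_bmax f n x : bsum f n.+1 x <= bmax f n x.
Proof.
elim: n x => [|n IH] x; first by rewrite /bsum big_ord_recl big_ord0 addr0.
by rewrite bsumS /= lerD2l le_max IH orbT.
Qed.

Lemma bmaxS f n x : bmax f n x <= bmax f n.+1 x.
Proof.
elim: n x => [|n IH] x; first by rewrite /= lerDl le_max lexx.
by rewrite [leLHS]/= [leRHS]/= lerD2l ge_max !le_max lexx /= IH orbT.
Qed.

Lemma bmax_homo f x : {homo (fun n => bmax f n x) : i j / (i <= j)%N >-> i <= j}.
Proof. by apply: homo_leq => // [? ? ?|n]; [exact: le_trans|exact: bmaxS]. Qed.

Lemma bm_bmax f n : bm f -> bm (bmax f n).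
Proof.
move=> bf; elim: n => [//|n IH]; apply: bmD => //.
by apply: bm_max; [exact: bm_cst|exact: bm_comp].
Qed.

(** The maximal ergodic argument: the functions [bmax f n.+1 - bmax f n \o h]
    have a nonnegative mean and decrease to [f] wherever the Birkhoff sums are
    unbounded above. That set is invariant; if it had full measure, the mean
    of [f] would be nonnegative. *)
Lemma bsum_bounded f : bm f -> EX m f < 0 ->
  {ae m, forall x, exists B, forall n, bsum f n.+1 x <= B}.
Proof.
move=> bf f0.
pose A := [set x | forall k : nat, exists n, k%:R < bmax f n x].
have mA : measurable A.
  rewrite (_ : A = \bigcap_(k in [set: nat]) \bigcup_(n in [set: nat])
    (bmax f n @^-1` `]k%:R, +oo[%classic)).
    apply: bigcapT_measurable => k; apply: bigcupT_measurable => n.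
    rewrite -[X in measurable X]setTI; have [mf _] := bm_bmax n bf.
    by apply: mf => //; exact: measurable_itv.
  apply/seteqP; split => x /= Ax k.
    by move=> _; have [n ?] := Ax k; exists n => //; rewrite /= in_itv /= andbT.
  by have [n _] := Ax k I; rewrite /= in_itv /= andbT; exists n.
have invA : h @^-1` A = A.
  apply/seteqP; split => x /= Ax k.
    have [j hj] := exists_nat_gt (k%:R - f x).
    have [n hn] := Ax j.
    exists n.+1 => /=; rewrite -ltrBlDl; apply: (@lt_le_trans _ _ (bmax f n (h x))).
      exact: lt_trans hn.
    by rewrite le_max lexx orbT.
  have [j hj] := exists_nat_gt (k%:R + `|f x|).
  have [n hn] := Ax j.
  exists n; have : k%:R + `|f x| < bmax f n.+1 x.
    by apply: lt_le_trans (bmaxS _ _ _); exact: lt_trans hn.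
  rewrite /=; have k0 : 0 <= k%:R :> R by [].
  have h1 := ler_norm (f x).
  by have [h3|h3] := leP 0 (bmax f n (h x)) => h2; lra.
have [A0|A1] := erg mA invA.
  exists A; split => // x /= hx k; apply: contrapT => nk; apply: hx.
  exists k%:R => n; apply: le_trans (bsum_le_bmax _ _ _) _.
  by rewrite leNgt; apply/negP => h1; apply: nk; exists n.
(* The invariant set of unbounded sums cannot have full measure. *)
exfalso.
pose D n x := bmax f n.+1 x - bmax f n (h x).
have bD n : bm (D n).
  by apply: bmB; [exact: bm_bmax|apply: bm_comp => //; exact: bm_bmax].
have D0 n : 0 <= EX m (D n).
  rewrite EXB; [|exact: bm_bmax|by apply: bm_comp => //; exact: bm_bmax].
  rewrite (@EX_push _ _ _ _ _ m m h (bmax f n))//; last exact: bm_bmax.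
  rewrite subr_ge0; apply: EX_le => //; try exact: bm_bmax.
  by move=> x; exact: bmaxS.
have [B fB] := bf.2.
have DE n x : D n x = f x + Num.max 0 (- bmax f n (h x)).
  rewrite /D /= -addrA; congr (_ + _).
  by case: (leP 0 (bmax f n (h x))) => h1; case: leP => h2; lra.
have Dbd n x : `|D n x| <= B + B.
  rewrite DE; apply: le_trans (ler_normD _ _) _; apply: lerD => //.
  have B0 : 0 <= B by apply: le_trans (fB x).
  have : bmax f 0 (h x) <= bmax f n (h x) by exact: bmax_homo.
  rewrite /=; have := fB (h x); rewrite ler_norml => /andP[h1 h2] h3.
  by have [h4|h4] := leP 0 (- bmax f n (h x)); rewrite ?normr0// ger0_norm//; lra.
(* On that set the correction vanishes as soon as one sum is positive. *)
have cv : (fun n => EX m (D n)) @ \oo --> EX m f.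
  apply: (@EX_dct _ _ _ m D f (B + B)) => //.
  exists (~` A); split; first exact: measurableC.
    have := probability_setC m mA; rewrite A1 => ->; exact: subee.
  apply: subsetC => x Ax; apply: cvg_near_cst.
  have : A (h x) by rewrite -[A]invA in Ax.
  move=> /(_ 0%N)[N hN]; near=> n; rewrite DE.
  have : bmax f N (h x) <= bmax f n (h x) by apply: bmax_homo; near: n; exact: nbhs_infty_ge.
  move=> h1; rewrite max_l ?addr0//.
  by rewrite oppr_le0 (le_trans _ h1)// ltW.
have : 0 <= EX m f by exact: cvg_ge_near cv (nearW _ D0).
by rewrite leNgt f0.
Unshelve. all: by end_near. Qed.

(** [bsum_bounded] applies to [f] minus a constant slightly larger than its
    mean. *)
Lemma bsum_limsup f e : bm f -> 0 < e ->
  {ae m, forall x, \forall n \near \oo, n%:R^-1 * bsum f n x <= EX m f + e}.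
Proof.
move=> bf e0; pose c := EX m f + e / 2.
have bg : bm (fun x => f x - c) by apply: bmB => //; exact: bm_cst.
have : EX m (fun x => f x - c) < 0.
  by rewrite EXB//; [rewrite EX_cst /c; lra|exact: bm_cst].
move=> /(bsum_bounded bg); apply: filterS => x [B hB].
have [j hj] := exists_nat_gt (B / (e / 2)).
near=> n; have n0 : (0 < n)%N by near: n; exact: nbhs_infty_gt.
have n0' : 0 < n%:R :> R by rewrite ltr0n.
have := hB n.-1; rewrite prednK// /bsum sumrB sumr_const card_ord -/(bsum f n x).
rewrite -[c *+ n]mulr_natl => h1.
have h2 : B <= n%:R * (e / 2).
  rewrite -ler_pdivrMr ?divr_gt0//; apply: le_trans (ltW hj) _.
  by rewrite ler_nat; near: n; exact: nbhs_infty_ge.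
rewrite ler_pdivrMl//.
by move: h1; rewrite /c; lra.
Unshelve. all: by end_near. Qed.

(** Both inequalities come from [bsum_limsup], applied to [f] and to its
    opposite. *)
Theorem birkhoff f : bm f ->
  {ae m, forall x, (fun n => n%:R^-1 * bsum f n x) @ \oo --> EX m f}.
Proof.
move=> bf.
have H1 : {ae m, forall x, forall k : nat, \forall n \near \oo,
    n%:R^-1 * bsum f n x <= EX m f + k.+1%:R^-1}.
  by apply/ae_foralln => k; apply: bsum_limsup.
have H2 : {ae m, forall x, forall k : nat, \forall n \near \oo,
    n%:R^-1 * bsum (fun x => - f x) n x <= EX m (fun x => - f x) + k.+1%:R^-1}.
  by apply/ae_foralln => k; apply: bsum_limsup => //; exact: bmN.
apply: filterS2 H1 H2 => x h1 h2; apply/cvgrPdist_le => /= e e0.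
have [k hk] := exists_nat_gt e^-1.
have ke : k.+1%:R^-1 <= e.
  rewrite invf_ple ?posrE ?ltr0n//; apply: le_trans (ltW hk) _.
  by rewrite ler_nat.
have {}h1 := h1 k; have {}h2 := h2 k.
near=> n.
have u1 : n%:R^-1 * bsum f n x <= EX m f + k.+1%:R^-1 by near: n.
have : n%:R^-1 * bsum (fun x => - f x) n x <= EX m (fun x => - f x) + k.+1%:R^-1 by near: n.
rewrite EXN// /bsum sumrN mulrN -/(bsum f n x) => u2.
move: u1 u2 ke; set u := _ * _; set v := _^-1 => u1 u2 ke.
by rewrite ler_norml; apply/andP; split; lra.
Unshelve. all: by end_near. Qed.

End birkhoff.

(** * Approximation of bounded measurable functions *)

Section halving.
Context {R : realType} {d} {T : measurableType d}.
Implicit Types (f g : T -> R) (A : set T).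

(** Binary digits: a function with values in [0, 1] is the average of an
    indicator and of another such function. *)
Lemma halving f : bm f -> (forall x, 0 <= f x <= 1) ->
  exists A g, [/\ measurable A, bm g, forall x, 0 <= g x <= 1
    & forall x, f x = 2^-1 * (\1_A x) + 2^-1 * g x].
Proof.
move=> bf f01; pose A := [set x | 2^-1 <= f x].
have mA : measurable A.
  rewrite (_ : A = f @^-1` `[2^-1, +oo[%classic).
    rewrite -[X in measurable X]setTI; have [mf _] := bf.
    by apply: mf => //; exact: measurable_itv.
  by apply/seteqP; split => x /=; rewrite in_itv /= andbT.
exists A, (fun x => 2 * f x - \1_A x); split => //.
- by apply: bmB; [exact: bmZ|exact: bm_indic].
- move=> x; have := f01 x; rewrite indicE.
  have [xA|xA] := boolP (x \in A).
    by move: xA; rewrite inE /A /= => xA; lra.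
  by move: xA; rewrite notin_setE /A /= => /negP; rewrite -ltNge => xA; lra.
- by move=> x; field.
Qed.

(** A bounded linear functional is determined by its values on indicators:
    after [n] applications of [halving] it only remains to evaluate it on a
    function with values in [0, 1], weighted by 2^-n. *)
Lemma bm_functional_ext (L : (T -> R) -> R) (C : R) :
  (forall f g, bm f -> bm g -> L (fun x => f x + g x) = L f + L g) ->
  (forall c f, bm f -> L (fun x => c * f x) = c * L f) ->
  (forall f, bm f -> (forall x, `|f x| <= 1) -> `|L f| <= C) ->
  (forall A, measurable A -> L (\1_A) = 0) ->
  forall f, bm f -> L f = 0.
Proof.
move=> LD LZ LC LI.
have C0 : 0 <= C.
  apply: le_trans (LC (cst 0) (bm_cst 0) _) => // x.
  by rewrite normr0.
have H n : forall f, bm f -> (forall x, 0 <= f x <= 1) -> `|L f| <= 2^-1 ^+ n * C.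
  elim: n => [|n IH] f bf f01.
    rewrite expr0 mul1r; apply: LC => // x; have := f01 x.
    by move=> /andP[h1 h2]; rewrite ger0_norm.
  have [A [g [mA bg g01 fE]]] := halving bf f01.
  rewrite (funext fE) LD; try by apply: bmZ => //; exact: bm_indic.
  rewrite !LZ//; last exact: bm_indic.
  by rewrite LI// mulr0 add0r normrM ger0_norm// exprS -mulrA ler_wpM2l ?IH.
have H0 f : bm f -> (forall x, 0 <= f x <= 1) -> L f = 0.
  move=> bf f01; apply/eqP; rewrite -normr_le0.
  have cv : (fun n => (2^-1 : R) ^+ n * C) @ \oo --> (0 : R).
    rewrite -[X in _ --> X](mul0r C); apply: cvgMl.
    by apply: cvg_expr; rewrite ger0_norm// invf_lt1// ltr1n.
  by apply: cvg_ge_near cv _; apply: nearW => n; exact: H.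
move=> f bf; have [mf [B fB]] := bf.
pose B' := `|B| + 1; have B'0 : 0 < B' by rewrite ltr_wpDl.
have fB' x : `|f x| <= B'.
  by apply: le_trans (fB x) _; apply: le_trans (ler_norm B) _; rewrite lerDl.
have L1 : L (cst 1) = 0.
  rewrite (_ : cst 1 = \1_[set: T]); first exact: LI.
  by apply/funext => x; rewrite indicE in_setT.
have bg : bm (fun x => (2 * B')^-1 * f x + 2^-1 * cst 1 x).
  by apply: bmD; apply: bmZ => //; exact: bm_cst.
have := H0 _ bg; rewrite LD; last 2 first.
- exact: bmZ.
- by apply: bmZ; exact: bm_cst.
rewrite !LZ// ?L1 ?mulr0 ?addr0; last exact: bm_cst.
have h : forall x, 0 <= (2 * B')^-1 * f x + 2^-1 * cst 1 x <= 1.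
  move=> x; have := fB' x; rewrite ler_norml /= mulr1 invfM -mulrA.
  move=> /andP[h1 h2]; have : -1 <= B'^-1 * f x <= 1.
    by rewrite ler_pdivrMl// mulr1 h2 andbT ler_pdivlMl// mulrN1 h1.
  by lra.
move=> /(_ h)/eqP; rewrite mulf_eq0 invr_eq0 mulf_eq0 pnatr_eq0 /= gt_eqF//=.
by move=> /eqP.
Qed.

Lemma EX_ext (m : probability T R) f g : bm f -> bm g ->
  (forall h, bm h -> EX m (fun x => f x * h x) = EX m (fun x => g x * h x)) ->
  {ae m, forall x, f x = g x}.
Proof.
move=> bf bg fg.
have bfg : bm (fun x => f x - g x) by exact: bmB.
have : EX m (fun x => (f x - g x) * (f x - g x)) = 0.
  under eq_fun do rewrite mulrBl.
  by rewrite EXB; [rewrite fg// subrr|exact: bmM|exact: bmM].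
move=> /EX_eq0 h; have : {ae m, forall x, (f x - g x) * (f x - g x) = 0}.
  by apply: h; [exact: bmM|move=> x; rewrite -expr2 sqr_ge0].
by apply: filterS => x /eqP; rewrite mulf_eq0 orbb subr_eq0 => /eqP.
Qed.

End halving.

Section fubini_bounded.
Context {R : realType} {d1 d2} {T1 : measurableType d1} {T2 : measurableType d2}.
Variables (m1 : probability T1 R) (m2 : probability T2 R).
Implicit Types F : T1 * T2 -> R.

Lemma bm_slice1 F x : bm F -> bm (fun y => F (x, y)).
Proof. by move=> bF; apply: bm_comp bF _; exact: measurable_pair1. Qed.

Lemma bm_slice2 F y : bm F -> bm (fun x => F (x, y)).
Proof. by move=> bF; apply: bm_comp bF _; exact: measurable_pair2. Qed.

Lemma bm_EX F : bm F -> bm (fun x => EX m2 (fun y => F (x, y))).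
Proof.
move=> bF; have [mF [B FB]] := bF; split; last first.
  exists B => x; apply: EX_norm_le; first exact: bm_slice1.
  by move=> y; exact: FB.
have -> : (fun x => EX m2 (fun y => F (x, y))) =
    fun x => EX m2 (fun y => F (x, y) + B) - B.
  apply/funext => x; rewrite EXD ?EX_cst ?addrK//; first exact: bm_slice1.
  exact: bm_cst.
apply: measurable_funB => //; apply/measurable_EFinP.
rewrite (_ : _ \o _ = fubini_F m2 (fun z => (F z + B)%:E)); last first.
  apply/funext => x /=; rewrite /fubini_F EXE//.
  by apply: bmD; [exact: bm_slice1|exact: bm_cst].
apply: measurable_fun_fubini_tonelli_F.
  by apply/measurable_EFinP; exact: measurable_funD.
by move=> z; rewrite lee_fin -lerBlDr sub0r; have := FB z; rewrite ler_norml => /andP[].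
Qed.

End fubini_bounded.

Section fubini_bounded2.
Context {R : realType} {d1 d2} {T1 : measurableType d1} {T2 : measurableType d2}.
Variables (m1 : probability T1 R) (m2 : probability T2 R).
Implicit Types F : T1 * T2 -> R.

Lemma bm_swap F : bm F -> bm (fun z : T2 * T1 => F (z.2, z.1)).
Proof.
move=> bF; apply: (bm_comp bF (h := fun z : T2 * T1 => (z.2, z.1))).
exact: measurable_fun_pair.
Qed.

Lemma EX_fubini F : bm F ->
  EX m1 (fun x => EX m2 (fun y => F (x, y))) =
  EX m2 (fun y => EX m1 (fun x => F (x, y))).
Proof.
move=> bF; have bE1 := bm_EX m2 bF; have bE2 := bm_EX m1 (bm_swap bF).
have bs := bm_slice1 _ bF; have bs2 := bm_slice2 _ bF.
apply: EFin_inj; rewrite -!EXE//=.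
under eq_integral do rewrite -EXE//.
under [RHS]eq_integral do rewrite -EXE//.
apply: (@Fubini _ _ _ _ _ m1 m2 (fun z => (F z)%:E)).
have [mF [B FB]] := bF.
apply/integrable12ltyP; first exact/measurable_EFinP.
apply: (@le_lt_trans _ _ (\int[m1]_x B%:E)%E); last first.
  by rewrite integral_cst// -[X in (_ * X)%E]/(m1 setT) probability_setT mule1 ltry.
apply: ge0_le_integral => //.
- by move=> x _; exact: integral_ge0.
- apply: (measurable_fun_fubini_tonelli_F (m2 := m2) (fun z => `|(F z)%:E|%E)) => //.
  by apply: measurableT_comp => //; exact/measurable_EFinP.
move=> x _; apply: (@le_trans _ _ (\int[m2]_y B%:E)%E); last first.
  by rewrite integral_cst// -[X in (_ * X)%E]/(m2 setT) probability_setT mule1.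
apply: ge0_le_integral => //.
- apply: measurableT_comp => //; apply/measurable_EFinP.
  by case: (bs x).
- by move=> y _; rewrite lee_fin; exact: le_trans (FB (x, y)).
Qed.

End fubini_bounded2.

(** * Lipschitz functions on the circle *)

Section lipschitz.
Context {R : realType}.
Implicit Types (f g : diff2 R) (u v : circle R -> R) (x y z : circle R).

(** Lipschitz with respect to [ell], hence also with respect to the distance,
    since [x] and [y] can be exchanged. *)
Definition clip u := exists2 K : R, 0 <= K & forall x y, `|u y - u x| <= K * ell x y.

Lemma clip_cst c : clip (cst c).
Proof. by exists 0 => // x y; rewrite subrr normr0 mul0r. Qed.

Lemma clipD u v : clip u -> clip v -> clip (fun x => u x + v x).
Proof.
move=> [K K0 uK] [L L0 vL]; exists (K + L); first exact: addr_ge0.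
move=> x y; rewrite opprD addrACA mulrDl.
by apply: le_trans (ler_normD _ _) _; exact: lerD.
Qed.

Lemma clipZ c u : clip u -> clip (fun x => c * u x).
Proof.
move=> [K K0 uK]; exists (`|c| * K); first exact: mulr_ge0.
by move=> x y; rewrite -mulrBr normrM -mulrA ler_wpM2l.
Qed.

Lemma clipN u : clip u -> clip (fun x => - u x).
Proof. by move=> /(clipZ (-1)) h; under eq_fun do rewrite -mulN1r. Qed.

Lemma clipB u v : clip u -> clip v -> clip (fun x => u x - v x).
Proof. by move=> cu cv; apply: clipD => //; exact: clipN. Qed.

Lemma max_lip (a b c e : R) : `|Num.max a b - Num.max c e| <= `|a - c| + `|b - e|.
Proof.
have := normr_ge0 (a - c); have := normr_ge0 (b - e).
have := ler_norm (a - c); have := ler_norm (b - e).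
have := ler_norm (c - a); have := ler_norm (e - b); rewrite (distrC c) (distrC e).
rewrite ler_norml.
by have [h1|h1] := leP a b; have [h2|h2] := leP c e => *; apply/andP; split; lra.
Qed.

Lemma clip_max u v : clip u -> clip v -> clip (fun x => Num.max (u x) (v x)).
Proof.
move=> [K K0 uK] [L L0 vL]; exists (K + L); first exact: addr_ge0.
move=> x y; rewrite mulrDl; apply: le_trans (max_lip _ _ _ _) _.
exact: lerD.
Qed.

Lemma min_maxN (a b : R) : Num.min a b = - Num.max (- a) (- b).
Proof. by rewrite oppr_max !opprK. Qed.

Lemma clip_min u v : clip u -> clip v -> clip (fun x => Num.min (u x) (v x)).
Proof.
move=> cu cv; under eq_fun do rewrite min_maxN.
by apply: clipN; apply: clip_max; exact: clipN.
Qed.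

Lemma clip_continuous u : clip u -> continuous (u \o @cproj R).
Proof.
move=> [K K0 uK] s; apply/cvgrPdist_le => /= e e0.
have K1 : 0 < K + 1 by rewrite ltr_wpDl.
near=> t.
have st1 : `|s - t| < 1.
  near: t; apply: (@cvgr_dist_lt _ _ _ (nbhs s) _ id s) => //; exact: cvg_id.
have st2 : `|s - t| <= e / (K + 1).
  near: t; apply: (@cvgr_dist_le _ _ _ (nbhs s) _ id s); first exact: cvg_id.
  by rewrite divr_gt0.
have {}st2 : K * `|s - t| <= e.
  apply: (@le_trans _ _ ((K + 1) * `|s - t|)).
    by rewrite ler_wpM2r// lerDl.
  by rewrite mulrC -ler_pdivlMr.
apply: le_trans st2; have [h|h] := leP t s.
  apply: le_trans (uK _ _) _; rewrite ellE2 ?ger0_norm ?subr_ge0//.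
  by move: st1; rewrite ger0_norm ?subr_ge0//; lra.
rewrite distrC; apply: le_trans (uK _ _) _; rewrite distrC.
rewrite ellE2 ?gtr0_norm ?subr_gt0//.
by move: st1; rewrite distrC gtr0_norm ?subr_gt0//; lra.
Unshelve. all: by end_near. Qed.

Lemma clip_measurable u : clip u -> measurable_fun setT u.
Proof.
move=> cu; rewrite (_ : u = (u \o @cproj R) \o @rep R); last first.
  by apply/funext => x /=; rewrite cproj_rep.
apply: measurableT_comp measurable_rep; apply: continuous_measurable_fun.
exact: clip_continuous.
Qed.

Lemma clip_bm u : clip u -> bm u.
Proof.
move=> cu; split; first exact: clip_measurable.
have [K K0 uK] := cu; exists (`|u (cproj 0)| + K) => x.
rewrite -[u x](subrK (u (cproj 0))) addrC.
apply: le_trans (ler_normD _ _) _; rewrite lerD2l.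
by apply: le_trans (uK _ _) _; rewrite ler_piMr// ltW// ell_lt1.
Qed.

Lemma clip_lncderiv f : clip (fun x => ln (cderiv f x)).
Proof.
by have [K K0 h] := lncderiv_lip f; exists K => // x y; exact: (h true).
Qed.

Lemma clip_post (F : R -> R) (C : R) u : 0 <= C ->
  (forall x y, `|F (u y) - F (u x)| <= C * `|u y - u x|) -> clip u ->
  clip (fun x => F (u x)).
Proof.
move=> C0 FC [K K0 uK]; exists (C * K); first exact: mulr_ge0.
by move=> x y; apply: le_trans (FC _ _) _; rewrite -mulrA ler_wpM2l.
Qed.

Lemma expR_lip (b s t : R) : s <= b -> t <= b ->
  `|expR t - expR s| <= expR b * `|t - s|.
Proof.
wlog st : s t / s <= t => [H|] sb tb.
  have [st|ts] := leP s t; first exact: H.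
  by rewrite distrC [ `|t - s|]distrC; apply: H => //; exact: ltW.
rewrite !ger0_norm ?subr_ge0 ?ler_expR//.
have h : expR (s - t) >= 1 + (s - t) by exact: expR_ge1Dx.
have -> : expR s = expR t * expR (s - t) by rewrite -expRD addrC subrK.
have e0 := expR_gt0 t; have et : expR t <= expR b by rewrite ler_expR.
apply: (@le_trans _ _ (expR t * (t - s))).
  rewrite -subr_ge0 (_ : _ - _ = expR t * (expR (s - t) - (1 + (s - t)))).
    by rewrite mulr_ge0 ?expR_ge0// subr_ge0.
  by ring.
by rewrite ler_wpM2r// subr_ge0.
Qed.

Lemma clip_expR u : clip u -> clip (fun x => expR (u x)).
Proof.
move=> cu; have [_ [B uB]] := clip_bm cu.
apply: (clip_post (C := expR B)) => // x y.
by apply: expR_lip; apply: le_trans (ler_norm _) _; exact: uB.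
Qed.

Lemma diff2_lip f : exists2 C : R, 0 <= C & forall x y, ell (f x) (f y) <= C * ell x y.
Proof.
have [B hB] := lncderiv_bounded f.
exists (expR B) => [|x y]; first exact: expR_ge0.
have [z _ ->] := ell_mvt f x y; rewrite ler_wpM2r ?ell_ge0//.
rewrite -[cderiv f z]lnK ?posrE ?cderiv_gt0// ler_expR.
by apply: le_trans (ler_norm _) _.
Qed.

Lemma clip_comp u f : clip u -> clip (fun x => u (f x)).
Proof.
move=> [K K0 uK]; have [C C0 fC] := diff2_lip f.
exists (K * C); first exact: mulr_ge0.
by move=> x y; apply: le_trans (uK _ _) _; rewrite -mulrA ler_wpM2l.
Qed.

(** The arc length metric. *)
Definition cd x y : R := Num.min (ell x y) (ell y x).

Lemma cdC x y : cd x y = cd y x. Proof. exact: minC. Qed.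
Lemma cd_ge0 x y : 0 <= cd x y. Proof. by rewrite le_min !ell_ge0. Qed.
Lemma cd_le_ell x y : cd x y <= ell x y. Proof. by rewrite ge_min lexx. Qed.
Lemma cd_le_ellb b x y : cd x y <= ellb b x y.
Proof. by rewrite ge_min; case: b; rewrite lexx ?orbT. Qed.

Lemma cd_triangle x y z : cd x z <= cd x y + cd y z.
Proof.
have l1 := @ellb_triangle R true; have l0 := @ellb_triangle R false.
have g := @ell_ge0 R.
rewrite {2 3}/cd.
have [h1|h1] := leP (ell x y) (ell y x); have [h2|h2] := leP (ell y z) (ell z y).
- by apply: le_trans (cd_le_ell _ _) _; exact: l1.
- have [h|h] := leP (ell x y) (ell z y).
    by apply: le_trans (cd_le_ellb false _ _) _; rewrite /ellb /=;
      have := ellb_split (b := false); rewrite /ellb => H; have := l0 z y x;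
      rewrite /ellb; have := g x y; have := @ell_splitr R z x y h; have := g z x; lra.
  have := @ell_splitr R x z y (ltW h); have := g x z.
  by have := cd_le_ell x z; have := g x y; have := g z y; lra.
- have [h|h] := leP (ell y x) (ell y z).
    have := @ell_split R y x z h; have := g x z; have := cd_le_ell x z.
    by have := g y x; lra.
  have := @ell_split R y z x (ltW h); have := g z x.
  by have := cd_le_ellb false x z; rewrite /ellb; have := g y z; lra.
- apply: le_trans (cd_le_ellb false _ _) _; rewrite /ellb addrC; exact: (l1 z y x).
Qed.

Variable m : probability (circle R) R.

(** Approximation in the mean by Lipschitz functions. It allows integrals of
    discontinuous functions, such as densities, to be compared with integrals
    over the circle that are computed with the fundamental theorem of
    calculus. *)
Definition approx (u : circle R -> R) :=
  forall e, 0 < e -> exists2 v, clip v & EX m (fun x => `|u x - v x|) <= e.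

Lemma bm_dist u v : bm u -> bm v -> bm (fun x => `|u x - v x|).
Proof. by move=> bu bv; apply: bm_norm; exact: bmB. Qed.

(** An open set is the increasing union of the sets where a multiple of the
    distance to its complement exceeds 1. *)
Lemma approx_open (U : set (circle R)) : open U -> approx \1_U.
Proof.
move=> oU e e0.
have [UT|/existsNP[p Up]] := pselect (forall x, U x).
  exists (cst 1); first exact: clip_cst.
  rewrite (_ : (fun _ => _) = cst 0) ?EX_cst ?ltW//.
  by apply/funext => x; rewrite indicE mem_set//= subrr normr0.
pose D x := inf [set cd x y | y in ~` U].
have D0 x : [set cd x y | y in ~` U] !=set0 by exists (cd x p); exists p.
have Db x : has_lbound [set cd x y | y in ~` U].
  by exists 0 => _ [y _ <-]; exact: cd_ge0.
have DS x : has_inf [set cd x y | y in ~` U] by [].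
have Dge0 x : 0 <= D x.
  by apply: lb_le_inf => // _ [y _ <-]; exact: cd_ge0.
have Dlip x z : D z <= D x + ell x z.
  rewrite -lerBlDr; apply: lb_le_inf => // _ [y Uy <-]; rewrite lerBlDr.
  apply: (@le_trans _ _ (cd z y)); first by apply: ge_inf => //; exists y.
  apply: le_trans (cd_triangle _ x _) _; rewrite addrC lerD2l cdC; exact: cd_le_ell.
have Dlip2 x z : D x <= D z + ell x z.
  rewrite -lerBlDr; apply: lb_le_inf => // _ [y Uy <-]; rewrite lerBlDr.
  apply: (@le_trans _ _ (cd x y)); first by apply: ge_inf => //; exists y.
  apply: le_trans (cd_triangle _ z _) _; rewrite addrC lerD2l; exact: cd_le_ell.
have cD : clip D.
  exists 1 => // x z; rewrite mul1r ler_norml.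
  by have := Dlip x z; have := Dlip2 x z; lra.
have DU x : U x -> 0 < D x.
  move=> Ux; have [r r0 hr] := open_ell_ball oU Ux.
  apply: lt_le_trans r0 _; apply: lb_le_inf => // _ [y Uy <-].
  rewrite leNgt; apply/negP; rewrite gt_min => /orP[h|h]; apply: Uy.
    exact: (hr true).
  exact: (hr false).
have DnU x : ~ U x -> D x = 0.
  move=> Ux; apply/eqP; rewrite eq_le Dge0 andbT.
  apply: (@le_trans _ _ (cd x x)); first by apply: ge_inf => //; exists x.
  by rewrite -(ellxx x); exact: cd_le_ell.
(* These functions increase to the indicator of the open set. *)
pose v k x := Num.min 1 (k%:R * D x).
have cv k : clip (v k) by apply: clip_min; [exact: clip_cst|exact: clipZ].
have v01 k x : 0 <= v k x <= 1.
  by rewrite le_min ge_min ler01 lexx mulr_ge0.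
have bU : bm (\1_U : circle R -> R) by apply: bm_indic; exact: measurable_open_circle.
have : (fun k => EX m (fun x => `|\1_U x - v k x|)) @ \oo --> EX m (cst 0).
  apply: (@EX_dct _ _ _ m _ _ 1).
  - by move=> k; apply: bm_dist => //; exact: clip_bm.
  - exact: bm_cst.
  - move=> k x; rewrite normr_id indicE ler_norml.
    by have := v01 k x; case: (_ \in _) => /=; lra.
  apply: aeW => x; apply: cvg_near_cst; rewrite /v indicE.
  have [Ux|Ux] := pselect (U x); last first.
    by near=> k; rewrite memNset// DnU// mulr0 min_r// subrr normr0.
  have [j hj] := exists_nat_gt (D x)^-1.
  near=> k; rewrite mem_set//= min_l ?subrr ?normr0//.
  rewrite -ler_pdivrMr ?DU// mul1r; apply: le_trans (ltW hj) _.
  by rewrite ler_nat; near: k; exact: nbhs_infty_ge.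
rewrite EX_cst => /cvgrPdist_le/(_ e e0)[k _ /(_ k (leqnn k))].
rewrite sub0r normrN => h; exists (v k) => //.
by apply: le_trans (ler_norm _) h.
Unshelve. all: by end_near. Qed.

Lemma approx_setC A : measurable A -> approx \1_A -> approx \1_(~` A).
Proof.
move=> mA hA e /hA[v cv hv]; exists (fun x => 1 - v x).
  by apply: clipB => //; exact: clip_cst.
apply: le_trans hv; apply: EX_le; try apply: bm_dist; try exact: bm_indic.
- by apply: bm_indic; exact: measurableC.
- by apply: clip_bm; apply: clipB => //; exact: clip_cst.
- exact: clip_bm.
move=> x; rewrite !indicE in_setC.
have -> : (x \notin A)%:R - (1 - v x) = - ((x \in A)%:R - v x).
  by case: (x \in A) => /=; ring.
by rewrite normrN.
Qed.

Lemma approx_setU A B : measurable A -> measurable B ->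
  approx \1_A -> approx \1_B -> approx \1_(A `|` B).
Proof.
move=> mA mB hA hB e e0; have e2 : 0 < e / 2 by rewrite divr_gt0.
have [u cu hu] := hA _ e2; have [v cv hv] := hB _ e2.
exists (fun x => Num.max (u x) (v x)); first exact: clip_max.
have bA : bm (\1_A : circle R -> R) by exact: bm_indic.
have bB : bm (\1_B : circle R -> R) by exact: bm_indic.
have bu := clip_bm cu; have bv := clip_bm cv.
apply: (@le_trans _ _ (EX m (fun x => `|\1_A x - u x| + `|\1_B x - v x|))).
  apply: EX_le => [||x].
  - apply: bm_dist; last exact: bm_max.
    by apply: bm_indic; exact: measurableU.
  - by apply: bmD; exact: bm_dist.
  rewrite (_ : \1_(A `|` B) x = Num.max (\1_A x) (\1_B x)); first exact: max_lip.
  rewrite !indicE in_setU; case: (x \in A); case: (x \in B) => /=.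
  - by rewrite maxxx.
  - by rewrite max_l ?ler01.
  - by rewrite max_r ?ler01.
  - by rewrite maxxx.
rewrite EXD; [|exact: bm_dist|exact: bm_dist].
by lra.
Qed.

Lemma approx_bigcup (A : nat -> set (circle R)) : (forall k, measurable (A k)) ->
  (forall k, approx \1_(A k)) -> approx \1_(\bigcup_k A k).
Proof.
move=> mA hA e e0; have e2 : 0 < e / 2 by rewrite divr_gt0.
pose B n := \big[setU/set0]_(k < n) A k.
have mB n : measurable (B n) by exact: bigsetU_measurable.
have hB n : approx \1_(B n).
  rewrite /B; elim: n => [|n IH].
    rewrite big_ord0 => r r0; exists (cst 0); first exact: clip_cst.
    rewrite (_ : (fun _ => _) = cst 0) ?EX_cst ?ltW//.
    by apply/funext => x; rewrite indicE in_set0 /= subrr normr0.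
  by rewrite big_ord_recr; apply: approx_setU => //; exact: mB.
have mU : measurable (\bigcup_k A k) by exact: bigcupT_measurable.
have bU : bm (\1_(\bigcup_k A k) : circle R -> R) by exact: bm_indic.
have bB n : bm (\1_(B n) : circle R -> R) by exact: bm_indic.
have : (fun n => EX m (fun x => `|\1_(\bigcup_k A k) x - \1_(B n) x|)) @ \oo --> EX m (cst 0).
  apply: (@EX_dct _ _ _ m _ _ 1).
  - by move=> n; exact: bm_dist.
  - exact: bm_cst.
  - move=> n x; rewrite normr_id !indicE.
    by case: (_ \in _); case: (_ \in _) => /=; rewrite ?subrr ?subr0 ?sub0r ?normrN ?normr1 ?normr0.
  apply: aeW => x; apply: cvg_near_cst.
  have [[j _ Ax]|Ax] := pselect ((\bigcup_k A k) x).
    near=> n; rewrite !indicE !mem_set ?subrr ?normr0//; last by exists j.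
    have jn : (j < n)%N by near: n; exact: nbhs_infty_gt.
    by rewrite /B -bigcup_mkord; exists j.
  near=> n; rewrite !indicE !memNset ?subrr ?normr0//.
  by rewrite /B -bigcup_mkord => -[k _ ?]; apply: Ax; exists k.
rewrite EX_cst => /cvgrPdist_le/(_ _ e2)[n _ /(_ n (leqnn n))].
rewrite sub0r normrN => /(le_trans (ler_norm _)) h.
have [v cv hv] := hB n _ e2; have bv := clip_bm cv; exists v => //.
apply: (@le_trans _ _ (EX m (fun x => `|\1_(\bigcup_k A k) x - \1_(B n) x| +
    `|\1_(B n) x - v x|))).
  apply: EX_le => [||x]; [exact: bm_dist|by apply: bmD; exact: bm_dist|].
  by apply: le_trans (ler_normD _ _); rewrite addrA subrK.
rewrite EXD; [|exact: bm_dist|exact: bm_dist].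
by lra.
Unshelve. all: by end_near. Qed.

(** The sets whose indicator can be approximated form a sigma-algebra. *)
Lemma approx_indic A : measurable A -> approx \1_A.
Proof.
move=> mA; pose G := [set B : set (circle R) | measurable B /\ approx \1_B].
suff : <<s @open (circle R) >> `<=` G by move=> /(_ A mA)[].
apply: smallest_sub; last first.
  by move=> U oU; split; [exact: measurable_open_circle|exact: approx_open].
split.
- by split => //; apply: approx_open; exact: open0.
- by move=> B [mB hB]; rewrite setTD; split; [exact: measurableC|exact: approx_setC].
- move=> F hF; split; first by apply: bigcupT_measurable => k; case: (hF k).
  by apply: approx_bigcup => k; case: (hF k).
Qed.

(** The binary expansion given by [halving] reduces the question to
    indicators. *)
Lemma approx_bm u : bm u -> approx u.
Proof.
have H n e : 0 < e -> forall u, bm u -> (forall x, 0 <= u x <= 1) ->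
    exists2 v, clip v & EX m (fun x => `|u x - v x|) <= 2^-1 ^+ n + e.
  move=> e0; elim: n => [|n IH] {}u bu u01.
    exists (cst 0); first exact: clip_cst.
    rewrite expr0; apply: (@le_trans _ _ 1); last by lra.
    rewrite -[leRHS](EX_cst m 1); apply: EX_le => [||x]; [|exact: bm_cst|].
      by apply: bm_dist => //; exact: bm_cst.
    by rewrite /= subr0 ger0_norm; have := u01 x; lra.
  have [A [g [mA bg g01 uE]]] := halving bu u01.
  have [v cv hv] := IH g bg g01.
  have [a ca ha] := approx_indic mA e0.
  have bA : bm (\1_A : circle R -> R) by exact: bm_indic.
  have ba := clip_bm ca; have bv := clip_bm cv.
  exists (fun x => 2^-1 * a x + 2^-1 * v x).
    by apply: clipD; exact: clipZ.
  apply: (@le_trans _ _ (EX m (fun x => 2^-1 * `|\1_A x - a x| + 2^-1 * `|g x - v x|))).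
    apply: EX_le => [||x].
    - by apply: bm_dist => //; apply: bmD; exact: bmZ.
    - by apply: bmD; apply: bmZ; exact: bm_dist.
    rewrite uE opprD addrACA -!mulrBr; apply: le_trans (ler_normD _ _) _.
    by rewrite !normrM ger0_norm.
  rewrite EXD ?EXZ; try (by exact: bm_dist); try by apply: bmZ; exact: bm_dist.
  by rewrite exprS; lra.
move=> bu e e0; have [mu [B uB]] := bu.
pose B' := `|B| + 1; have B'0 : 0 < B' by rewrite ltr_wpDl.
have uB' x : `|u x| <= B'.
  by apply: le_trans (uB x) _; apply: le_trans (ler_norm B) _; rewrite lerDl.
pose w x := (2 * B')^-1 * u x + 2^-1.
have bw : bm w by apply: bmD; [exact: bmZ|exact: bm_cst].
have w01 x : 0 <= w x <= 1.
  have := uB' x; rewrite ler_norml /w invfM -mulrA.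
  move=> /andP[h1 h2]; have : -1 <= B'^-1 * u x <= 1.
    by rewrite ler_pdivrMl// mulr1 h2 andbT ler_pdivlMl// mulrN1 h1.
  by lra.
pose r := e / (4 * B'); have r0 : 0 < r by rewrite divr_gt0// mulr_gt0.
have [n hn] : exists n : nat, (2^-1 : R) ^+ n <= r.
  have cv : (fun n => (2^-1 : R) ^+ n) @ \oo --> (0 : R).
    by apply: cvg_expr; rewrite ger0_norm// invf_lt1// ltr1n.
  move: cv => /cvgrPdist_le/(_ _ r0)[n _ /(_ n (leqnn n))] h; exists n.
  by move: h; rewrite sub0r normrN; apply: le_trans; exact: ler_norm.
have [v cv hv] := H n r r0 w bw w01; have bv := clip_bm cv.
exists (fun x => 2 * B' * (v x - 2^-1)).
  by apply: clipZ; apply: clipB => //; exact: clip_cst.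
have -> : (fun x => `|u x - 2 * B' * (v x - 2^-1)|) = fun x => 2 * B' * `|w x - v x|.
  apply/funext => x.
  rewrite -[2 * B' in RHS]gtr0_norm ?mulr_gt0// -normrM; congr `|_|.
  by rewrite /w; field; exact: lt0r_neq0.
rewrite EXZ; last exact: bm_dist.
rewrite mulrC -ler_pdivlMr ?mulr_gt0//; apply: le_trans hv _.
have -> : e / (2 * B') = r + r by rewrite /r; field; exact: lt0r_neq0.
by rewrite lerD2r.
Qed.

End lipschitz.

(** * Lebesgue averages of periodic functions *)

Section unit_interval.
Context {R : realType}.
Implicit Types (f g : R -> R) (s t : R).

Definition U01 : probability (measurableTypeR R) R := uniform_prob (@ltr01 R).

Lemma EXU_ge0E f : bm (f : measurableTypeR R -> R) -> (forall t, 0 <= f t) ->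
  (EX U01 f)%:E = (\int[lebesgue_measure]_(t in `[0%R, 1%R]) (f t)%:E)%E.
Proof.
move=> bf f0; rewrite -EXE// /U01 integral_uniform//.
  by rewrite subr0 invr1 mul1e.
by apply/measurable_EFinP; case: bf.
Qed.

Lemma EXU_le f g : bm (f : measurableTypeR R -> R) -> bm (g : measurableTypeR R -> R) ->
  (forall t, 0 <= t <= 1 -> f t <= g t) -> EX U01 f <= EX U01 g.
Proof.
move=> bf bg fg.
have [mf [B fB]] := bf; have [mg [C gC]] := bg.
pose M := B + C.
have B0 : 0 <= B by apply: le_trans (fB 0).
have C0 : 0 <= C by apply: le_trans (gC 0).
have h1 t : 0 <= f t + M by have := fB t; rewrite ler_norml /M; lra.
have h2 t : 0 <= g t + M by have := gC t; rewrite ler_norml /M; lra.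
have bM := @bm_cst R _ (measurableTypeR R) M.
rewrite -(lerD2r M) -{1}(EX_cst U01 M) -{2}(EX_cst U01 M) -!EXD//.
have bf' := bmD bf bM; have bg' := bmD bg bM.
rewrite -lee_fin !EXU_ge0E//; apply: ge0_le_integral => //.
- by move=> t _; rewrite lee_fin.
- apply/measurable_EFinP/measurable_funTS; by case: bf'.
- apply/measurable_EFinP/measurable_funTS; by case: bg'.
by move=> t /=; rewrite in_itv /= => t01; rewrite lee_fin lerD2r fg.
Qed.

Lemma deriv_ge0_le (D D' : R -> R) s t : s <= t ->
  (forall u, s <= u <= t -> is_derive u (1 : R) D (D' u)) ->
  (forall u, s <= u <= t -> 0 <= D' u) -> D s <= D t.
Proof.
move=> st dD D'0.
have cD : {within `[s, t], continuous D}.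
  apply: derivable_within_continuous => u; rewrite in_itv /= => su.
  by have := dD u su => -[].
have [||u uI e] := @MVT_segment R D D' s t st.
- by move=> u; rewrite in_itv /= => /andP[su ut]; apply: dD; rewrite !ltW.
- exact: cD.
by rewrite -subr_ge0 e mulr_ge0 ?subr_ge0//; apply: D'0; move: uI; rewrite in_itv.
Qed.

Lemma EXU_FTC f (A : R -> R) : bm (f : measurableTypeR R -> R) ->
  (forall t, 0 <= f t) -> {within `[0, 1], continuous f} ->
  (forall t, 0 <= t <= 1 -> is_derive t (1 : R) A (f t)) ->
  EX U01 f = A 1 - A 0.
Proof.
move=> bf f0 cf dA; apply: EFin_inj; rewrite EXU_ge0E// EFinB.
have cA t : 0 <= t <= 1 -> {for t, continuous A}.
  by move=> h; apply/differentiable_continuous/derivable1_diffP; case: (dA t h).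
apply: continuous_FTC2 => //.
- split.
  + by move=> t; rewrite in_itv /= => /andP[h1 h2]; case: (dA t); rewrite // !ltW.
  + by apply: cvg_at_right_filter; apply: cA; rewrite lexx ler01.
  + by apply: cvg_at_left_filter; apply: cA; rewrite lexx ler01.
move=> t; rewrite in_itv /= => /andP[h1 h2]; rewrite derive1E.
by apply: derive_val; apply: dA; rewrite !ltW.
Qed.

(** The base point only has to lie below the intervals of integration used
    later, which are contained in [0, 2]. *)
Lemma antiderivative f : continuous f ->
  exists A : R -> R, forall t, -3 < t -> is_derive t (1 : R) A (f t).
Proof.
move=> cf; exists (fun x => (\int[lebesgue_measure]_(t in `[(-3)%R, x]) f t)%R) => t ht.
have fi : lebesgue_measure.-integrable `[-3, (t + 1)] (EFin \o f).
  apply: continuous_compact_integrable; first exact: segment_compact.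
  exact: continuous_subspaceT.
have t1 : t < t + 1 by rewrite ltrDl.
have [d e] := continuous_FTC1_closed t1 fi ht (cf t).
by rewrite -e derive1E; exact: derivableP.
Qed.

Definition periodic f := forall t, f (t + 1) = f t.

Lemma periodic_int f (n : int) t : periodic f -> f (t + n%:~R) = f t.
Proof.
move=> pf; have H (k : nat) s : f (s + k%:R) = f s.
  elim: k s => [|k IH] s; first by rewrite addr0.
  by rewrite -natr1 addrA pf.
case: n => k; first exact: H.
by rewrite NegzE mulrNz -[in RHS](subrK (k.+1%:R) t) H.
Qed.

(** The integral of a periodic function over a period is preserved by
    reparametrizations of degree one: a substitution turns it into an integral
    over another period, and a period can be moved because its integral has a
    vanishing derivative. *)
Lemma EXU_subst f (G G' : R -> R) : continuous f -> periodic f ->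
  (forall t, 0 <= f t) -> bm (f : measurableTypeR R -> R) ->
  continuous G' -> (forall t, is_derive t (1 : R) G (G' t)) ->
  (forall t, 0 <= G' t) -> (forall t, G (t + 1) = G t + 1) ->
  bm ((fun t => f (G t) * G' t) : measurableTypeR R -> R) ->
  EX U01 (fun t => f (G t) * G' t) = EX U01 f.
Proof.
move=> cf pf f0 bf cG' dG G'0 G1 bfG.
have [A dA] := antiderivative cf.
pose n := Num.floor (G 0); pose H t := G t - n%:~R.
have /andP[H0 H01] : 0 <= H 0 < 1 by exact: fpart_itv.
have dH t : is_derive t (1 : R) H (G' t).
  rewrite -[G' t]subr0 /H; apply: is_deriveB.
have Hmono s t : s <= t -> H s <= H t by move=> st; apply: (deriv_ge0_le st).
have H1 : H 1 = H 0 + 1 by rewrite /H -[in LHS](add0r 1) G1; lra.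
have fH t : f (H t) = f (G t) by rewrite /H -mulrNz periodic_int.
have cH : continuous H by apply: derivable_continuous => t; case: (dH t).
have e1 : EX U01 (fun t => f (G t) * G' t) = (A \o H) 1 - (A \o H) 0.
  apply: EXU_FTC => //.
  - by move=> t; rewrite mulr_ge0.
  - apply: continuous_subspaceT => t.
    rewrite (_ : (fun t => _) = (fun t => f (H t) * G' t)); last first.
      by apply/funext => u; rewrite fH.
    have cfH : {for t, continuous (f \o H)}.
      by apply: continuous_comp; [exact: cH|exact: cf].
    exact: (continuousM cfH (cG' t)).
  - move=> t /andP[t0 t1]; rewrite -fH; apply: is_derive1_comp.
    by apply: dA; apply: lt_le_trans (Hmono _ _ t0); lra.
have e2 : EX U01 f = A 1 - A 0.
  apply: EXU_FTC => //; first exact: continuous_subspaceT.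
  by move=> t t01; apply: dA; lra.
have e3 : A (H 0 + 1) - A (H 0) = A 1 - A 0.
  pose D t := A (t + 1) - A t.
  have dD t : -3 < t -> is_derive t (1 : R) D 0.
    move=> ht; rewrite -[X in is_derive _ _ _ X](subrr (f t)); apply: is_deriveB; last exact: dA.
    rewrite -[f t]pf -[f _]mulr1.
    apply: (@is_derive1_comp R A (fun t => t + 1)); first by apply: dA; lra.
    rewrite -[X in is_derive _ _ _ X]addr0; exact: is_deriveD.
  have le1 : D 0 <= D (H 0).
    by apply: (@deriv_ge0_le D (cst 0)) => // t h; apply: dD; lra.
  have le2 : - D 0 <= - D (H 0).
    apply: (@deriv_ge0_le (fun t => - D t) (cst (- 0))) => // t h; last by rewrite oppr0.
    by apply: is_deriveN; apply: dD; lra.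
  by move: le1 le2; rewrite /D add0r; lra.
by rewrite e1 e2 /= H1.
Qed.

End unit_interval.

Section circle_average.
Context {R : realType}.
Implicit Types (u v : circle R -> R) (x y : circle R) (s t : R) (f : diff2 R).

Lemma bm_cproj u : bm u -> bm ((fun t => u (cproj t)) : measurableTypeR R -> R).
Proof. by move=> bu; apply: bm_comp bu _; exact: measurable_cproj. Qed.

(** The mean of a function with respect to the arc length. *)
Definition cmean u : R := EX U01 (fun t => u (cproj t)).

Lemma clip_periodic u : periodic (fun t => u (cproj t)).
Proof. by move=> t; rewrite cproj_add1. Qed.

Lemma clip_cderiv f : clip (cderiv f).
Proof.
rewrite (_ : cderiv f = fun x => expR (ln (cderiv f x))).
  by apply: clip_expR; exact: clip_lncderiv.
by apply/funext => x; rewrite lnK ?posrE ?cderiv_gt0.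
Qed.

Lemma clipM u v : clip u -> clip v -> clip (fun x => u x * v x).
Proof.
move=> cu cv; have [_ [B uB]] := clip_bm cu; have [_ [C vC]] := clip_bm cv.
have [K K0 uK] := cu; have [L L0 vL] := cv.
have B0 : 0 <= B by apply: le_trans (uB (cproj 0)).
have C0 : 0 <= C by apply: le_trans (vC (cproj 0)).
exists (B * L + C * K) => [|x y]; first by rewrite addr_ge0 ?mulr_ge0.
have -> : u y * v y - u x * v x = u y * (v y - v x) + v x * (u y - u x) by ring.
rewrite mulrDl -!mulrA; apply: le_trans (ler_normD _ _) _.
by rewrite !normrM; apply: lerD; apply: ler_pM.
Qed.

Lemma cmean_diff2 u f : clip u -> (forall x, 0 <= u x) ->
  cmean (fun x => u (f x) * cderiv f x) = cmean u.
Proof.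
move=> cu u0; rewrite /cmean.
have cuf : clip (fun x => u (f x) * cderiv f x).
  by apply: clipM; [exact: clip_comp|exact: clip_cderiv].
have dG t : is_derive t (1 : R) (rlift f) (derive1 (rlift f) t).
  by rewrite derive1E; apply: derivableP; exact: lift_derivable.
have E : (fun t => u (f (cproj t)) * cderiv f (cproj t)) =
    (fun t => u (cproj (rlift f t)) * derive1 (rlift f) t).
  by apply/funext => t; rewrite liftE cderiv_cproj.
have bE : bm ((fun t => u (cproj (rlift f t)) * derive1 (rlift f) t) : measurableTypeR R -> R).
  by rewrite -E; exact: (bm_cproj (clip_bm cuf)).
rewrite E; apply: (EXU_subst (clip_continuous cu) (clip_periodic u) _ _ _ dG) => //.
- by move=> t; exact: u0.
- exact: (bm_cproj (clip_bm cu)).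
- exact: lift_deriv_continuous.
- by move=> t; rewrite ltW// lift_deriv_gt0.
- exact: lift1.
Qed.

Lemma cmean_adv u y : clip u -> (forall x, 0 <= u x) ->
  EX U01 (fun t => u (adv y t)) = cmean u.
Proof.
move=> cu u0; rewrite /cmean; have bu := bm_cproj (clip_bm cu).
have bua : bm ((fun t => u (cproj (rep y + t)) * 1) : measurableTypeR R -> R).
  under eq_fun do rewrite mulr1; apply: (bm_comp bu (h := fun t => rep y + t)).
  by apply: measurable_funD => //; exact: measurable_cst.
have dG t : is_derive t (1 : R) (fun t => rep y + t) (cst 1 t).
  rewrite -[cst 1 t]add0r; exact: is_deriveD.
have := EXU_subst (clip_continuous cu) (clip_periodic u) _ _ _ dG.
move=> /(_ _ _ _ _ _ bua) <- //.
- by congr EX; apply/funext => t; rewrite mulr1.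
- by move=> t; exact: u0.
- by move=> t; exact: cst_continuous.
- by move=> t; rewrite addrA.
Qed.

End circle_average.

(** * Smoothing kernels *)

Section kernel.
Context {R : realType} (nu : probability (circle R) R).
Variables (b e : R).
Hypotheses (b0 : 0 < b) (e0 : 0 < e).
Let a : R := 1 + b.
Implicit Types (u v : circle R -> R) (x y : circle R) (s t : R) (f : diff2 R).

Let e_neq0 : e != 0. Proof. exact: lt0r_neq0. Qed.

(** The opposite of the logarithm of the kernel at distance [s]. *)
Definition lk s : R := a * ln (1 + s / e).

Let lk_pos s : 0 <= s -> 0 < 1 + s / e.
Proof. by move=> s0; rewrite ltr_pwDl// divr_ge0// ltW. Qed.

Lemma lk_ge0 s : 0 <= s -> 0 <= lk s.
Proof.
move=> s0; rewrite mulr_ge0 ?ln_ge0//; first by rewrite /a addr_ge0// ltW.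
by rewrite lerDl divr_ge0// ltW.
Qed.

Lemma lk_le s t : 0 <= s <= t -> lk s <= lk t.
Proof.
move=> /andP[s0 st]; rewrite ler_pM2l ?addr_gt0// ler_ln ?posrE ?lk_pos ?(le_trans s0)//.
by rewrite lerD2l ler_pM2r// invr_gt0.
Qed.

Lemma lk_add s t : 0 <= s -> 0 <= t -> lk (s + t) <= lk s + lk t.
Proof.
move=> s0 t0; rewrite -mulrDr ler_pM2l ?addr_gt0//.
rewrite -lnM ?posrE ?lk_pos// ler_ln ?posrE ?mulr_gt0 ?lk_pos ?addr_ge0//.
rewrite mulrDl mulrDl mul1r mulrDr mulr1.
have : 0 <= s / e * (t / e) by rewrite mulr_ge0// divr_ge0// ltW.
lra.
Qed.

Lemma lk_lin s : 0 <= s -> lk s <= a / e * s.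
Proof.
move=> s0; rewrite -mulrA ler_pM2l ?addr_gt0// mulrC; apply: le_ln1Dx.
by apply: lt_le_trans (_ : 0 <= _); rewrite ?ltrN10// mulrC divr_ge0// ltW.
Qed.

(** The kernel (1 + cd x y / e) ^ -(1 + b). Its tail is integrable, because 1
    + b > 1, and heavy enough for the convolution of any probability with it
    to vary slowly (see [ln_dens_le]); the tail is barely integrable when [b]
    is small. *)
Definition kern x y : R := expR (- lk (cd x y)).

Lemma clip_lkcd y : clip (fun x => lk (cd x y)).
Proof.
exists (a / e) => [|x z]; first by rewrite divr_ge0 ?addr_ge0// ltW.
have H x' z' : lk (cd x' y) - lk (cd z' y) <= lk (cd x' z').
  rewrite lerBlDr; apply: le_trans (lk_le _) (lk_add _ _); rewrite ?cd_ge0//=.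
  exact: cd_triangle.
apply: (@le_trans _ _ (lk (cd x z))).
  by rewrite ler_norml; have := H x z; have := H z x; rewrite (cdC z x); lra.
apply: le_trans (lk_lin (cd_ge0 _ _)) _.
rewrite ler_pM2l ?divr_gt0 ?addr_gt0//; exact: cd_le_ell.
Qed.

Lemma clip_kern y : clip (fun x => kern x y).
Proof. by apply: clip_expR; apply: clipN; exact: clip_lkcd. Qed.

Lemma kern_gt0 x y : 0 < kern x y. Proof. exact: expR_gt0. Qed.

Lemma kern_le1 x y : kern x y <= 1.
Proof. by rewrite -expR0 ler_expR oppr_le0 lk_ge0// cd_ge0. Qed.

Lemma bm_kern d (T : measurableType d) (h h' : T -> circle R) :
  measurable_fun setT h -> measurable_fun setT h' ->
  bm (fun z => kern (h z) (h' z)).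
Proof.
move=> mh mh'; split; last first.
  by exists 1 => z; rewrite ger0_norm ?kern_le1// ltW// kern_gt0.
apply: measurableT_comp => //; apply: measurableT_comp => //.
apply: measurable_funM => //; apply: measurableT_comp => //.
apply: measurable_funD => //; apply: measurable_funM => //.
by apply: measurable_minr; exact: measurable_ell.
Qed.

Let bk x : bm (fun y => kern x y).
Proof. by apply: (bm_kern (h := cst x)) => //; exact: measurable_cst. Qed.

(** Up to a normalization, the density of [nu] smoothed at the scale [e]. *)
Definition dens x : R := EX nu (kern x).

Lemma dens_gt0 x : 0 < dens x.
Proof.
apply: (@lt_le_trans _ _ (expR (- lk 1))); first exact: expR_gt0.
rewrite -[leLHS](EX_cst nu); apply: EX_le => // [|y]; first exact: bm_cst.
rewrite ler_expR lerN2; apply: lk_le; rewrite cd_ge0 /=.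
by apply: le_trans (cd_le_ell _ _) _; rewrite ltW// ell_lt1.
Qed.

(** A Harnack inequality. Since [lk] is subadditive, moving [x] by [s] divides
    [kern x y] by at most [expR (lk s)], whatever [y]. *)
Lemma ln_dens_le x z s : cd x z <= s -> ln (dens x) <= ln (dens z) + lk s.
Proof.
move=> xz; have s0 : 0 <= s by apply: le_trans xz; exact: cd_ge0.
rewrite -[lk s]expRK -lnM ?posrE ?dens_gt0 ?expR_gt0//.
rewrite ler_ln ?posrE ?mulr_gt0 ?dens_gt0 ?expR_gt0// mulrC -EXZ//.
apply: EX_le => // [|y]; first exact: bmZ.
have H : lk (cd z y) <= lk s + lk (cd x y).
  apply: le_trans (lk_le _) (lk_add s0 (cd_ge0 x y)); rewrite cd_ge0 /=.
  by apply: le_trans (cd_triangle _ x _) _; rewrite lerD2r cdC.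
by rewrite /kern -expRD ler_expR lerNl opprD opprK -lerBlDl in H *; rewrite addrC.
Qed.

Lemma clip_ln_dens : clip (fun x => ln (dens x)).
Proof.
exists (a / e) => [|x z]; first by rewrite divr_ge0 ?addr_ge0// ltW.
apply: (@le_trans _ _ (lk (ell x z))); last exact: lk_lin (ell_ge0 _ _).
have H (A B C : R) : A <= B + C -> B <= A + C -> `|A - B| <= C.
  by move=> *; rewrite ler_norml; lra.
by apply: H; apply: ln_dens_le; rewrite ?cd_le_ell// cdC cd_le_ell.
Qed.

Lemma clip_dens : clip dens.
Proof.
rewrite (_ : dens = fun x => expR (ln (dens x))).
  exact: clip_expR clip_ln_dens.
by apply/funext => x; rewrite lnK ?posrE ?dens_gt0.
Qed.

(** The mass of the kernel is of the order of its scale: each of the two sides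
    of [y] contributes at most the integral of (1 + t / e) ^ -(1 + b) over the
    half-line, which is e / b. *)
Lemma kern_mass y : cmean (fun x => kern x y) <= 2 * e / b.
Proof.
rewrite -(@cmean_adv _ _ y); [|exact: clip_kern|by move=> x; rewrite ltW// kern_gt0].
pose k t := expR (- lk (Num.max 0 t)).
have bk0 : bm (k : measurableTypeR R -> R).
  split; last first.
    exists 1 => t; rewrite ger0_norm ?expR_ge0// -expR0 ler_expR oppr_le0 lk_ge0//.
    by rewrite le_max lexx.
  apply: measurableT_comp => //; apply: measurableT_comp => //.
  apply: measurable_funM => //; apply: measurableT_comp => //.
  apply: measurable_funD => //; apply: measurable_funM => //.
  exact: measurable_maxr.
have mrev : measurable_fun setT ((fun t => 1 - t) : measurableTypeR R -> measurableTypeR R).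
  exact: measurable_funB.
have bk1 : bm ((fun t => k (1 - t)) : measurableTypeR R -> R).
  exact: (bm_comp bk0 mrev).
have bky : bm ((fun t => kern (adv y t) y) : measurableTypeR R -> R).
  apply: bm_kern; last exact: measurable_cst.
  apply: (@measurable_advb R true _ (measurableTypeR R) (cst y) id) => //.
apply: (@le_trans _ _ (EX U01 (fun t => k t + k (1 - t)))).
  apply: EXU_le => // [|t /andP[t0 t1]]; first exact: bmD.
  have kp s : 0 <= k s by exact: expR_ge0.
  have [te|te] := eqVneq t 1.
    rewrite te subrr adv1 (_ : kern y y = k 0).
      by rewrite lerDr.
    by rewrite /kern /k maxxx /cd ellxx minxx.
  have {}t1 : t < 1 by rewrite lt_neqAle te.
  have [te'|te'] := eqVneq t 0.
    rewrite te' adv0 (_ : kern y y = k 0); first by rewrite lerDl.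
    by rewrite /kern /k maxxx /cd ellxx minxx.
  have {}t0 : 0 < t by rewrite lt_neqAle eq_sym te'.
  have ny : y <> adv y t.
    by move=> /(congr1 (ell y)); rewrite ellxx ell_adv ?ltW// => h; rewrite -h ltxx in t0.
  have E1 : ell y (adv y t) = t by rewrite ell_adv// ltW.
  have E2 : ell (adv y t) y = 1 - t by rewrite (ell_sym ny) E1.
  rewrite /kern /cd E1 E2; have [h|h] := leP (1 - t) t.
    rewrite (_ : expR _ = k (1 - t)) ?lerDr//.
    by rewrite /k max_r// subr_ge0 ltW.
  by rewrite (_ : expR _ = k t) ?lerDl// /k max_r// ltW.
rewrite EXD//.
(* An antiderivative of the kernel on one side. *)
pose A t := - (e / b) * expR (- b * ln (1 + t / e)).
have dA t : 0 <= t -> is_derive t (1 : R) A (expR (- lk t)).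
  move=> t0.
  have d1 : is_derive t (1 : R) (fun t => 1 + t / e) (e^-1).
    have : is_derive t (1 : R) ((cst 1 : R -> R) + (e^-1 *: (id : R -> R))) (0 + e^-1 *: 1).
      by apply: is_deriveD; exact: is_deriveZ.
    rewrite add0r /GRing.scale /= mulr1; congr is_derive.
    by apply/funext => s /=; rewrite /cst /= mulrC.
  have d2 : is_derive (1 + t / e) (1 : R) (@ln R) (1 + t / e)^-1.
    by apply: is_derive1_ln; exact: lk_pos.
  have d3 := @is_derive1_comp R (@ln R) (fun t => 1 + t / e) t _ _ d2 d1.
  have d4 : is_derive t (1 : R) (fun t => - b * ln (1 + t / e)) (- b * ((1 + t / e)^-1 * e^-1)).
    exact: (is_deriveZ (- b) d3).
  have d5 := @is_derive1_comp R expR (fun t => - b * ln (1 + t / e)) t _ _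
    (is_derive_expR (- b * ln (1 + t / e))) d4.
  have d6 := is_deriveZ (- (e / b)) d5.
  apply: (is_derive_eq d6); rewrite /GRing.scale /=.
  have -> : expR (- lk t) = expR (- b * ln (1 + t / e)) * (1 + t / e)^-1.
    rewrite /lk /a -[in RHS](lnK (_ : (1 + t / e)^-1 \is Num.pos)) ?posrE ?invr_gt0 ?lk_pos//.
    by rewrite lnV ?posrE ?lk_pos// -expRD; congr expR; ring.
  move: (expR _) ((1 + t / e)^-1) => p q; field.
  by rewrite e_neq0 lt0r_neq0.
have ck : continuous k.
  move=> t.
  apply: continuous_comp; last exact: continuous_expR.
  apply: continuousN; apply: cvgM; first exact: cvg_cst.
  apply: (@continuous_comp _ _ _ (fun t => 1 + Num.max 0 t / e)); last first.
    by apply: continuous_ln; apply: lk_pos; rewrite le_max lexx.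
  apply: cvgD; first exact: cvg_cst.
  apply: cvgM; last exact: cvg_cst.
  apply: (@continuous_max _ _ (cst 0) id); [exact: cst_continuous|exact: cvg_id].
have kE t : 0 <= t -> k t = expR (- lk t) by move=> t0; rewrite /k max_r.
have dk t : 0 <= t <= 1 -> is_derive t (1 : R) A (k t).
  by move=> /andP[t0 _]; rewrite (kE _ t0); exact: (dA _ t0).
have dk1 t : 0 <= t <= 1 -> is_derive t (1 : R) (fun t => - A (1 - t)) (k (1 - t)).
  move=> t01; have h : is_derive (1 - t) (1 : R) A (k (1 - t)) by apply: dk; lra.
  have h1 : is_derive t (1 : R) (fun t => 1 - t) (0 - 1) by exact: is_deriveB.
  have := is_deriveN (@is_derive1_comp R A (fun t => 1 - t) t _ _ h h1).
  by rewrite sub0r mulrN1 opprK.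
have k0 t : 0 <= k t by exact: expR_ge0.
have ck1 : continuous (fun t => k (1 - t)).
  move=> t; apply: continuous_comp; last exact: ck.
  by apply: cvgB; [exact: cvg_cst|exact: cvg_id].
have AE : A 0 = - (e / b) by rewrite /A mul0r addr0 ln1 mulr0 expR0 mulr1.
have A1 : A 1 <= 0.
  by rewrite /A mulNr oppr_le0 mulr_ge0 ?expR_ge0// divr_ge0// ltW.
have e1 : EX U01 k <= e / b.
  rewrite (EXU_FTC bk0 k0 (continuous_subspaceT ck) dk) AE opprK.
  by rewrite gerDr.
have e2 : EX U01 (fun t => k (1 - t)) <= e / b.
  rewrite (EXU_FTC bk1 _ (continuous_subspaceT ck1) dk1)//.
  by rewrite subrr subr0 opprK AE opprK gerDl.
have -> : 2 * e / b = e / b + e / b by ring.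
by apply: le_trans (lerD e1 e2) _; rewrite lexx.
Qed.

(** Within distance [e] of [y] the kernel is at least 2 ^ -(1 + b), so that an
    average over these points is controlled by the kernel. *)
Lemma kern_average u y : e <= 1 -> clip u -> (forall x, 0 <= u x) ->
  EX U01 (fun s => u (adv y (e * s))) <=
  expR (a * ln 2) / e * cmean (fun x => u x * kern x y).
Proof.
move=> e1 cu u0; set c := expR (a * ln 2).
have cuk : clip (fun x => u x * kern x y) by apply: clipM => //; exact: clip_kern.
have uk0 x : 0 <= u x * kern x y by rewrite mulr_ge0// ltW// kern_gt0.
rewrite -(@cmean_adv _ _ y)//.
have cadv v : clip v -> continuous (fun t => v (adv y t)).
  move=> cv t; apply: (@continuous_comp _ _ _ (fun t => rep y + t) (v \o @cproj R)).
    by apply: (@continuousD _ _ _ (cst (rep y)) id) => //; exact: cst_continuous.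
  exact: clip_continuous.
have madv : measurable_fun setT ((fun t => adv y t) : measurableTypeR R -> circle R).
  by apply: (@measurable_advb R true _ (measurableTypeR R) (cst y) id).
have [A dA] := antiderivative (cadv _ cu).
have [B dB] := antiderivative (cadv _ cuk).
have -> : EX U01 (fun t => u (adv y t) * kern (adv y t) y) = B 1 - B 0.
  apply: EXU_FTC => //.
  - exact: (bm_comp (clip_bm cuk) madv).
  - by apply: continuous_subspaceT; exact: (cadv _ cuk).
  - by move=> t /andP[t0 t1]; apply: dB; lra.
have dAe t : 0 <= t <= 1 -> is_derive t (1 : R) (fun s => e^-1 * A (e * s)) (u (adv y (e * t))).
  move=> /andP[t0 t1].
  have h1 : is_derive t (1 : R) (fun s => e * s) (e *: (1 : R)) by exact: is_deriveZ.
  have h2 : is_derive (e * t) (1 : R) A (u (adv y (e * t))).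
    by apply: dA; apply: (@lt_le_trans _ _ 0); rewrite ?mulr_ge0// ltW.
  have := is_deriveZ e^-1 (@is_derive1_comp R A (fun s => e * s) t _ _ h2 h1).
  by rewrite /GRing.scale /= mulr1 mulrC mulfK.
have me : measurable_fun setT ((fun s => e * s) : measurableTypeR R -> measurableTypeR R).
  exact: measurable_funM.
have bue : bm ((fun s => u (adv y (e * s))) : measurableTypeR R -> R).
  exact: (bm_comp (clip_bm cu) (measurableT_comp madv me)).
have cue : continuous (fun s => u (adv y (e * s))).
  move=> t; apply: (@continuous_comp _ _ _ (fun s => e * s) (fun s => u (adv y s))).
    by apply: (@continuousM _ _ (cst e) id) => //; exact: cst_continuous.
  exact: (cadv _ cu).
rewrite (EXU_FTC bue _ (continuous_subspaceT cue) dAe)//.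
rewrite mulr1 mulr0 -mulrBr (_ : c / e * _ = e^-1 * (c * (B 1 - B 0))); last by ring.
rewrite ler_pM2l ?invr_gt0//.
have le1 : B e <= B 1.
  apply: (deriv_ge0_le e1 (D' := fun t => u (adv y t) * kern (adv y t) y)) => t /andP[t0 _].
    by apply: dB; apply: lt_le_trans (_ : 0 <= _) => //; rewrite ?oppr_lt0// (le_trans _ t0)// ltW.
  exact: uk0.
have kc t : 0 <= t <= e -> c^-1 <= kern (adv y t) y.
  move=> /andP[t0 te]; rewrite /c -expRN /kern ler_expR lerN2.
  apply: (@le_trans _ _ (lk t)).
    apply: lk_le; rewrite cd_ge0 /= cdC; have [t1|t1] := ltP t 1.
      by apply: le_trans (cd_le_ell _ _) _; rewrite ell_adv// t0.
    by apply: le_trans (cd_le_ell _ _) _; apply: le_trans t1; rewrite ltW// ell_lt1.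
  rewrite ler_pM2l ?addr_gt0// ler_ln ?posrE ?lk_pos// -[2]/(1 + 1) lerD2l.
  by rewrite ler_pdivrMr// mul1r.
have c0 : 0 < c by exact: expR_gt0.
(* On [0, e] the kernel is at least 1 / c. *)
have le2 : B 0 - c^-1 * A 0 <= B e - c^-1 * A e.
  apply: (@deriv_ge0_le _ (fun t => B t - c^-1 * A t)
    (fun t => u (adv y t) * kern (adv y t) y - c^-1 * u (adv y t))) => // [|t|t].
  - exact: ltW.
  - move=> /andP[t0 _]; have t3 : -3 < t by lra.
    by apply: is_deriveB; [exact: dB|apply: is_deriveZ; exact: dA].
  - by move=> /kc h; rewrite mulrC -mulrBl mulr_ge0// subr_ge0.
have : c^-1 * (A e - A 0) <= B 1 - B 0 by rewrite mulrBr; lra.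
by rewrite ler_pdivrMl.
Qed.

End kernel.

(** * The smoothing inequality *)

Section smoothing.
Context {R : realType} (nu : probability (circle R) R) (b : R).
Hypothesis b0 : 0 < b.
Implicit Types (u : circle R -> R) (x y : circle R) (f : diff2 R).

Lemma dens_fubini e u : 0 < e -> clip u ->
  EX nu (fun y => cmean (fun x => u x * kern b e x y)) =
  cmean (fun x => u x * dens nu b e x).
Proof.
move=> e0 cu; rewrite /cmean.
have bF : bm (fun z : circle R * measurableTypeR R =>
    u (cproj z.2) * kern b e (cproj z.2) z.1).
  have mc : measurable_fun setT (fun z : circle R * measurableTypeR R => cproj z.2).
    exact: (measurableT_comp measurable_cproj).
  apply: bmM; first exact: (bm_comp (clip_bm cu) mc).
  exact: bm_kern.
rewrite (EX_fubini nu U01 bF); congr EX; apply/funext => t /=.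
rewrite EXZ//; apply: (bm_kern b0 e0 (h := cst _)) => //; exact: measurable_cst.
Qed.

(** What matters is that this depends neither on the scale, nor on the
    diffeomorphism, nor on the test function. *)
Definition smoothing_cst : R :=
  (1 + b) * ln 2 *+ 2 + ln (2 / b) + (1 + b) + b / 2 + 1.

Lemma ln1expR_le (s : R) : 0 <= s -> ln (1 + expR 1 * s) <= 1 + ln (1 + s).
Proof.
move=> s0; have e1 : 1 <= expR (1 : R) by rewrite -expR0 ler_expR.
have -> : 1 + ln (1 + s) = ln (expR 1 * (1 + s)).
  by rewrite lnM ?posrE ?expR_gt0 ?ltr_pwDl// expRK.
rewrite ler_ln ?posrE ?mulr_gt0 ?expR_gt0 ?ltr_pwDl// ?mulr_ge0 ?expR_ge0//.
by rewrite mulrDr mulr1 lerD2r.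
Qed.

Lemma clip_ln1cderiv f : clip (fun x => ln (1 + cderiv f x)).
Proof.
apply: (@clip_post _ (@ln R) 1 (fun x => 1 + cderiv f x)) => // [x y|]; last first.
  by apply: clipD; [exact: clip_cst|exact: clip_cderiv].
rewrite mul1r.
have W (s t : R) : 1 <= s -> s <= t -> `|ln t - ln s| <= `|t - s|.
  move=> s1 st; have s0 : 0 < s by apply: lt_le_trans s1.
  have t0 : 0 < t by apply: lt_le_trans st.
  rewrite !ger0_norm ?subr_ge0 ?ler_ln//.
  rewrite -ln_div// (_ : t / s = 1 + (t - s) / s); last by field; exact: lt0r_neq0.
  have h : 0 <= t - s by rewrite subr_ge0.
  apply: le_trans (le_ln1Dx _) _.
    by apply: lt_le_trans (_ : 0 <= _); rewrite ?ltrN10// divr_ge0// ltW.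
  by rewrite ler_pdivrMr// ler_peMr.
have c1 z : 1 <= 1 + cderiv f z by rewrite lerDl ltW// cderiv_gt0.
have [h|/ltW h] := leP (1 + cderiv f x) (1 + cderiv f y); first exact: W.
by rewrite distrC [leRHS]distrC; exact: W.
Qed.

(* The arithmetic steps are isolated, so that linear arithmetic runs in small
   contexts. *)
Let arith_near (u1 u2 l1 l2 px py pfx pfy q r : R) : `|u1 - u2| <= 1 ->
  `|l1 - l2| <= 1 -> px <= py + q -> pfy <= pfx + r ->
  u2 + l2 + pfy - py - (2 + q + r) <= u1 + l1 + pfx - px.
Proof. by rewrite !ler_norml; lra. Qed.

Let arith_gibbs (L p q r : R) : p - q <= r -> p - q - L + 1 <= 1 + (r - L).
Proof. by lra. Qed.

Let arith_tail (B p q r : R) : b * q <= (1 + b) * p - B ->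
  (1 + b) * (p - q) <= (1 + b) * r -> B - (1 + b) * r <= q.
Proof. by lra. Qed.

Let exp_split (L p q r t : R) : 0 < q -> 0 < r -> 0 < t ->
  expR (p + ln r + ln q - ln t - L) * t = expR (- L) * (expR p * q * r).
Proof.
move=> q0 r0 t0.
have -> : p + ln r + ln q - ln t - L = - L + p + ln q + ln r + - ln t by ring.
rewrite !expRD -lnV ?posrE// !lnK ?posrE ?invr_gt0//.
by rewrite mulrVK ?unitfE ?lt0r_neq0// !mulrA.
Qed.

Let ln_ratio (p q : R) : 0 < p -> 0 < q -> ln p - ln q <= ln (1 + p / q).
Proof.
move=> p0 q0; have pq : 0 < p / q by exact: divr_gt0.
by rewrite -ln_div ?posrE// ler_ln ?posrE ?addr_gt0// lerDr.
Qed.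

Let EX4 (u1 u2 u3 u4 : circle R -> R) : bm u1 -> bm u2 -> bm u3 -> bm u4 ->
  EX nu (fun x => u1 x + u2 x + u3 x - u4 x) =
  EX nu u1 + EX nu u2 + EX nu u3 - EX nu u4.
Proof.
move=> b1 b2 b3 b4; rewrite EXB//; last by apply: bmD => //; exact: bmD.
by rewrite EXD ?(EXD _ b1)//; exact: bmD.
Qed.

Let EX_affine (p q r : R) u : bm u ->
  EX nu (fun x => p + (q + r * u x)) = p + (q + r * EX nu u).
Proof.
move=> bu; rewrite EXD; [|exact: bm_cst|by apply: bmD; [exact: bm_cst|exact: bmZ]].
by rewrite EXD ?EXZ ?EX_cst//; [exact: bm_cst|exact: bmZ].
Qed.

Let EX_shift (p q : R) u v : bm u -> bm v ->
  EX nu (fun x => u x - v x - p + q) = EX nu u - EX nu v - p + q.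
Proof.
move=> bu bv; have bp := @bm_cst R _ (circle R) p; have bq := @bm_cst R _ (circle R) q.
by rewrite EXD ?EXB ?EX_cst//; [exact: bmB|apply: bmB => //; exact: bmB].
Qed.

Let arith_cst (e p q : R) : 0 < e ->
  p * q + b / 2 = b / (2 * e) * (p * q * (2 * e / b) + e).
Proof. by move=> e0; field; rewrite !lt0r_neq0. Qed.

Let arith_scale (c e : R) : 0 < c -> 0 < e -> c / e * (c^-1 * (2 / b)^-1) = b / (2 * e).
Proof. by move=> c0 e0; field; rewrite !lt0r_neq0. Qed.

Let arith_fin (a p1 p2 p3 p4 q1 q2 q3 q4 : R) :
  p1 + p2 + p3 - p4 - (2 + q1 + (a + q2)) - (q1 + q3) + 1 <= q4 + b / 2 ->
  p1 + p2 + p3 - p4 <= q1 *+ 2 + q3 + a + b / 2 + 1 + q4 + q2.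
Proof. by rewrite mulr2n; lra. Qed.

(** Let [P] be the density of [nu] smoothed at the scale [e], and let [H] be
    the logarithm of [expR (u (f x)) * P (f x) * f' x / P x]. The left-hand
    side is the mean of [H]. By the inequality [H - L <= expR (H - L) - 1],
    that mean is controlled by the mean of [expR H] over the points at
    distance less than [e] from a [nu]-random point, hence by the integral of
    [expR H * P], which a change of variables turns into the integral of [expR
    u * P]. The price for moving a point by less than [e] is a constant plus
    [(1 + b) * ln (1 + f')], by [ln_dens_le]. Later, [u] approximates the
    logarithm of the density of the image of [nu] by [f], so that the mean of
    [u \o f] is a relative entropy. *)
Lemma smoothing_ineq f u : clip u -> exists2 e0 : R, 0 < e0 &
  forall e, 0 < e <= e0 ->
  EX nu (fun x => u (f x)) + EX nu (fun x => ln (cderiv f x)) +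
  EX nu (fun x => ln (dens nu b e (f x))) - EX nu (fun x => ln (dens nu b e x)) <=
  smoothing_cst + expR 1 * EX nu (fun x => expR (u x)) +
  (1 + b) * EX nu (fun x => ln (1 + cderiv f x)).
Proof.
move=> cu; pose a := 1 + b.
have cuf : clip (fun x => u (f x)) by exact: clip_comp.
have cl := clip_lncderiv f.
have [K K0 uK] := cu; have [K1 K10 ufK] := cuf; have [K2 K20 lK] := cl.
have [_ [B uB]] := clip_bm cu.
pose del := (K + 1)^-1; have del0 : 0 < del by rewrite invr_gt0 ltr_wpDl.
(* Below the scale [e0], the functions [u], [u \o f] and [ln f'] vary by at
   most 1, and the tail of the kernel at distance more than [del], where [u]
   may vary more, is absorbed by [e]. *)
pose e0 := Num.min (Num.min 2^-1 (expR ((a * ln del - B) / b)))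
                   (Num.min (K1 + 1)^-1 (K2 + 1)^-1).
exists e0; first by rewrite !lt_min expR_gt0 !invr_gt0 !ltr_wpDl.
move=> e /andP[ep]; rewrite !le_min => /andP[/andP[e2 eB] /andP[eK1 eK2]].
have e1 : e < 1 by apply: le_lt_trans e2 _; rewrite invf_lt1 ?ltr1n.
have cP := clip_ln_dens nu b0 ep.
have cPf : clip (fun x => ln (dens nu b e (f x))) by exact: (clip_comp f cP).
pose H x := u (f x) + ln (cderiv f x) + ln (dens nu b e (f x)) - ln (dens nu b e x).
have cH : clip H by apply: clipB => //; apply: clipD => //; exact: clipD.
(* This normalization makes the final constant independent of the scale; see
   [cL]. *)
pose L := a * ln 2 + ln (2 / b).
pose psi x := expR (H x - L).
have cpsi : clip psi by apply: clip_expR; apply: clipB => //; exact: clip_cst.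
pose err y := 2 + a * ln 2 + (a + a * ln (1 + cderiv f y)).
have cd0 y : 0 < cderiv f y by exact: cderiv_gt0.
have cl1 := clip_ln1cderiv f.
have cerr : clip err.
  by apply: clipD; [exact: clip_cst|apply: clipD; [exact: clip_cst|exact: clipZ]].
have small (M : R) : 0 <= M -> e <= (M + 1)^-1 -> forall s : R, 0 <= s <= e -> M * s <= 1.
  move=> M0 eM s /andP[s0 se]; apply: (@le_trans _ _ ((M + 1) * e)).
    by apply: ler_pM => //; rewrite lerDl.
  by rewrite -ler_pdivlMl ?mulr1// ltr_wpDl.
(* Moving [y] by less than [e] changes [H] by at most [err y]. *)
have near y s : 0 <= s <= 1 -> H y - err y <= H (adv y (e * s)).
  move=> /andP[s0 s1]; set x := adv y (e * s).
  have es : 0 <= e * s <= e by rewrite mulr_ge0 ?(ltW ep)//= ler_piMr// ltW.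
  have E : ell y x = e * s by rewrite ell_adv//; lra.
  have h1 : `|u (f x) - u (f y)| <= 1.
    by apply: le_trans (ufK _ _) _; rewrite E; exact: small.
  have h2 : `|ln (cderiv f x) - ln (cderiv f y)| <= 1.
    by apply: le_trans (lK _ _) _; rewrite E; exact: small.
  have h3 : ln (dens nu b e x) <= ln (dens nu b e y) + a * ln 2.
    apply: le_trans (ln_dens_le nu b0 ep (_ : cd x y <= e)) _.
      by rewrite cdC; apply: le_trans (cd_le_ell _ _) _; rewrite E; case/andP: es.
    by rewrite lerD2l /lk divff ?lt0r_neq0.
  have h4 : ln (dens nu b e (f y)) <= ln (dens nu b e (f x)) + (a + a * ln (1 + cderiv f y)).
    apply: le_trans (ln_dens_le nu b0 ep (cd_le_ell (f y) (f x))) _.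
    rewrite lerD2l /lk -/a (_ : a + _ = a * (1 + ln (1 + cderiv f y))); last by ring.
    rewrite ler_pM2l ?addr_gt0//.
    apply: le_trans (ln1expR_le (ltW (cd0 y))).
    rewrite ler_ln ?posrE ?ltr_pwDl ?divr_ge0 ?ell_ge0 ?(ltW ep)//; last first.
      by rewrite mulr_ge0 ?expR_ge0 ?ltW.
    rewrite lerD2l ler_pdivrMr//.
    have [z zl ->] := ell_mvt f y x; rewrite E in zl *.
    apply: ler_pM; rewrite ?(ltW (cd0 _))//; try by case/andP: es.
    rewrite -[cderiv f z]lnK ?posrE// -[cderiv f y]lnK ?posrE// -expRD ler_expR.
    have : `|ln (cderiv f z) - ln (cderiv f y)| <= 1.
      apply: le_trans (lK _ _) _; apply: small => //; rewrite ell_ge0 /=.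
      by apply: le_trans zl _; case/andP: es.
    by rewrite ler_norml lerBlDr => /andP[].
  exact: (arith_near h1 h2 h3 h4).
have mvy y : measurable_fun setT ((fun s => adv y (e * s)) : measurableTypeR R -> circle R).
  have madv : measurable_fun setT ((fun t => adv y t) : measurableTypeR R -> circle R).
    by apply: (@measurable_advb R true _ (measurableTypeR R) (cst y) id).
  have me : measurable_fun setT ((fun s => e * s) : measurableTypeR R -> measurableTypeR R).
    exact: measurable_funM.
  exact: (measurableT_comp madv me).
have step1 y : H y - err y - L + 1 <= EX U01 (fun s => psi (adv y (e * s))).
  rewrite -[leLHS](EX_cst U01); apply: EXU_le.
  - exact: bm_cst.
  - exact: (bm_comp (clip_bm cpsi) (mvy y)).
  move=> s /(near y) h; rewrite /cst /psi; apply: le_trans (expR_ge1Dx _).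
  exact: arith_gibbs.
have psi0 x : 0 <= psi x by exact: expR_ge0.
have step2 y : H y - err y - L + 1 <= expR (a * ln 2) / e * cmean (fun x => psi x * kern b e x y).
  by apply: le_trans (step1 y) _; apply: kern_average => //; exact: ltW.
pose c := expR (a * ln 2).
have bker v : clip v -> bm (fun y => cmean (fun x => v x * kern b e x y)).
  move=> cv; apply: (bm_EX U01 (F := fun z : circle R * measurableTypeR R =>
    v (cproj z.2) * kern b e (cproj z.2) z.1)).
  have mc : measurable_fun setT (fun z : circle R * measurableTypeR R => cproj z.2).
    exact: (measurableT_comp measurable_cproj).
  apply: bmM; first exact: (bm_comp (clip_bm cv) mc).
  exact: bm_kern.
have bH := clip_bm cH; have berr := clip_bm cerr.
have bl : bm (fun y => H y - err y - L + 1).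
  by apply: bmD; [apply: bmB; [exact: bmB|exact: bm_cst]|exact: bm_cst].
have step3 : EX nu (fun y => H y - err y - L + 1) <= c / e * cmean (fun x => psi x * dens nu b e x).
  rewrite -dens_fubini// -EXZ; last exact: bker.
  by apply: EX_le => //; apply: bmZ; exact: bker.
have cud : clip (fun x => expR (u x) * dens nu b e x).
  by apply: clipM; [exact: clip_expR|exact: clip_dens].
have ud0 x : 0 <= expR (u x) * dens nu b e x.
  by rewrite mulr_ge0 ?expR_ge0// ltW// dens_gt0.
(* The factor [f'] contained in [psi] is the Jacobian of the change of
   variables. *)
have step4 : cmean (fun x => psi x * dens nu b e x) =
    expR (- L) * cmean (fun x => expR (u x) * dens nu b e x).
  rewrite -(cmean_diff2 f cud ud0) /cmean -EXZ; last first.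
    exact: (bm_cproj (clip_bm (clipM (clip_comp f cud) (clip_cderiv f)))).
  congr EX; apply/funext => t; set x := cproj t.
  have p1 := dens_gt0 nu b0 ep x; have p2 := dens_gt0 nu b0 ep (f x).
  exact: (exp_split _ _ p2 (cd0 x) p1).
(* The kernel concentrates near the diagonal, where [u] varies little. *)
have tail x y : expR (u x) * kern b e x y <= expR 1 * expR (u y) * kern b e x y + e.
  have k0 := ltW (kern_gt0 b e x y).
  have [h|h] := leP (cd x y) del.
    apply: (@le_trans _ _ (expR 1 * expR (u y) * kern b e x y)); last by rewrite lerDl ltW.
    rewrite ler_wpM2r// -expRD ler_expR -lerBlDr.
    have H1 x' y' : ell x' y' <= del -> `|u y' - u x'| <= 1.
      move=> h'; apply: le_trans (uK _ _) _; apply: (@le_trans _ _ ((K + 1) * del)).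
        by apply: ler_pM => //; rewrite ?ell_ge0// lerDl.
      by rewrite mulfV// lt0r_neq0// ltr_wpDl.
    move: h; rewrite ge_min => /orP[/H1|/H1]; last by move=> h; exact: le_trans (ler_norm _) h.
    by rewrite distrC => h; exact: le_trans (ler_norm _) h.
  apply: (@le_trans _ _ e); last by rewrite lerDr !mulr_ge0 ?expR_ge0.
  apply: (@le_trans _ _ (expR B * expR (- lk b e del))).
    apply: ler_pM; rewrite ?expR_ge0// ler_expR; first by apply: le_trans (ler_norm _) _.
    by rewrite lerN2; apply: lk_le => //; rewrite (ltW del0) ltW.
  rewrite -expRD -[leRHS](lnK (_ : e \is Num.pos)) ?posrE// ler_expR.
  have h1 := ln_ratio del0 ep.
  have h2 : b * ln e <= a * ln del - B.
    rewrite -ler_pdivlMl// mulrC -[leRHS]expRK ler_ln ?posrE ?expR_gt0//.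
  rewrite /lk; have h3 : (1 + b) * (ln del - ln e) <= (1 + b) * ln (1 + del / e).
    by rewrite ler_pM2l ?addr_gt0.
  exact: arith_tail h2 h3.
have step5 y : cmean (fun x => expR (u x) * kern b e x y) <= expR 1 * expR (u y) * (2 * e / b) + e.
  have bk : bm ((fun t => kern b e (cproj t) y) : measurableTypeR R -> R).
    exact: (bm_cproj (clip_bm (clip_kern b0 ep y))).
  apply: (@le_trans _ _ (EX U01 (fun t => expR 1 * expR (u y) * kern b e (cproj t) y + e))).
    apply: EXU_le.
    - exact: (bm_cproj (clip_bm (clipM (clip_expR cu) (clip_kern b0 ep y)))).
    - by apply: bmD; [exact: bmZ|exact: bm_cst].
    - by move=> t _; exact: tail.
  rewrite EXD ?EX_cst ?EXZ//; [|exact: bmZ|exact: bm_cst].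
  by rewrite lerD2r ler_wpM2l ?mulr_ge0 ?expR_ge0//; exact: kern_mass.
have beu : bm (fun x => expR (u x)) by apply: clip_bm; exact: clip_expR.
have step6 : cmean (fun x => expR (u x) * dens nu b e x) <=
    expR 1 * EX nu (fun x => expR (u x)) * (2 * e / b) + e.
  rewrite -dens_fubini//; last exact: clip_expR.
  apply: (@le_trans _ _ (EX nu (fun y => (expR 1 * (2 * e / b)) * expR (u y) + e))).
    apply: EX_le; [by apply: bker; exact: clip_expR|by apply: bmD; [exact: bmZ|exact: bm_cst]|].
    by move=> y; rewrite mulrAC; exact: step5.
  rewrite (EXD nu (bmZ _ beu) (bm_cst e)) EX_cst (EXZ nu _ beu).
  by rewrite [leRHS]addrC [leRHS]addrC lerD2r [leRHS]mulrAC.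
have cL : c / e * expR (- L) = b / (2 * e).
  rewrite /L opprD expRD -lnV ?posrE ?divr_gt0// lnK ?posrE ?invr_gt0 ?divr_gt0//.
  by rewrite expRN -/c arith_scale// expR_gt0.
have fin : EX nu (fun y => H y - err y - L + 1) <=
    expR 1 * EX nu (fun x => expR (u x)) + b / 2.
  apply: le_trans step3 _; rewrite step4 mulrA cL.
  rewrite (arith_cst _ _ ep).
  by rewrite ler_wpM2l// divr_ge0 ?mulr_ge0// ltW.
have bl1 := clip_bm cl1.
have EH : EX nu H = EX nu (fun x => u (f x)) + EX nu (fun x => ln (cderiv f x)) +
  EX nu (fun x => ln (dens nu b e (f x))) - EX nu (fun x => ln (dens nu b e x)).
  have b1 := clip_bm cuf; have b2 := clip_bm cl; have b3 := clip_bm cP; have b4 := clip_bm cPf.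
  exact: EX4.
have Eerr : EX nu err = 2 + a * ln 2 + (a + a * EX nu (fun x => ln (1 + cderiv f x))).
  exact: EX_affine.
move: fin; rewrite (EX_shift _ _ bH berr) EH Eerr.
exact: arith_fin.
Qed.

End smoothing.

(** * Images of probabilities and densities *)

Section pushed_probability.
Context {R : realType} {d d'} {T : measurableType d} {T' : measurableType d'}.

Lemma push_exists (m : probability T R) (h : T -> T') : measurable_fun setT h ->
  exists m' : probability T' R, forall A, m' A = m (h @^-1` A).
Proof.
move=> mh; pose H : {mfun T >-> T'} := HB.pack h (isMeasurableFun.Build _ _ _ _ h mh).
by exists (distribution m H).
Qed.

(** The Radon-Nikodym derivative is bounded by 1 / c almost everywhere;
    truncating it there makes it bounded everywhere. *)
Lemma bounded_density (m m' : probability T R) (c : R) : 0 < c ->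
  (forall A, measurable A -> (c%:E * m' A <= m A)%E) ->
  exists J : T -> R, [/\ bm J, forall x, 0 <= J x
    & forall A, measurable A -> m' A = (EX m (fun x => \1_A x * J x))%:E].
Proof.
move=> c0 cm.
have dom : m' `<< m.
  apply/null_content_dominatesP => A mA A0; apply/eqP; rewrite eq_le measure_ge0 andbT.
  have : (c%:E * m' A <= c%:E * 0)%E by rewrite mule0 -A0; exact: cm.
  by rewrite lee_pmul2l// lte_fin.
pose g x := fine (Radon_Nikodym_SigmaFinite.f m' m x).
have gE x : (g x)%:E = Radon_Nikodym_SigmaFinite.f m' m x.
  by rewrite fineK//; exact: Radon_Nikodym_SigmaFinite.f_fin_num.
have g0 x : 0 <= g x by rewrite fine_ge0//; exact: Radon_Nikodym_SigmaFinite.f_ge0.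
have ig : m.-integrable setT (EFin \o g).
  rewrite (_ : _ \o _ = Radon_Nikodym_SigmaFinite.f m' m).
    exact: Radon_Nikodym_SigmaFinite.f_integrable.
  by apply/funext => x /=; exact: gE.
have mg : measurable_fun setT g by apply/measurable_EFinP; exact: measurable_int ig.
have gI A : measurable A -> m' A = (\int[m]_(x in A) (g x)%:E)%E.
  move=> mA; rewrite (Radon_Nikodym_SigmaFinite.f_integral dom mA).
  by apply: eq_integral => x _; rewrite gE.
pose J x := Num.min (g x) c^-1.
have bJ : bm J.
  split; first by apply: measurable_minr.
  exists c^-1 => x; rewrite ger0_norm; first by rewrite ge_min lexx orbT.
  by rewrite le_min g0 invr_ge0 ltW.
(* On this set the density exceeds 1 / c by a definite amount, which the
   domination forbids unless the set is negligible. *)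
have Bk0 (k : nat) : m [set x | c^-1 + k.+1%:R^-1 <= g x] = 0%E.
  set B := [set x | _].
  have mB : measurable B.
    rewrite (_ : B = g @^-1` `[c^-1 + k.+1%:R^-1, +oo[%classic).
      by rewrite -[X in measurable X]setTI; apply: mg => //; exact: measurable_itv.
    by apply/seteqP; split => x; rewrite /B /= in_itv /= andbT.
  have h1 : ((c^-1 + k.+1%:R^-1)%:E * m B <= m' B)%E.
    rewrite gI// -integral_cst//; apply: ge0_le_integral => //.
    - by move=> x _; rewrite lee_fin addr_ge0 ?invr_ge0// ltW.
    - exact/measurable_EFinP/measurable_funTS.
  have h2 : (m' B <= (c^-1)%:E * m B)%E.
    have ci : (0 <= (c^-1)%:E)%E by rewrite lee_fin invr_ge0 ltW.
    have := lee_wpmul2l ci (cm B mB).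
    by rewrite muleA -EFinM mulVf ?mul1e// lt0r_neq0.
  have fB : m B \is a fin_num by exact: fin_num_measure.
  apply/eqP; rewrite eq_le measure_ge0 andbT.
  have := le_trans h1 h2; rewrite -(fineK fB) -!EFinM !lee_fin mulrDl gerDl.
  by rewrite pmulr_rle0// invr_gt0.
have JE : {ae m, forall x, J x = g x}.
  exists (\bigcup_k [set x | c^-1 + k.+1%:R^-1 <= g x]); split.
  - apply: bigcupT_measurable => k.
    rewrite (_ : [set x | _] = g @^-1` `[c^-1 + k.+1%:R^-1, +oo[%classic).
      by rewrite -[X in measurable X]setTI; apply: mg => //; exact: measurable_itv.
    by apply/seteqP; split => x; rewrite /= in_itv /= andbT.
  - apply/eqP; rewrite eq_le measure_ge0 andbT.
    have mF (k : nat) : measurable [set x | c^-1 + k.+1%:R^-1 <= g x].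
      rewrite (_ : [set x | _] = g @^-1` `[c^-1 + k.+1%:R^-1, +oo[%classic).
        by rewrite -[X in measurable X]setTI; apply: mg => //; exact: measurable_itv.
      by apply/seteqP; split => x; rewrite /= in_itv /= andbT.
    apply: le_trans (@measure_sigma_subadditive _ _ _ m (\bigcup_k [set x | c^-1 + k.+1%:R^-1 <= g x]) _ mF _ _) _ => //.
      exact: bigcupT_measurable.
    by rewrite eseries0//= => k _; exact: Bk0.
  move=> x /= Jx; apply: contrapT => nx; apply: Jx; rewrite /J min_l//.
  rewrite leNgt; apply/negP => cg; apply: nx.
  have [k hk] := exists_nat_gt (g x - c^-1)^-1.
  exists k => //=; rewrite -lerBrDl; apply: (@le_trans _ _ k%:R^-1).
    rewrite lef_pV2 ?posrE ?ltr0n ?ler_nat// -(ltr0n R).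
    by apply: lt_trans hk; rewrite invr_gt0 subr_gt0.
  have d0 : 0 < g x - c^-1 by rewrite subr_gt0.
  have k0 : 0 < k%:R :> R by apply: lt_trans hk; rewrite invr_gt0.
  by rewrite -[X in _ <= X]invrK lef_pV2 ?posrE ?invr_gt0//; exact: ltW.
exists J; split => //; first by move=> x; rewrite le_min g0 invr_ge0 ltW.
move=> A mA; have bA : bm (\1_A : T -> R) by exact: bm_indic.
rewrite gI// -EXE; last exact: bmM.
rewrite integral_mkcond; apply: ae_eq_integral => //.
- apply/(measurable_restrictT _ mA); exact/measurable_EFinP/measurable_funTS.
- by apply/measurable_EFinP; case: (bmM bA bJ).
apply: filterS JE => x /= JE _; rewrite /patch indicE JE.
by case: (x \in A); rewrite ?mul1r ?mul0r.
Qed.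

End pushed_probability.

(** * Furstenberg entropy and the sign of the exponent *)

Section words.
Context {R : realType} (nu : probability (circle R) R) (I : finType).
Variables (a : I -> diff2 R) (p : I -> R).
Hypotheses (p0 : forall i, 0 < p i) (psum : \sum_i p i = 1).
Hypothesis stat : forall u, bm u -> EX nu u = \sum_i p i * EX nu (fun x => u (a i x)).
Implicit Types (w : seq I) (F G : seq I -> R) (u v : circle R -> R)
  (f : diff2 R).

Fixpoint ev w : diff2 R := if w is i :: w' then (a i * ev w')%g else 1%g.

(** The expectation of a function of a random word of length [n]. *)
Fixpoint Ew (n : nat) F : R :=
  if n is k.+1 then Ew k (fun w => \sum_i p i * F (i :: w)) else F [::].

Lemma Ew_ext n F G : (forall w, F w = G w) -> Ew n F = Ew n G.
Proof. by move=> FG; congr Ew; apply/funext. Qed.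

Lemma EwD n F G : Ew n (fun w => F w + G w) = Ew n F + Ew n G.
Proof.
elim: n F G => [//|n IH] F G /=; rewrite -IH; apply: Ew_ext => w.
by rewrite -big_split; apply: eq_bigr => i _; rewrite mulrDr.
Qed.

Lemma EwZ n c F : Ew n (fun w => c * F w) = c * Ew n F.
Proof.
elim: n F => [//|n IH] F /=; rewrite -IH; apply: Ew_ext => w.
by rewrite mulr_sumr; apply: eq_bigr => i _; rewrite mulrCA.
Qed.

Lemma Ew_cst n c : Ew n (cst c) = c.
Proof.
elim: n => [//|n IH] /=; rewrite -[RHS]IH; apply: Ew_ext => w.
by rewrite -mulr_suml psum mul1r.
Qed.

Lemma Ew_sum n (J : finType) (F : J -> seq I -> R) :
  Ew n (fun w => \sum_j F j w) = \sum_j Ew n (F j).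
Proof.
elim: n F => [//|n IH] F /=; rewrite -IH; apply: Ew_ext => w.
by rewrite exchange_big; apply: eq_bigr => i _; rewrite mulr_sumr.
Qed.

Lemma Ew_le n F G : (forall w, size w = n -> F w <= G w) -> Ew n F <= Ew n G.
Proof.
elim: n F G => [|n IH] F G FG /=; first exact: FG.
apply: IH => w wn; apply: ler_sum => i _; apply: ler_wpM2l; first exact: ltW.
by apply: FG; rewrite /= wn.
Qed.

Lemma bm_Ew n (V : seq I -> circle R -> R) : (forall w, bm (V w)) ->
  bm (fun x => Ew n (fun w => V w x)).
Proof.
elim: n V => [|n IH] V bV /=; first exact: bV.
by apply: (IH (fun w x => \sum_i p i * V (i :: w) x)) => w; apply: bm_sum => i; exact: bmZ.
Qed.

Lemma Ew_EX n (V : seq I -> circle R -> R) : (forall w, bm (V w)) ->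
  Ew n (fun w => EX nu (V w)) = EX nu (fun x => Ew n (fun w => V w x)).
Proof.
elim: n V => [//|n IH] V bV /=.
rewrite -(IH (fun w x => \sum_i p i * V (i :: w) x)).
  apply: Ew_ext => w; rewrite EX_sum => [|i]; last exact: bmZ.
  by apply: eq_bigr => i _; rewrite EXZ.
by move=> w; apply: bm_sum => i; exact: bmZ.
Qed.

Lemma bm_act u f : bm u -> bm (fun x => u (f x)).
Proof. by move=> bu; apply: (bm_comp bu); exact: diff2_measurable. Qed.

Lemma Ew_stat n u : bm u -> Ew n (fun w => EX nu (fun x => u (ev w x))) = EX nu u.
Proof.
elim: n u => [//|n IH] u bu /=.
rewrite Ew_sum [RHS]stat//; apply: eq_bigr => i _; rewrite EwZ; congr (_ * _).
by rewrite -(IH (fun x => u (a i x)))//; exact: bm_act.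
Qed.

Definition exponent : R := \sum_i p i * EX nu (fun x => ln (cderiv (a i) x)).

Lemma bm_lncderiv f : bm (fun x => ln (cderiv f x)).
Proof. exact: clip_bm (clip_lncderiv f). Qed.

Lemma Ew_lncderiv n :
  Ew n (fun w => EX nu (fun x => ln (cderiv (ev w) x))) = n%:R * exponent.
Proof.
elim: n => [|n IH] /=.
  rewrite mul0r -(EX_cst nu 0); congr EX; apply/funext => x.
  by rewrite cderiv1 ln1.
rewrite (Ew_ext _ (G := fun w => \sum_i p i * EX nu (fun x => ln (cderiv (a i) (ev w x)))
    + EX nu (fun x => ln (cderiv (ev w) x)))); last first.
  move=> w; rewrite -[X in _ + X]mul1r -psum mulr_suml -big_split.
  apply: eq_bigr => i _ /=; rewrite -mulrDr -EXD; last exact: bm_lncderiv.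
    by congr (_ * EX _ _); apply/funext => x; rewrite cderivM lnM ?posrE ?cderiv_gt0.
  exact: (bm_act (ev w) (bm_lncderiv (a i))).
rewrite EwD IH Ew_sum -natr1 mulrDl mul1r addrC; congr (_ + _).
apply: eq_bigr => i _; rewrite EwZ (Ew_stat n (u := fun x => ln (cderiv (a i) x)))//.
exact: bm_lncderiv.
Qed.

Definition is_density f (J : circle R -> R) :=
  [/\ bm J, forall x, 0 <= J x
    & forall u, bm u -> EX nu (fun x => u (f x)) = EX nu (fun x => u x * J x)].

(** By stationarity [nu] is a combination of its images by the letters, so
    that it dominates [p i] times the image by [a i]. *)
Lemma density_exists i : exists J, is_density (a i) J.
Proof.
have [m' m'E] := push_exists nu (diff2_measurable (a i)).
have [|J [bJ J0 JE]] := bounded_density (m := nu) (m' := m') (p0 i).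
  move=> A mA.
  have mA' : measurable (a i @^-1` A).
    by rewrite -[X in measurable X]setTI; exact: diff2_measurable.
  rewrite m'E -EX_indic//.
  rewrite -EX_indic// -EFinM lee_fin (stat (bm_indic mA)) (bigD1 i)//=.
  rewrite lerDl; apply: sumr_ge0 => j _; apply: mulr_ge0; first exact: ltW.
    by apply: EX_ge0 => x; rewrite indicE.
exists J; split => // u bu.
pose L u := EX nu (fun x => u (a i x)) - EX nu (fun x => u x * J x).
have [_ [B JB]] := bJ.
apply/eqP; rewrite -subr_eq0; apply/eqP; apply: (@bm_functional_ext _ _ _ L (1 + B)) bu.
- move=> f g bf bg; rewrite /L; have bf' := bm_act (a i) bf; have bg' := bm_act (a i) bg.
  have -> : (fun x => (f x + g x) * J x) = (fun x => f x * J x + g x * J x).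
    by apply/funext => x; rewrite mulrDl.
  by rewrite (EXD nu bf' bg') (EXD nu (bmM bf bJ) (bmM bg bJ)); ring.
- move=> c f bf; rewrite /L (EXZ nu c (bm_act (a i) bf)).
  have -> : (fun x => c * f x * J x) = (fun x => c * (f x * J x)).
    by apply/funext => x; rewrite mulrA.
  by rewrite (EXZ nu c (bmM bf bJ)) mulrBr.
- move=> f bf f1; apply: le_trans (ler_normB _ _) _; apply: lerD.
    by apply: EX_norm_le => //; exact: bm_act.
  apply: EX_norm_le => [|x]; first exact: bmM.
  by rewrite normrM -[B]mul1r ler_pM.
- move=> A mA; have := JE A mA; rewrite m'E -EX_indic => [[E]|].
    by rewrite /L -E; apply/eqP; rewrite subr_eq0.
  by rewrite -[X in measurable X]setTI; exact: diff2_measurable.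
Qed.

Definition letter_density i : circle R -> R := sval (cid (density_exists i)).
Lemma letter_densityP i : is_density (a i) (letter_density i).
Proof. exact: (svalP (cid (density_exists i))). Qed.

(** Densities multiply along words, the density of the tail being transported
    by the first letter. *)
Fixpoint word_density w : circle R -> R :=
  if w is i :: w' then fun y => letter_density i y * word_density w' (((a i)^-1%g : diff2 R) y) else cst 1.

Lemma word_densityP w : is_density (ev w) (word_density w).
Proof.
elim: w => [|i w [bw w0 wE]] /=.
  split => [||u bu]; [exact: bm_cst|by []|].
  by congr EX; apply/funext => x; rewrite mulr1.
have [bi i0 iE] := letter_densityP i; have bw' := bm_act (a i)^-1%g bw.
split => [||u bu]; [exact: bmM|by move=> x; rewrite mulr_ge0|].
have := wE _ (bm_act (a i) bu) => ->.
have -> : (fun x => u (a i x) * word_density w x) =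
    (fun x => (fun y => u y * word_density w (((a i)^-1%g : diff2 R) y)) (a i x)).
  by apply/funext => x; rewrite diff2K.
rewrite (iE (fun y => u y * word_density w (((a i)^-1%g : diff2 R) y))); last exact: bmM.
by congr EX; apply/funext => x; ring.
Qed.

Definition xlnx (t : R) : R := t * ln t.

Lemma xlnxM s t : 0 <= s -> 0 <= t -> xlnx (s * t) = xlnx s * t + s * xlnx t.
Proof.
rewrite /xlnx !le_eqVlt => /predU1P[<-|s0]; first by rewrite !mul0r add0r.
move=> /predU1P[<-|t0]; first by rewrite !(mulr0, mul0r) addr0.
by rewrite lnM ?posrE//; ring.
Qed.

Lemma bm_xlnx u : bm u -> (forall x, 0 <= u x) -> bm (fun x => xlnx (u x)).
Proof.
move=> [mu [B uB]] u0; split.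
  by apply: measurable_funM => //; exact: measurableT_comp.
exists (1 + B ^+ 2) => x; have := u0 x; rewrite le_eqVlt => /predU1P[<-|t0].
  by rewrite /xlnx mul0r normr0 addr_ge0// sqr_ge0.
have uxB : u x <= B by apply: le_trans (ler_norm _) (uB x).
have B0 : 0 <= B by apply: le_trans uxB; exact: ltW.
rewrite /xlnx normrM (gtr0_norm t0); have [h|h] := leP (u x) 1.
  have l1 : ln (u x)^-1 <= (u x)^-1 - 1.
    rewrite -{1}[(u x)^-1](subrK 1) addrC; apply: le_ln1Dx.
    by rewrite ltrBrDl subrr invr_gt0.
  rewrite ler0_norm ?ln_le0// -lnV ?posrE//.
  apply: (@le_trans _ _ (u x * ((u x)^-1 - 1))); first by rewrite ler_pM2l.
  rewrite mulrBr mulfV ?lt0r_neq0// mulr1.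
  by have := sqr_ge0 B; lra.
have l1 : ln (u x) <= u x.
  rewrite -{1}[u x](subrK 1) addrC; apply: le_trans (le_ln1Dx _) _; last by lra.
  by rewrite ltrBrDl subrr.
have l0 : 0 <= ln (u x) by apply: ln_ge0; exact: ltW.
rewrite (ger0_norm l0); apply: (@le_trans _ _ (B ^+ 2)); last by rewrite lerDr.
by rewrite expr2; apply: ler_pM => //; exact: le_trans l1 _.
Qed.

(** The relative entropy of the image of [nu] under the word [w]. *)
Definition word_entropy w : R := EX nu (fun x => xlnx (word_density w x)).

(** The mean relative entropy of the images of [nu] by one letter, which is
    the Furstenberg entropy of the stationary measure. *)
Definition entropy : R := \sum_i p i * EX nu (fun x => xlnx (letter_density i x)).

(** The mean of the images of [nu] under the words of length [n] is [nu]
    itself. *)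
Lemma Ew_word_density n : {ae nu, forall y, Ew n (fun w => word_density w y) = 1}.
Proof.
have bE := @bm_Ew n word_density (fun w => let: And3 h _ _ := word_densityP w in h).
apply: (EX_ext bE (bm_cst 1)) => u bu.
transitivity (Ew n (fun w => EX nu (fun x => u x * word_density w x))).
  rewrite Ew_EX.
    by congr EX; apply/funext => x; rewrite mulrC -EwZ.
  by move=> w; have [bw _ _] := word_densityP w; exact: bmM.
transitivity (Ew n (fun w => EX nu (fun x => u (ev w x)))).
  by apply: Ew_ext => w; have [_ _ ->] := word_densityP w.
by rewrite Ew_stat//; congr EX; apply/funext => x; rewrite mul1r.
Qed.

(** The chain rule for relative entropy. The entropy of [i :: w] is the
    entropy of [w] plus the integral of [xlnx (letter_density i)] against the
    transported density of [w]; the latter has mean 1 by [Ew_word_density]. *)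
Lemma Ew_entropy n : Ew n word_entropy = n%:R * entropy.
Proof.
have bw w : bm (word_density w) by have [] := word_densityP w.
have w0 w x : 0 <= word_density w x by have [_ h _] := word_densityP w; exact: h.
have bi i : bm (letter_density i) by have [] := letter_densityP i.
have i0 i x : 0 <= letter_density i x by have [_ h _] := letter_densityP i; exact: h.
have bx i : bm (fun x => xlnx (letter_density i x)) by exact: bm_xlnx.
have bxw w : bm (fun x => xlnx (word_density w x)) by exact: bm_xlnx.
elim: n => [|n IH] /=.
  by rewrite mul0r /word_entropy /= /xlnx ln1 mulr0 -[RHS](EX_cst nu 0).
have ch i w : word_entropy (i :: w) =
    EX nu (fun y => xlnx (letter_density i y) * word_density w (((a i)^-1%g : diff2 R) y)) + word_entropy w.
  rewrite /word_entropy /=.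
  transitivity (EX nu (fun y => xlnx (letter_density i y) * word_density w (((a i)^-1%g : diff2 R) y) +
      letter_density i y * xlnx (word_density w (((a i)^-1%g : diff2 R) y)))).
    by congr EX; apply/funext => y; rewrite xlnxM.
  rewrite EXD; last 2 first.
  - by apply: bmM => //; exact: (bm_act (a i)^-1%g (bw w)).
  - by apply: bmM => //; exact: (bm_act (a i)^-1%g (bxw w)).
  congr (_ + _).
  have [_ _ iE] := letter_densityP i.
  have := iE _ (bm_act (a i)^-1%g (bxw w)) => E.
  transitivity (EX nu (fun x => xlnx (word_density w (((a i)^-1%g : diff2 R) x)) * letter_density i x)).
    by congr EX; apply/funext => x; rewrite mulrC.
  by rewrite -E; congr EX; apply/funext => x; rewrite diff2K.
rewrite (Ew_ext _ (G := fun w => \sum_i p i * EX nu (fun y => xlnx (letter_density i y) *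
    word_density w (((a i)^-1%g : diff2 R) y)) + word_entropy w)); last first.
  move=> w; rewrite -[X in _ + X]mul1r -psum mulr_suml -big_split.
  by apply: eq_bigr => i _ /=; rewrite -mulrDr ch.
rewrite EwD IH Ew_sum -natr1 mulrDl mul1r addrC; congr (_ + _).
apply: eq_bigr => i _; rewrite EwZ; congr (_ * _).
rewrite (Ew_EX n (V := fun w y => xlnx (letter_density i y) * word_density w (((a i)^-1%g : diff2 R) y))); last first.
  by move=> w; apply: bmM => //; exact: (bm_act (a i)^-1%g (bw w)).
pose S y := Ew n (fun w => word_density w y); have bS : bm S by exact: bm_Ew.
have bSi := bm_act (a i)^-1%g bS.
have b1 := @bm_cst R _ (circle R) 1.
have bd : bm (fun y => `|S (((a i)^-1%g : diff2 R) y) - 1|) by exact: bm_dist.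
have z : {ae nu, forall y, `|S (((a i)^-1%g : diff2 R) y) - 1| * letter_density i y = 0}.
  apply: EX_eq0; [exact: bmM|by move=> x; rewrite mulr_ge0|].
  have [_ _ iE] := letter_densityP i; rewrite -(iE _ bd).
  rewrite -(EX_cst nu 0); apply: EX_ae; [|exact: bm_cst|].
    by under eq_fun do rewrite diff2K; exact: bm_dist.
  by apply: filterS (Ew_word_density n) => x e; rewrite diff2K /S e subrr normr0.
apply: EX_ae => //.
  under eq_fun do rewrite EwZ.
  exact: bmM.
apply: filterS z => y /eqP; rewrite mulf_eq0 normr_eq0 EwZ => /orP[|/eqP->].
  by rewrite subr_eq0 /S => /eqP ->; rewrite mulr1.
by rewrite /xlnx !mul0r.
Qed.

Lemma xlnx_ge t : 0 <= t -> t - 1 <= xlnx t.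
Proof.
rewrite le_eqVlt => /predU1P[<-|t0]; first by rewrite /xlnx mul0r sub0r lerN10.
have l1 : ln t^-1 <= t^-1 - 1.
  rewrite -{1}[t^-1](subrK 1) addrC; apply: le_ln1Dx.
  by rewrite ltrBrDl subrr invr_gt0.
have : t * ln t^-1 <= t * (t^-1 - 1) by rewrite ler_pM2l.
by rewrite lnV ?posrE// mulrBr mulfV ?lt0r_neq0// mulr1 mulrN /xlnx; lra.
Qed.

Lemma xlnx_eq t : 0 <= t -> xlnx t = t - 1 -> t = 1.
Proof.
rewrite le_eqVlt => /predU1P[<-|t0]; first by rewrite /xlnx mul0r; lra.
move=> e; apply/eqP/negPn/negP => t1.
have lt0 : - ln t != 0.
  by rewrite oppr_eq0; apply: contra_neq t1 => l0; rewrite -[t]lnK ?posrE// l0 expR0.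
have := expR_gt1Dx lt0; rewrite expRN lnK ?posrE// => h.
have : t * (1 + - ln t) < t * t^-1 by rewrite ltr_pM2l.
by rewrite mulfV ?lt0r_neq0// mulrDr mulr1 mulrN -/(xlnx t) e; lra.
Qed.

(** Since [t * ln t >= t - 1] with equality at 1 only, a vanishing entropy
    forces all the densities to be 1. *)
Lemma entropy_gt0 : (exists i A, measurable A /\ nu (a i @^-1` A) <> nu A) -> 0 < entropy.
Proof.
move=> [i0 [A [mA nA]]].
have bi i : bm (letter_density i) by have [] := letter_densityP i.
have ge i x : 0 <= letter_density i x by have [_ h _] := letter_densityP i; exact: h.
have bx i : bm (fun x => xlnx (letter_density i x)) by exact: bm_xlnx.
have b1 := @bm_cst R _ (circle R) 1.
have J1 i : EX nu (letter_density i) = 1.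
  have [_ _ iE] := letter_densityP i; have := iE _ b1; rewrite EX_cst => ->.
  by congr EX; apply/funext => x; rewrite mul1r.
have pos i : 0 <= EX nu (fun x => xlnx (letter_density i x)).
  apply: (@le_trans _ _ (EX nu (fun x => letter_density i x - 1))).
    by rewrite EXB// EX_cst J1 subrr.
  by apply: EX_le => // [|x]; [exact: bmB|exact: xlnx_ge].
rewrite lt_neqAle; apply/andP; split; last first.
  by apply: sumr_ge0 => i _; apply: mulr_ge0; [exact: ltW|exact: pos].
apply/eqP => e0.
have {e0} e0 : EX nu (fun x => xlnx (letter_density i0 x)) = 0.
  have := @psumr_eq0P _ _ predT (fun i => p i * EX nu (fun x => xlnx (letter_density i x))).
  move=> /(_ (fun i _ => mulr_ge0 (ltW (p0 i)) (pos i)) (esym e0) i0 erefl)/eqP.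
  by rewrite mulf_eq0 gt_eqF//= => /eqP.
have z : {ae nu, forall x, xlnx (letter_density i0 x) - (letter_density i0 x - 1) = 0}.
  apply: EX_eq0; first by apply: bmB => //; exact: bmB.
    by move=> x; rewrite subr_ge0 xlnx_ge.
  by rewrite EXB//; [rewrite e0 EXB// EX_cst J1 !subrr|exact: bmB].
apply: nA; have [_ _ iE] := letter_densityP i0; have := iE _ (bm_indic mA) => E.
have mA' : measurable (a i0 @^-1` A).
  by rewrite -[X in measurable X]setTI; exact: diff2_measurable.
rewrite -EX_indic// -[RHS]EX_indic//; congr (_%:E).
transitivity (EX nu (fun x => \1_A x * letter_density i0 x)); first by rewrite -E.
apply: EX_ae; [by apply: bmM => //; exact: bm_indic|exact: bm_indic|].
apply: filterS z => x /eqP; rewrite subr_eq0 => /eqP/(xlnx_eq (ge i0 x)) ->.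
by rewrite mulr1.
Qed.

Let arith_test (W X Y Z : R) : W <= X -> X <= Y + Z -> Z <= 1 -> W - 1 <= Y.
Proof. by lra. Qed.

Let arith_exp (E E0 J Z : R) : E0 <= J -> E - E0 <= Z -> E <= J + Z.
Proof. by lra. Qed.

(** A Lipschitz approximation of the logarithm of [Num.max J 1], where [J] is
    the density of the image of [nu] by [w]. The truncation keeps the
    logarithm bounded and only increases its integral, while its exponential
    stays below [J + 1]. *)
Lemma test_function w : exists u, [/\ clip u,
  word_entropy w - 1 <= EX nu (fun x => u (ev w x))
  & EX nu (fun x => expR (u x)) <= 3].
Proof.
have [bw w0 wE] := word_densityP w; have [_ [B wB]] := bw.
have b1 := @bm_cst R _ (circle R) 1.
have bM : bm (fun x => Num.max (word_density w x) 1) by exact: bm_max.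
have M1 x : 1 <= Num.max (word_density w x) 1 by rewrite le_max lexx orbT.
have B0 : 0 <= B by apply: le_trans (wB (cproj 0)).
pose C := ln (B + 1); have C0 : 0 <= C by rewrite ln_ge0// lerDr.
pose u0 x := ln (Num.max (word_density w x) 1).
have u0C x : 0 <= u0 x <= C.
  rewrite ln_ge0//= ler_ln ?posrE ?(lt_le_trans _ (M1 x)) ?ltr_wpDl//.
  rewrite ge_max lerDr B0 andbT; apply: le_trans (ler_norm _) _.
  by apply: le_trans (wB x) _; rewrite lerDl.
have bu0 : bm u0.
  split; first by apply: measurableT_comp => //; case: bM.
  by exists C => x; rewrite ger0_norm; case/andP: (u0C x).
(* Each of the two means below suffers an error of at most 1. *)
pose del := Num.min (B + 1)^-1 (expR C)^-1.
have del0 : 0 < del by rewrite lt_min !invr_gt0 expR_gt0 ltr_wpDl.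
have [v cv hv] := approx_bm nu bu0 del0; have bv := clip_bm cv.
pose u x := Num.min (Num.max (v x) 0) C.
have cu : clip u.
  by apply: clip_min; [apply: clip_max => //; exact: clip_cst|exact: clip_cst].
have bu := clip_bm cu.
have uv x : `|u0 x - u x| <= `|u0 x - v x|.
  have := u0C x; rewrite /u; have [h|h] := leP (v x) 0.
    by have [h2|h2] := leP 0 C => ?; rewrite !ger0_norm; lra.
  have [h2|h2] := leP (v x) C => // ?.
  by rewrite !ler0_norm; lra.
have hu : EX nu (fun x => `|u0 x - u x|) <= del.
  by apply: le_trans hv; apply: EX_le => //; exact: bm_dist.
have uC x : 0 <= u x <= C by rewrite /u le_min ge_min C0 lexx orbT andbT le_max lexx orbT.
exists u; split => //.
  rewrite wE//; have h1 : word_entropy w <= EX nu (fun x => u0 x * word_density w x).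
    apply: EX_le; [exact: bm_xlnx|exact: bmM|].
    move=> x; rewrite /xlnx mulrC; have := w0 x; rewrite le_eqVlt => /predU1P[<-|h].
      by rewrite !mulr0.
    by rewrite ler_pM2r// ler_ln ?posrE ?(lt_le_trans _ (M1 x))// le_max lexx.
  have h2 : EX nu (fun x => u0 x * word_density w x) <=
      EX nu (fun x => u x * word_density w x + B * `|u0 x - u x|).
    apply: EX_le; [exact: bmM|by apply: bmD; [exact: bmM|apply: bmZ; exact: bm_dist]|].
    move=> x; rewrite -lerBlDl -mulrBl mulrC; apply: le_trans (ler_norm _) _.
    by rewrite normrM ler_wpM2r.
  move: h2; rewrite EXD; [|exact: bmM|by apply: bmZ; exact: bm_dist].
  rewrite EXZ; last exact: bm_dist.
  have h3 : B * EX nu (fun x => `|u0 x - u x|) <= 1.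
    apply: (@le_trans _ _ ((B + 1) * (B + 1)^-1)); last by rewrite mulfV// lt0r_neq0// ltr_wpDl.
    apply: ler_pM => //; [by apply: EX_ge0|by rewrite lerDl|].
    by apply: le_trans hu _; rewrite ge_min lexx.
  move=> h2; exact: (arith_test h1 h2 h3).
have beu : bm (fun x => expR (u x)) by apply: clip_bm; exact: clip_expR.
have h1 : EX nu (fun x => expR (u x)) <=
    EX nu (fun x => (word_density w x + 1) + expR C * `|u0 x - u x|).
  apply: EX_le => //; first by apply: bmD; [exact: bmD|apply: bmZ; exact: bm_dist].
  move=> x; have := @expR_lip R C (u0 x) (u x).
  have /andP[_ ->] := u0C x; have /andP[_ ->] := uC x => /(_ erefl erefl) h.
  have e0 : expR (u0 x) <= word_density w x + 1.
    rewrite lnK ?posrE ?(lt_le_trans _ (M1 x))// ge_max lerDl lerDr w0 andbT.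
    exact: ler01.
  have := le_trans (ler_norm (expR (u x) - expR (u0 x))) _; move=> /(_ _ h); rewrite [ `|u x - _|]distrC.
  exact: (arith_exp e0).
apply: le_trans h1 _.
rewrite EXD; [|exact: bmD|by apply: bmZ; exact: bm_dist].
rewrite EXD// EX_cst EXZ; last exact: bm_dist.
have -> : EX nu (word_density w) = 1.
  have := wE _ b1; rewrite EX_cst => ->.
  by congr EX; apply/funext => x; rewrite mul1r.
have h3 : expR C * EX nu (fun x => `|u0 x - u x|) <= 1.
  rewrite -ler_pdivlMl ?expR_gt0// mulr1; apply: le_trans hu _.
  by rewrite ge_min lexx orbT.
by lra.
Qed.

(** There are finitely many words of each length. *)
Lemma uniform_scale n (F : seq I -> R) : (forall w, 0 < F w) ->
  exists2 e, 0 < e & forall w, size w = n -> e <= F w.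
Proof.
elim: n F => [|n IH] F F0; first by exists (F [::]) => // -[].
have [|e e0 he] := IH (fun w => \big[Num.min/1]_i F (i :: w)).
  by move=> w; apply: lt_bigmin => //= *; exact: F0.
exists e => // -[//|i w] [] /he/le_trans; apply; exact: bigmin_le_cond.
Qed.

Definition spread w : R := EX nu (fun x => ln (1 + cderiv (ev w) x)).

Let arith_word (W L D D0 s c x B u : R) : u + L + D - D0 <= s + c * x + B ->
  W - 1 <= u -> c * x <= c * 3 -> (W - 1) + L + D + - D0 <= s + 3 * c + B.
Proof. by lra. Qed.

Let arith_mean (H L X s B : R) : H - 1 + L + X + - X <= s + B -> H + L <= s + 1 + B.
Proof. by lra. Qed.

(** The mean of [smoothing_ineq] over the words of length [n], with the test
    functions of [test_function] and a common scale: by stationarity the two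
    terms with the smoothed density cancel. *)
Lemma entropy_exponent b n : 0 < b ->
  n%:R * (entropy + exponent) <=
  smoothing_cst b + 3 * expR 1 + 1 + (1 + b) * Ew n spread.
Proof.
move=> b0.
have /choice[u hu] := test_function.
have cu w : clip (u w) by have [] := hu w.
have sm w : exists e0, 0 < e0 /\ forall e, 0 < e <= e0 ->
  EX nu (fun x => u w (ev w x)) + EX nu (fun x => ln (cderiv (ev w) x)) +
  EX nu (fun x => ln (dens nu b e (ev w x))) - EX nu (fun x => ln (dens nu b e x)) <=
  smoothing_cst b + expR 1 * EX nu (fun x => expR (u w x)) +
  (1 + b) * spread w.
  by have [e0 ? h] := smoothing_ineq nu b0 (ev w) (cu w); exists e0.
have /choice[e0 he0] := sm.
have [|e ep he] := @uniform_scale n e0; first by move=> w; have [] := he0 w.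
have bl : bm (fun x => ln (dens nu b e x)) := clip_bm (clip_ln_dens nu b0 ep).
pose V w := EX nu (fun x => ln (dens nu b e (ev w x))).
pose L w := EX nu (fun x => ln (cderiv (ev w) x)).
pose X := EX nu (fun x => ln (dens nu b e x)).
pose s := smoothing_cst b + 3 * expR 1.
have key : Ew n (fun w => (((word_entropy w + cst (- 1) w) + L w) + V w) + cst (- X) w)
  <= Ew n (fun w => cst s w + (1 + b) * spread w).
  apply: Ew_le => w wn; have [_ h] := he0 w; have [_ g1 g2] := hu w.
  have ee : 0 < e <= e0 w by rewrite ep he.
  have g3 : expR 1 * EX nu (fun x => expR (u w x)) <= expR 1 * 3.
    by apply: ler_wpM2l => //; exact: expR_ge0.
  exact: (arith_word (h e ee) g1 g3).
have eL : Ew n (fun w => (((word_entropy w + cst (- 1) w) + L w) + V w) + cst (- X) w) =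
    n%:R * entropy - 1 + n%:R * exponent + X + - X.
  rewrite EwD Ew_cst; congr (_ + - X).
  rewrite EwD; congr (_ + _); last exact: (Ew_stat n bl).
  rewrite EwD; congr (_ + _); last exact: Ew_lncderiv.
  by rewrite EwD Ew_cst; congr (_ + - 1); exact: Ew_entropy.
have eR : Ew n (fun w => cst s w + (1 + b) * spread w) = s + (1 + b) * Ew n spread.
  by rewrite EwD Ew_cst EwZ.
rewrite eL eR in key; rewrite mulrDr; exact: (arith_mean key).
Qed.

(** Dividing [entropy_exponent] by [n] gives [entropy + exponent <= (1 + b) *
    Num.max 0 exponent] for all [b > 0]. For a nonnegative exponent, a small
    [b] would give [entropy <= 0]. *)
Theorem exponent_lt0 : (exists i A, measurable A /\ nu (a i @^-1` A) <> nu A) ->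
  (fun n => n%:R^-1 * Ew n spread) @ \oo --> Num.max 0 exponent ->
  exponent < 0.
Proof.
move=> /entropy_gt0 h0 cv.
have key b : 0 < b -> entropy + exponent <= (1 + b) * Num.max 0 exponent.
  move=> b0.
  have cv' : (fun n => n%:R^-1 * (smoothing_cst b + 3 * expR 1 + 1) +
      (1 + b) * (n%:R^-1 * Ew n spread)) @ \oo --> (1 + b) * Num.max 0 exponent.
    rewrite -[X in _ --> X]add0r; apply: cvgD; last exact: cvgMr.
    rewrite -[X in _ --> X](mul0r (smoothing_cst b + 3 * expR 1 + 1)).
    apply: cvgMl; apply/gtr0_cvgV0; last exact: cvgr_idn.
    by near=> n; rewrite ltr0n; near: n; exact: nbhs_infty_gt.
  apply: cvg_ge_near cv' _; near=> n.
  have n0 : 0 < n%:R :> R by rewrite ltr0n; near: n; exact: nbhs_infty_gt.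
  rewrite -(ler_pM2l n0); apply: le_trans (entropy_exponent n b0) _.
  rewrite mulrDr mulrA mulfV ?lt0r_neq0// mul1r lerD2l mulrCA mulrA.
  by rewrite -[X in _ <= X]mulrA mulVKf ?lt0r_neq0.
rewrite ltNge; apply/negP => e0.
have := key 1 ltr01; rewrite max_r// => k1.
have [e1|e1] := eqVneq exponent 0; first by move: k1; rewrite e1; lra.
have ep : 0 < exponent by rewrite lt_neqAle eq_sym e1.
have := key (entropy / (2 * exponent)); rewrite divr_gt0 ?mulr_gt0// max_r// => /(_ erefl).
have -> : (1 + entropy / (2 * exponent)) * exponent = exponent + entropy / 2.
  by field; rewrite gt_eqF.
by lra.
Unshelve. all: by end_near. Qed.

End words.

(** * Product measures and almost sure statements *)

Lemma mpre d d' (T : measurableType d) (T' : measurableType d') (h : T -> T')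
    (A : set T') : measurable_fun setT h -> measurable A -> measurable (h @^-1` A).
Proof. by move=> mh mA; rewrite -[X in measurable X]setTI; exact: mh. Qed.

Lemma cvg_sum0 {R : realType} (I : Type) (r : seq I) (u : I -> nat -> R) :
  (forall i, u i @ \oo --> 0) -> (fun n => \sum_(i <- r) u i n) @ \oo --> 0.
Proof.
move=> u0; elim: r => [|i r IH].
  by under eq_fun do rewrite big_nil; exact: cvg_cst.
have h : (fun n => u i n + \sum_(j <- r) u j n) @ \oo --> 0.
  by rewrite -[X in _ --> X]addr0; exact: cvgD.
by under eq_fun do rewrite big_cons.
Qed.

Section product_probability.
Context {R : realType} {d1 d2} {T1 : measurableType d1} {T2 : measurableType d2}.
Variables (m1 : probability T1 R) (m2 : probability T2 R).

(** A name for the product measure, to carry the structure of a probability.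
    *)
Definition pp : set (T1 * T2) -> \bar R := (m1 \x m2)%E.

HB.instance Definition _ := Measure.on pp.

Lemma pp_setT : pp setT = 1%E.
Proof.
have := product_measure1E m1 m2 (@measurableT _ T1) (@measurableT _ T2).
rewrite setXTT -/pp => ->.
have e1 : m1 setT = 1%E := probability_setT m1.
have e2 : m2 setT = 1%E := probability_setT m2.
exact: (etrans (f_equal2 (fun a b => a * b)%E e1 e2) (mule1 1%E)).
Qed.

HB.instance Definition _ := Measure_isProbability.Build _ _ _ pp pp_setT.

Lemma EX_pp F : bm F -> EX pp F = EX m1 (fun x => EX m2 (fun y => F (x, y))).
Proof.
move=> bF; apply: EFin_inj; rewrite -(EXE _ bF) -(EXE _ (bm_EX m2 bF)).
under [in RHS]eq_integral => x _ do (rewrite -EXE; last exact: bm_slice1).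
rewrite /pp (@integral12_prod_meas1 _ _ _ _ _ m1 m2 (EFin \o F))//.
exact: (bm_integrable pp bF).
Qed.

Lemma ae_pp (Q : T1 * T2 -> Prop) : {ae pp, forall z, Q z} ->
  {ae m1, forall x, {ae m2, forall y, Q (x, y)}}.
Proof.
move=> [N [mN N0 QN]].
have mx := measurable_fun_xsection m2 mN.
have : {ae m1, forall x, m2 (xsection N x) = 0%E}.
  have /ae_eq_integral_abs := mx => /(_ m1 measurableT)[h _].
  have := h _; rewrite (eq_integral (fun x => (m2 \o xsection N) x)).
    by move=> /(_ N0); apply: filterS => x /= /(_ I).
  by move=> x _ /=; rewrite gee0_abs.
apply: filterS => x x0; exists (xsection N x); split => //.
  exact: measurable_xsection.
by move=> y /= nQ; rewrite /xsection /= inE; exact: QN.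
Qed.

End product_probability.

Section almost_everywhere.
Context {R : realType} {d d'} {T : measurableType d} {T' : measurableType d'}.

Lemma ae_comp (m : probability T R) (m' : probability T' R) (h : T -> T')
    (Q : T' -> Prop) : measurable_fun setT h ->
  (forall A, measurable A -> m (h @^-1` A) = m' A) ->
  {ae m', forall y, Q y} -> {ae m, forall x, Q (h x)}.
Proof.
move=> mh hm [N [mN N0 QN]]; exists (h @^-1` N); split.
- by rewrite -[X in measurable X]setTI; exact: mh.
- by rewrite hm.
- by move=> x /= nQ; exact: QN.
Qed.

Lemma ae_witness (m : probability T R) (Q : T -> Prop) :
  {ae m, forall x, Q x} -> exists x, Q x.
Proof.
move=> [N [mN N0 QN]]; apply: contrapT => /forallNP nQ.
have NT : N = setT by apply/seteqP; split => // x _; exact/QN/nQ.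
by move: N0; rewrite NT probability_setT => /eqP; rewrite onee_eq0.
Qed.

End almost_everywhere.

(** * The space of bilateral words *)

Section word_space.
Context {R : realType} (mu : fsprob R).
Implicit Types (w v : Sigma mu) (n m : int) (e : bool).

Lemma letters_exist : exists s : seq (letter mu), forall a, a \in s.
Proof.
have [A /finite_seqP[s ->] s1] := fsprob_fin mu.
pose s' := pmap (insub : diff2 R -> option {f | f \in supp mu}) s.
exists s' => a; rewrite mem_pmap_sub.
apply/negPn/negP => nas; have /= := svalP a; rewrite inE /supp /=.
rewrite ltNge => /negP; apply.
have c0 : mu (~` [set` s]) = 0%E by rewrite probability_setC// s1 subee.
rewrite -[X in (_ <= X)%E]c0; apply: le_measure; rewrite ?inE// => f /= ->; exact/negP.
Qed.

Definition letters : seq (letter mu) := undup (sval (cid letters_exist)).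

Lemma mem_letters a : a \in letters.
Proof. by rewrite mem_undup; exact: (svalP (cid letters_exist)). Qed.

Lemma measurable_letter n (B : set (letter mu)) :
  measurable [set w : Sigma mu | B (w n)].
Proof. by apply: sub_sigma_algebra; exists n, B. Qed.

Lemma measurable_Sigma d (T : measurableType d) (h : T -> Sigma mu) :
  (forall n B, measurable [set t | B (h t n)]) -> measurable_fun setT h.
Proof.
move=> mh; apply: measurability; first by [].
by move=> _ [_ [n [B ->]] <-]; rewrite setTI; exact: mh.
Qed.

(** Finitely many letters: a map obtained by selecting one measurable map per
    letter is measurable. *)
Lemma measurable_select d d' (T : measurableType d) (T' : measurableType d')
    (u : T -> letter mu) (g : letter mu -> T -> T') :
  (forall a, measurable [set t | u t = a]) ->
  (forall a, measurable_fun setT (g a)) ->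
  measurable_fun setT (fun t => g (u t) t).
Proof.
move=> mu' mg _ Y mY; rewrite setTI.
rewrite (_ : _ @^-1` _ =
    \big[setU/set0]_(a <- letters) ([set t | u t = a] `&` g a @^-1` Y)).
  apply: bigsetU_measurable => a _; apply: measurableI => //.
  by rewrite -[X in measurable X]setTI; exact: mg.
apply/seteqP; split => t /=; rewrite -bigcup_seq.
  by move=> Yt; exists (u t) => //=; exact: mem_letters.
by move=> [a _ [<-]].
Qed.

Lemma measurable_sigma n : measurable_fun setT (@sigma R mu n).
Proof. by apply: measurable_Sigma => k B; exact: measurable_letter. Qed.

Lemma sigma0 w : sigma 0 w = w.
Proof. by apply/funext => k; rewrite /sigma addr0. Qed.

Lemma sigmaD m n w : sigma (m + n) w = sigma m (sigma n w).
Proof. by apply/funext => k; rewrite /sigma addrA addrAC. Qed.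

Lemma fpow_succ w n : fpow w (n + 1) = (step w n * fpow w n)%g.
Proof.
case: n => [k|[|k]]; first by rewrite -PoszD addn1.
  by rewrite -[Negz 0 + 1]/(0 : int) /= mulg1 mulgV.
rewrite (_ : Negz k.+1 + 1 = Negz k); last by lia.
by rewrite [in RHS]/fpow [bwd w k.+2]/= -NegzE mulVKg.
Qed.

Lemma fpowD w m n : fpow w (m + n) = (fpow (sigma n w) m * fpow w n)%g.
Proof.
have ind k : fpow w (k + n) = (fpow (sigma n w) k * fpow w n)%g <->
    fpow w (k + 1 + n) = (fpow (sigma n w) (k + 1) * fpow w n)%g.
  have -> : k + 1 + n = (k + n) + 1 by rewrite addrAC.
  rewrite !fpow_succ -mulgA; split => [->//|]; exact: mulgI.
elim/int_rect: m => [|m IH|m IH]; first by rewrite add0r mul1g.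
  by rewrite -addn1 PoszD; apply/(ind m%:Z).
apply/(ind (- m.+1%:Z)); rewrite (_ : - m.+1%:Z + 1 = - m%:Z)//; lia.
Qed.

(** The time reversal symmetry exchanges the two halves of the problem: [e]
    is the direction of time. *)
Definition ez e n : int := if e then n else - n.
Definition flow e n w : Sigma mu := sigma (ez e n) w.
Definition act e n w : diff2 R := fpow w (ez e n).

Lemma ezD e m n : ez e (m + n) = ez e m + ez e n.
Proof. by case: e; rewrite /ez ?opprD. Qed.

Lemma ezNN e n : ez (~~ e) n = ez e (- n). Proof. by case: e; rewrite /ez /= ?opprK. Qed.

Lemma flow0 e w : flow e 0 w = w.
Proof. by case: e; rewrite /flow /ez ?oppr0 sigma0. Qed.

Lemma flowD e m n w : flow e (m + n) w = flow e m (flow e n w).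
Proof. by rewrite /flow ezD sigmaD. Qed.

Lemma flowK e n w : flow e (- n) (flow e n w) = w.
Proof. by rewrite -flowD addNr flow0. Qed.

Lemma flowVK e n w : flow e n (flow e (- n) w) = w.
Proof. by rewrite -flowD subrr flow0. Qed.

Lemma flowN e n w : flow (~~ e) n w = flow e (- n) w.
Proof. by rewrite /flow ezNN. Qed.

Lemma act0 e w : act e 0 w = 1%g.
Proof. by case: e. Qed.

Lemma actD e m n w : act e (m + n) w = (act e m (flow e n w) * act e n w)%g.
Proof. by rewrite /act ezD fpowD. Qed.

Lemma actN e n w : act (~~ e) n w = act e (- n) w.
Proof. by rewrite /act ezNN. Qed.

Lemma actV e n w : act e (- n) (flow e n w) = (act e n w)^-1%g.
Proof.
have := actD e (- n) n w; rewrite addNr act0 => h.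
by apply: (mulIg (act e n w)); rewrite -h mulVg.
Qed.

Lemma measurable_flow e n : measurable_fun setT (flow e n).
Proof. exact: measurable_sigma. Qed.

(** The coordinate read at time zero, and its action. *)
Definition tcoord e : int := if e then 0 else -1.
Definition lact e (a : letter mu) : diff2 R := if e then val a else (val a)^-1%g.

Lemma act1 e w : act e 1 w = lact e (w (tcoord e)).
Proof. by case: e; rewrite /act /ez /= mulg1. Qed.

Lemma actS e (k : nat) w : act e k.+1 w = (lact e (flow e k w (tcoord e)) * act e k w)%g.
Proof. by rewrite -[k.+1]add1n PoszD actD act1. Qed.

Lemma measurable_coord d' (T' : measurableType d') e (h : diff2 R -> circle R -> T') :
  (forall f, measurable_fun setT (h f)) ->
  measurable_fun setT (fun z : Sigma mu * circle R => h (act e 1 z.1) z.2).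
Proof.
move=> mh; under eq_fun do rewrite act1.
apply: (measurable_select (u := fun z : Sigma mu * circle R => z.1 (tcoord e))
  (g := fun a z => h (lact e a) z.2)) => a.
  exact: (mpre measurable_fst (measurable_letter (tcoord e) [set a])).
exact: (measurableT_comp (mh _) measurable_snd).
Qed.

(** The skew product and its inverse, in the time direction [e]. *)
Definition skewe e (z : Sigma mu * circle R) := (flow e 1 z.1, act e 1 z.1 z.2).

Lemma measurable_skewe e : measurable_fun setT (skewe e).
Proof.
apply: measurable_fun_pair.
  exact: (measurableT_comp (measurable_flow e 1) measurable_fst).
apply: (@measurable_coord _ (circle R) e (fun f => diff2_fun f)) => f; exact: diff2_measurable.
Qed.

Lemma skewe_iter e (n : nat) z : iter n (skewe e) z = (flow e n z.1, act e n z.1 z.2).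
Proof.
elim: n => [|n IH] /=; first by rewrite flow0 act0; case: z.
by rewrite IH /skewe /= -flowD -[n.+1]add1n PoszD (actD e 1 n).
Qed.

Lemma skewe_can e : cancel (skewe e) (skewe (~~ e)).
Proof.
by move=> [w x]; rewrite /skewe /= !flowN !actN flowK actV diff2K.
Qed.

Lemma measurable_iter d (T : measurableType d) (h : T -> T) (n : nat) :
  measurable_fun setT h -> measurable_fun setT (iter n h).
Proof.
by move=> mh; elim: n => [|n IH]; [exact: measurable_id|exact: measurableT_comp].
Qed.

Lemma measurable_act e (n : nat) d (T : measurableType d) (u : T -> Sigma mu)
    (v : T -> circle R) : measurable_fun setT u -> measurable_fun setT v ->
  measurable_fun setT (fun t => act e n (u t) (v t)).
Proof.
move=> mu' mv.
have := measurable_iter n (measurable_skewe e) => /(measurableT_comp measurable_snd).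
move=> /measurableT_comp/(_ (measurable_fun_pair mu' mv)).
by apply: eq_measurable_fun => t _ /=; rewrite skewe_iter.
Qed.

(** [splice e w' w] follows [w] in the time direction [e] and [w'] in the
    other one. *)
Definition splice e (w' w : Sigma mu) : Sigma mu :=
  fun k => if (0 <= k) == e then w k else w' k.

Lemma act_splice e (n : nat) w' w : act e n (splice e w' w) = act e n w.
Proof.
elim: n => [|n IH]; first by rewrite !act0.
rewrite !actS IH; congr (lact e _ * _)%g.
rewrite /flow /sigma /splice; case: (e); rewrite /tcoord /ez /=.
  by [].
by rewrite (_ : (0 <= -1 - n%:Z) = false)//; lia.
Qed.

Lemma measurable_splice e : measurable_fun setT (fun z : Sigma mu * Sigma mu => splice e z.1 z.2).
Proof.
apply: measurable_Sigma => n B; rewrite /splice; case: eqP => _.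
  exact: (mpre measurable_snd (measurable_letter n B)).
exact: (mpre measurable_fst (measurable_letter n B)).
Qed.

Lemma past_splice w' w : past (splice true w' w) = past w'.
Proof. by apply/funext => -[k k0]; rewrite /past /splice /=; case: ifP => //; lia. Qed.

Lemma future_splice w' w : future (splice false w' w) = future w'.
Proof. by apply/funext => -[k k0]; rewrite /future /splice /= k0. Qed.

Lemma past_splice2 w' w : past (splice false w' w) = past w.
Proof. by apply/funext => -[k k0]; rewrite /past /splice /=; case: ifP => //; lia. Qed.

Lemma future_splice2 w' w : future (splice true w' w) = future w.
Proof. by apply/funext => -[k k0]; rewrite /future /splice /= k0. Qed.

Definition cyl (s : seq int) (B : int -> set (diff2 R)) : set (Sigma mu) :=
  [set w | forall n : int, n \in s -> B n (step w n)].

Lemma cyl_cons n s B : cyl (n :: s) B = [set w | B n (step w n)] `&` cyl s B.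
Proof.
apply/seteqP; split => w /=.
  by move=> h; split => [|k ks]; apply: h; rewrite inE ?eqxx// ks orbT.
by move=> [h1 h2] k; rewrite inE => /predU1P[->//|]; exact: h2.
Qed.

Lemma cyl_nil B : cyl [::] B = setT.
Proof. by apply/seteqP; split. Qed.

Lemma measurable_cyl s B : measurable (cyl s B).
Proof.
elim: s => [|n s IH]; first by rewrite cyl_nil.
rewrite cyl_cons; apply: measurableI => //.
exact: (measurable_letter n (fun a => B n (val a))).
Qed.

Section bernoulli.
Variable P : probability (Sigma mu) R.
Hypothesis bernP : is_bernoulli P.

Lemma bern_cyl (Q : probability (Sigma mu) R) s B : is_bernoulli Q -> uniq s ->
  Q (cyl s B) = (\prod_(n <- s) fine (mu (B n)))%:E.
Proof. by move=> bQ; exact: bQ. Qed.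

(** The cylinders over finite sets of coordinates are stable under
    intersection. *)
Lemma bernoulli_unique (Q : probability (Sigma mu) R) : is_bernoulli Q ->
  forall A, measurable A -> Q A = P A.
Proof.
move=> bernQ A mA.
pose G : set (set (Sigma mu)) := [set C | exists s B, uniq s /\ C = cyl s B].
have mG : measurable = <<s G>>.
  apply/seteqP; split.
    apply: smallest_sub; first exact: smallest_sigma_algebra.
    move=> _ [n [B ->]]; apply: sub_sigma_algebra.
    exists [:: n], (fun=> val @` B); split => //; apply/seteqP; split => w /=.
      by move=> Bw k; rewrite inE => /eqP->; exists (w n).
    by move=> /(_ n); rewrite inE eqxx => /(_ erefl)[a Ba /val_inj <-].
  apply: smallest_sub; first exact: sigma_algebra_measurable.
  by move=> _ [s [B [_ ->]]]; exact: measurable_cyl.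
have GI : setI_closed G.
  move=> _ _ [s [B [_ ->]]] [s' [B' [_ ->]]].
  exists (undup (s ++ s')), (fun n => (if n \in s then B n else setT) `&`
    (if n \in s' then B' n else setT)); split; first exact: undup_uniq.
  apply/seteqP; split => w /=.
    move=> [h h'] n; rewrite mem_undup mem_cat => _.
    by split; case: ifP => // ns; [exact: h|exact: h'].
  move=> h; split => n ns; have := h n; rewrite mem_undup mem_cat ns ?orbT => /(_ erefl).
    by case.
  by case.
apply: (measure_unique G (fun=> setT)) => //.
- by move=> _; exists [::], (fun=> setT); split => //; apply/seteqP; split.
- by rewrite bigcup_const//; exists 0%N.
- by move=> _ [s [B [us ->]]]; exact: etrans (bern_cyl B bernQ us) (esym (bern_cyl B bernP us)).
- by move=> _; rewrite (le_lt_trans (probability_le1 Q measurableT))// ltry.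
Qed.

Lemma sigma_pres n A : measurable A -> P (@sigma R mu n @^-1` A) = P A.
Proof.
move=> mA; have [Q QE] := push_exists P (measurable_sigma n).
rewrite -QE; apply: bernoulli_unique => // s B us; rewrite QE.
rewrite (_ : _ @^-1` _ = cyl [seq k + n | k <- s] (fun k => B (k - n))).
  rewrite bern_cyl ?map_inj_uniq//; last exact: addIr.
  by rewrite big_map; congr (_%:E); apply: eq_bigr => k _; rewrite addrK.
apply/seteqP; split => w /= h k.
  by move=> /mapP[j js ->]; rewrite addrK; exact: h.
by move=> ks; have := h (k + n) (map_f _ ks); rewrite addrK.
Qed.

Lemma flow_pres e n A : measurable A -> P (flow e n @^-1` A) = P A.
Proof. exact: sigma_pres. Qed.

(** The two halves of a Bernoulli word are independent of each other. *)
Lemma splice_pres e A : measurable A ->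
  pp P P ((fun z => splice e z.1 z.2) @^-1` A) = P A.
Proof.
move=> mA; have [Q QE] := push_exists (pp P P) (measurable_splice e).
rewrite -QE; apply: bernoulli_unique => // s B us; rewrite QE.
pose C (b : bool) : set (Sigma mu) := cyl [seq k <- s | ((0 <= k) == e) == b] B.
have mC b : measurable (C b) by exact: measurable_cyl.
rewrite (_ : _ @^-1` _ = C false `*` C true).
  rewrite [LHS](product_measure1E P P (mC false) (mC true)).
  have PC b : P (C b) = _ := bern_cyl B bernP (filter_uniq _ us).
  apply: (etrans (f_equal2 (fun a b => a * b)%E (PC false) (PC true))).
  rewrite -EFinM; congr (_%:E).
  rewrite !big_filter big_mkcond [X in _ * X = _]big_mkcond -big_split /=.
  by apply: eq_bigr => k _; case: ((0 <= k) == e); rewrite ?mul1r ?mulr1.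
apply/seteqP; split => -[w' w] /=.
  move=> h; split => k; rewrite mem_filter => /andP[/eqP kb ks];
    by have := h k ks; rewrite /step /splice kb.
move=> [h0 h1] k ks; rewrite /step /splice; case: ifP => kb.
  by apply: h1; rewrite mem_filter kb eqxx.
by apply: h0; rewrite mem_filter kb eqxx.
Qed.

Lemma pp_pres (h : Sigma mu -> Sigma mu) : measurable_fun setT h ->
  (forall A, measurable A -> P (h @^-1` A) = P A) ->
  forall A, measurable A -> pp P P ((fun z => (z.1, h z.2)) @^-1` A) = pp P P A.
Proof.
move=> mh hP A mA; rewrite /pp /product_measure1; apply: eq_integral => w _ /=.
rewrite -(hP (xsection A w)); last exact: measurable_xsection.
by congr (P _); apply/seteqP; split => v; rewrite /xsection /= !inE.
Qed.

(** A word whose remote past (in direction [e]) has been replaced by that of an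
    independent word. *)
Definition splice_past e (n : nat) (z : Sigma mu * Sigma mu) : Sigma mu :=
  flow e n (splice e z.1 (flow e (- n%:Z) z.2)).

Lemma measurable_flow2 e n :
  measurable_fun setT (fun z : Sigma mu * Sigma mu => (z.1, flow e n z.2)).
Proof.
apply: measurable_fun_pair; first exact: measurable_fst.
exact: (measurableT_comp (measurable_flow e n) measurable_snd).
Qed.

Lemma measurable_splice_past e (n : nat) : measurable_fun setT (splice_past e n).
Proof.
apply: (measurableT_comp (measurable_flow e n)).
exact: (measurableT_comp (measurable_splice e) (measurable_flow2 e _)).
Qed.

Lemma splice_past_pres e (n : nat) A : measurable A -> pp P P (splice_past e n @^-1` A) = P A.
Proof.
move=> mA; have mB : measurable (flow e n @^-1` A).
  by rewrite -[X in measurable X]setTI; exact: measurable_flow.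
have mC : measurable ((fun z => splice e z.1 z.2) @^-1` (flow e n @^-1` A)).
  by rewrite -[X in measurable X]setTI; exact: measurable_splice.
rewrite -(flow_pres e n mA) -(splice_pres e mB).
by rewrite -(pp_pres (measurable_flow e (- n%:Z)) (@flow_pres e _) mC).
Qed.

Lemma splice_past_coord e (n : nat) z k : (`|k| < n)%N -> splice_past e n z k = z.2 k.
Proof.
move=> kn; rewrite /splice_past /flow /sigma /splice; case: e; rewrite /ez /=.
  by case: ifP => [_|]; [congr (z.2 _); lia|lia].
by case: ifP => [_|]; [congr (z.2 _); lia|lia].
Qed.

(** The probability that [A] distinguishes a word from the same word with an
    independent past before the time [- n]. *)
Definition past_influence e A (n : nat) : R := EX (pp P P) (fun z => `|\1_A z.2 - \1_A (splice_past e n z)|).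

Lemma bm_snd (f : Sigma mu -> R) : bm f -> bm (fun z : Sigma mu * Sigma mu => f z.2).
Proof. by move=> bf; apply: (bm_comp bf); exact: measurable_snd. Qed.

Lemma bm_splice_past e (n : nat) (f : Sigma mu -> R) : bm f -> bm (fun z => f (splice_past e n z)).
Proof. by move=> bf; apply: (bm_comp bf); exact: measurable_splice_past. Qed.

Lemma EX_snd (f : Sigma mu -> R) : bm f -> EX (pp P P) (fun z => f z.2) = EX P f.
Proof. by move=> bf; rewrite (EX_pp P P (bm_snd bf)); exact: (EX_cst P (EX P f)). Qed.

Lemma EX_splice_past e (n : nat) (f : Sigma mu -> R) : bm f -> EX (pp P P) (fun z => f (splice_past e n z)) = EX P f.
Proof. move=> bf; apply: EX_push => //; [exact: measurable_splice_past|exact: splice_past_pres]. Qed.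

Lemma past_influence_bigcup e (A : nat -> set (Sigma mu)) : (forall j, measurable (A j)) ->
  (forall j, past_influence e (A j) @ \oo --> 0) -> past_influence e (\bigcup_j A j) @ \oo --> 0.
Proof.
move=> mA cA; set U := \bigcup_j A j.
have mU : measurable U by exact: bigcup_measurable.
pose V J := \big[setU/set0]_(j < J) A j.
have mV J : measurable (V J) by exact: bigsetU_measurable.
have bU := bm_indic mU; have bV J := bm_indic (mV J).
have dV : (fun J => EX P (fun w => \1_U w - \1_(V J) w)) @ \oo --> 0.
  rewrite -(EX_cst P 0); apply: (EX_dct (B := 1)) => //.
  - by move=> J; exact: bmB.
  - exact: bm_cst.
  - by move=> J w; rewrite !indicE; case: (_ \in _); case: (_ \in _);
      rewrite ?subrr ?subr0 ?sub0r ?normrN ?normr1 ?normr0.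
  apply: aeW => w; apply: cvg_near_cst.
  have [Uw|nUw] := pselect (U w).
    have [j _ Aj] := Uw; near=> J; rewrite /= !indicE !mem_set ?subrr//.
    rewrite /V -bigcup_mkord; exists j => //=; near: J; exact: nbhs_infty_gt.
  near=> J; rewrite /= !indicE !memNset ?subrr// => Vw; apply: nUw.
  by move: Vw; rewrite /V -bigcup_mkord => -[j _ Aj]; exists j.
have VU J w : \1_(V J) w <= \1_U w :> R.
  rewrite !indicE; have [/set_mem Vw|//] := boolP (w \in V J).
  rewrite mem_set//; move: Vw; rewrite /V -bigcup_mkord => -[j _ Aj]; exists j => //.
have le (n J : nat) : past_influence e U n <= 2 * EX P (fun w => \1_U w - \1_(V J) w) + \sum_(j < J) past_influence e (A j) n.
  have bd A' : measurable A' -> bm (fun z => `|\1_A' z.2 - \1_A' (splice_past e n z)| : R).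
    by move=> mA'; have bA' := bm_indic mA'; apply/bm_norm/bmB; [exact: bm_snd|exact: bm_splice_past].
  have bW : bm (fun w => \1_U w - \1_(V J) w : R) by exact: bmB.
  apply: (@le_trans _ _ (EX (pp P P) (fun z => ((\1_U z.2 - \1_(V J) z.2) +
      (\1_U (splice_past e n z) - \1_(V J) (splice_past e n z))) +
      \sum_(j < J) `|\1_(A j) z.2 - \1_(A j) (splice_past e n z)|))).
    apply: EX_le => [||z]; first exact: bd.
      apply: bmD; first by apply: bmD; [exact: (bm_snd bW)|exact: (bm_splice_past e n bW)].
      by apply: bm_sum => j; exact: bd.
    have h : `|\1_(V J) z.2 - \1_(V J) (splice_past e n z)| <=
        \sum_(j < J) `|\1_(A j) z.2 - \1_(A j) (splice_past e n z)| :> R.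
      rewrite /V; elim: (J) => [|K IH].
        by rewrite !big_ord0 !indicE !in_set0 subrr normr0.
      rewrite !big_ord_recr /=; apply: le_trans (lerD IH (lexx _)).
      rewrite !indicE !in_setU.
      by do 4 (case: (_ \in _)) => /=; rewrite ?subrr ?subr0 ?sub0r ?normrN ?normr1 ?normr0; lra.
    have := VU J z.2; have := VU J (splice_past e n z).
    have := ler_norm (\1_(V J) z.2 - \1_(V J) (splice_past e n z) : R).
    have := ler_norm (- (\1_(V J) z.2 - \1_(V J) (splice_past e n z)) : R); rewrite normrN.
    move: h; set S := \sum_(_ < _) _; set v := `|\1_(V J) z.2 - _|.
    move: (\1_U z.2) (\1_U (splice_past e n z)) (\1_(V J) z.2) (\1_(V J) (splice_past e n z)) S v => *.
    by rewrite ler_norml; apply/andP; split; lra.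
  rewrite EXD; last 2 first.
  - by apply: bmD; [exact: (bm_snd bW)|exact: (bm_splice_past e n bW)].
  - by apply: bm_sum => j; exact: bd.
  rewrite (EX_sum (pp P P)); last by move=> j; exact: bd.
  rewrite EXD; [|exact: (bm_snd bW)|exact: (bm_splice_past e n bW)].
  by rewrite (EX_snd bW) (EX_splice_past e n bW) mulr_natl mulr2n.
apply/cvgrPdist_le => /= eps eps0.
have : \forall J \near \oo, `|0 - EX P (fun w => \1_U w - \1_(V J) w)| <= eps / 4.
  by move/cvgrPdist_le: dV; apply; rewrite divr_gt0.
move=> [J _ /(_ J (leqnn J))] /=; rewrite sub0r normrN => hJ.
have cS : (fun n : nat => \sum_(j < J) past_influence e (A j) n) @ \oo --> (0 : R).
  exact: (cvg_sum0 (index_enum _) (u := fun j : 'I_J => past_influence e (A j))).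
have e2 : 0 < eps / 2 by rewrite divr_gt0.
have /cvgrPdist_le/(_ _ e2) := cS; apply: filterS => n /=.
rewrite !sub0r !normrN => hS.
have t0 : 0 <= past_influence e U n by apply: EX_ge0.
rewrite ger0_norm//; apply: le_trans (le n J) _.
have := ler_norm (EX P (fun w => \1_U w - \1_(V J) w)).
have := ler_norm (\sum_(j < J) past_influence e (A j) n).
move: hJ hS; move: (EX _ _) (\sum_(j < J) _) => *; lra.
Unshelve. all: by end_near. Qed.

(** The remote past of a word is asymptotically irrelevant for any event: this
    is clear for cylinders, and the events with this property form a
    sigma-algebra. *)
Lemma past_influence_cvg0 e A : measurable A -> past_influence e A @ \oo --> 0.
Proof.
move=> mA.
pose G := [set B : set (Sigma mu) | measurable B /\ (past_influence e B @ \oo --> (0 : R))].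
suff : <<s @cylinders R mu>> `<=` G by move=> /(_ A mA)[].
apply: smallest_sub; last first.
  move=> _ [k [B ->]]; split; first exact: measurable_letter.
  apply: cvg_near_cst; near=> n; rewrite /past_influence.
  rewrite -[RHS](EX_cst (pp P P) 0); congr EX; apply/funext => z.
  rewrite !indicE; have -> : (splice_past e n z \in [set w | B (w k)]) = (z.2 \in [set w | B (w k)]).
    have kn : (`|k| < n)%N by near: n; exact: nbhs_infty_gt.
    by apply/idP/idP => /set_mem h; apply/mem_set; move: h => /=; rewrite splice_past_coord.
  by rewrite subrr normr0.
split.
- split; first exact: measurable0.
  apply: cvg_near_cst; near=> n; rewrite /past_influence.
  rewrite -[RHS](EX_cst (pp P P) 0); congr EX; apply/funext => z.
  by rewrite !indicE !in_set0 subrr normr0.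
- move=> B [mB cB]; rewrite setTD; split; first exact: measurableC.
  rewrite (_ : past_influence e (~` B) = past_influence e B)//; apply/funext => n.
  congr EX; apply/funext => z; rewrite !indicE !in_setC.
  by do 2 (case: (_ \in _)) => /=; rewrite ?subrr ?subr0 ?sub0r ?normrN.
- move=> F mF; split; first by apply: bigcup_measurable => j _; case: (mF j).
  by apply: past_influence_bigcup => j; case: (mF j).
Unshelve. all: by end_near. Qed.

End bernoulli.
End word_space.

(** * Finite subsets of the circle depending measurably on a parameter *)

Section point_list.
Context {R : realType} (r : nat).
Implicit Types (Q : Sr R r) (O : set (circle R)) (k : nat).

(** The points of [Q], ordered by their representatives in [0, 1). *)
Definition pl Q : seq (circle R) :=
  sort (fun x y => rep x <= rep y) (enum_fset (fset_set (Q : set (circle R)))).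

Lemma Sr_card Q : (Q : set (circle R)) #= `I_r.
Proof. by case: Q. Qed.

Lemma Sr_finite Q : finite_set Q.
Proof. by apply/finite_setP; exists r; exact: Sr_card. Qed.

Lemma uniq_pl Q : uniq (pl Q).
Proof. by rewrite sort_uniq fset_uniq. Qed.

Lemma size_pl Q : size (pl Q) = r.
Proof. by rewrite size_sort; exact/card_fset_set/Sr_card. Qed.

Lemma mem_plP Q x : (x \in pl Q) <-> (Q : set (circle R)) x.
Proof.
rewrite mem_sort in_fset_set; last exact: Sr_finite.
by split => [/set_mem|h]//; exact/mem_set.
Qed.

Definition pts k Q : circle R := nth (cproj 0) (pl Q) k.

Lemma ptsP Q x : (Q : set (circle R)) x <-> exists2 k, (k < r)%N & x = pts k Q.
Proof.
rewrite -mem_plP; split => [xQ|[k kr ->]]; last by rewrite mem_nth ?size_pl.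
exists (index x (pl Q)); first by rewrite -(size_pl Q) index_mem.
by rewrite /pts nth_index.
Qed.

Definition cnt O Q : nat := count (fun x => x \in O) (pl Q).

Definition cntlt (t : R) Q : nat := count (fun x => rep x < t) (pl Q).

Lemma rep_pts_lt k Q (t : R) : (k < r)%N ->
  (rep (pts k Q) < t) = (k < cntlt t Q)%N.
Proof.
move=> kr; have sz := size_pl Q; rewrite /cntlt.
have so : sorted (fun x y => rep x <= rep y) (pl Q).
  by apply: sort_sorted => x y; exact: le_total.
have tr : transitive (fun x y : circle R => rep x <= rep y).
  by move=> x y z; exact: le_trans.
have sn i j : (i <= j < r)%N -> rep (nth (cproj 0) (pl Q) i) <= rep (nth (cproj 0) (pl Q) j).
  move=> /andP[ij jr]; apply: (sorted_leq_nth tr _ (cproj 0) so) => //; rewrite ?inE ?sz//.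
  exact: leq_ltn_trans ij jr.
apply/idP/idP => [h|].
  rewrite -(cat_take_drop k.+1 (pl Q)) count_cat.
  have -> : count (fun x => rep x < t) (take k.+1 (pl Q)) = k.+1.
    apply/eqP; rewrite -[X in _ == X](_ : size (take k.+1 (pl Q)) = _); last first.
      by apply: size_takel; rewrite sz.
    rewrite -all_count; apply/(all_nthP (cproj 0)) => i.
    rewrite size_take sz => ir; rewrite nth_take; last by move: ir; case: ifP; lia.
    by apply: le_lt_trans h; apply: sn; move: ir; case: ifP; lia.
  exact: leq_addr.
apply: contraTT; rewrite -leqNgt -leNgt => h.
rewrite -(cat_take_drop k (pl Q)) count_cat.
have -> : count (fun x => rep x < t) (drop k (pl Q)) = 0%N.
  apply/eqP; rewrite -leqn0 leqNgt -has_count; apply/(has_nthP (cproj 0)) => -[i].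
  rewrite size_drop sz nth_drop => ir; rewrite ltNge => /negP; apply.
  by apply: le_trans h _; apply: sn; lia.
by rewrite addn0; apply: leq_trans (count_size _ _) _; rewrite size_take sz kr.
Qed.

Lemma cdist_lt (x y : circle R) (e : R) : e <= 1 -> cdist x y < e ->
  exists b, ellb b x y < e.
Proof.
move=> e1 /inf_lt[|_ [s /= sx [t /= ty <-]]].
  by exists `|rep x - rep y|; exists (rep x); [exact: cproj_rep|exists (rep y) => //; exact: cproj_rep].
rewrite -sx -ty; have [st|st] := leP s t.
  by rewrite ltr_norml => /andP[h1 h2]; exists true; rewrite /= ellE2; lra.
by rewrite ltr_norml => /andP[h1 h2]; exists false; rewrite /= ellE2; lra.
Qed.

Lemma cdist_ge0 (x y : circle R) : 0 <= cdist x y.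
Proof.
apply: lb_le_inf => [|_ [s _ [t _ <-]]]; last exact: normr_ge0.
by exists `|rep x - rep y|; exists (rep x); [exact: cproj_rep|exists (rep y) => //; exact: cproj_rep].
Qed.

Lemma perm_pl Q (x : 'I_r -> circle R) : range x = Q ->
  perm_eq [seq x i | i <- enum 'I_r] (pl Q).
Proof.
move=> xQ; have sub y : y \in pl Q -> y \in [seq x i | i <- enum 'I_r].
  by move=> /mem_plP; rewrite -xQ => -[i _ <-]; rewrite map_f// mem_enum.
have sz : (size [seq x i | i <- enum 'I_r] <= size (pl Q))%N.
  by rewrite size_map size_enum_ord size_pl.
rewrite perm_sym; apply: uniq_perm; first exact: uniq_pl.
  exact: leq_size_uniq (uniq_pl Q) sub sz.
by move=> y; have [] := uniq_min_size (uniq_pl Q) sub sz.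
Qed.

(** The number of points in an open set is lower semicontinuous: the points
    that a nearby set matches to those in [O] are in [O] too. *)
Lemma Sr_open_cnt O k : open O -> Sr_open [set Q | (k <= cnt O Q)%N].
Proof.
move=> oO A /= kA.
have [e e0 he] : exists2 e : R, 0 < e & forall x, x \in pl A -> O x ->
    forall b y, ellb b x y < e -> O y.
  elim: (pl A) => [|x s [e e0 he]]; first by exists 1.
  have [Ox|nOx] := pselect (O x).
    have [e' e'0 he'] := open_ell_ball oO Ox.
    exists (Num.min e e'); first by rewrite lt_min e0.
    move=> z; rewrite inE => /predU1P[->|zs] Oz b y; rewrite lt_min => /andP[h1 h2].
      exact: he' h2.
    exact: (he z zs Oz b y h1).
  exists e => // z; rewrite inE => /predU1P[->//|]; exact: he.
exists (Num.min e 1); first by rewrite lt_min e0 ltr01.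
have ex (Q : Sr R r) : exists x : 'I_r -> circle R, range x = Q.
  exists (fun i => pts i Q); apply/seteqP; split => [x [i _ <-]|x /ptsP[i ir ->]].
    by apply/ptsP; exists i.
  by exists (Ordinal ir).
move=> B; rewrite /Sr_dist => /inf_lt[|s [x [y [xA yB ->]]] h].
  have [x xA] := ex A; have [y yB] := ex B.
  by exists (\sum_(i < r) cdist (x i) (y i)); exists x, y.
apply: (leq_trans kA); rewrite /cnt.
rewrite -(permP (perm_pl xA)) -(permP (perm_pl yB)) !count_map.
apply: sub_count => i /= /set_mem Oi; apply/mem_set.
have /cdist_lt : cdist (x i) (y i) < Num.min e 1.
  apply: le_lt_trans h; rewrite (bigD1 i)//= lerDl.
  by apply: sumr_ge0 => j _; exact: cdist_ge0.
move=> /(_ _)[|b]; first by rewrite ge_min lexx orbT.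
rewrite lt_min => /andP[h1 _]; apply: (he _ _ Oi b) => //.
by apply/mem_plP; rewrite -xA; exists i.
Qed.

(** A half-open arc from 0 is a decreasing intersection of open arcs, and the
    number of points of a finite set in them is eventually constant. *)
Lemma cnt_arc k Q (t : R) : 0 < t <= 1 ->
  (k < cntlt t Q)%N <->
  forall m : nat, (k < cnt (@cproj R @` `]- m.+1%:R^-1, t[) Q)%N.
Proof.
move=> /andP[t0 t1]; split => [h m|h].
  apply: leq_trans h _; apply: sub_count => x xt; apply/mem_set.
  exists (rep x); last exact: cproj_rep.
  rewrite /= in_itv /= xt andbT; have /andP[r0 _] := rep_itv x.
  by apply: lt_le_trans r0; rewrite oppr_lt0 invr_gt0.
have [m hm] : exists m : nat, forall x, x \in pl Q -> rep x < 1 - m.+1%:R^-1.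
  elim: (pl Q) => [|x s [m hm]]; first by exists 0%N.
  have d0 : 0 < 1 - rep x by rewrite subr_gt0; have /andP[] := rep_itv x.
  have [m' hm'] := exists_nat_gt (1 - rep x)^-1.
  have lt (j i : nat) : (i <= j)%N -> j.+1%:R^-1 <= i.+1%:R^-1 :> R.
    by move=> ij; rewrite lef_pV2 ?posrE// ler_nat.
  exists (maxn m m') => z; rewrite inE => /predU1P[->|/hm zm].
    have : (maxn m m').+1%:R^-1 < 1 - rep x.
      apply: le_lt_trans (lt _ m' (leq_maxr _ _)) _.
      rewrite -[X in _ < X]invrK ltf_pV2 ?posrE ?invr_gt0//.
      by apply: lt_trans hm' _; rewrite ltr_nat.
    by rewrite !ltrBrDl addrC.
  apply: lt_le_trans zm _; rewrite lerD2l lerN2.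
  exact: lt _ m (leq_maxl m m').
apply: leq_trans (h m) _; rewrite /cnt /cntlt -!size_filter; apply: uniq_leq_size.
  by rewrite filter_uniq// uniq_pl.
move=> x; rewrite !mem_filter => /andP[/set_mem[s /=]]; rewrite in_itv /= => /andP[s1 s2] sx xQ.
rewrite xQ andbT -sx rep_cproj; have [s0|s0] := leP 0 s.
  by rewrite fpart_id// s0; lra.
have := hm x xQ; rewrite -sx rep_cproj -(fpart_cproj (cproj_add1 s)) fpart_id; last first.
  have : m.+1%:R^-1 <= 1 :> R by rewrite invf_le1 ?ler1n.
  by move: (m.+1%:R^-1 : R) s1 => j *; lra.
by move: (m.+1%:R^-1 : R) s1 => j *; lra.
Qed.

(** Whether the point number [k] lies before [t] is decided by the number of
    points in [0, t), which is a limit of numbers of points in open arcs;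
    these are Borel functions of the set. *)
Lemma measurable_pts d (T : measurableType d) (Q : T -> Sr R r) k :
  (forall U, @Sr_borel R r U -> measurable [set w | U (Q w)]) ->
  measurable_fun setT (fun w => pts k (Q w)).
Proof.
move=> mQ; have [kr|rk] := ltnP k r; last first.
  rewrite (_ : (fun w => _) = cst (cproj 0)); first exact: measurable_cst.
  by apply/funext => w; rewrite /pts nth_default// size_pl.
rewrite (_ : (fun w => _) = @cproj R \o (fun w => rep (pts k (Q w)))); last first.
  by apply/funext => w /=; rewrite cproj_rep.
apply: measurableT_comp; first exact: measurable_cproj.
apply: (measurability _ (RGenInftyO.measurableE R)) => _ [_ [t ->] <-]; rewrite setTI.
rewrite (_ : _ @^-1` _ = [set w | rep (pts k (Q w)) < t]); last first.
  by apply/seteqP; split => w /=; rewrite in_itv.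
have [t0|t0] := leP t 0.
  rewrite (_ : [set w | _] = set0); first exact: measurable0.
  by apply/seteqP; split => w //=; have := rep_itv (pts k (Q w)); lra.
have [t1|t1] := leP t 1; last first.
  rewrite (_ : [set w | _] = setT); first exact: measurableT.
  by apply/seteqP; split => w //= _; have := rep_itv (pts k (Q w)); lra.
rewrite (_ : [set w | _] = \bigcap_m [set w |
    (k < cnt (@cproj R @` `]- m.+1%:R^-1, t[) (Q w))%N]).
  apply: bigcapT_measurable => m; apply: (mQ [set Q | (k < cnt _ Q)%N]).
  by apply: sub_sigma_algebra; apply: (@Sr_open_cnt _ k.+1); exact: open_arc_open.
apply/seteqP; split => w /=; rewrite rep_pts_lt//.
  by move=> h m _; apply: (proj1 (cnt_arc k (Q w) _) h m); rewrite t0.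
by move=> h; apply/(cnt_arc k (Q w) (t := t)); [rewrite t0|move=> m; exact: h].
Qed.

Definition avg (g : circle R -> R) Q : R := r%:R^-1 * \sum_(x <- pl Q) g x.

Lemma avgE g Q : avg g Q = r%:R^-1 * \sum_(k < r) g (pts k Q).
Proof. by congr (_ * _); rewrite (big_nth (cproj 0)) size_pl big_mkord. Qed.

Lemma unifE Q (B : set (circle R)) : unif Q B = (avg \1_B Q)%:E.
Proof.
rewrite /unif /counting asboolT; last by apply: finite_setIl; exact: Sr_finite.
rewrite -EFinM /avg; congr ((_ * _)%:E).
have -> : \sum_(x <- pl Q) \1_B x = (count (fun x => x \in B) (pl Q))%:R :> R.
  elim: (pl Q) => [|x s IH]; first by rewrite big_nil.
  by rewrite big_cons IH indicE natrD.
congr (_%:R); rewrite -size_filter; apply: perm_size; apply: uniq_perm.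
- exact: fset_uniq.
- by rewrite filter_uniq// uniq_pl.
move=> x; rewrite mem_filter in_fset_set; last by apply: finite_setIl; exact: Sr_finite.
rewrite in_setI andbC; congr (_ && _).
by apply/idP/idP => [/set_mem/mem_plP|/mem_plP/mem_set].
Qed.

Lemma avg_image (f : diff2 R) g Q Q' : [set f x | x in Q] = Q' ->
  avg g Q' = avg (fun x => g (f x)) Q.
Proof.
move=> fQ; rewrite /avg; congr (_ * _).
rewrite -(big_map f predT g); apply: perm_big; apply: uniq_perm; first exact: uniq_pl.
  by rewrite map_inj_uniq ?uniq_pl//; exact: diff2_injective.
move=> y; apply/idP/mapP => [/mem_plP|[x /mem_plP Qx ->]].
  by rewrite -fQ => -[x Qx <-]; exists x => //; exact/mem_plP.
by apply/mem_plP; rewrite -fQ; exists x.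
Qed.

End point_list.

Section random_points.
Context {R : realType} {d} {T : measurableType d} (r : nat).
Variables (P : probability T R) (Q : T -> Sr R r).
Hypothesis mQ : forall U, @Sr_borel R r U -> measurable [set w | U (Q w)].
Implicit Types (F G : T * circle R -> R).

Lemma bm_pts F k : bm F -> bm (fun w => F (w, pts k (Q w))).
Proof.
move=> bF; apply: (bm_comp (h := fun w => (w, pts k (Q w))) bF).
by apply: measurable_fun_pair => //; exact: measurable_pts.
Qed.

Lemma bm_avg F : bm F -> bm (fun w => avg (fun x => F (w, x)) (Q w)).
Proof.
move=> bF; under eq_fun do rewrite avgE.
by apply: bmZ; apply: bm_sum => k; exact: bm_pts.
Qed.

Lemma EX_avgD F G : bm F -> bm G -> EX P (fun w => avg (fun x => F (w, x) + G (w, x)) (Q w)) =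
  EX P (fun w => avg (fun x => F (w, x)) (Q w)) + EX P (fun w => avg (fun x => G (w, x)) (Q w)).
Proof.
move=> bF bG; rewrite -EXD; [|exact: bm_avg|exact: bm_avg].
by congr EX; apply/funext => w; rewrite /avg big_split mulrDr.
Qed.

Lemma EX_avgZ c F : bm F -> EX P (fun w => avg (fun x => c * F (w, x)) (Q w)) =
  c * EX P (fun w => avg (fun x => F (w, x)) (Q w)).
Proof.
move=> bF; rewrite -EXZ; last exact: bm_avg.
by congr EX; apply/funext => w; rewrite /avg -mulr_sumr mulrCA.
Qed.

Lemma avg_norm_le F (B : R) w : (0 < r)%N -> (forall z, `|F z| <= B) ->
  `|avg (fun x => F (w, x)) (Q w)| <= B.
Proof.
move=> r0 FB; have rr : 0 < r%:R :> R by rewrite ltr0n.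
have ri : 0 <= r%:R^-1 :> R by rewrite invr_ge0 ltW.
rewrite /avg normrM (ger0_norm ri) ler_pdivrMl//.
rewrite -[r in r%:R](size_pl (Q w)); elim: (pl _) => [|x s IH].
  by rewrite big_nil normr0 mul0r.
rewrite big_cons -[size _]/(size s).+1 -natr1 mulrDl mul1r addrC.
by apply: le_trans (ler_normD _ _) _; rewrite lerD.
Qed.

Section measure_on_points.
Variable m : probability (T * circle R)%type R.
Hypothesis mE : meas_eq m (fun C => \int[P]_w unif (Q w) (xsection C w))%E.
Hypothesis r0 : (0 < r)%N.

(** Both sides are bounded linear functionals that agree on indicators. *)
Lemma EX_points F : bm F -> EX m F = EX P (fun w => avg (fun x => F (w, x)) (Q w)).
Proof.
pose L F := EX m F - EX P (fun w => avg (fun x => F (w, x)) (Q w)).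
move=> bF; apply/eqP; rewrite -subr_eq0; apply/eqP.
apply: (@bm_functional_ext _ _ _ L (1 + 1)) bF.
- move=> f g bf bg; rewrite /L (EXD m bf bg) (EX_avgD bf bg); ring.
- by move=> c f bf; rewrite /L (EXZ m c bf) (EX_avgZ c bf) mulrBr.
- move=> f bf f1; apply: le_trans (ler_normB _ _) _; apply: lerD.
    exact: EX_norm_le.
  by apply: EX_norm_le => [|w]; [exact: bm_avg|exact: avg_norm_le].
move=> A mA; have bA : bm (\1_A : T * circle R -> R) by exact: bm_indic.
apply/eqP; rewrite subr_eq0; apply/eqP/EFin_inj; rewrite EX_indic// mE// -EXE; last exact: bm_avg.
apply: eq_integral => w _; rewrite unifE; congr (_%:E); rewrite /avg; congr (_ * _).
apply: eq_bigr => x _; rewrite !indicE; congr (_%:R); congr nat_of_bool.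
by apply/idP/idP => [/set_mem|/set_mem h]; [rewrite /xsection /= => ?|rewrite /xsection; apply/mem_set => /=; exact/mem_set].
Qed.

(** Each of the [r] points has mass 1 / r in its fibre. *)
Lemma ae_points (Z : T * circle R -> Prop) : {ae m, forall z, Z z} ->
  {ae P, forall w, forall x, (Q w : set (circle R)) x -> Z (w, x)}.
Proof.
move=> [N [mN N0 ZN]]; have bN : bm (\1_N : T * circle R -> R) by exact: bm_indic.
have z : {ae P, forall w, avg (fun x => \1_N (w, x)) (Q w) = 0}.
  apply: EX_eq0; first exact: (bm_avg bN).
    by move=> w; rewrite /avg mulr_ge0 ?invr_ge0// sumr_ge0// => x _; rewrite indicE.
  by rewrite -EX_points//; apply: EFin_inj; rewrite EX_indic.
apply: filterS z => w /eqP; rewrite /avg mulf_eq0 invr_eq0 pnatr_eq0 gtn_eqF//= => s0 x Qx.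
apply: contrapT => nZ; have Nx : N (w, x) by exact: ZN.
have xQ : x \in pl (Q w) by apply/mem_plP.
move: s0; rewrite psumr_eq0; last by move=> y _; rewrite indicE.
by move=> /allP/(_ x xQ)/=; rewrite indicE mem_set//= oner_eq0.
Qed.

End measure_on_points.

Lemma EX_marginal (nu : probability (circle R) R) g : (0 < r)%N ->
  meas_eq nu (fun A => \int[P]_w unif (Q w) A)%E -> bm g ->
  EX nu g = EX P (fun w => avg g (Q w)).
Proof.
move=> r0 nuE; pose L g := EX nu g - EX P (fun w => avg g (Q w)).
have lift (f : circle R -> R) : bm f -> bm (fun z : T * circle R => f z.2).
  by move=> bf; apply: (bm_comp bf); exact: measurable_snd.
have ba f (bf : bm f) := bm_avg (lift f bf).
move=> bg; apply/eqP; rewrite -subr_eq0; apply/eqP.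
apply: (@bm_functional_ext _ _ _ L (1 + 1)) bg.
- move=> f h bf bh; rewrite /L (EXD nu bf bh) (EX_avgD (lift f bf) (lift h bh)); ring.
- by move=> c f bf; rewrite /L (EXZ nu c bf) (EX_avgZ c (lift f bf)) mulrBr.
- move=> f bf f1; apply: le_trans (ler_normB _ _) _; apply: lerD.
    exact: EX_norm_le.
  apply: EX_norm_le => [|w]; first exact: (ba f).
  by apply: (avg_norm_le w (F := fun z : T * circle R => f z.2)).
move=> A mA; have bA : bm (\1_A : circle R -> R) by exact: bm_indic.
apply/eqP; rewrite subr_eq0; apply/eqP/EFin_inj; rewrite EX_indic// nuE// -EXE; last exact: (ba _ bA).
by apply: eq_integral => w _; rewrite unifE.
Qed.

End random_points.

(** * Exponents of the random walk *)

Section finite_letters.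
Context {R : realType} (mu : fsprob R).

Lemma letter_uniform (B : letter mu -> R) : exists C, forall a, B a <= C.
Proof.
exists (\sum_(a <- letters mu) `|B a|) => a; apply: le_trans (ler_norm _) _.
rewrite (big_rem a (mem_letters a))/= lerDl; exact: sumr_ge0.
Qed.

Lemma lncderiv_letters e : exists2 B, 0 <= B &
  forall (a : letter mu) x, `|ln (cderiv (lact e a) x)| <= B.
Proof.
have /choice[B hB] : forall a : letter mu, exists B, forall x, `|ln (cderiv (lact e a) x)| <= B.
  by move=> a; exact: lncderiv_bounded.
have [C hC] := letter_uniform B; exists C => [|a x]; last exact: le_trans (hB a x) _.
have [a _] := supp_neq0 mu.
by apply: le_trans (hC point); apply: le_trans (hB _ (cproj 0)).
Qed.

Lemma lncderiv_letters_lip e : exists2 K, 0 <= K &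
  forall (a : letter mu) b x y,
    `|ln (cderiv (lact e a) y) - ln (cderiv (lact e a) x)| <= K * ellb b x y.
Proof.
have /choice[K hK] : forall a : letter mu, exists K, 0 <= K /\ forall b x y,
    `|ln (cderiv (lact e a) y) - ln (cderiv (lact e a) x)| <= K * ellb b x y.
  by move=> a; have [K K0 h] := lncderiv_lip (lact e a); exists K.
have [C hC] := letter_uniform K; exists C => [|a b x y].
  by apply: le_trans (hC point); have [] := hK point.
have [_ h] := hK a; apply: le_trans (h b x y) _.
by rewrite ler_wpM2r// ellb_ge0.
Qed.

(** The law of the walk in the time direction [e]. *)
Definition step_law e : set (diff2 R) -> \bar R := if e then (mu : set _ -> _) else mu_minus mu.

Definition idx (a : letter mu) : seq_sub (letters mu) := SeqSub (mem_letters a).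

Variable P : probability (Sigma mu) R.
Hypothesis bernP : is_bernoulli P.
Variable e : bool.

Definition letter_map (i : seq_sub (letters mu)) : diff2 R := lact e (val i).
Definition letter_prob (i : seq_sub (letters mu)) : R := fine (mu [set val (val i)]).

Lemma P_letter (n : int) (B : set (diff2 R)) : P [set w | B (step w n)] = mu B.
Proof.
have := bernP (s := [:: n]) (fun=> B) erefl; rewrite big_seq1 fineK; last exact: fin_num_measure.
move=> <-; congr (P _); apply/seteqP; split => w /=.
  by move=> Bw k; rewrite inE => /eqP->.
by move=> /(_ n); rewrite inE eqxx; exact.
Qed.

Lemma EX_letter n (G : letter mu -> R) :
  EX P (fun w => G (w n)) = \sum_i letter_prob i * G (val i).
Proof.
have mA i : measurable [set w : Sigma mu | w n = val i] := measurable_letter n [set val i].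
transitivity (EX P (fun w => \sum_(i : seq_sub (letters mu)) G (val i) * \1_[set w : Sigma mu | w n = val i] w)).
  congr EX; apply/funext => w; rewrite (bigD1 (idx (w n)))//= indicE mem_set//= mulr1.
  rewrite big1 ?addr0// => i ni; rewrite indicE memNset ?mulr0//= => ei.
  by move: ni; rewrite -(inj_eq val_inj) /= ei eqxx.
rewrite EX_sum; last by move=> i; apply: bmZ; exact: bm_indic.
apply: eq_bigr => i _; rewrite EXZ; last exact: bm_indic.
rewrite mulrC; congr (_ * _); apply: EFin_inj; rewrite EX_indic//.
rewrite /letter_prob fineK; last exact: fin_num_measure.
rewrite -(P_letter n); congr (P _); apply/seteqP; split => w /=; first by rewrite /step => ->.
by rewrite /step => /val_inj.
Qed.

Lemma letter_prob_gt0 i : 0 < letter_prob i.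
Proof.
have /set_mem h := svalP (val i); apply: fine_gt0; move: h; rewrite /supp /= => h.
by rewrite h /= (le_lt_trans (probability_le1 mu _)) ?ltry.
Qed.

Lemma letter_prob_sum : \sum_i letter_prob i = 1.
Proof.
rewrite -(EX_cst P 1) (EX_letter 0 (fun=> 1)); apply: eq_bigr => i _; by rewrite mulr1.
Qed.

Lemma step_lawE : step_law e = pushforward P (fun w => act e 1 w : diff2 R).
Proof.
apply/funext => B; rewrite /pushforward /step_law.
transitivity (mu [set f : diff2 R | B (if e then f else f^-1%g)]); first by case: e.
rewrite -(P_letter (tcoord e)); congr (P _); apply/seteqP.
by split => w /=; rewrite act1 /lact /step; case: e.
Qed.

Lemma measurable_act1 : measurable_fun setT (fun w : Sigma mu => act e 1 w : diff2 R).
Proof.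
move=> _ Y _; rewrite setTI (_ : _ @^-1` _ = [set w | Y (lact e (w (tcoord e)))]).
  exact: (measurable_letter (tcoord e) (fun a => Y (lact e a))).
by apply/seteqP; split => w /=; rewrite act1.
Qed.

Lemma EX_stationary (nu : probability (circle R) R) u : stationary (step_law e) nu ->
  bm u -> EX nu u = EX P (fun w => EX nu (fun x => u (act e 1 w x))).
Proof.
move=> snu bu.
have mh : measurable_fun setT (fun z : Sigma mu * circle R => act e 1 z.1 z.2).
  by apply: (@measurable_coord _ _ _ (circle R) e (fun f => diff2_fun f)) => f; exact: diff2_measurable.
rewrite -(EX_pp P nu (F := fun z => u (act e 1 z.1 z.2))); last exact: (bm_comp bu mh).
rewrite (EX_push (m := pp P nu) (m' := nu) (f := u) mh)// => A mA.
rewrite snu// step_lawE ge0_integral_pushforward//.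
- rewrite preimage_setT /pp /product_measure1; apply: eq_integral => w _ /=.
  congr (nu _); rewrite /xsection; apply/seteqP.
  by split => x /= h; [exact: set_mem h|exact: mem_set].
- exact: measurable_act1.
- by move=> f fT; exact: (measure_ge0 nu).
Qed.

Lemma stationary_letters (nu : probability (circle R) R) u : stationary (step_law e) nu ->
  bm u -> EX nu u = \sum_i letter_prob i * EX nu (fun x => u (letter_map i x)).
Proof.
move=> snu bu; rewrite (EX_stationary snu bu).
under eq_fun do rewrite act1.
exact: (EX_letter (tcoord e) (fun a => EX nu (fun x => u (lact e a x)))).
Qed.

Fixpoint word (n : nat) (w : Sigma mu) : seq (seq_sub (letters mu)) :=
  if n is k.+1 then idx (flow e k w (tcoord e)) :: word k w else [::].

Lemma ev_word n w : ev letter_map (word n w) = act e n w.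
Proof. by elim: n => [|n IH] /=; rewrite ?act0// actS IH. Qed.

Lemma bm_word n (F : seq (seq_sub (letters mu)) -> R) : bm (fun w => F (word n w)).
Proof.
elim: n F => [|n IH] F; first exact: (@bm_cst _ _ (Sigma mu) (F [::])).
split.
  apply: (measurable_select (u := fun w : Sigma mu => flow e n w (tcoord e))
    (g := fun a w => F (idx a :: word n w))) => a.
    exact: (measurable_letter _ [set a]).
  by have [] := IH (fun v => F (idx a :: v)).
have /choice[B hB] : forall a, exists B, forall w, `|F (idx a :: word n w)| <= B.
  by move=> a; have [_ [B ?]] := IH (fun v => F (idx a :: v)); exists B.
have [C hC] := letter_uniform B; exists C => w; exact: le_trans (hB _ _) (hC _).
Qed.

Lemma word_flow (n : nat) w' w :
  word n (flow e (- n%:Z) (splice e w' w)) = word n (flow e (- n%:Z) w').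
Proof.
have h k : (k <= n)%N ->
    word k (flow e (- n%:Z) (splice e w' w)) = word k (flow e (- n%:Z) w').
  elim: k => [//|k IH] kn /=; rewrite IH 1?ltnW//; congr (idx _ :: _).
  rewrite -!flowD /flow /sigma /splice; case: (e); rewrite /tcoord /ez /=.
    by rewrite (_ : (0 <= 0 + (k%:Z - n%:Z)) = false)//; lia.
  by rewrite (_ : (0 <= -1 - (k%:Z - n%:Z)) = true)//; lia.
exact: h.
Qed.

(** Words of the walk are random words with independent letters: [splice]
    makes the last letter independent of the others. *)
Lemma EX_word n (F : seq (seq_sub (letters mu)) -> R) :
  Ew letter_prob n F = EX P (fun w => F (word n w)).
Proof.
elim: n F => [|n IH] F /=; first by rewrite (EX_cst P (F [::])).
rewrite IH; have bH := bm_word n.+1 F.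
have bH' : bm (fun v => F (word n.+1 (flow e (- n%:Z) v))).
  by apply: (bm_comp bH); exact: measurable_flow.
rewrite -(EX_push (m := P) (m' := P) (h := flow e (- n%:Z)) (measurable_flow e _) (flow_pres bernP e _) bH).
rewrite -(EX_push (m := pp P P) (m' := P) (measurable_splice e) (splice_pres bernP e) bH').
rewrite EX_pp; last by apply: (bm_comp bH'); exact: measurable_splice.
rewrite -(EX_push (m := P) (m' := P) (h := flow e (- n%:Z)) (measurable_flow e _) (flow_pres bernP e _)
  (bm_word n (fun w => \sum_i letter_prob i * F (i :: w)))).
congr EX; apply/funext => w' /=.
transitivity (\sum_i letter_prob i * (fun a => F (idx a :: word n (flow e (- n%:Z) w'))) (val i)).
  by apply: eq_bigr => i _; congr (_ * F (_ :: _)); exact: val_inj.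
rewrite -(EX_letter (tcoord e) (fun a => F (idx a :: word n (flow e (- n%:Z) w')))).
congr EX; apply/funext => w; rewrite word_flow flowVK; congr (F (idx _ :: _)).
by rewrite /splice /tcoord; case: (e).
Qed.

End finite_letters.

Section one_family.
Context {R : realType} (mu : fsprob R) (P : probability (Sigma mu) R).
Hypothesis bernP : is_bernoulli P.
Variables (r : nat) (Q : Sigma mu -> Sr R r).
Variables (m : probability (Sigma mu * circle R)%type R).
Hypothesis r0 : (0 < r)%N.
Hypothesis mQ : forall U, @Sr_borel R r U -> measurable [set w | U (Q w)].
Hypothesis mE : meas_eq m (fun C => \int[P]_w unif (Q w) (xsection C w))%E.
Hypothesis minv : skew_invariant m.
Hypothesis merg : skew_ergodic m.
Implicit Types (e : bool) (z : Sigma mu * circle R).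

Definition phi e z : R := ln (cderiv (act e 1 z.1) z.2).

(** The Lyapunov exponent, in natural logarithms, of the walk in the time
    direction [e]. *)
Definition lam e : R := EX m (phi e).

Lemma phiE e w x : phi e (w, x) = ln (cderiv (lact e (w (tcoord e))) x).
Proof. by rewrite /phi act1. Qed.

Lemma bm_phi e : bm (phi e).
Proof.
split.
  have mh (f : diff2 R) : measurable_fun setT (fun x => ln (cderiv f x)).
    by have [] := bm_lncderiv f.
  have := @measurable_coord _ mu _ _ e (fun f x => ln (cderiv f x)) mh.
  exact.
by have [B _ hB] := lncderiv_letters mu e; exists B => z; rewrite /phi act1.
Qed.

Lemma bsum_phi e n z : bsum (skewe e) (phi e) n z = ln (cderiv (act e n z.1) z.2).
Proof.
elim: n z => [|n IH] z; first by rewrite /bsum big_ord0 act0 cderiv1 ln1.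
rewrite bsumS IH -addn1 PoszD actD cderivM lnM; [|exact: cderiv_gt0|exact: cderiv_gt0].
by rewrite addrC.
Qed.

Lemma m_skewe e A : measurable A -> m (skewe e @^-1` A) = m A.
Proof.
case: e => mA; first exact: minv.
have mB : measurable (skewe false @^-1` A) by exact: mpre (measurable_skewe _) mA.
rewrite -(minv mB) /pushforward; congr (m _); apply/seteqP.
by split => z /=; have := skewe_can true z => /= ->.
Qed.

Lemma m_skewe_erg e A : measurable A -> skewe e @^-1` A = A -> m A = 0%E \/ m A = 1%E.
Proof.
case: e => mA h; first exact: merg.
apply: merg => //; rewrite -[LHS]/(skewe true @^-1` A) -{1}h.
by apply/seteqP; split => z /=; have := skewe_can true z => /= ->.
Qed.

Lemma lamN e : lam (~~ e) = - lam e.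
Proof.
rewrite /lam -(EX_push (measurable_skewe e) (m_skewe e) (bm_phi (~~ e))).
rewrite -EXN; last exact: bm_phi.
congr EX; apply/funext => z; rewrite /phi /= actN actV cderivV lnV ?posrE//.
exact: cderiv_gt0.
Qed.

Lemma lyap_birkhoff e : {ae P, forall w, forall x, (Q w : set (circle R)) x ->
  (fun n : nat => n%:R^-1 * ln (cderiv (act e n w) x)) @ \oo --> lam e}.
Proof.
have B := birkhoff (measurable_skewe e) (m_skewe e) (m_skewe_erg (e := e)) (bm_phi e).
have := ae_points mQ mE r0 B; apply: filterS => w h x Qx.
by have := h x Qx; under eq_fun do rewrite bsum_phi.
Qed.

Variable e : bool.
Hypothesis Qpast : {ae pp P P, forall z : Sigma mu * Sigma mu,
  (Q (splice e z.1 z.2) : set (circle R)) = Q z.1}.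
Variable nu : probability (circle R) R.
Hypothesis nuE : meas_eq nu (fun A => \int[P]_w unif (Q w) A)%E.
Hypothesis snu : stationary (step_law mu e) nu.

Lemma avg_ext g (A B : Sr R r) : (A : set (circle R)) = B -> avg g A = avg g B.
Proof. by move=> AB; rewrite /avg /pl AB. Qed.

(** Under [m], the point is independent of the part of the word that lies in
    the direction [e]. *)
Lemma EX_independent G : bm G -> (forall w' w x, G (splice e w' w, x) = G (w, x)) ->
  EX m G = EX P (fun w => EX nu (fun x => G (w, x))).
Proof.
move=> bG Gs; rewrite (EX_points mQ mE r0 bG).
have ba := bm_avg mQ bG.
rewrite -(EX_push (m := pp P P) (m' := P) (measurable_splice e) (splice_pres bernP e) ba).
have mQ1 U : @Sr_borel R r U -> measurable [set z : Sigma mu * Sigma mu | U (Q z.1)].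
  by move=> /mQ; exact: (mpre measurable_fst).
have bG1 : bm (fun z : (Sigma mu * Sigma mu) * circle R => G (z.1.2, z.2)).
  apply: (bm_comp bG (h := fun z : (Sigma mu * Sigma mu) * circle R => (z.1.2, z.2))).
  apply: measurable_fun_pair; last exact: measurable_snd.
  exact: (measurableT_comp measurable_snd measurable_fst).
have ba1 := bm_avg mQ1 bG1.
transitivity (EX (pp P P) (fun z : Sigma mu * Sigma mu => avg (fun x => G (z.2, x)) (Q z.1))).
  apply: EX_ae; [by apply: (bm_comp ba); exact: measurable_splice|exact: ba1|].
  apply: filterS Qpast => z h; rewrite (avg_ext _ h); congr avg.
  by apply/funext => x; exact: Gs.
rewrite (EX_pp P P ba1) (EX_fubini P P ba1); congr EX; apply/funext => w.
by rewrite (EX_marginal mQ r0 nuE)//; exact: bm_slice1.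
Qed.

Lemma exponentE : exponent nu (letter_map (mu := mu) e) (letter_prob (mu := mu)) = lam e.
Proof.
rewrite /lam (EX_independent (bm_phi e)); last first.
  by move=> w' w x; rewrite /phi /= (act_splice e 1).
rewrite /exponent -(EX_letter bernP (tcoord e) (fun a => EX nu (fun x => ln (cderiv (lact e a) x)))).
apply: (congr1 (EX P)); apply/funext => w; apply: (congr1 (EX nu)).
by apply/funext => x; exact/esym/phiE.
Qed.

Lemma ln1e_bounds (s : R) : Num.max 0 s <= ln (1 + expR s) <= ln 2 + Num.max 0 s.
Proof.
have e0 := expR_gt0 s; apply/andP; split.
  rewrite ge_max; apply/andP; split; first by rewrite ln_ge0// lerDl ltW.
  by rewrite -{1}[s]expRK ler_ln ?posrE// ?lerDr// addr_gt0.
have -> : ln 2 + Num.max 0 s = ln (2 * expR (Num.max 0 s)).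
  by rewrite lnM ?posrE ?expR_gt0// expRK.
rewrite ler_ln ?posrE ?addr_gt0 ?mulr_gt0 ?expR_gt0//.
rewrite mulr_natl mulr2n; apply: lerD.
  by rewrite -expR0 ler_expR le_max lexx.
by rewrite ler_expR le_max lexx orbT.
Qed.

Definition psi (n : nat) z : R := ln (1 + cderiv (act e n z.1) z.2).

Lemma psiE n z : psi n z = ln (1 + expR (bsum (skewe e) (phi e) n z)).
Proof. by rewrite bsum_phi lnK// posrE cderiv_gt0. Qed.

Lemma bsum_bound : exists2 B, 0 <= B & forall (n : nat) z, `|bsum (skewe e) (phi e) n z| <= n%:R * B.
Proof.
have [B B0 hB] := lncderiv_letters mu e; exists B => // n z.
rewrite /bsum; apply: le_trans (ler_norm_sum _ _ _) _.
rewrite mulr_natl -[n in B *+ n](card_ord n) -sumr_const.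
by apply: ler_sum => k _; rewrite /phi act1.
Qed.

Lemma psi_bound : exists2 B, 0 <= B & forall (n : nat) z, 0 <= psi n z <= ln 2 + n%:R * B.
Proof.
have [B B0 hB] := bsum_bound; exists B => // n z.
rewrite psiE; have /andP[h1 h2] := ln1e_bounds (bsum (skewe e) (phi e) n z).
apply/andP; split; first by apply: le_trans h1; rewrite le_max lexx.
apply: le_trans h2 _; rewrite lerD2l ge_max mulr_ge0//=.
exact: le_trans (ler_norm _) (hB n z).
Qed.

Lemma bm_psi n : bm (psi n).
Proof.
split; last first.
  have [B B0 hB] := psi_bound; exists (ln 2 + n%:R * B) => z.
  by have /andP[h1 h2] := hB n z; rewrite ger0_norm.
rewrite (funext (psiE n)).
apply: measurableT_comp => //; apply: measurable_funD => //.
apply: measurableT_comp => //; rewrite /bsum.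
apply: measurable_sum => k; apply: measurableT_comp; first by have [] := bm_phi e.
exact: measurable_iter (measurable_skewe e).
Qed.

Lemma spreadE n : Ew (letter_prob (mu := mu)) n (spread nu (letter_map (mu := mu) e)) = EX m (psi n).
Proof.
rewrite (EX_word bernP e) (EX_independent (bm_psi n)).
  apply: (congr1 (EX P)); apply/funext => w.
  by rewrite /spread ev_word; apply: (congr1 (EX nu)).
by move=> w' w x; rewrite /psi /= act_splice.
Qed.

(** Since [ln (1 + expR s)] differs from [Num.max 0 s] by at most [ln 2], this
    is a consequence of the ergodic theorem. *)
Lemma spread_cvg : (fun n : nat => n%:R^-1 * EX m (psi n)) @ \oo --> Num.max 0 (lam e).
Proof.
have [B B0 hB] := psi_bound.
have l2 : 0 <= ln 2 :> R by rewrite ln_ge0// ler1n.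
under eq_fun => n do rewrite -(EXZ m _ (bm_psi n)).
rewrite -(EX_cst m (Num.max 0 (lam e))); apply: (EX_dct (B := ln 2 + B)).
- by move=> n; apply: bmZ; exact: bm_psi.
- exact: bm_cst.
- move=> n z; have /andP[h1 h2] := hB n z.
  rewrite ger0_norm ?mulr_ge0 ?invr_ge0//; case: n h1 h2 => [|n] h1 h2.
    by rewrite invr0 mul0r addr_ge0.
  rewrite ler_pdivrMl// mulrDr; apply: le_trans h2 _; rewrite lerD2r.
  by rewrite ler_peMl// ler1n.
have := birkhoff (measurable_skewe e) (m_skewe e) (m_skewe_erg (e := e)) (bm_phi e).
apply: filterS => z cz.
have cm : (fun n : nat => Num.max 0 (n%:R^-1 * bsum (skewe e) (phi e) n z)) @ \oo
    --> Num.max 0 (lam e).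
  rewrite maxr_absE; under eq_fun do rewrite maxr_absE.
  apply: cvgMl; apply: cvgD; first by apply: cvgD => //; exact: cvg_cst.
  by apply: cvg_norm; apply: cvgB => //; exact: cvg_cst.
have c0 : (fun n : nat => n%:R^-1 * ln 2 : R) @ \oo --> 0.
  rewrite -[X in _ --> X](mul0r (ln 2)); apply: cvgMl.
  apply/gtr0_cvgV0; last exact: cvgr_idn.
  by near=> n; rewrite ltr0n; near: n; exact: nbhs_infty_gt.
have c1 : (fun n : nat => n%:R^-1 * ln 2 + Num.max 0 (n%:R^-1 * bsum (skewe e) (phi e) n z))
    @ \oo --> Num.max 0 (lam e).
  by rewrite -[X in _ --> X]add0r; exact: cvgD.
apply: (squeeze_cvgr _ cm c1); near=> n; rewrite psiE.
have ni : 0 <= n%:R^-1 :> R by rewrite invr_ge0.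
have /andP[h1 h2] := ln1e_bounds (bsum (skewe e) (phi e) n z).
rewrite -[X in Num.max X](mulr0 n%:R^-1) -maxr_pMr// -mulrDr.
by rewrite !ler_wpM2l.
Unshelve. all: by end_near. Qed.

Hypothesis no_inv : ~ exists nu : probability (circle R) R, preserves (supp mu) nu.

Lemma not_invariant : exists i A, measurable A /\ nu (letter_map (mu := mu) e i @^-1` A) <> nu A.
Proof.
apply: contrapT => h; apply: no_inv; exists nu => f sf A mA; rewrite /pushforward.
have {}h i B : measurable B -> nu (letter_map (mu := mu) e i @^-1` B) = nu B.
  by move=> mB; apply: contrapT => n; apply: h; exists i, B.
have sf' : f \in supp mu by exact/mem_set.
pose a : letter mu := exist _ f sf'.
case: (e) h => h; first exact: (h (idx a)).
have mB : measurable (f @^-1` A) by exact: mpre (diff2_measurable f) mA.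
rewrite -(h (idx a) _ mB); congr (nu _); apply/seteqP.
by split => x; rewrite /letter_map /lact /= diff2VK.
Qed.

(** The point being independent of the steps to come, this is the exponent of
    a stationary measure, and [exponent_lt0] applies. *)
Theorem lam_lt0 : lam e < 0.
Proof.
rewrite -exponentE; apply: (exponent_lt0 (@letter_prob_gt0 _ mu) (letter_prob_sum bernP)).
- by move=> u bu; exact: (stationary_letters bernP snu bu).
- exact: not_invariant.
under eq_fun do rewrite spreadE.
by rewrite exponentE; exact: spread_cvg.
Qed.

End one_family.

(** * Stable sets *)

Lemma ae_of_approx {R : realType} {d} {T : measurableType d} (m : probability T R)
    (Z : T -> Prop) :
  (forall k : nat, exists M, [/\ measurable M, (m (~` M) <= (k.+1%:R^-1)%:E)%E
    & forall x, M x -> Z x]) ->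
  {ae m, forall x, Z x}.
Proof.
move=> /choice[M hM]; exists (\bigcap_k ~` M k); split.
- by apply: bigcapT_measurable => k; have [mM _ _] := hM k; exact: measurableC.
- apply/eqP; rewrite eq_le measure_ge0 andbT; apply/lee_addgt0Pr => eps eps0.
  have [k hk] := exists_nat_gt eps^-1; rewrite add0e.
  have mI : measurable (\bigcap_k ~` M k).
    by apply: bigcapT_measurable => j; have [mM _ _] := hM j; exact: measurableC.
  have [mM hm _] := hM k; apply: le_trans (_ : (m (~` M k) <= _)%E).
    by apply: le_measure; [exact: mem_set|exact/mem_set/measurableC|exact: bigcap_inf].
  apply: le_trans hm _; rewrite lee_fin.
  have k0 : 0 < k%:R :> R by apply: lt_trans hk; rewrite invr_gt0.
  rewrite -[X in _ <= X]invrK lef_pV2 ?posrE ?invr_gt0//.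
  by apply: ltW; apply: lt_trans hk _; rewrite ltr_nat.
by move=> x /= nZ k _ Mx; apply: nZ; have [_ _ h] := hM k; exact: h.
Qed.

Lemma measurable_cvg0 {R : realType} {d} {T : measurableType d} (u : nat -> T -> R) :
  (forall n, measurable_fun setT (u n)) ->
  measurable [set t | u ^~ t @ \oo --> (0 : R)].
Proof.
move=> mu'.
have -> : [set t | u ^~ t @ \oo --> (0 : R)] =
    \bigcap_k \bigcup_N \bigcap_(n in [set n | (N <= n)%N]) [set t | `|u n t| < k.+1%:R^-1].
  apply/seteqP; split => t /=.
    move=> /cvgr0Pnorm_lt h k _; have k0 : 0 < k.+1%:R^-1 :> R by rewrite invr_gt0.
    by have [N _ hN] := h _ k0; exists N => // n /=; exact: hN.
  move=> h; apply/cvgr0Pnorm_lt => eps eps0.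
  have [k hk] := exists_nat_gt eps^-1.
  have [N _ hN] := h k I; exists N => // n /= Nn; apply: lt_trans (hN n Nn) _.
  have k0 : 0 < k%:R :> R by apply: lt_trans hk; rewrite invr_gt0.
  rewrite -[X in _ < X]invrK ltf_pV2 ?posrE ?invr_gt0//.
  by apply: lt_trans hk _; rewrite ltr_nat.
apply: bigcapT_measurable => k; apply: bigcupT_measurable => N.
apply: bigcap_measurableType => n _.
rewrite (_ : [set t | _] = (fun t => `|u n t|) @^-1` `]-oo, k.+1%:R^-1[).
  by apply: mpre (measurable_itv _); exact: measurableT_comp.
by apply/seteqP; split => t; rewrite /= in_itv.
Qed.

Section stable_sets.
Context {R : realType} (mu : fsprob R).
Implicit Types (w : Sigma mu) (x y z : circle R) (b e : bool).

Definition gap e b w x y (n : nat) : R := ellb b (act e n w x) (act e n w y).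

Lemma gap_ge0 e b w x y n : 0 <= gap e b w x y n.
Proof. exact: ellb_ge0. Qed.

(** Bounded distortion: by the mean value theorem each step multiplies the gap
    by the derivative at a nearby point, and the error on the logarithm of
    this derivative is proportional to the current gap. *)
Lemma gap_growth e : exists2 K, 0 <= K & forall b w x y n,
  gap e b w x y n <= ellb b x y *
    expR (ln (cderiv (act e n w) x) + K * \sum_(j < n) gap e b w x y j).
Proof.
have [K K0 hK] := lncderiv_letters_lip mu e; exists K => // b w x y.
elim=> [|n IH]; first by rewrite big_ord0 act0 cderiv1 ln1 mulr0 addr0 expR0 mulr1 /gap act0.
set g := lact e (flow e n w (tcoord e)); set X := act e n w x; set Y := act e n w y.
have -> : gap e b w x y n.+1 = ellb b (g X) (g Y) by rewrite /gap actS.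
have [z z1 ->] := ellb_mvt b g X Y.
have c : cderiv g z <= expR (ln (cderiv g X) + K * gap e b w x y n).
  rewrite -{1}[cderiv g z]lnK ?posrE ?cderiv_gt0// ler_expR -lerBlDl.
  apply: le_trans (ler_norm _) _; apply: le_trans (hK _ b X z) _.
  by rewrite ler_wpM2l.
apply: le_trans (ler_pM _ _ c IH) _; [exact/ltW/cderiv_gt0|exact: ellb_ge0|].
rewrite actS cderivM lnM ?posrE ?cderiv_gt0// big_ord_recr /= mulrDr.
rewrite mulrCA -expRD; apply: ler_wpM2l; first exact: ellb_ge0.
by rewrite ler_expR; lra.
Qed.

(** A point whose derivatives decay exponentially has a neighbourhood that is
    contracted exponentially, whose size depends only on the constants: by
    [gap_growth] the sum of the gaps stays small as long as they decay
    geometrically, and conversely. *)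
Lemma local_contraction e (c rho : R) : 0 < c -> 0 < rho < 1 ->
  exists2 del, 0 < del & forall b w x y,
    (forall n : nat, cderiv (act e n w) x <= c * rho ^+ n) -> ellb b x y <= del ->
    forall n, gap e b w x y n <= (c * expR 1) * rho ^+ n.
Proof.
move=> c0 /andP[r0 r1]; have [K K0 hK] := gap_growth e.
pose c' := c * expR 1; have c'0 : 0 < c' by rewrite mulr_gt0 ?expR_gt0.
have r1' : 0 < 1 - rho by rewrite subr_gt0.
pose A := K * c' / (1 - rho); have A0 : 0 <= A.
  by apply: divr_ge0; [apply: mulr_ge0 => //|]; exact: ltW.
exists (A + 1)^-1; first by rewrite invr_gt0 ltr_wpDl.
move=> b w x y hc; set del := (A + 1)^-1 => hd.
have d0 : 0 < del by rewrite invr_gt0 ltr_wpDl.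
have Ad : A * del <= 1 by rewrite ler_pdivrMr ?ltr_wpDl// mul1r lerDl.
have geo n : \sum_(j < n) rho ^+ j <= (1 - rho)^-1.
  have -> : \sum_(j < n) rho ^+ j = (1 - rho ^+ n) / (1 - rho).
    apply: (mulIf (lt0r_neq0 r1')); rewrite mulfVK ?lt0r_neq0//.
    elim: n => [|n IH]; first by rewrite big_ord0 mul0r expr0 subrr.
    by rewrite big_ord_recr /= mulrDl IH exprS; ring.
  by rewrite ler_pdivrMr// mulVf ?lt0r_neq0// gerBl exprn_ge0// ltW.
(* By induction, the accumulated distortion is at most [A * del], hence at
   most 1. *)
suff H n : gap e b w x y n <= del * c' * rho ^+ n.
  move=> n; apply: le_trans (H n) _; rewrite ler_wpM2r ?exprn_ge0 ?(ltW r0)//.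
  by rewrite ler_piMl ?(ltW c'0)// invf_le1 ?ltr_wpDl// lerDr.
elim/ltn_ind: n => n IH.
apply: le_trans (hK b w x y n) _; rewrite expRD lnK ?posrE ?cderiv_gt0//.
have s1 : K * \sum_(j < n) gap e b w x y j <= 1.
  apply: le_trans Ad; apply: (@le_trans _ _ (K * \sum_(j < n) del * c' * rho ^+ j)).
    by apply: ler_wpM2l => //; apply: ler_sum => j _; exact: IH.
  rewrite -mulr_sumr; set S := \sum_(j < n) _.
  have -> : K * (del * c' * S) = (K * c' * S) * del by ring.
  apply: ler_wpM2r; first exact: ltW.
  by apply: ler_wpM2l; [apply: mulr_ge0 => //; exact: ltW|exact: geo].
have -> : del * c' * rho ^+ n = del * ((c * rho ^+ n) * expR 1) by rewrite /c'; ring.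
apply: ler_pM => //; [exact: ellb_ge0|by rewrite mulr_ge0 ?expR_ge0// ltW ?cderiv_gt0|].
by apply: ler_pM; rewrite ?expR_ge0 ?ler_expR//; exact/ltW/cderiv_gt0.
Qed.

(** The arc from [x] to [y] in the direction [b] shrinks to a point. *)
Definition asymptotic e b w x y : Prop := gap e b w x y @ \oo --> 0.

(** Once the gap is small, the distortion in [gap_growth] cannot offset more
    than a fraction of the exponential decay of the derivative. *)
Lemma exponential_contraction e b w x y (l : R) : l < 0 ->
  (fun n : nat => n%:R^-1 * ln (cderiv (act e n w) x)) @ \oo --> l ->
  asymptotic e b w x y ->
  exists C rho, 0 < rho < 1 /\ forall n, gap e b w x y n <= C * rho ^+ n.
Proof.
move=> l0 cl sxy; have [K K0 hK] := gap_growth e.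
have K1 : 0 < K + 1 by rewrite ltr_wpDl.
have e1 : 0 < (- l / 4) / (K + 1) by rewrite divr_gt0// divr_gt0// oppr_gt0.
have [N1 _ h1] : \forall n \near \oo, n%:R^-1 * ln (cderiv (act e n w) x) < l * (3 / 4).
  by apply: (cvgr_lt l) => //; lra.
have [N2 _ h2] : \forall n \near \oo, `|gap e b w x y n| < (- l / 4) / (K + 1).
  by move/cvgr0Pnorm_lt: sxy; apply.
have g1 j : gap e b w x y j <= 1 by apply: ltW; exact: ellb_lt1.
(* From the time [N2] on, each step costs at most a quarter of the exponent.
   *)
have hs n : K * \sum_(j < n) gap e b w x y j <= K * N2%:R + n%:R * (- l / 4).
  elim: n => [|n IH]; first by rewrite big_ord0 mul0r addr0 mulr0 mulr_ge0.
  rewrite big_ord_recr /= mulrDr -natr1 mulrDl mul1r.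
  have [nN|Nn] := ltnP n N2.
    have : K * \sum_(j < n) gap e b w x y j + K * gap e b w x y n <= K * (n.+1)%:R.
      rewrite -mulrDr ler_wpM2l// -natr1; apply: lerD => //.
      apply: (@le_trans _ _ (\sum_(j < n) 1)); first by apply: ler_sum.
      by rewrite sumr_const card_ord.
    have : K * (n.+1)%:R <= K * N2%:R by rewrite ler_wpM2l// ler_nat.
    have : 0 <= n%:R * (- l / 4) + - l / 4.
      have l4 : 0 <= - l / 4 by lra.
      by apply: addr_ge0 => //; exact: mulr_ge0.
    by move: (K * _) (K * _) (K * _) (K * _) (n%:R * _) => *; lra.
  rewrite addrA; apply: lerD => //.
  have := h2 n Nn; rewrite ger0_norm ?gap_ge0// => /ltW hg.
  apply: (@le_trans _ _ ((K + 1) * gap e b w x y n)).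
    by rewrite ler_wpM2r ?gap_ge0// lerDl.
  by rewrite mulrC -ler_pdivlMr.
pose rho := expR (l / 2); pose C := expR (K * N2%:R).
have rho01 : 0 < rho < 1 by rewrite expR_gt0 /= expR_lt1; lra.
have rhoE n : rho ^+ n = expR (n%:R * (l / 2)) by rewrite -expRM_natl.
have tail n : (N1 < n)%N -> gap e b w x y n <= C * rho ^+ n.
  move=> Nn; apply: le_trans (hK b w x y n) _.
  apply: (@le_trans _ _ (1 * expR (ln (cderiv (act e n w) x) +
      K * \sum_(j < n) gap e b w x y j))).
    by rewrite ler_wpM2r ?expR_ge0//; apply: ltW; exact: ellb_lt1.
  rewrite mul1r rhoE -expRD ler_expR.
  have n0 : 0 < n%:R :> R by rewrite ltr0n; lia.
  have := h1 n (ltnW Nn); rewrite /= ltr_pdivrMl// => hl.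
  have := hs n; move: hl.
  have -> : n%:R * (- l / 4) = - (n%:R * l) / 4 by ring.
  have -> : n%:R * (l * (3 / 4)) = 3 * (n%:R * l) / 4 by ring.
  have -> : n%:R * (l / 2) = (n%:R * l) / 2 by ring.
  by move: (n%:R * l) (ln _) (K * _) (K * _) => *; lra.
have r0 : 0 < rho by case/andP: rho01.
exists (C + (rho ^+ N1)^-1), rho; split => // n.
have [nN|Nn] := leqP n N1; last first.
  apply: le_trans (tail n Nn) _; rewrite ler_wpM2r ?exprn_ge0 ?(ltW r0)//.
  by rewrite lerDl invr_ge0 exprn_ge0// ltW.
apply: le_trans (g1 n) _; rewrite mulrDl.
apply: (@le_trans _ _ ((rho ^+ N1)^-1 * rho ^+ n)); last first.
  by rewrite lerDr mulr_ge0 ?expR_ge0// exprn_ge0// ltW.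
rewrite ler_pdivlMl ?exprn_gt0// mulr1; apply: ler_wiXn2l => //; first exact: ltW.
by apply: ltW; case/andP: rho01.
Qed.

Lemma asymptotic_refl e b w x : asymptotic e b w x x.
Proof.
rewrite /asymptotic (_ : gap e b w x x = cst 0); first exact: cvg_cst.
by apply/funext => n; rewrite /gap ellbxx.
Qed.

Lemma asymptotic_le e b w x y x' y' : (forall n, gap e b w x' y' n <= gap e b w x y n) ->
  asymptotic e b w x y -> asymptotic e b w x' y'.
Proof.
move=> h sxy; apply: (squeeze_cvgr _ (cvg_cst 0) sxy).
by apply: nearW => n; rewrite gap_ge0 h.
Qed.

Lemma asymptotic_down e b w x y z : ellb b x z <= ellb b x y -> asymptotic e b w x y -> asymptotic e b w x z.
Proof. by move=> h; apply: asymptotic_le => n; rewrite /gap ellb_mono_le. Qed.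

Lemma asymptotic_trans e b w x y z : asymptotic e b w x y -> asymptotic e b w y z -> asymptotic e b w x z.
Proof.
move=> h1 h2.
have h : (fun n => gap e b w x y n + gap e b w y z n) @ \oo --> 0.
  by rewrite -[X in _ --> X]addr0; exact: cvgD.
apply: (squeeze_cvgr _ (cvg_cst 0) h).
by apply: nearW => n; rewrite gap_ge0; exact: ellb_triangle.
Qed.

Lemma asymptotic_sub e b w x y z : ellb b x y <= ellb b x z -> asymptotic e b w x z -> asymptotic e b w y z.
Proof.
move=> h; apply: asymptotic_le => n; rewrite /gap.
have h' : ellb b (act e n w x) (act e n w y) <= ellb b (act e n w x) (act e n w z).
  by rewrite ellb_mono_le.
by rewrite (ellb_split h') lerDr ellb_ge0.
Qed.

(** The two arcs between distinct points have total length 1 at all times. *)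
Lemma asymptotic_antisym e b w x y : asymptotic e b w x y -> asymptotic e b w y x -> x = y.
Proof.
move=> h1 h2; apply: contrapT => xy.
have h : (fun n => gap e b w x y n + gap e b w y x n) @ \oo --> 0.
  by rewrite -[X in _ --> X]addr0; exact: cvgD.
move/cvgr0Pnorm_lt: h => /(_ 1 ltr01)[N _ /(_ N (leqnn N))] /=.
rewrite /gap (ellb_sym b (x := act e N w x)); last by move=> /diff2_injective.
by rewrite addrC subrK normr1 ltxx.
Qed.

Lemma gap_flow e b w x y (k : nat) n :
  gap e b (flow e k w) (act e k w x) (act e k w y) n = gap e b w x y (n + k)%N.
Proof. by rewrite /gap PoszD actD !diff2M. Qed.

Lemma asymptotic_flow e b w x y (k : nat) :
  asymptotic e b (flow e k w) (act e k w x) (act e k w y) <-> asymptotic e b w x y.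
Proof.
rewrite /asymptotic -(cvg_shiftn k (gap e b w x y)).
by rewrite (funext (gap_flow e b w x y k)).
Qed.

Lemma asymptotic_opp e b w x y : asymptotic e b w x y -> asymptotic e (~~ b) w y x.
Proof.
rewrite /asymptotic (_ : gap e (~~ b) w y x = gap e b w x y)//.
by apply/funext => n; rewrite /gap ellbN.
Qed.

(** The length of the maximal asymptotic arc issued from [x]; it is 1, and the
    end of the arc is [x] itself, when the arc is the whole circle. *)
Definition stable_radius e b w x : R := sup [set ellb b x y | y in asymptotic e b w x].
Definition stable_end e b w x : circle R := advb b x (stable_radius e b w x).

Lemma stable_radius_ge e b w x y : asymptotic e b w x y -> ellb b x y <= stable_radius e b w x.
Proof.
move=> h; apply: ub_le_sup; last by exists y.
by exists 1 => _ [z _ <-]; apply: ltW; exact: ellb_lt1.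
Qed.

Lemma stable_radius_le e b w x (c : R) : (forall y, asymptotic e b w x y -> ellb b x y <= c) -> stable_radius e b w x <= c.
Proof.
move=> h; apply: ge_sup; first by exists (ellb b x x), x => //; exact: asymptotic_refl.
by move=> _ [z sz <-]; exact: h.
Qed.

Lemma stable_radius_ge0 e b w x : 0 <= stable_radius e b w x.
Proof. by have := stable_radius_ge (@asymptotic_refl e b w x); rewrite ellbxx. Qed.

Lemma stable_radius_le1 e b w x : stable_radius e b w x <= 1.
Proof. by apply: stable_radius_le => y _; apply: ltW; exact: ellb_lt1. Qed.

Lemma stable_radius_lt e b w x y : ellb b x y < stable_radius e b w x -> asymptotic e b w x y.
Proof.
move=> /sup_gt[|_ [z sz <-] h]; last exact: asymptotic_down (ltW h) sz.
by exists (ellb b x x), x => //; exact: asymptotic_refl.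
Qed.

(** Concatenating asymptotic arcs never wraps around the circle, by
    [asymptotic_antisym]. *)
Lemma stable_end_same e b w x y : asymptotic e b w x y -> stable_end e b w x = stable_end e b w y.
Proof.
move=> sxy; have [->//|/eqP xy] := eqVneq x y.
suff rE : stable_radius e b w x = ellb b x y + stable_radius e b w y.
  by rewrite /stable_end rE -advb_adv advb_ell.
apply/eqP; rewrite eq_le; apply/andP; split.
  apply: stable_radius_le => z sz; have [h|h] := leP (ellb b x y) (ellb b x z).
    rewrite (ellb_split h) lerD2l; apply: stable_radius_ge; exact: asymptotic_sub h sz.
  by apply: le_trans (ltW h) _; rewrite lerDl stable_radius_ge0.
rewrite -lerBrDl; apply: stable_radius_le => z sz; rewrite lerBrDl.
have [h|h] := ltP (ellb b x y + ellb b y z) 1.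
  by rewrite -ellb_add//; apply: stable_radius_ge; exact: asymptotic_trans sz.
exfalso; apply: (xy); apply: (asymptotic_antisym sxy); apply: asymptotic_down sz.
by rewrite (ellb_sym b xy) lerBlDr addrC.
Qed.

Lemma stable_end_flow e b w x (k : nat) :
  act e k w (stable_end e b w x) = stable_end e b (flow e k w) (act e k w x).
Proof.
set f := act e k w; set w' := flow e k w.
have lt_st y : ellb b x y < stable_radius e b w x -> ellb b (f x) (f y) <= stable_radius e b w' (f x).
  by move=> /stable_radius_lt h; apply: stable_radius_ge; exact/asymptotic_flow.
have st_le' y' : asymptotic e b w' (f x) y' -> ellb b x ((f^-1%g : diff2 R) y') <= stable_radius e b w x.
  by move=> h; apply: stable_radius_ge; apply/(asymptotic_flow _ _ _ _ _ k); rewrite -/f diff2VK.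
have r0 := stable_radius_ge0 e b w x; have r1 := stable_radius_le1 e b w x.
move: r1; rewrite le_eqVlt => /predU1P[r1|r1].
  suff r1' : stable_radius e b w' (f x) = 1 by rewrite /stable_end r1 r1' !advb1.
  apply/eqP; rewrite eq_le stable_radius_le1 /= leNgt; apply/negP => h.
  pose t := (stable_radius e b w' (f x) + 1) / 2.
  have t01 : 0 <= t < 1 by have := stable_radius_ge0 e b w' (f x); rewrite /t; lra.
  have := lt_st ((f^-1%g : diff2 R) (advb b (f x) t)); rewrite diff2VK ellb_adv// r1 ellb_lt1.
  by move=> /(_ erefl); rewrite /t; lra.
pose E := stable_end e b w x; have eE : ellb b x E = stable_radius e b w x by rewrite ellb_adv// r0.
suff r' : stable_radius e b w' (f x) = ellb b (f x) (f E) by rewrite [RHS]/stable_end r' advb_ell.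
apply/eqP; rewrite eq_le; apply/andP; split.
  apply: stable_radius_le => y' /st_le'; rewrite -eE -(ellb_mono_le b f) diff2VK.
  by [].
rewrite leNgt; apply/negP => h.
pose t := (stable_radius e b w' (f x) + ellb b (f x) (f E)) / 2.
have l1 := ellb_lt1 b (f x) (f E).
have t01 : 0 <= t < 1 by have := stable_radius_ge0 e b w' (f x); rewrite /t; lra.
have := lt_st ((f^-1%g : diff2 R) (advb b (f x) t)).
rewrite -eE -(ellb_mono b f) diff2VK ellb_adv//.
have -> : t < ellb b (f x) (f E) by rewrite /t; lra.
by move=> /(_ erefl); rewrite /t; lra.
Qed.

Lemma stable_end_splice e b w' w x : stable_end e b (splice e w' w) x = stable_end e b w x.
Proof.
suff rE : stable_radius e b (splice e w' w) x = stable_radius e b w x by rewrite /stable_end rE.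
congr (sup _); apply/seteqP.
have gE y : gap e b (splice e w' w) x y = gap e b w x y.
  by apply/funext => n; rewrite /gap act_splice.
by split => _ [y sy <-]; exists y => //; move: sy; rewrite /asymptotic gE.
Qed.

Lemma measurable_gap e b n d (T : measurableType d) (u : T -> Sigma mu)
    (v v' : T -> circle R) : measurable_fun setT u -> measurable_fun setT v ->
  measurable_fun setT v' -> measurable_fun setT (fun t => gap e b (u t) (v t) (v' t) n).
Proof.
by move=> mu' mv mv'; apply: measurable_ellb; exact: measurable_act.
Qed.

(** The radius exceeds [a] when some point at a rational distance larger than
    [a] is asymptotic to [x]. *)
Lemma measurable_stable_end e b :
  measurable_fun setT (fun z : Sigma mu * circle R => stable_end e b z.1 z.2).
Proof.
apply: measurable_advb; first exact: measurable_snd.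
apply: (measurability _ (RGenOInfty.measurableE R)) => _ [_ [a ->] <-]; rewrite setTI.
rewrite (_ : _ @^-1` _ = [set z | a < stable_radius e b z.1 z.2]); last first.
  by apply/seteqP; split => z /=; rewrite in_itv /= andbT.
have [a0|a0] := ltP a 0.
  rewrite (_ : [set z : Sigma mu * circle R | _] = setT); first exact: measurableT.
  by apply/seteqP; split => z //= _; apply: lt_le_trans a0 (stable_radius_ge0 _ _ _ _).
pose B (q : rat) := [set z : Sigma mu * circle R |
  (a < (ratr q : R) < 1) /\ asymptotic e b z.1 z.2 (advb b z.2 (ratr q))].
rewrite (_ : [set z : Sigma mu * circle R | _] = \bigcup_q B q).
  apply: bigcupT_measurable_rat => q; have [h|h] := boolP (a < (ratr q : R) < 1); rewrite /B; last first.
    rewrite (_ : [set z : Sigma mu * circle R | _] = set0); first exact: measurable0.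
    by apply/seteqP; split => z //= -[h' _]; move: h; rewrite h'.
  rewrite (_ : [set z : Sigma mu * circle R | _] = [set z : Sigma mu * circle R |
      (fun n (z : Sigma mu * circle R) => gap e b z.1 z.2 (advb b z.2 (ratr q)) n) ^~ z
        @ \oo --> (0 : R)]).
    apply: measurable_cvg0 => n; apply: measurable_gap.
    - exact: measurable_fst.
    - exact: measurable_snd.
    - by apply: measurable_advb; [exact: measurable_snd|exact: measurable_cst].
  by apply/seteqP; split => z /=; [case|].
apply/seteqP; split => z /=.
  move=> /sup_gt[|_ [y sy <-] ay].
    by exists (ellb b z.2 z.2), z.2 => //; exact: asymptotic_refl.
  have [q] := rat_in_itvoo ay; rewrite in_itv /= => /andP[aq qy].
  have y1 := ellb_lt1 b z.2 y.
  exists q => //; split; first by rewrite aq (lt_trans qy).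
  apply: asymptotic_down sy; rewrite ellb_adv; first exact: ltW.
  by rewrite (le_trans a0 (ltW aq)) (lt_trans qy).
move=> [q _ [/andP[aq q1] /stable_radius_ge]]; rewrite ellb_adv; last by rewrite q1 (le_trans a0 (ltW aq)).
exact: lt_le_trans.
Qed.

End stable_sets.

(** * Synchronization and the ends of the stable arcs *)

Section mean_kernel.
Context {R : realType} {d d'} {X : measurableType d} {Y : measurableType d'}.
Variables (r : nat) (F : nat -> X -> Y).
Hypothesis r0 : (0 < r)%N.
Hypothesis mF : forall k, measurable_fun setT (F k).

Let c_ge0 : 0 <= r%:R^-1 :> R. Proof. by rewrite invr_ge0. Qed.

(** The average of the Dirac masses at [F 0 x], ..., [F r.-1 x]; the points
    may coincide. *)
Definition mkern (x : X) : {measure set Y -> \bar R} :=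
  mscale (NngNum c_ge0) (msum (fun k => \d_(F k x)) r).

Lemma mkernE x U : mkern x U = (r%:R^-1 * \sum_(k < r) \1_U (F k x))%:E.
Proof.
rewrite /mkern /= /mscale /= /msum EFinM; congr (_ * _)%E.
by rewrite -sumEFin; apply: eq_bigr => k _; rewrite indicE; exact: diracE.
Qed.

Lemma measurable_mkern U : measurable U -> measurable_fun setT (mkern ^~ U).
Proof.
move=> mU; under eq_fun do rewrite mkernE.
apply/measurable_EFinP; apply: measurable_funM => //; apply: measurable_sum => k.
apply: (measurableT_comp (f := \1_U : Y -> R)) => //.
Qed.

HB.instance Definition _ := isKernel.Build _ _ X Y R mkern measurable_mkern.

Lemma mkern_prob x : mkern x setT = 1%E.
Proof.
rewrite mkernE; under eq_bigr do rewrite indicE in_setT.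
by rewrite sumr_const card_ord mulVf// pnatr_eq0 gtn_eqF.
Qed.

HB.instance Definition _ := Kernel_isProbability.Build _ _ X Y R mkern mkern_prob.

Definition mean_kernel : R.-pker X ~> Y := mkern.

End mean_kernel.

Section synchronization.
Context {R : realType} (mu : fsprob R) (P : probability (Sigma mu) R).
Hypothesis bernP : is_bernoulli P.
Variables (r : nat) (Q : Sigma mu -> Sr R r) (e : bool) (l : R).
Hypothesis r0 : (0 < r)%N.
Hypothesis mQ : forall U, @Sr_borel R r U -> measurable [set w | U (Q w)].
Hypothesis Qpast : {ae pp P P, forall z : Sigma mu * Sigma mu,
  (Q (splice e z.1 z.2) : set (circle R)) = Q z.1}.
Hypothesis Qequiv : {ae P, forall w (n : nat),
  act e n w @` Q w = Q (flow e n w)}.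
Hypothesis l0 : l < 0.
Hypothesis lyap : {ae P, forall w, forall x, (Q w : set (circle R)) x ->
  (fun n : nat => n%:R^-1 * ln (cderiv (act e n w) x)) @ \oo --> l}.

Lemma measurable_cderiv_act (n : nat) (v : Sigma mu -> circle R) :
  measurable_fun setT v -> measurable_fun setT (fun w => cderiv (act e n w) (v w)).
Proof.
move=> mv; have -> : (fun w => cderiv (act e n w) (v w)) =
    (fun w => expR (bsum (skewe e) (@phi R mu e) n (w, v w))).
  by apply/funext => w; rewrite bsum_phi lnK// posrE cderiv_gt0.
apply: measurableT_comp => //; rewrite /bsum; apply: measurable_sum => k.
apply: (measurableT_comp (f := @phi R mu e)); first by have [] := @bm_phi R mu e.
apply: (measurableT_comp (measurable_iter _ (measurable_skewe e))).
by apply: measurable_fun_pair.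
Qed.

(** Outside a small event, the constants of the exponential decay of the
    derivatives are bounded, so that [local_contraction] provides
    neighbourhoods of a fixed size. *)
Lemma uniform_contraction (k : nat) : exists G del, [/\ measurable G,
  (P (~` G) <= (k.+1%:R^-1)%:E)%E, 0 < del &
  forall w, G w -> forall x, (Q w : set (circle R)) x ->
    forall b y, ellb b x y <= del -> asymptotic e b w x y].
Proof.
pose rho := expR (l / 2).
have rho01 : 0 < rho < 1 by rewrite expR_gt0 /= expR_lt1 pmulr_llt0 ?invr_gt0.
have rp : 0 < rho by case/andP: rho01.
have rhoE n : rho ^+ n = expR (n%:R * (l / 2)) by rewrite -expRM_natl.
pose G (c : nat) := [set w | forall j : nat, (j < r)%N -> forall n : nat,
  cderiv (act e n w) (pts j (Q w)) <= c%:R * rho ^+ n].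
have mG c : measurable (G c).
  pose H (j n : nat) := [set w | cderiv (act e n w) (pts j (Q w)) <= c%:R * rho ^+ n].
  rewrite (_ : G c = \bigcap_(j in [set j | (j < r)%N]) \bigcap_n H j n); last first.
    by apply/seteqP; split => w /= h j jr => [n _|n]; exact: h.
  apply: bigcap_measurableType => j _; apply: bigcapT_measurable => n.
  rewrite (_ : H j n = (fun w => cderiv (act e n w) (pts j (Q w)))
      @^-1` `]-oo, c%:R * rho ^+ n]).
    by apply: mpre (measurable_itv _); apply: measurable_cderiv_act; exact: measurable_pts.
  by rewrite /H; apply/seteqP; split => w; rewrite /= in_itv.
have G0 : {ae P, forall w, (fun c => \1_(~` G c) w : R) @ \oo --> cst 0 w}.
  apply: filterS lyap => w hw; apply: cvg_near_cst.
  suff [c hc] : exists c, G c w.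
    near=> c'; rewrite indicE memNset//= => n; apply: n => j jr n.
    apply: le_trans (hc j jr n) _; rewrite ler_wpM2r ?exprn_ge0 ?(ltW rp)// ler_nat.
    by near: c'; exact: nbhs_infty_ge.
  have /choice[c hc] : forall j, exists c : nat, (j < r)%N -> forall n : nat,
      cderiv (act e n w) (pts j (Q w)) <= c%:R * rho ^+ n.
    move=> j; have [jr|_] := boolP (j < r)%N; last by exists 0%N.
    have Qj : (Q w : set (circle R)) (pts j (Q w)) by apply/ptsP; exists j.
    have [N _ hN] : \forall n \near \oo, n%:R^-1 * ln (cderiv (act e n w) (pts j (Q w))) < l / 2.
      by apply: (cvgr_lt l); [exact: hw|have := l0; lra].
    pose B := \sum_(i < N.+1) cderiv (act e i w) (pts j (Q w)) / rho ^+ i.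
    have [c hc] := exists_nat_gt (1 + B).
    have B0 : 0 <= B.
      by apply: sumr_ge0 => i _; apply: divr_ge0; [exact/ltW/cderiv_gt0|rewrite exprn_ge0// ltW].
    exists c => _ n; have rn : 0 < rho ^+ n by rewrite exprn_gt0.
    rewrite -ler_pdivrMr//; apply: le_trans (ltW hc).
    have [nN|Nn] := leqP n N.
      have nN' : (n < N.+1)%N by [].
      rewrite /B (bigD1 (Ordinal nN'))//= addrCA lerDl addr_ge0//.
      by apply: sumr_ge0 => i _; apply: divr_ge0; [exact/ltW/cderiv_gt0|rewrite exprn_ge0// ltW].
    apply: (@le_trans _ _ 1); last by rewrite lerDl.
    rewrite ler_pdivrMr// mul1r -[leLHS]lnK ?posrE ?cderiv_gt0// rhoE ler_expR.
    have n0 : 0 < n%:R :> R by rewrite ltr0n; lia.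
    by rewrite -ler_pdivrMl//; apply: ltW; apply: hN; exact: ltnW.
  exists (\sum_(j < r) c j)%N => j jr n; apply: le_trans (hc j jr n) _.
  rewrite ler_wpM2r ?exprn_ge0 ?(ltW rp)// ler_nat.
  by rewrite (bigD1 (Ordinal jr))//= leq_addr.
have b1 c : bm (\1_(~` G c) : _ -> R) by apply: bm_indic; exact: measurableC.
have cv : (fun c => EX P (\1_(~` G c))) @ \oo --> (0 : R).
  rewrite -(EX_cst P 0); apply: (EX_dct (B := 1)) G0 => //; first exact: bm_cst.
  by move=> c w; rewrite indicE; case: (_ \in _); rewrite ?normr1 ?normr0.
have k0 : 0 < k.+1%:R^-1 :> R by rewrite invr_gt0.
have [N _ hN] := (cvgr0Pnorm_lt _).1 cv _ k0.
pose c := N.+1; have c0 : 0 < c%:R :> R by rewrite ltr0n.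
have [del d0 hd] := local_contraction mu e c0 rho01.
exists (G c), del; split => //.
  rewrite -EX_indic ?lee_fin; last exact: measurableC.
  by apply: le_trans (ler_norm _) (ltW (hN c (leqnSn N))).
move=> w Gw x /ptsP[j jr ->] b y hy.
have h := hd b w _ y (Gw j jr) hy.
apply: (squeeze_cvgr _ (cvg_cst 0) (h := fun n => (c%:R * expR 1) * rho ^+ n)).
  by apply: nearW => n; rewrite gap_ge0 h.
rewrite -[X in _ --> X](mulr0 (c%:R * expR 1)); apply: cvgMr.
by apply: cvg_expr; rewrite ger0_norm ?ltW//; case/andP: rho01.
Unshelve. all: by end_near. Qed.

(** Arcs of the partition of the circle into [M] equal arcs. *)
Let cell (M k j : nat) : set (Sigma mu) :=
  [set w | j%:R <= M%:R * rep (pts k (Q w)) < j.+1%:R].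

Let measurable_cell M k j : measurable (cell M k j).
Proof.
rewrite (_ : cell M k j = (fun w => M%:R * rep (pts k (Q w))) @^-1` `[j%:R, j.+1%:R[).
  apply: mpre (measurable_itv _); apply: measurable_funM => //.
  exact: (measurableT_comp measurable_rep (measurable_pts _ mQ)).
by apply/seteqP; split => w; rewrite /cell /= in_itv.
Qed.

(** The number of discrepancies, up to the resolution 1 / M, between the
    points attached to a word and those attached to the word with another
    remote past; it is an integer. *)
Let close (M n : nat) (z : Sigma mu * Sigma mu) : R :=
  \sum_(k < r) \sum_(j < M) `|\1_(cell M k j) z.2 - \1_(cell M k j) (splice_past e n z)|.

Let bm_close M n : bm (close M n).
Proof.
apply: bm_sum => k; apply: bm_sum => j; apply: bm_norm.
have b := bm_indic (measurable_cell M k j) : bm (\1_(cell M k j) : _ -> R).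
by apply: bmB; [exact: bm_snd|exact: bm_splice_past].
Qed.

Let close_cvg M : (fun n => EX (pp P P) (close M n)) @ \oo --> 0.
Proof.
have b k j n : bm (fun z => `|\1_(cell M k j) z.2 - \1_(cell M k j) (splice_past e n z)| : R).
  have b := bm_indic (measurable_cell M k j) : bm (\1_(cell M k j) : _ -> R).
  by apply: bm_norm; apply: bmB; [exact: bm_snd|exact: bm_splice_past].
rewrite (_ : (fun n => _) = fun n => \sum_(k < r) \sum_(j < M) past_influence P e (cell M k j) n).
  apply: (cvg_sum0 _ (u := fun k : 'I_r => fun n => \sum_(j < M) past_influence P e (cell M k j) n)) => k.
  by apply: (cvg_sum0 _ (u := fun j : 'I_M => past_influence P e (cell M k j))) => j; exact: past_influence_cvg0.
apply/funext => n; rewrite /close EX_sum; last by move=> k; apply: bm_sum => j.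
by apply: eq_bigr => k _; rewrite EX_sum.
Qed.

Let close_lt1 M n z (del : R) k : (k < r)%N -> (0 < M)%N -> M%:R^-1 <= del -> close M n z < 1 ->
  exists b, ellb b (pts k (Q z.2)) (pts k (Q (splice_past e n z))) <= del.
Proof.
move=> kr M0 Md c1; set x := pts k (Q z.2); set y := pts k (Q (splice_past e n z)).
have Mp : 0 < M%:R :> R by rewrite ltr0n.
pose j := Num.truncn (M%:R * rep x); have /andP[x0 x1] := rep_itv x.
have /andP[j1 j2] : j%:R <= M%:R * rep x < j.+1%:R.
  by apply: truncn_itv; rewrite mulr_ge0.
have jM : (j < M)%N.
  by rewrite -(ltr_nat R); apply: le_lt_trans j1 _; rewrite gtr_pMr.
have xc : cell M k j z.2 by rewrite /cell /= -/x j1 j2.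
have zc : \1_(cell M k j) z.2 = 1 :> R by rewrite indicE mem_set.
have yc : cell M k j (splice_past e n z).
  apply: contrapT => ny; move: c1; rewrite ltNge => /negP; apply.
  rewrite /close (bigD1 (Ordinal kr))//= (bigD1 (Ordinal jM))//= zc.
  rewrite [\1_(cell M k j) (splice_past e n z)]indicE memNset// subr0 normr1 -addrA lerDl.
  by rewrite addr_ge0// sumr_ge0// => i _; exact: sumr_ge0.
have {yc} /andP[y1 y2] := yc; rewrite -/y in y1 y2.
have {}Md : 1 <= M%:R * del by rewrite -ler_pdivrMl// mulr1.
have [/andP[y0 y3]] := rep_itv y.
rewrite -[x]cproj_rep -[y]cproj_rep.
rewrite -natr1 in j2 y2; have [h|h] := leP (rep x) (rep y).
  exists true; rewrite /= ellE2; last by lra.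
  by rewrite -(ler_pM2l Mp) mulrBr; apply: le_trans Md; lra.
exists false; rewrite /= ellE2; last by lra.
by rewrite -(ler_pM2l Mp) mulrBr; apply: le_trans Md; lra.
Qed.

(** Almost surely, the points read off an independent past are, along a given
    future, asymptotic to the actual ones. By [past_influence_cvg0] a change
    of the remote past hardly moves the points, so that at a large time they
    lie in the neighbourhoods provided by [uniform_contraction]. *)
Lemma synchronized : {ae pp P P, forall z : Sigma mu * Sigma mu, exists n : nat,
  forall k, (k < r)%N -> forall b,
    stable_end e b (flow e n z.2) (pts k (Q (flow e n (splice e z.1 z.2)))) =
    stable_end e b (flow e n z.2) (pts k (Q (flow e n z.2)))}.
Proof.
apply: ae_of_approx => i.
(* Each of the two bad events gets half of the allowed probability. *)
have [G [del [mG PG d0 hG]]] := uniform_contraction (2 * i.+1).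
have [M hM] := exists_nat_gt del^-1.
have M0 : 0 < M%:R :> R by apply: lt_trans hM; rewrite invr_gt0.
have Mn : (0 < M)%N by rewrite -(ltr0n R).
have Md : M%:R^-1 <= del.
  by rewrite -[leRHS]invrK lef_pV2 ?posrE ?invr_gt0// ltW.
have i0 : 0 < (2 * i.+1).+1%:R^-1 :> R by rewrite invr_gt0.
have [n _ hn] := (cvgr0Pnorm_lt _).1 (close_cvg M) _ i0.
have {}hn := hn n (leqnn n).
pose A := [set z : Sigma mu * Sigma mu | G z.2 /\ close M n z < 1].
have mA : measurable A.
  rewrite (_ : A = snd @^-1` G `&` close M n @^-1` `]-oo, 1[).
    apply: measurableI; first exact: (mpre measurable_snd mG).
    by apply: mpre (measurable_itv _); have [] := bm_close M n.
  by apply/seteqP; split => z; rewrite /A /= in_itv.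
have PA : (pp P P (~` A) <= (i.+1%:R^-1)%:E)%E.
  have bA : bm (\1_(~` A) : _ -> R) by apply: bm_indic; exact: measurableC.
  have bG : bm (\1_(~` G) : _ -> R) by apply: bm_indic; exact: measurableC.
  rewrite -EX_indic ?lee_fin; last exact: measurableC.
  apply: (@le_trans _ _ (EX (pp P P) (fun z => \1_(~` G) z.2 + close M n z))).
    apply: EX_le => //; first by apply: bmD => //; exact: bm_snd.
    move=> z; rewrite !indicE !in_setC.
    have c0 : 0 <= close M n z by apply: sumr_ge0 => k _; exact: sumr_ge0.
    have [//|zA] := boolP (z \in A); first by rewrite /= addr_ge0.
    have [zG|//] := boolP (z.2 \in G); last by rewrite /= lerDl.
    rewrite /= add0r leNgt; apply/negP => c1; move/negP: zA; apply.
    by apply/mem_set; split => //; exact: set_mem.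
  rewrite EXD; [|exact: bm_snd|exact: bm_close].
  rewrite (EX_snd P bG).
  have h1 : EX P \1_(~` G) <= (2 * i.+1).+1%:R^-1.
    by rewrite -lee_fin EX_indic//; exact: measurableC.
  have h2 := le_trans (ler_norm _) (ltW hn).
  have h3 : (2 * i.+1).+1%:R^-1 <= 2^-1 * i.+1%:R^-1 :> R.
    by rewrite -invfM -natrM lef_pV2 ?posrE// ler_nat.
  by move: h1 h2 h3; move: (EX _ _) (EX _ _) (i.+1%:R^-1 : R) (_.+1%:R^-1 : R) => *; lra.
exists ((fun z => (z.1, flow e n z.2)) @^-1` A); split.
- exact: (mpre (measurable_flow2 e n) mA).
- rewrite -[X in (X <= _)%E]/(pp P P ((fun z => (z.1, flow e n z.2)) @^-1` (~` A))).
  by rewrite (pp_pres (measurable_flow e n) (flow_pres bernP e n)); [exact: PA|exact: measurableC].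
move=> z [/= Gz cz]; exists n => k kr b.
have [b' hb] := close_lt1 kr Mn Md cz.
have twE : splice_past e n (z.1, flow e n z.2) = flow e n (splice e z.1 z.2).
  by rewrite /splice_past /= flowK.
rewrite twE /= in hb.
have Qk : (Q (flow e n z.2) : set (circle R)) (pts k (Q (flow e n z.2))).
  by apply/ptsP; exists k.
have := hG _ Gz _ Qk b' _ hb.
case: (eqVneq b b') => [->|bb'] s; first by rewrite (stable_end_same s).
have -> : b = ~~ b' by case: b b' bb' {s hb} => [] [].
by rewrite (stable_end_same (asymptotic_opp s)).
Qed.

Lemma ae_splice (Z : Sigma mu -> Prop) : {ae P, forall w, Z w} ->
  {ae pp P P, forall z, Z (splice e z.1 z.2)}.
Proof. by apply: ae_comp; [exact: measurable_splice|exact: splice_pres]. Qed.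

Lemma ae_snd (Z : Sigma mu -> Prop) : {ae P, forall w, Z w} ->
  {ae pp P P, forall z, Z z.2}.
Proof.
apply: ae_comp; first exact: measurable_snd.
move=> A mA; have bA := bm_indic mA : bm (\1_A : _ -> R).
have mA' : measurable (snd @^-1` A : set (Sigma mu * Sigma mu)) by exact: (mpre measurable_snd mA).
by rewrite -EX_indic// -[RHS]EX_indic// -(EX_snd P bA).
Qed.

(** Hence the law of the end of the stable arc only depends on the future. *)
Lemma stable_end_law : {ae pp P P, forall z : Sigma mu * Sigma mu, forall b g,
  avg (fun x => g (stable_end e b z.2 x)) (Q z.1) =
  avg (fun x => g (stable_end e b z.2 x)) (Q z.2)}.
Proof.
have E1 := ae_splice Qequiv; have E2 := ae_snd Qequiv.
apply: filterS (filterI synchronized (filterI Qpast (filterI E1 E2))).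
move=> z [[n hn] [zp [/= z1 z2]]] b g.
set w := z.2 in hn *; set w' := splice e z.1 z.2 in hn zp z1 *.
set f := act e n w.
have fE x : stable_end e b w x = (f^-1%g : diff2 R) (stable_end e b (flow e n w) (f x)).
  by rewrite -stable_end_flow diff2K.
pose h x := g ((f^-1%g : diff2 R) (stable_end e b (flow e n w) x)).
have hE : (fun x => g (stable_end e b w x)) = (fun x => h (f x)).
  by apply/funext => x; rewrite fE.
rewrite hE -(avg_ext _ zp) -(avg_image h (z2 n)).
have z1' := z1 n; rewrite (act_splice e n) in z1'.
rewrite -(avg_image h z1') !avgE; congr (_ * _); apply: eq_bigr => k _.
by rewrite /h hn.
Qed.

End synchronization.

Section state_of_stable_ends.
Context {R : realType} (mu : fsprob R) (P : probability (Sigma mu) R).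
Hypothesis bernP : is_bernoulli P.
Variables (r : nat) (Q : Sigma mu -> Sr R r) (e : bool) (l : R).
Hypothesis r0 : (0 < r)%N.
Hypothesis mQ : forall U, @Sr_borel R r U -> measurable [set w | U (Q w)].
Hypothesis Qpast : {ae pp P P, forall z : Sigma mu * Sigma mu,
  (Q (splice e z.1 z.2) : set (circle R)) = Q z.1}.
Hypothesis Qequiv : {ae P, forall w (n : nat),
  act e n w @` Q w = Q (flow e n w)}.
Hypothesis l0 : l < 0.
Hypothesis lyap : {ae P, forall w, forall x, (Q w : set (circle R)) x ->
  (fun n : nat => n%:R^-1 * ln (cderiv (act e n w) x)) @ \oo --> l}.
Variable m : probability (Sigma mu * circle R)%type R.
Hypothesis mE : meas_eq m (fun C => \int[P]_w unif (Q w) (xsection C w))%E.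
Hypothesis minv : skew_invariant m.
Hypothesis merg : skew_ergodic m.
Variable b : bool.

Definition endmap (z : Sigma mu * circle R) := (z.1, stable_end e b z.1 z.2).

Lemma measurable_endmap : measurable_fun setT endmap.
Proof. by apply: measurable_fun_pair; [exact: measurable_fst|exact: measurable_stable_end]. Qed.

Lemma endmap_skewe z : endmap (skewe e z) = skewe e (endmap z).
Proof. by rewrite /endmap /skewe /= (stable_end_flow e b z.1 z.2 1). Qed.

Lemma endmap_skew z : endmap (Defs.skew z) = Defs.skew (endmap z).
Proof.
have [eT|eF] := boolP e.
  by have := endmap_skewe z; rewrite (_ : e = true).
have := endmap_skewe (skewe true z); rewrite (negbTE eF) (skewe_can true) => h.
by rewrite h -[RHS]/(skewe true _) (skewe_can false).
Qed.

Lemma avg_cst (c : R) (A : Sr R r) : avg (cst c) A = c.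
Proof.
rewrite avgE /= sumr_const card_ord -[c *+ r]mulr_natl mulKf// pnatr_eq0.
by rewrite gtn_eqF.
Qed.

(** The image of [m] by the map that sends each point to the end of its stable
    arc. By [stable_end_law] its conditional measures can be computed from a
    single fixed past, which makes them functions of the future. *)
Lemma stable_end_state : exists m' : probability (Sigma mu * circle R)%type R,
  [/\ skew_invariant m', projects_to_P P m', skew_ergodic m',
    forall A, m' A = m (endmap @^-1` A) &
    exists (k : R.-pker Sigma mu ~> circle R) (K : Sigma mu -> set (circle R) -> \bar R),
    [/\ disintegration P m' k, {ae P, forall w, meas_eq (k w) (K w)}
      & forall w' w, K (splice e w' w) = K w]].
Proof.
have [m' m'E] := push_exists m measurable_endmap.
have msk : measurable_fun setT (@Defs.skew R mu) := measurable_skewe true.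
have pre A : endmap @^-1` (@Defs.skew R mu @^-1` A) = @Defs.skew R mu @^-1` (endmap @^-1` A).
  by apply/seteqP; split => z /=; rewrite endmap_skew.
exists m'; split => //.
- move=> A mA; rewrite /pushforward !m'E pre; apply: minv.
  exact: (mpre measurable_endmap mA).
- move=> A mA; rewrite /pushforward m'E.
  have -> : endmap @^-1` (fst @^-1` A) = fst @^-1` A by [].
  have mA1 : measurable (fst @^-1` A : set (Sigma mu * circle R)) by exact: (mpre measurable_fst mA).
  have bA1 : bm (\1_(fst @^-1` A) : Sigma mu * circle R -> R) by exact: bm_indic.
  rewrite -EX_indic// (EX_points mQ mE r0 bA1) -EX_indic//; congr (_%:E).
  apply: (congr1 (EX P)); apply/funext => w; rewrite -[RHS](avg_cst _ (Q w)) /avg.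
  by congr (_ * _); apply: eq_bigr => x _; rewrite /= !indicE.
- move=> C mC sC; rewrite m'E; apply: merg; first exact: (mpre measurable_endmap mC).
  by rewrite -pre sC.
pose F (k : nat) w := stable_end e b w (pts k (Q w)).
have mF k : measurable_fun setT (F k).
  have mp : measurable_fun setT (fun w : Sigma mu => (w, pts k (Q w))).
    by apply: measurable_fun_pair => //; exact: measurable_pts.
  by have := measurableT_comp (@measurable_stable_end R mu e b) mp; apply.
pose k : R.-pker Sigma mu ~> circle R := mean_kernel r0 mF.
have kE w U : k w U = (avg (fun x => \1_U (stable_end e b w x)) (Q w))%:E.
  by rewrite avgE; exact: (mkernE r F w U).
have law := stable_end_law bernP r0 mQ Qpast Qequiv l0 lyap.
(* A past [w0] for which the law of the ends is the right one along almost
   every future. *)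
have [w0 hw0] := ae_witness (ae_pp law).
exists k, (fun w U => (avg (fun x => \1_U (stable_end e b w x)) (Q w0))%:E); split.
- move=> C mC; rewrite m'E mE; last exact: (mpre measurable_endmap mC).
  by apply: eq_integral => w _; rewrite unifE kE; congr (_%:E).
- by apply: filterS hw0 => w h U _; rewrite kE -(h b \1_U).
- move=> w' w; have E : stable_end e b (splice e w' w) = stable_end e b w.
    by apply/funext => x; exact: stable_end_splice.
  by apply/funext => U; rewrite E.
Qed.

End state_of_stable_ends.

(** * The structural data, with the two time directions on the same footing *)

Section signed_data.
Context {R : realType} (mu : fsprob R) (P : probability (Sigma mu) R).
Hypothesis bernP : is_bernoulli P.
Variables (d r : nat) (Pi Xi : Sigma mu -> 'I_d -> Sr R r).
Variables (mp mm : 'I_d -> probability (Sigma mu * circle R)%type R).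
Variables (nup num : 'I_d -> probability (circle R) R).
Hypothesis sdata : structural_data P Pi Xi mp mm nup num.
Implicit Types (e f b : bool) (i j : 'I_d).

Definition fam e := if e then Pi else Xi.
Definition ms e := if e then mp else mm.
Definition ns e := if e then nup else num.

Lemma fam_measurable e i U : @Sr_borel R r U -> measurable [set w | U (fam e w i)].
Proof. by case: e; [exact: (sd_measurable (sd_plus sdata))|exact: (sd_measurable (sd_minus sdata))]. Qed.

Lemma fam_m e i : meas_eq (ms e i) (fun C => \int[P]_w unif (fam e w i) (xsection C w))%E.
Proof. by case: e; [exact: (sd_m (sd_plus sdata))|exact: (sd_m (sd_minus sdata))]. Qed.

Lemma fam_nu e i : meas_eq (ns e i) (fun A => \int[P]_w unif (fam e w i) A)%E.
Proof. by case: e; [exact: (sd_nu (sd_plus sdata))|exact: (sd_nu (sd_minus sdata))]. Qed.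

Lemma ms_invariant e i : skew_invariant (ms e i).
Proof.
case: e.
  have [_ /(_ (ex_intro _ i _))[//|[]//]] := sd_ergodic_states (sd_plus sdata) (mp i).
have [_ /(_ (ex_intro _ i _))[//|[]//]] := sd_ergodic_states (sd_minus sdata) (mm i).
Qed.

Lemma ms_ergodic e i : skew_ergodic (ms e i).
Proof.
case: e.
  have [_ /(_ (ex_intro _ i _))[//|[]//]] := sd_ergodic_states (sd_plus sdata) (mp i).
have [_ /(_ (ex_intro _ i _))[//|[]//]] := sd_ergodic_states (sd_minus sdata) (mm i).
Qed.

Lemma ns_stationary e i : stationary (step_law mu e) (ns e i).
Proof.
case: e.
  have [_ /(_ (ex_intro _ i _))[//|]] := sd_ergodic_stationary (sd_plus sdata) (nup i).
  by [].
have [_ /(_ (ex_intro _ i _))[//|]] := sd_ergodic_stationary (sd_minus sdata) (num i).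
by [].
Qed.

Lemma ae_fst (Z : Sigma mu -> Prop) : {ae P, forall w, Z w} ->
  {ae pp P P, forall z : Sigma mu * Sigma mu, Z z.1}.
Proof.
apply: ae_comp; first exact: measurable_fst.
move=> A mA; rewrite -[LHS]/((P \x P)%E (fst @^-1` A)).
have -> : (fst @^-1` A : set (Sigma mu * Sigma mu)) = A `*` setT.
  by apply/seteqP; split => z //= [].
rewrite product_measure1E//.
by rewrite -[RHS]mule1; congr (_ * _)%E; exact: probability_setT.
Qed.

Lemma fam_past e : {ae pp P P, forall z : Sigma mu * Sigma mu, forall i,
  (fam e (splice e z.1 z.2) i : set (circle R)) = fam e z.1 i}.
Proof.
case: e.
  have [F hF] := sd_factors (sd_plus sdata).
  apply: filterS (filterI (ae_splice bernP true hF) (ae_fst hF)).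
  by move=> z [h1 h2] i; rewrite /fam h1 h2 past_splice.
have [F hF] := sd_factors (sd_minus sdata).
apply: filterS (filterI (ae_splice bernP false hF) (ae_fst hF)).
by move=> z [h1 h2] i; rewrite /fam h1 h2 future_splice.
Qed.

Lemma fam_future e : {ae pp P P, forall z : Sigma mu * Sigma mu, forall i,
  (fam (~~ e) (splice e z.1 z.2) i : set (circle R)) = fam (~~ e) z.2 i}.
Proof.
case: e.
  have [F hF] := sd_factors (sd_minus sdata).
  apply: filterS (filterI (ae_splice bernP true hF) (ae_snd hF)).
  by move=> z [h1 h2] i; rewrite /fam /= h1 h2 future_splice2.
have [F hF] := sd_factors (sd_plus sdata).
apply: filterS (filterI (ae_splice bernP false hF) (ae_snd hF)).
by move=> z [h1 h2] i; rewrite /fam /= h1 h2 past_splice2.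
Qed.

Lemma fam_equivariant e f : {ae P, forall w, forall i (n : int),
  act e n w @` fam f w i = fam f (flow e n w) i}.
Proof.
by case: f; [apply: filterS (sd_equivariant (sd_plus sdata))
  |apply: filterS (sd_equivariant (sd_minus sdata))] => w h i n; exact: h.
Qed.

Let extp (u : {n : int | n < 0} -> letter mu) : Sigma mu :=
  fun k => if (insub k : option {n : int | n < 0}) is Some i then u i else point.
Let extf (u : {n : int | 0 <= n} -> letter mu) : Sigma mu :=
  fun k => if (insub k : option {n : int | 0 <= n}) is Some i then u i else point.

Let extp_past w : extp (past w) = splice false (fun=> point) w.
Proof.
apply/funext => k; rewrite /extp /splice /past; case: insubP => [i ki ik|ki].
  by rewrite ik (_ : (0 <= k) = false)//; lia.
by rewrite (_ : (0 <= k) = true)//; lia.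
Qed.

Let extf_future w : extf (future w) = splice true (fun=> point) w.
Proof.
apply/funext => k; rewrite /extf /splice /future; case: insubP => [i ki ik|ki].
  by rewrite ik ki.
by rewrite (negbTE ki).
Qed.

(** The list of ergodic states is used here: conditional measures that ignore
    the past are functions of the projection to the future. *)
Lemma future_states e m' (k : R.-pker Sigma mu ~> circle R)
    (K : Sigma mu -> set (circle R) -> \bar R) :
  skew_invariant m' -> projects_to_P P m' -> skew_ergodic m' ->
  disintegration P m' k -> {ae P, forall w, meas_eq (k w) (K w)} ->
  (forall w' w, K (splice e w' w) = K w) -> exists j, meas_eq m' (ms (~~ e) j).
Proof.
move=> h1 h2 h3 h4 h5 h6; case: e h6 => h6.
  apply/(sd_ergodic_states (sd_minus sdata)); split => //; split => //.
  exists k => //; exists (fun u => K (extf u)).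
  by apply: filterS h5 => w h A mA; rewrite h// extf_future h6.
apply/(sd_ergodic_states (sd_plus sdata)); split => //; split => //.
exists k => //; exists (fun u => K (extp u)).
by apply: filterS h5 => w h A mA; rewrite h// extp_past h6.
Qed.

Hypothesis no_inv : ~ exists nu : probability (circle R) R, preserves (supp mu) nu.

Definition expo e i : R := lam (ms e i) e.

Lemma expo_lt0 e i : expo e i < 0.
Proof.
apply: (lam_lt0 bernP (sd_r sdata) (@fam_measurable e i) (@fam_m e i)
  (@ms_invariant e i) (@ms_ergodic e i) _ (@fam_nu e i) (@ns_stationary e i) no_inv).
by apply: filterS (fam_past e) => z.
Qed.

Lemma fam_birkhoff e f i : {ae P, forall w, forall x, (fam f w i : set (circle R)) x ->
  (fun n : nat => n%:R^-1 * ln (cderiv (act e n w) x)) @ \oo --> lam (ms f i) e}.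
Proof.
exact: (lyap_birkhoff (sd_r sdata) (@fam_measurable f i) (@fam_m f i)
  (@ms_invariant f i) (@ms_ergodic f i) e).
Qed.

Definition tot e w : set (circle R) := total_set (fam e) w.

Lemma measurable_fam_graph e i :
  measurable [set z : Sigma mu * circle R | (fam e z.1 i : set (circle R)) z.2].
Proof.
rewrite (_ : [set z | _] = \bigcup_(k in [set k | (k < r)%N])
    [set z : Sigma mu * circle R | z.2 = pts k (fam e z.1 i)]); last first.
  apply/seteqP; split => z /=; first by move=> /ptsP[k kr h]; exists k.
  by move=> [k kr h]; apply/ptsP; exists k.
apply: bigcup_measurable => k _.
rewrite (_ : [set z | _] = (fun z : Sigma mu * circle R => ell z.2 (pts k (fam e z.1 i)))
    @^-1` [set 0]); last first.
  apply/seteqP; split => z /=; first by move=> ->; rewrite ellxx.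
  by move=> /ell_eq0.
apply: mpre (measurable_set1 _); apply: measurable_ell; first exact: measurable_snd.
exact: (measurableT_comp (measurable_pts k (@fam_measurable e i)) measurable_fst).
Qed.

(** The measure given by [stable_end_state] is one of the states of the other
    direction, and these are carried by the opposite family. *)
Lemma stable_end_in_opposite e i b : {ae P, forall w, forall x,
  (fam e w i : set (circle R)) x -> tot (~~ e) w (stable_end e b w x)}.
Proof.
have past1 : {ae pp P P, forall z : Sigma mu * Sigma mu,
    (fam e (splice e z.1 z.2) i : set (circle R)) = fam e z.1 i}.
  by apply: filterS (fam_past e) => z.
have eq1 : {ae P, forall w (n : nat), act e n w @` fam e w i = fam e (flow e n w) i}.
  by apply: filterS (fam_equivariant e e) => w h n; exact: h.
have [m' [h1 h2 h3 h4 [k [K [h5 h6 h7]]]]] := stable_end_state bernP (sd_r sdata)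
  (@fam_measurable e i) past1 eq1 (expo_lt0 e i) (fam_birkhoff e e i) (@fam_m e i)
  (@ms_invariant e i) (@ms_ergodic e i) b.
have [j hj] := future_states h1 h2 h3 h5 h6 h7.
pose Gr := [set z : Sigma mu * circle R | (fam (~~ e) z.1 j : set (circle R)) z.2].
have mG : measurable Gr by exact: measurable_fam_graph.
have Gm : {ae ms (~~ e) j, forall z, Gr z}.
  exists (~` Gr); split => //; first exact: measurableC.
  rewrite (fam_m _ _ (measurableC mG)); apply: integral0_eq => w _.
  rewrite unifE /avg big_seq big1 ?mulr0// => x /mem_plP xQ.
  by rewrite indicE memNset// /xsection /= => /set_mem; apply.
have {}Gm : {ae ms e i, forall z, Gr (endmap e b z)}.
  have [N [mN N0 GN]] := Gm; exists (endmap e b @^-1` N); split.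
  - exact: (mpre (measurable_endmap e b) mN).
  - by rewrite -h4 hj.
  - by move=> z /= nG; exact: GN.
have := ae_points (@fam_measurable e i) (@fam_m e i) (sd_r sdata) Gm.
by apply: filterS => w h x xQ; exists j => //; exact: h.
Qed.

(** Otherwise the stable arc issued from [x] would end before the first point
    of the opposite family, contradicting [stable_end_in_opposite]. *)
Lemma gap_contraction e i : {ae P, forall w, forall x, (fam e w i : set (circle R)) x ->
  forall b y, (forall xi, tot (~~ e) w xi -> ellb b x y < ellb b x xi) -> asymptotic e b w x y}.
Proof.
apply: filterS (filterI (stable_end_in_opposite e i true) (stable_end_in_opposite e i false)).
move=> w [ht hf] x xQ b y hy.
have hb : tot (~~ e) w (stable_end e b w x) by case: b {hy}; [exact: ht|exact: hf].
have := hy _ hb; have := stable_radius_le1 e b w x; rewrite le_eqVlt => /predU1P[r1|r1].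
  by rewrite /stable_end r1 advb1 ellbxx ltNge ellb_ge0.
by rewrite ellb_adv; [exact: stable_radius_lt|rewrite stable_radius_ge0].
Qed.

End signed_data.

(** * Interlaced families of points on the circle *)

Section interlaced.
Context {R : realType} (d r : nat).
Implicit Types (F : bool -> 'I_d -> Sr R r) (e b : bool) (i j : 'I_d) (x y : circle R).

Definition all_pts F e : set (circle R) := [set x | exists i, (F e i : set (circle R)) x].

(** The two families are disjoint, their points alternate around the circle
    and, seen from a point of the family [e], the nearest point of the other
    family in the direction [e] bears the same label. This is the form in
    which the cyclic listing is used: it is symmetric under the exchange of
    the families together with a reversal of the orientation. *)
Definition interlaced F :=
  [/\ (forall e i j x, (F e i : set (circle R)) x -> (F e j : set (circle R)) x -> i = j) /\
        (forall e x, all_pts F e x -> ~ all_pts F (~~ e) x),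
      forall e, exists x, all_pts F e x,
      (forall e b x x', all_pts F e x -> all_pts F e x' -> x <> x' ->
        exists2 xi, all_pts F (~~ e) xi & ellb b x xi < ellb b x x'),
      (forall e b xi, all_pts F (~~ e) xi -> exists2 x, all_pts F e x &
        forall xi', all_pts F (~~ e) xi' -> ellb b x xi <= ellb b x xi')
    & forall e i x xi, (F e i : set (circle R)) x -> all_pts F (~~ e) xi ->
        (forall xi', all_pts F (~~ e) xi' -> ellb e x xi <= ellb e x xi') ->
        (F (~~ e) i : set (circle R)) xi].

Section listing.
Variables (F : bool -> 'I_d -> Sr R r) (t : nat -> R).
Hypothesis d0 : (0 < d)%N.
Hypothesis r0 : (0 < r)%N.
Let L := (2 * d * r)%N.
Hypothesis tmono : forall k l : nat, (k < l < L)%N -> t k < t l.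
Hypothesis tlast : t L.-1 < t 0 + 1.
Hypothesis lab : forall (k : nat) i, (k < d * r)%N -> i = (k %% d)%N :> nat ->
  (F true i : set (circle R)) (cproj (t (2 * k)%N)) /\
  (F false i : set (circle R)) (cproj (t (2 * k).+1)).

Let L0 : (0 < L)%N. Proof. by rewrite /L !muln_gt0 d0 r0. Qed.

(** The periodic extension of the listing. *)
Let tau (k : nat) : R := t (k %% L) + (k %/ L)%:R.
Let pt (k : nat) : circle R := cproj (tau k).

Let tau_S k : tau k < tau k.+1.
Proof.
rewrite /tau; have kL : (k %% L < L)%N by rewrite ltn_mod.
have [h|h] := ltnP (k %% L).+1 L.
  have e1 : (k.+1 %% L = (k %% L).+1)%N.
    by rewrite -addn1 -modnDml addn1 modn_small.
  have e2 : (k.+1 %/ L = k %/ L)%N.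
    by have := divn_eq k L; have := divn_eq k.+1 L; rewrite e1; move: (k %/ L)%N (k.+1 %/ L)%N => *; nia.
  by rewrite e1 e2 ltrD2r; apply: tmono; rewrite ltnSn.
have h' : (k %% L = L.-1)%N by lia.
have e1 : (k.+1 %% L = 0)%N.
  by rewrite -addn1 -modnDml h' addn1 prednK// modnn.
have e2 : (k.+1 %/ L = (k %/ L).+1)%N.
  by have := divn_eq k L; have := divn_eq k.+1 L; rewrite e1 h'; move: (k %/ L)%N (k.+1 %/ L)%N => *; nia.
rewrite e1 e2 h' -natr1 [_ + 1]addrC addrA ltrD2r.
by [].
Qed.

Let tau_lt k l : (k < l)%N -> tau k < tau l.
Proof.
elim: l => [//|l IH]; rewrite ltnS leq_eqVlt => /predU1P[->|kl]; first exact: tau_S.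
exact: lt_trans (IH kl) (tau_S l).
Qed.

Let tau_le k l : (k <= l)%N -> tau k <= tau l.
Proof. by rewrite leq_eqVlt => /predU1P[->//|/tau_lt/ltW]. Qed.

Let tau_L k : tau (k + L)%N = tau k + 1.
Proof. by rewrite /tau modnDr divnDr ?dvdnn// divnn L0 natrD addrA. Qed.

Let pt_L k : pt (k + L)%N = pt k.
Proof. by rewrite /pt tau_L cproj_add1. Qed.

Let ell_pt k l : (k <= l < k + L)%N -> ell (pt k) (pt l) = tau l - tau k.
Proof.
move=> /andP[kl lk]; rewrite ellE2// tau_le//=.
by rewrite -tau_L; exact: tau_lt.
Qed.

Let pt_mod k l : k = l %[mod L] -> pt k = pt l.
Proof.
move=> kl; rewrite /pt /tau kl; apply/cproj_eqP.
by rewrite opprD addrACA subrr add0r rpredB// ?rpred_nat.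
Qed.

Let pt_inj k l : (k <= l < k + L)%N -> pt k = pt l -> k = l.
Proof.
move=> kl ekl; have := ell_pt kl; rewrite ekl ellxx => /esym/eqP.
rewrite subr_eq0 => /eqP tt; apply/eqP; rewrite eqn_leq; case/andP: kl => -> _ /=.
by rewrite leqNgt; apply/negP => /tau_lt; rewrite tt ltxx.
Qed.

(** Any residue class has a representative in a given period. *)
Let representative k m : exists2 l, (k <= l < k + L)%N & l = m %[mod L].
Proof.
exists (k + (m + (L - k %% L)) %% L)%N.
  by rewrite leq_addr/= ltn_add2l ltn_mod.
rewrite modnDmr (_ : k + (m + (L - k %% L)) = (k %/ L).+1 * L + m)%N ?modnMDl//.
have := divn_eq k L; have := ltn_pmod k L0.
by rewrite mulSn; move: (k %/ L * L)%N (k %% L)%N => *; lia.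
Qed.

Let odd_mod k : odd (k %% L) = odd k.
Proof.
have evL : odd L = false by rewrite /L -mulnA oddM.
by rewrite [in RHS](divn_eq k L) oddD oddM evL andbF.
Qed.

Let label_mod k : ((k %% L)./2 %% d = k./2 %% d)%N.
Proof.
rewrite [in RHS](divn_eq k L) halfD oddM; have -> : odd L = false by rewrite /L -mulnA oddM.
rewrite andbF add0n (_ : k %/ L * L = (k %/ L * r * d).*2)%N.
  by rewrite doubleK modnMDl.
by rewrite /L -muln2; ring.
Qed.

Let pt_family e (i : 'I_d) (k : nat) : odd k = ~~ e -> (k./2 %% d)%N = i ->
  (F e i : set (circle R)) (pt k).
Proof.
rewrite -odd_mod -label_mod => ok /esym ki.
have -> : pt k = pt (k %% L) by apply: pt_mod; rewrite modn_mod.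
set k' := (k %% L)%N in ok ki *; have k'L : (k' < L)%N by rewrite ltn_mod.
have kd : (k'./2 < d * r)%N.
  by have := odd_double_half k'; move: k'L; rewrite /L -mulnA => ?; lia.
have [h1 h2] := lab kd ki.
have te : tau k' = t k' by rewrite /tau modn_small// divn_small// addr0.
rewrite /pt te -[k']odd_double_half ok -mul2n.
by case: (e) => /=; rewrite ?add0n ?add1n.
Qed.

Let family_pt e i x : (F e i : set (circle R)) x ->
  exists k, [/\ odd k = ~~ e, (k./2 %% d)%N = i & x = pt k].
Proof.
pose idx k := (2 * (i + d * k) + ~~ e)%N.
have idxo k : odd (idx k) = ~~ e by rewrite /idx oddD oddM /= oddb.
have idxh k : (idx k)./2 = (i + d * k)%N.
  by rewrite /idx mul2n addnC half_bit_double.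
have idxd k : ((idx k)./2 %% d)%N = i by rewrite idxh addnC mulnC modnMDl modn_small.
pose s := [seq pt (idx k) | k <- iota 0 r].
have ss : {subset s <= pl (F e i)}.
  by move=> _ /mapP[k _ ->]; apply/mem_plP; exact: pt_family.
have us : uniq s.
  rewrite map_inj_in_uniq ?iota_uniq// => k l; rewrite !mem_iota !add0n /= => kr lr.
  have bd m : (m < r)%N -> (idx m < L)%N.
    move=> mr; have : (i + d * m < d * r)%N.
      apply: (@leq_trans (d * m.+1)); first by rewrite mulnS ltn_add2r.
      by rewrite leq_mul2l mr orbT.
    by rewrite /idx /L -mulnA; case: (e) => /=; lia.
  have h := bd k kr; have h' := bd l lr.
  move=> ekl; have : idx k = idx l.
    have [kl|lk] := leqP (idx k) (idx l); first by apply: pt_inj => //; lia.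
    by apply/esym/pt_inj => //; lia.
  by rewrite /idx => /eqP; rewrite eqn_add2r => /eqP; nia.
move=> /mem_plP xF.
have : x \in s.
  have sz : (size (pl (F e i)) <= size s)%N by rewrite size_map size_iota size_pl.
  by have [_ ->] := uniq_min_size us ss sz.
by move=> /mapP[k _ ->]; exists (idx k).
Qed.

Let all_pt e x : all_pts F e x -> forall k, exists l,
  [/\ (k <= l < k + L)%N, odd l = ~~ e & x = pt l].
Proof.
move=> [i /family_pt[m [om _ ->]]] k; have [l kl lm] := representative k m.
exists l; split => //; last by apply/esym/pt_mod.
by rewrite -om -odd_mod lm odd_mod.
Qed.

Let pt_all e k : odd k = ~~ e -> all_pts F e (pt k).
Proof.
move=> ok; have h : (k./2 %% d < d)%N by rewrite ltn_mod.
by exists (Ordinal h); exact: pt_family.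
Qed.

Lemma listing_interlaced : interlaced F.
Proof.
split.
- split=> [e i j x /family_pt[k [ok ki xk]] /family_pt[l [ol lj xl]]|e x xe xe'].
    have [m km ml] := representative k l.
    have ekm : k = m by apply: pt_inj => //; rewrite -xk xl; apply: pt_mod.
    by apply: val_inj; rewrite /= -ki -lj -label_mod ekm ml label_mod.
  have [k [_ ok xk]] := all_pt xe 0; have [l [kl ol xl]] := all_pt xe' k.
  have ekl : k = l by apply: pt_inj => //; rewrite -xk.
  by move: ol; rewrite -ekl ok negbK; case: (e).
- by move=> e; exists (pt (~~ e)); apply: pt_all; rewrite oddb.
- move=> e [] x x' xe xe' xx'.
    have [k [_ ok xk]] := all_pt xe 0; have [l [/andP[kl lk] ol xl]] := all_pt xe' k.
    have kl' : (k.+1 < l)%N.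
      rewrite ltn_neqAle; apply/andP; split.
        by apply/eqP => h; move: ol; rewrite -h /= ok; case: (e).
      by rewrite ltn_neqAle kl andbT; apply/eqP => h; apply: xx'; rewrite xk xl h.
    exists (pt k.+1); first by apply: pt_all; rewrite /= ok.
    by rewrite /= xk xl !ell_pt ?ltrD2r ?tau_lt//; lia.
  have [k [_ ok xk]] := all_pt xe' 0; have [l [/andP[kl lk] ol xl]] := all_pt xe k.
  have kl' : (k.+1 < l)%N.
    rewrite ltn_neqAle; apply/andP; split.
      by apply/eqP => h; move: ol; rewrite -h /= ok; case: (e).
    by rewrite ltn_neqAle kl andbT; apply/eqP => h; apply: xx'; rewrite xk xl h.
  case: l kl lk ol xl kl' => [//|l] kl lk ol xl kl'.
  exists (pt l); first by apply: pt_all; rewrite -ol /= negbK.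
  by rewrite /= xk xl !ell_pt ?ltrD2l ?ltrN2 ?tau_lt//; lia.
- move=> e [] xi xie.
    have [l [kl ol xl]] := all_pt xie 1; case: l kl ol xl => [//|l] _ ol xl.
    exists (pt l); first by apply: pt_all; move: ol; rewrite negbK /=; case: (e); case: odd.
    move=> xi' /all_pt/(_ l)[m [/andP[lm ml] om ->]].
    have lm' : (l < m)%N.
      rewrite ltn_neqAle lm andbT; apply/eqP => h.
      by move: om ol; rewrite -h /=; case: (e); case: odd.
    by rewrite /= xl !ell_pt ?lerD2r ?tau_le//; lia.
  have [l [/andP[ll _] ol xl]] := all_pt xie L.
  exists (pt l.+1); first by apply: pt_all; rewrite /= ol negbK.
  move=> xi' /all_pt/(_ (l.+2 - L)%N)[m [/andP[lm ml] om ->]].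
  have lm' : (m <= l)%N.
    rewrite leqNgt; apply/negP => h; have h' : m = l.+1 by lia.
    by move: om ol; rewrite h' /=; case: (e); case: odd.
  by rewrite /= xl !ell_pt ?lerD2l ?lerN2 ?tau_le//; lia.
move=> e i x xi /family_pt[k [ok ki xk]] xie near; case: e ok xie near => ok xie near.
  have [l [/andP[kl lk] ol xl]] := all_pt xie k.
  have kl' : (k < l)%N.
    by rewrite ltn_neqAle kl andbT; apply/eqP => h; move: ol; rewrite -h ok.
  have := near (pt k.+1) (pt_all _); rewrite /= ok => /(_ erefl).
  rewrite xk xl !ell_pt ?lerD2r; [|lia..] => h.
  have -> : l = k.+1.
    by apply/eqP; rewrite eqn_leq kl' andbT leqNgt; apply/negP => /tau_lt; rewrite ltNge h.
  by apply: pt_family; [rewrite /= ok|rewrite -ki /= uphalf_half ok].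
have {}xk : x = pt (k + L) by rewrite pt_L.
have okL : odd (k + L) by rewrite -odd_mod modnDr odd_mod ok.
have kiL : ((k + L)./2 %% d)%N = i by rewrite -label_mod modnDr label_mod.
case: (k + L)%N (leq_addl k L) xk okL kiL => [|q] qL xq oq qi; first by rewrite leqNgt L0 in qL.
have [m [/andP[mq qm] om xm]] := all_pt xie (q.+2 - L)%N.
have := near (pt q) (pt_all _); rewrite /= in oq * => /(_ (negbTE oq)).
have mq' : (m <= q)%N.
  rewrite leqNgt; apply/negP => h; have h' : m = q.+1 by lia.
  by move: om; rewrite h' /= oq.
rewrite xq xm !ell_pt ?lerD2l ?lerN2; [|lia..] => h.
have -> : m = q.
  by apply/eqP; rewrite eqn_leq mq' leqNgt; apply/negP => /tau_lt; rewrite ltNge h.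
by apply: pt_family; [exact: negbTE|rewrite -qi /= uphalf_half (negbTE oq)].
Qed.

End listing.

(** The points that can be reached from [x], in one of the two directions,
    before meeting the family opposite to [e]. *)
Definition gapset F e x : set (circle R) :=
  [set y | exists b, forall xi, all_pts F (~~ e) xi -> ellb b x y < ellb b x xi].

Lemma gapset_sym F e x y : gapset F e x y -> gapset F e y x.
Proof.
move=> [b h]; exists (~~ b) => xi xie; rewrite !ellbN ltNge; apply/negP => h'.
have := h xi xie; rewrite ltNge => /negP; apply.
by rewrite (ellb_splitr h') lerDl ellb_ge0.
Qed.

Lemma gapset_avoid F e x y : gapset F e x y -> ~ all_pts F (~~ e) y.
Proof. by move=> [b h] /h; rewrite ltxx. Qed.

Section interlaced_geometry.
Variable F : bool -> 'I_d -> Sr R r.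
Hypothesis intF : interlaced F.

Lemma interlaced_label e i j x :
  (F e i : set (circle R)) x -> (F e j : set (circle R)) x -> i = j.
Proof. by have [[h _] _ _ _ _] := intF; exact: h. Qed.

Lemma interlaced_disjoint e x xi : all_pts F e x -> all_pts F (~~ e) xi -> x <> xi.
Proof. by have [[_ h] _ _ _ _] := intF => /h h' h'' E; apply: h'; rewrite E. Qed.

Lemma gapset_refl e x : all_pts F e x -> gapset F e x x.
Proof.
move=> xe; exists true => xi xie; rewrite ellbxx ellb_gt0//.
exact: interlaced_disjoint xe xie.
Qed.

Lemma nearest e b x : exists2 xi, all_pts F e xi &
  forall xi', all_pts F e xi' -> ellb b x xi <= ellb b x xi'.
Proof.
pose s := flatten [seq pl (F e i) | i <- enum 'I_d].
have sP y : (y \in s) <-> all_pts F e y.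
  split=> [/flattenP[_ /mapP[i _ ->] /mem_plP]|[i /mem_plP iy]]; first by exists i.
  by apply/flattenP; exists (pl (F e i)) => //; apply: map_f; rewrite mem_enum.
have [_ ne _ _ _] := intF; have [z /sP zs] := ne e.
suff [xi /sP xie h] : exists2 xi, xi \in s & forall xi', xi' \in s -> ellb b x xi <= ellb b x xi'.
  by exists xi => // xi' /sP/h.
elim: s z zs {sP} => [//|a s IH] z _.
have [s0|/eqP s0] := pselect (s = [::]).
  by exists a; rewrite ?s0 ?mem_head// => xi'; rewrite inE => /eqP->.
have [|xi xis h] := IH (head a s); first by case: (s) s0 => //= *; rewrite mem_head.
have [ax|xa] := leP (ellb b x a) (ellb b x xi).
  exists a; first exact: mem_head.
  move=> xi'; rewrite inE => /predU1P[->//|/h]; exact: le_trans ax.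
exists xi; first by rewrite inE xis orbT.
by move=> xi'; rewrite inE => /predU1P[->|/h//]; exact: ltW.
Qed.

(** Two points of the same family are separated on both sides by points of the
    opposite family. *)
Lemma gapset_inj e x x' y : all_pts F e x -> all_pts F e x' ->
  gapset F e x y -> gapset F e x' y -> x = x'.
Proof.
have [_ ne sep _ _] := intF.
have same b u v : all_pts F e u -> all_pts F e v -> ellb b v y <= ellb b u y ->
    (forall xi, all_pts F (~~ e) xi -> ellb b u y < ellb b u xi) -> u = v.
  move=> ue ve vu h; apply: contrapT => uv.
  have [xi xie hxi] := sep e b u v ue ve uv; have := h xi xie.
  by rewrite (ellb_splitr vu) ltNge => /negP; apply; rewrite (le_trans (ltW hxi))// lerDl ellb_ge0.
have opp b u v : all_pts F e u -> all_pts F e v ->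
    (forall xi, all_pts F (~~ e) xi -> ellb b u y < ellb b u xi) ->
    (forall xi, all_pts F (~~ e) xi -> ellb b y v < ellb b xi v) -> u = v.
  move=> ue ve hu hv; apply: contrapT => uv.
  have [xi xie hxi] : exists2 xi, all_pts F (~~ e) xi & ellb b y xi <= ellb b y v.
    have [s1|s1] := ltP (ellb b u y + ellb b y v) 1.
      have [xi xie hxi] := sep e b u v ue ve uv; exists xi => //.
      have := ltW (hu xi xie) => /ellb_split E; have := ellb_add s1 => E'.
      by move: hxi; rewrite E E' ltrD2l => /ltW.
    have [xi xie] := ne (~~ e); exists xi => //.
    have := ltW (hu xi xie) => /ellb_split E.
    by have := ellb_lt1 b u xi; lra.
  have := hv xi xie; rewrite (ellb_split hxi) ltNge => /negP; apply.
  by rewrite lerDr ellb_ge0.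
move=> xe x'e [b h] [b' h'].
have [bb|bb] := eqVneq b b'.
  rewrite -bb in h'; have [l|l] := leP (ellb b x' y) (ellb b x y); first exact: (same b x x').
  by apply/esym/(same b x' x) => //; exact: ltW.
have E : b' = ~~ b by case: b b' bb {h h'} => [] [].
apply: (opp b x x') => // xi /h'; rewrite E !ellbN; exact.
Qed.

(** The last point of the family [e] before the next point of the opposite
    family serves [y]. *)
Lemma gapset_cover e y : ~ all_pts F (~~ e) y -> exists2 x, all_pts F e x & gapset F e x y.
Proof.
move=> ye; have [xi xie near] := nearest (~~ e) true y.
have [_ _ _ prev _] := intF; have [x xe hx] := prev e true xi xie.
exists x => //; have [l|l] := ltP (ell x y) (ell x xi).
  by exists true => xi' /hx; exact: lt_le_trans.
exists false => xi' xie' /=; rewrite ltNge; apply/negP => h.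
have xxi : 0 < ell x xi by apply: ell_gt0; exact: interlaced_disjoint xe xie.
have xy : x <> y by move=> E; move: l; rewrite E ellxx leNgt -{1}E xxi.
have xiy : xi <> y by move=> E; apply: ye; rewrite -E.
have E1 := ell_split l; have E2 := ell_sym xy; have E3 := ell_sym xiy.
have E4 := ell_splitr h; have := near _ xie' => /=.
by have := ell_ge0 xi' x; lra.
Qed.

(** For [e] equal to [true] this is the stable set of label [i], for [false]
    the unstable one. *)
Definition basin e i : set (circle R) := \bigcup_(x in (F e i : set (circle R))) gapset F e x.

Lemma basin_trivIset e : trivIset setT (basin e).
Proof.
move=> i j _ _ [y [[x xi gx] [x' xj gx']]].
have E : x = x' by apply: gapset_inj gx gx'; [exists i|exists j].
by apply: (interlaced_label xi); rewrite E.
Qed.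

Lemma basin_cover e : \bigcup_i basin e i = ~` all_pts F (~~ e).
Proof.
apply/seteqP; split => y /=.
  by move=> [i _ [x _ /gapset_avoid]].
by move=> /gapset_cover[x [i xi] gx]; exists i => //; exists x.
Qed.

Lemma basin_sub e i : F e i `<=` basin e i.
Proof. by move=> x xi; exists x => //; apply: gapset_refl; exists i. Qed.

(** The ends are the nearest points of the opposite family on each side. *)
Lemma gapset_arc e x : all_pts F e x -> open_arc (gapset F e x).
Proof.
move=> xe; have [u ue hu] := nearest (~~ e) true x; have [v ve hv] := nearest (~~ e) false x.
rewrite /= in hu hv.
have xu := interlaced_disjoint xe ue; have xv := interlaced_disjoint xe ve.
have u0 := ell_gt0 xu; have v0 := ell_gt0 (fun h => xv (esym h)).
have u1 := ell_lt1 x u; have v1 := ell_lt1 v x.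
have uv1 : ell x u + ell v x <= 1.
  by have := hv u ue; rewrite (ell_sym xu); lra.
exists (rep x - ell v x), (rep x + ell x u); split; first by lra.
apply/seteqP; split => y.
  move=> [[] /= h].
    exists (rep x + ell x y); last by rewrite -/(adv x _) adv_ell.
    by rewrite /= in_itv /=; have := h u ue; have := ell_ge0 x y; lra.
  exists (rep x - ell y x); last first.
    by rewrite -/(adv x _) -[RHS](advb_ell false x y).
  by rewrite /= in_itv /=; have := h v ve; have := ell_ge0 y x; lra.
move=> [s /=]; rewrite in_itv /= => /andP[s1 s2] <-.
have xE := cproj_rep x; have [h|h] := leP (rep x) s.
  have E : ell x (cproj s) = s - rep x by rewrite -{1}xE ellE2//; lra.
  by exists true => xi xie; rewrite /= E; have := hu xi xie; lra.
have E : ell (cproj s) x = rep x - s by rewrite -{1}xE ellE2//; lra.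
by exists false => xi xie; rewrite /= E; have := hv xi xie; lra.
Qed.

Lemma gapset_open e x : all_pts F e x -> open (gapset F e x).
Proof. by move=> /gapset_arc[a [b [_ ->]]]; exact: open_arc_open. Qed.

Lemma basin_arcs e i : disjoint_open_arcs r (basin e i).
Proof.
have pe (k : 'I_r) : (F e i : set (circle R)) (pts k (F e i)) by apply/ptsP; exists k.
have pe' (k : 'I_r) : all_pts F e (pts k (F e i)) by exists i.
exists (fun k : 'I_r => gapset F e (pts k (F e i))); split.
- by move=> k; exact: gapset_arc.
- move=> k l _ _ [y [gk gl]]; have := gapset_inj (pe' k) (pe' l) gk gl.
  rewrite /pts => /eqP; rewrite nth_uniq ?size_pl ?uniq_pl// => /eqP; exact: val_inj.
- apply/seteqP; split => y.
    by move=> [x /ptsP[k kr ->] gx]; exists (Ordinal kr).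
  by move=> [k _ gk]; exists (pts k (F e i)).
Qed.

Lemma basin_component e i I : component (basin e i) I ->
  exists2 x, (F e i : set (circle R)) x & I = gapset F e x.
Proof.
move=> [y [x xi gx] ->]; exists x => //.
pose U := \bigcup_(z in [set z | (F e i : set (circle R)) z /\ z <> x]) gapset F e z.
have xe : all_pts F e x by exists i.
have -> : basin e i = gapset F e x `|` U.
  apply/seteqP; split => z.
    move=> [u ui gu]; have [E|E] := pselect (u = x); first by left; rewrite -E.
    by right; exists u.
  by move=> [gz|[u [ui _] gu]]; [exists x|exists u].
apply: open_connected_component => //.
- exact: gapset_open.
- by apply: bigcup_open => z [zi _]; apply: gapset_open; exists i.
- apply/seteqP; split => // z [gz [u [ui ux] gu]]; apply: ux.
  by apply: gapset_inj gu gz => //; exists i.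
- by have [a [b [_ ->]]] := gapset_arc xe; exact: open_arc_connected.
Qed.

End interlaced_geometry.

Lemma gapset_image (f : diff2 R) F F' e x :
  (forall i, [set f y | y in (F (~~ e) i : set (circle R))] = F' (~~ e) i) ->
  gapset F' e (f x) = [set f y | y in gapset F e x].
Proof.
move=> FF'; have all_image xi : all_pts F (~~ e) xi <-> all_pts F' (~~ e) (f xi).
  split=> [[i xii]|[i]]; first by exists i; rewrite -FF'; exists xi.
  by rewrite -FF' => -[z zi /diff2_injective <-]; exists i.
apply/seteqP; split => y.
  move=> [b h]; exists ((f^-1%g : diff2 R) y); last by rewrite diff2VK.
  exists b => xi xie; rewrite -(ellb_mono b f x) diff2VK; apply: h.
  exact/all_image.
move=> [z [b h] <-]; exists b => xi xie; rewrite -[xi](diff2VK f) ellb_mono.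
by apply: h; apply/all_image; rewrite diff2VK.
Qed.

Lemma basin_image (f : diff2 R) F F' e i :
  (forall e i, [set f y | y in (F e i : set (circle R))] = F' e i) ->
  [set f y | y in basin F e i] = basin F' e i.
Proof.
move=> FF'; apply/seteqP; split => y.
  move=> [z [x xi gz] <-]; exists (f x); first by rewrite -FF'; exists x.
  by rewrite (gapset_image (F := F))//; exists z.
move=> [u]; rewrite -FF' => -[x xi <-]; rewrite (gapset_image (F := F))// => -[z gz <-].
by exists z => //; exists x.
Qed.

(** The arc around a point of the family [e] only depends on the opposite
    family, and so does its label, which is that of the nearest point of the
    opposite family in the direction [e]. Hence, if the family [e] is replaced
    by another one interlaced with the same opposite family, the arc still
    contains exactly one point with that label. *)
Lemma gapset_count F1 F2 e i x : interlaced F1 -> interlaced F2 ->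
  (forall j, (F1 (~~ e) j : set (circle R)) = F2 (~~ e) j) ->
  (F2 e i : set (circle R)) x -> avg \1_(gapset F2 e x) (F1 e i) = r%:R^-1.
Proof.
move=> int1 int2 FF xi.
have FE xi' : all_pts F1 (~~ e) xi' <-> all_pts F2 (~~ e) xi'.
  by split => -[j h]; exists j; [rewrite -FF|rewrite FF].
have GE u : gapset F1 e u = gapset F2 e u.
  by apply/seteqP; split => y [b h]; exists b => xi' /FE/h.
have xe : all_pts F2 e x by exists i.
have [x' [j x'j] gx] : exists2 x', all_pts F1 e x' & gapset F1 e x' x.
  apply: gapset_cover => // /FE h; exact: (interlaced_disjoint int2 xe h).
have x'e : all_pts F1 e x' by exists j.
have [z ze hz] := nearest int2 (~~ e) e x.
have zi : (F2 (~~ e) i : set (circle R)) z by have [_ _ _ _ h] := int2; exact: h hz.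
(* The nearest point [z] is also the nearest one for the point [x'] of the
   first family, since no point of the opposite family separates [x] from
   [x']. *)
have zj : (F1 (~~ e) j : set (circle R)) z.
  have [_ _ _ _ h] := int1; apply: h x'j _ _; first exact/FE.
  move=> y /[dup] ye1 /FE ye; have := hz y ye.
  have [b hb] := gx; have [bE|bE] := eqVneq b e.
    rewrite -bE; have zE := ellb_split (ltW (hb z ((FE _).2 ze))).
    by have yE := ellb_split (ltW (hb y ye1)); rewrite zE yE lerD2l.
  have {}bE : b = ~~ e by move: bE; case: (b); case: (e).
  have tr y' : all_pts F1 (~~ e) y' -> ellb e x y' = ellb e x x' + ellb e x' y'.
    move=> y'e; have := hb y' y'e; rewrite bE !ellbN => /ltW/ellb_splitr E.
    have xy' : x <> y' by apply: interlaced_disjoint xe _ => //; exact/FE.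
    have x'y' : x' <> y' by exact: interlaced_disjoint x'e y'e.
    have := ellb_sym e xy'; have := ellb_sym e x'y'; lra.
  by rewrite (tr z ((FE _).2 ze)) (tr y ye1) lerD2l.
have ij : i = j.
  by apply: (interlaced_label int1 (e := ~~ e) (x := z)) => //; rewrite FF.
have x'g : gapset F2 e x x' by rewrite -GE; exact: gapset_sym.
rewrite /avg (bigD1_seq x') ?uniq_pl//=; last by apply/mem_plP; rewrite ij.
rewrite indicE mem_set// big_seq_cond big1 ?addr0 ?mulr1// => y /andP[/mem_plP yi yx].
rewrite indicE memNset// => gy; move/eqP: yx; apply.
have ye : all_pts F1 e y by exists i.
apply: (gapset_inj int1 ye x'e _ gx).
by rewrite GE; exact: gapset_sym.
Qed.

End interlaced.

(** * Contraction of closed arcs *)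

Section closed_arcs.
Context {R : realType}.
Implicit Types (s t : R) (p q x z : circle R).

Lemma closed_arcE s t : s <= t < s + 1 ->
  @cproj R @` `[s, t] = [set z | ell (cproj s) z <= t - s].
Proof.
move=> st; apply/seteqP; split => z /=.
  move=> [u]; rewrite /= in_itv /= => /andP[su ut] <-; rewrite ellE2; lra.
move=> h; exists (s + ell (cproj s) z); last exact: ellP.
by rewrite /= in_itv /=; have := ell_ge0 (cproj s) z; lra.
Qed.

(** An arc is the set of points that are met before its end, a description
    preserved by diffeomorphisms. *)
Lemma arc_length_image (f : diff2 R) s t : s <= t < s + 1 ->
  (arc_length ([set f z | z in @cproj R @` `[s, t]]) <=
    (ell (f (cproj s)) (f (cproj t)))%:E)%E.
Proof.
move=> st; have stE : ell (cproj s) (cproj t) = t - s by exact: ellE2.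
set y := f (cproj s); set l := ell y _.
have l0 : rep y <= rep y + l < rep y + 1.
  by rewrite lerDl ltrD2l ell_ge0 ell_lt1.
suff -> : [set f z | z in @cproj R @` `[s, t]] = @cproj R @` `[rep y, rep y + l].
    by have := arc_length_le l0; have ->  : rep y + l - rep y = l by rewrite addrC addKr.
have -> : @cproj R @` `[rep y, rep y + l] = [set z | ell y z <= l].
  by rewrite closed_arcE// cproj_rep [rep y + l]addrC addrK.
rewrite closed_arcE// -stE; apply/seteqP; split => z.
  by move=> [x /= hx <-]; rewrite /l /y; have := ellb_mono_le true f (cproj s) x (cproj t) => /= ->.
move=> /= hz; exists ((f^-1%g : diff2 R) z); last by rewrite diff2VK.
by have := ellb_mono_le true f (cproj s) ((f^-1%g : diff2 R) z) (cproj t) => /= <-; rewrite diff2VK.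
Qed.

(** The larger of the two ratios serves for both sequences. *)
Lemma geometric_add (u v : nat -> R) :
  (exists C rho : R, 0 < rho < 1 /\ forall n, u n <= C * rho ^+ n) ->
  (exists C rho : R, 0 < rho < 1 /\ forall n, v n <= C * rho ^+ n) ->
  exists C rho : R, 0 < rho < 1 /\ forall n, u n + v n <= C * rho ^+ n.
Proof.
move=> [C [a [/andP[a0 a1] hu]]] [D [b [/andP[b0 b1] hv]]].
exists (`|C| + `|D|), (Num.max a b); split.
  by rewrite lt_max a0 gt_max a1 b1.
move=> n; have an : a ^+ n <= Num.max a b ^+ n by rewrite lerXn2r// ?nnegrE ?le_max ?(ltW a0) ?lexx.
have bn : b ^+ n <= Num.max a b ^+ n by rewrite lerXn2r// ?nnegrE ?le_max ?(ltW a0) ?(ltW b0) ?lexx ?orbT.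
rewrite mulrDl lerD// ?(le_trans (hu n))// ?(le_trans (hv n))//.
  by rewrite (le_trans (ler_wpM2r (exprn_ge0 _ (ltW a0)) (ler_norm C)))// ler_wpM2l.
by rewrite (le_trans (ler_wpM2r (exprn_ge0 _ (ltW b0)) (ler_norm D)))// ler_wpM2l.
Qed.

End closed_arcs.

Section contraction_of_arcs.
Context {R : realType} (mu : fsprob R) (d r : nat) (F : bool -> 'I_d -> Sr R r).
Variables (e : bool) (w : Sigma mu).
Hypothesis intF : interlaced F.
Hypothesis contr : forall x b y, all_pts F e x ->
  (forall xi, all_pts F (~~ e) xi -> ellb b x y < ellb b x xi) ->
  exists C rho : R, 0 < rho < 1 /\ forall n, gap e b w x y n <= C * rho ^+ n.

(** The arc lies in the gap around some point [x]. According to the position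
    of [x], it is covered by an arc issued from [x], or by two such arcs in
    opposite directions. *)
Lemma closed_arc_contracts I : closed_arc I -> I `<=` ~` all_pts F (~~ e) ->
  exponentially_small (fun n : nat => arc_length ([set act e n w z | z in I])).
Proof.
move=> [s [t [st ->]]] avoid; set p := cproj s; set q := cproj t.
have pq xi : all_pts F (~~ e) xi -> ell p q < ell p xi.
  move=> xie; rewrite ltNge; apply/negP => h; apply: (avoid xi) => //.
  by rewrite closed_arcE//= -(ellE2 st).
suff [C [rho [rho1 h]]] : exists C rho : R, 0 < rho < 1 /\
    forall n : nat, ell (act e n w p) (act e n w q) <= C * rho ^+ n.
  exists C, rho; split => // n; apply: le_trans (arc_length_image _ st) _.
  by rewrite lee_fin.
have mono (f : diff2 R) x y z : ell x y <= ell x z -> ell (f x) (f y) <= ell (f x) (f z).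
  by move=> h; have := ellb_mono_le true f x y z => /= ->.
have pe : ~ all_pts F (~~ e) p by move=> /pq; rewrite ellxx ltNge ell_ge0.
have [x xe [b hb]] := gapset_cover intF pe.
have [xi0 xi0e] : exists xi, all_pts F (~~ e) xi by have [_ ne _ _ _] := intF.
case: b hb => /= hb.
  have add xi : all_pts F (~~ e) xi -> ell x p + ell p q < ell x xi.
    by move=> xie; rewrite (ell_split (ltW (hb xi xie))) ltrD2l pq.
  have xq : ell x q = ell x p + ell p q.
    by apply: ell_add; have := add _ xi0e; have := ell_lt1 x xi0; lra.
  have [C [rho [rho1 h]]] : exists C rho : R, 0 < rho < 1 /\
      forall n, gap e true w x q n <= C * rho ^+ n.
    by apply: contr => // xi xie /=; rewrite xq add.
  exists C, rho; split => // n; apply: le_trans (h n); rewrite /gap /=.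
  have le1 : ell x p <= ell x q by rewrite xq lerDl ell_ge0.
  by rewrite (ell_split (mono (act e n w) _ _ _ le1)) lerDr ell_ge0.
have [C [rho [rho1 h]]] := contr xe (b := false) hb.
have [le1|/ltW le1] := leP (ell p q) (ell p x).
  by exists C, rho; split => // n; exact: le_trans (mono _ _ _ _ le1) (h n).
have xq : exists C rho : R, 0 < rho < 1 /\ forall n, gap e true w x q n <= C * rho ^+ n.
  apply: contr => // xi xie /=; have := pq xi xie.
  by rewrite (ell_split le1) (ell_split (le_trans le1 (ltW (pq xi xie)))) ltrD2l.
have [D [rho' [rho'1 h']]] := geometric_add (ex_intro _ C (ex_intro _ rho (conj rho1 h))) xq.
exists D, rho'; split => // n; apply: le_trans (h' n).
by rewrite (ell_split (mono (act e n w) _ _ _ le1)).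
Qed.

End contraction_of_arcs.

(** * The stable and unstable sets *)

Section assembly.
Context {R : realType} (mu : fsprob R) (P : probability (Sigma mu) R).
Hypothesis bernP : is_bernoulli P.
Variables (d r : nat) (Pi Xi : Sigma mu -> 'I_d -> Sr R r).
Variables (mp mm : 'I_d -> probability (Sigma mu * circle R)%type R).
Variables (nup num : 'I_d -> probability (circle R) R).
Hypothesis sdata : structural_data P Pi Xi mp mm nup num.
Hypothesis no_inv : ~ exists nu : probability (circle R) R, preserves (supp mu) nu.

Let F w e : 'I_d -> Sr R r := fam Pi Xi e w.
Let m e := ms mp mm e.
Let nu e := ns nup num e.

Lemma all_pts_tot e w : all_pts (F w) e = tot Pi Xi e w.
Proof. by apply/seteqP; split => x [i]; exists i. Qed.

Lemma fam_interlaced : {ae P, forall w, interlaced (F w)}.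
Proof.
apply: filterS (sd_cyclic sdata) => w [_ [x [[t [tmono tlast xt _]] lab]]].
have r0 := sd_r sdata; have d0 := sd_d sdata.
apply: (listing_interlaced d0 r0 tmono tlast) => k i kd ik.
by have := lab k i kd ik; rewrite !xt; [|rewrite -mulnA; lia..].
Qed.

Lemma ae_swap (Z : Sigma mu * Sigma mu -> Prop) : {ae pp P P, forall z, Z z} ->
  {ae P, forall y, {ae P, forall x, Z (x, y)}}.
Proof.
move=> hZ; apply: (@ae_pp _ _ _ _ _ _ _ (fun z => Z (z.2, z.1))).
have ms : measurable_fun setT (fun z : Sigma mu * Sigma mu => (z.2, z.1)).
  by apply: measurable_fun_pair; [exact: measurable_snd|exact: measurable_fst].
apply: (ae_comp ms _ hZ) => A mA.
have mA' := mpre ms mA; have bA := bm_indic (R := R) mA; have bA' := bm_indic (R := R) mA'.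
rewrite -!EX_indic//; congr (_%:E).
by rewrite (EX_pp P P bA) (EX_pp P P bA') (EX_fubini P P bA).
Qed.

Lemma measurable_gapset w e x : interlaced (F w) -> all_pts (F w) e x ->
  measurable (gapset (F w) e x).
Proof. by move=> iF /(gapset_arc iF)[a [b [_ ->]]]; exact: measurable_open_arc. Qed.

(** The two families are independent: replacing the past of [e] by an
    independent one does not change the opposite family, and by [gapset_count]
    the arc contains exactly one of the [r] points of label [i] of the new
    family. *)
Lemma gapset_mass e : {ae P, forall w i x, (F w e i : set (circle R)) x ->
  nu e i (gapset (F w) e x) = (r%:R^-1)%:E}.
Proof.
have r0 := sd_r sdata.
have key : {ae pp P P, forall z : Sigma mu * Sigma mu, forall i x,
    (F z.2 e i : set (circle R)) x ->
    avg \1_(gapset (F z.2) e x) (F z.1 e i) = (r%:R^-1 : R)}.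
  apply: filterS (filterI (filterI (fam_past bernP sdata e) (fam_future bernP sdata e))
    (filterI (ae_splice bernP e fam_interlaced) (ae_snd fam_interlaced))).
  move=> z [[h1 h2] [i1 i2]] i x xi; rewrite -(avg_ext _ (h1 i)).
  exact: (gapset_count i1 i2 h2 xi).
apply: filterS (filterI (ae_swap key) fam_interlaced) => w [h iF] i x xi.
have mg : measurable (gapset (F w) e x) by apply: measurable_gapset => //; exists i.
have bg := bm_indic (R := R) mg.
rewrite -EX_indic// (EX_marginal (@fam_measurable _ _ _ _ _ _ _ _ _ _ _ sdata e i) r0 (@fam_nu _ _ _ _ _ _ _ _ _ _ _ sdata e i) bg).
congr (_%:E); rewrite -[RHS](EX_cst P); apply: EX_ae.
- have mQ := @fam_measurable _ _ _ _ _ _ _ _ _ _ _ sdata e i.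
  apply: (bm_avg mQ (F := fun z => \1_(gapset (F w) e x) z.2)).
  by apply: (bm_comp bg); exact: measurable_snd.
- exact: bm_cst.
- by apply: filterS h => w' /(_ i x xi).
Qed.

Lemma basin_mass w e i : interlaced (F w) ->
  (forall x, (F w e i : set (circle R)) x -> nu e i (gapset (F w) e x) = (r%:R^-1)%:E) ->
  nu e i (basin (F w) e i) = 1%E.
Proof.
move=> iF h; have r0 := sd_r sdata; pose G k := gapset (F w) e (pts k (F w e i)).
have pk k : (k < r)%N -> (F w e i : set (circle R)) (pts k (F w e i)).
  by move=> kr; apply/ptsP; exists k.
have mG k : (k < r)%N -> measurable (G k).
  by move=> kr; apply: measurable_gapset => //; exists i; exact: pk.
have -> : basin (F w) e i = \big[setU/set0]_(k < r) G k.
  rewrite -bigcup_mkord; apply/seteqP; split => y.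
    by move=> [x /ptsP[k kr ->] gx]; exists k.
  by move=> [k kr gk]; exists (pts k (F w e i)) => //; exact: pk.
rewrite measure_semi_additive_ord_I//; last 2 first.
- move=> k l /= kr lr [y [gk gl]].
  have := gapset_inj iF _ _ gk gl => /(_ (ex_intro _ i (pk k kr)) (ex_intro _ i (pk l lr))).
  by rewrite /pts => /eqP; rewrite nth_uniq ?size_pl ?uniq_pl// => /eqP.
- by apply: bigsetU_measurable => k _; exact: mG.
rewrite (eq_bigr (fun=> (r%:R^-1)%:E)); last by move=> k _; exact: (h _ (pk k (ltn_ord k))).
rewrite sumEFin sumr_const card_ord -[_ *+ r]mulr_natl mulfV//.
by rewrite pnatr_eq0 gtn_eqF.
Qed.

Lemma lyapunovE e i : lyapunov (m e i) = lam (m e i) true / ln 2.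
Proof.
rewrite mulrC /lam -EXZ; last exact: bm_phi.
by apply: (congr1 (EX (m e i))); apply/funext => z; rewrite mulrC.
Qed.

Lemma ln2_gt0 : 0 < ln 2 :> R. Proof. by rewrite ln_gt0// ltr1n. Qed.

Lemma lyapunov_sign e i : if e then lyapunov (m e i) < 0 else 0 < lyapunov (m e i).
Proof.
rewrite lyapunovE; have l2 := ln2_gt0; have := expo_lt0 bernP sdata no_inv e i.
rewrite /expo; case: e => h; first by rewrite pmulr_llt0 ?invr_gt0.
rewrite pmulr_lgt0 ?invr_gt0//.
by rewrite -[true]/(~~ false) lamN ?oppr_gt0//; exact: (ms_invariant sdata false i).
Qed.

(** Towards the past, the ergodic theorem is applied to the inverse skew
    product, whose exponent is the opposite one. *)
Lemma lyapunov_limits f i : {ae P, forall w, forall x, (F w f i : set (circle R)) x ->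
  (fun n : nat => lyapunov_quotient w x n%:Z) @ \oo --> lyapunov (m f i) /\
  (fun n : nat => lyapunov_quotient w x (- n%:Z)) @ \oo --> lyapunov (m f i)}.
Proof.
have lim (e : bool) : {ae P, forall w, forall x, (F w f i : set (circle R)) x ->
    (fun n : nat => lyapunov_quotient w x (ez e n)) @ \oo --> lyapunov (m f i)}.
  apply: filterS (fam_birkhoff sdata e f i) => w h x xi.
  pose sgn : R := if e then 1 else -1.
  rewrite lyapunovE (_ : (fun n : nat => _) = (fun n : nat =>
    (sgn / ln 2) * (n%:R^-1 * ln (cderiv (act e n w) x)))); last first.
    apply/funext => n; rewrite /lyapunov_quotient /log2 /act /ez.
    by rewrite /sgn; case: (e); rewrite ?mulrNz ?invrN; ring.
  have -> : lam (m f i) true / ln 2 = (sgn / ln 2) * lam (m f i) e.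
    rewrite /sgn; case: (e); first by ring.
    rewrite -[X in lam _ X]/(~~ false) (lamN (ms_invariant sdata f i)).
    by ring.
  apply: cvgM; first exact: cvg_cst.
  exact: h.
by apply: filterS (filterI (lim true) (lim false)) => w [h1 h2] x xi; split; [exact: h1|exact: h2].
Qed.

Lemma fam_contracts e : {ae P, forall w x b y, all_pts (F w) e x ->
  (forall xi, all_pts (F w) (~~ e) xi -> ellb b x y < ellb b x xi) ->
  exists C rho : R, 0 < rho < 1 /\ forall n, gap e b w x y n <= C * rho ^+ n}.
Proof.
have h : {ae P, forall w i x, (F w e i : set (circle R)) x -> forall b y,
    (forall xi, all_pts (F w) (~~ e) xi -> ellb b x y < ellb b x xi) ->
    exists C rho : R, 0 < rho < 1 /\ forall n, gap e b w x y n <= C * rho ^+ n}.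
  apply: filter_forall => i.
  apply: filterS (filterI (gap_contraction bernP sdata no_inv e i) (fam_birkhoff sdata e e i)).
  move=> w [h1 h2] x xi b y hy.
  apply: (exponential_contraction (expo_lt0 bernP sdata no_inv e i) (h2 x xi)).
  by apply: h1 => // z; rewrite -all_pts_tot; exact: hy.
by apply: filterS h => w h x b y [i xi] hy; exact: (h i x xi).
Qed.

Lemma fam_flow : {ae P, forall w (n : int) e i,
  [set fpow w n x | x in (F w e i : set (circle R))] = F (sigma n w) e i}.
Proof.
apply: filterS (filterI (fam_equivariant sdata true true) (fam_equivariant sdata true false)).
by move=> w [h1 h2] n [] i; [exact: h1|exact: h2].
Qed.

End assembly.

Theorem theorem4p16 (R : realType) (mu : fsprob R)
  (no_inv : ~ exists nu : probability (circle R) R, preserves (supp mu) nu)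
  (P : probability (Sigma mu) R) (bernP : is_bernoulli P)
  (d r : nat) (Pi Xi : Sigma mu -> 'I_d -> Sr R r)
  (mp mm : 'I_d -> probability (Sigma mu * circle R)%type R)
  (nup num : 'I_d -> probability (circle R) R)
  (sdata : structural_data P Pi Xi mp mm nup num) :
  exists Ws Wu : Sigma mu -> 'I_d -> set (circle R),
  (forall i, lyapunov (mp i) < 0 /\ 0 < lyapunov (mm i)) /\
  {ae P, forall w,
    (* (1) *)
    (forall i, disjoint_open_arcs r (Ws w i) /\ disjoint_open_arcs r (Wu w i))
    /\
    (* (2) *)
    (forall i, (Pi w i `<=` Ws w i /\ Ws w i `<=` ~` total_set Xi w) /\
      (Xi w i `<=` Wu w i /\ Wu w i `<=` ~` total_set Pi w))
    /\
    (* (3) *)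
    ((trivIset setT (Ws w) /\ \bigcup_i Ws w i = ~` total_set Xi w) /\
      (trivIset setT (Wu w) /\ \bigcup_i Wu w i = ~` total_set Pi w))
    /\
    (* (4) *)
    (forall i (n : int), fpow w n @` Ws w i = Ws (sigma n w) i /\
      fpow w n @` Wu w i = Wu (sigma n w) i)
    /\
    (* (5) *)
    ((forall i I, component (Ws w i) I -> nup i I = (r%:R^-1)%:E) /\
      (forall i J, component (Wu w i) J -> num i J = (r%:R^-1)%:E) /\
      (forall i, nup i (Ws w i) = 1%E /\ num i (Wu w i) = 1%E))
    /\
    (* (6) *)
    (forall i,
      (forall x, (Pi w i : set (circle R)) x ->
        (fun n : nat => lyapunov_quotient w x n%:Z) @ \oo
          --> lyapunov (mp i) /\
        (fun n : nat => lyapunov_quotient w x (- n%:Z)) @ \oo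
          --> lyapunov (mp i)) /\
      (forall y, (Xi w i : set (circle R)) y ->
        (fun n : nat => lyapunov_quotient w y n%:Z) @ \oo
          --> lyapunov (mm i) /\
        (fun n : nat => lyapunov_quotient w y (- n%:Z)) @ \oo
          --> lyapunov (mm i)))
    /\
    (* (7) *)
    ((forall I, closed_arc I -> I `<=` \bigcup_i Ws w i ->
        exponentially_small (fun n => arc_length (fpow w n%:Z @` I))) /\
      (forall J, closed_arc J -> J `<=` \bigcup_i Wu w i ->
        exponentially_small (fun n => arc_length (fpow w (- n%:Z) @` J))))}.
Proof.
pose F w e := fam Pi Xi e w.
have totE e w : all_pts (F w) e = total_set (fam Pi Xi e) w := all_pts_tot Pi Xi e w.
exists (fun w => basin (F w) true), (fun w => basin (F w) false); split.
  by move=> i; split; [exact: (lyapunov_sign bernP sdata no_inv true i)|exact: (lyapunov_sign bernP sdata no_inv false i)].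
have lims f : {ae P, forall w i, forall x, (F w f i : set (circle R)) x ->
    (fun n : nat => lyapunov_quotient w x n%:Z) @ \oo --> lyapunov (ms mp mm f i) /\
    (fun n : nat => lyapunov_quotient w x (- n%:Z)) @ \oo --> lyapunov (ms mp mm f i)}.
  by apply: filter_forall => i; exact: (lyapunov_limits sdata).
apply: filterS (filterI (filterI (fam_interlaced sdata) (fam_flow sdata))
  (filterI (filterI (filterI (gapset_mass bernP sdata true) (gapset_mass bernP sdata false))
    (filterI (lims true) (lims false)))
    (filterI (fam_contracts bernP sdata no_inv true) (fam_contracts bernP sdata no_inv false)))).
move=> w [[iF fF] [[[mt mf] [lt lf]] [ct cf]]].
have avoid e i : basin (F w) e i `<=` ~` all_pts (F w) (~~ e).
  by rewrite -(basin_cover iF e) => y Wy; exists i.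
split; first by move=> i; split; exact: basin_arcs.
split.
  move=> i; split; split.
  - exact: (basin_sub iF (e := true) (i := i)).
  - by have := avoid true i; rewrite totE; exact.
  - exact: (basin_sub iF (e := false) (i := i)).
  - by have := avoid false i; rewrite totE; exact.
split.
  split; split; try exact: basin_trivIset.
    by rewrite (basin_cover iF true) totE.
  by rewrite (basin_cover iF false) totE.
split.
  by move=> i n; split; exact: (basin_image _ _ (fF n)).
split.
  split; first by move=> i I /(basin_component iF)[x xi ->]; exact: mt.
  split; first by move=> i I /(basin_component iF)[x xi ->]; exact: mf.
  move=> i; split; first by apply: (basin_mass sdata iF (e := true)) => x; exact: mt.
  by apply: (basin_mass sdata iF (e := false)) => x; exact: mf.
split.
  by move=> i; split=> x; [exact: lt|exact: lf].
split=> I cI; rewrite basin_cover// => sI.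
  by have := closed_arc_contracts iF ct cI sI.
by have := closed_arc_contracts iF cf cI sI.
Qed.
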